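(* Define maps from $K[X]$ to $K$-valued functions on $\pi_B$ by $$\varphi_\circ(f)(\pi_b)=\langle f\,\mathcal{E}_b\,\mu_\circ\rangle,\qquad \psi_\circ(f)(\pi_b)=\langle f^*\,\mathcal{E}_b\,\mu_\circ\rangle=\langle \mathcal{E}_b,f\rangle_\circ\qquad(b\in B).$$ Then: (a) The $K$-linear map $\varphi_\circ:K[X]\to F_\#$ is unitary, i.e. $\langle\varphi_\circ(f),\varphi_\circ(g)\rangle_\#=\langle f,g\rangle_\circ$, and it induces the automorphism $\sigma$: $\varphi_\circ(H(p))=\sigma(H)(\varphi_\circ(p))$ for $p\in K[X]$, $H\in\mathbb{H}$. (b) The $*$-linear map $\psi_\circ:K[X]\to F_\#$ is unitary, i.e. $\langle\psi_\circ(f),\psi_\circ(g)\rangle_\#=\langle f,g\rangle_\circ^{*}$, and it induces the involution $\varepsilon$: $\psi_\circ(H(p))=\varepsilon(H)(\psi_\circ(p))$. (c) Explicitly, $\psi_\circ\big(\sum_b g_b\mathcal{E}_b\big)=\sum_b g_b^*\,\delta^\pi_b\in F_\#$ for $g_b\in K$ (finite sums); this is equivalent to the relations $\mathcal{E}_b=\varepsilon(G_{\pi_b})(1)$ for $b\in B$. (d) Consequently $$\varphi_\circ\Big(\sum_b g_b\mathcal{E}_b\Big)=\sum_b g_b\prod_\nu t_\nu^{l_\nu(w_0)/2}\;T_{w_0}^{-1}\big(\delta^\pi_{\varsigma(b)}\big),\qquad \varsigma(b)=-w_0(b).$$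
   Context: Roots. $R\subset\mathbb{R}^n$ is an irreducible reduced root system with simple roots $\alpha_1,\dots,\alpha_n$, positive roots $R_+$ ($R_-=-R_+$), Weyl group $W$, longest element $w_0$; $(\,,\,)$ is normalized by $(\alpha,\alpha)=2$ for short roots (all roots are short in the simply-laced case). $\alpha^\vee=2\alpha/(\alpha,\alpha)$, $\nu_\alpha=(\alpha,\alpha)/2$; $\omega_i$ fundamental weights, $(\omega_i,\alpha_j^\vee)=\delta_{ij}$; $\mathbb{Z}_+=\{0,1,\dots\}$; $Q=\oplus\mathbb{Z}\alpha_i\subset P=\oplus\mathbb{Z}\omega_i$, $Q_+=\oplus\mathbb{Z}_+\alpha_i$, $P_+=\oplus\mathbb{Z}_+\omega_i=-P_-$; $\vartheta=\vartheta^\vee$ is the highest short root. $B$ is a lattice with $Q\subset B\subset P$, $B_\pm=B\cap P_\pm$. $\widehat W^\flat=W\ltimes B$ acts on $\mathbb{R}^n\times\mathbb{R}$ by $(wb)([z,\zeta])=[w(z),\zeta-(z,b)]$ and on $\mathbb{R}^n$ by $(wb)(\!(z)\!)=w(b+z)$. $\tilde R=\{[\alpha,\nu_\alpha j]:\alpha\in R,j\in\mathbb{Z}\}$, $\tilde R_+=R_+\cup\{[\alpha,\nu_\alpha j]:j>0\}$, $\tilde R_-=-\tilde R_+$, $z$ identified with $[z,0]$; $\alpha_0=[-\vartheta,1]$, $s_0=\vartheta s_\vartheta\in\widehat W^\flat$, $s_i=s_{\alpha_i}$. $\lambda(\hat w)=\{\tilde\alpha\in\tilde R_+:\hat w(\tilde\alpha)\in\tilde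 R_-\}$, $l(\hat w)=|\lambda(\hat w)|$; $l_\nu(w_0)$ is the number of $\alpha\in R_+$ with $\nu_\alpha=\nu$. $\Pi^\flat=\{\hat w:l(\hat w)=0\}=\{\pi_r\}$ with $\pi_r(\alpha_0)=\alpha_r$; every $\hat w$ has a reduced decomposition $\hat w=\pi_rs_{i_l}\cdots s_{i_1}$, $l=l(\hat w)$. For $b\in B$: $b_-$ is the element of $W(b)\cap P_-$, $u_b\in W$ is the element of least length with $u_b(b)=b_-$, $\pi_b=bu_b^{-1}$, $\pi_B=\{\pi_b\}$. Parameters. $q,t_\nu$ are generic (independent), $q_\alpha=q^{\nu_\alpha}$, $t_\alpha=t_{\nu_\alpha}=q_\alpha^{k_\alpha}$ (formally), $t_i=t_{\alpha_i}$, $t_0=t_\vartheta$; $\tilde m$ is the least natural number with $\tilde m(B,B)\subset\mathbb{Z}$; $K=\mathbb{Q}(q^{1/(2\tilde m)},t_\nu^{1/2})$. $\rho_k=\frac12\sum_{\alpha\in R_+}k_\alpha\alpha$, $q^{(\rho_k,b)}=\prod_{\alpha\in R_+}t_\alpha^{(b,\alpha^\vee)/2}$, $b_\#=b-u_b^{-1}(\rho_k)$. $*$ on $K$ inverts $q^{1/(2\tilde m)},t_\nu^{1/2}$. $K[X]=K[X_b:b\in B]$, $X_bX_c=X_{b+c}$, $X_{[b,j]}=q^jX_b$ (so $X_{\alpha_0}=qX_\vartheta^{-1}$), $X_b^*=X_{-b}$, $X_a(q^z)=q^{(a,z)}$. A map $\psi$ is $*$-linear if it is additive and $\psi(cf)=c^*\psi(f)$.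 Algebra $\mathbb{H}$: generated over $K$ by $T_0,\dots,T_n$, $X_b$ ($b\in B$) and $\Pi^\flat$ with relations: $(T_i-t_i^{1/2})(T_i+t_i^{-1/2})=0$; affine Coxeter (braid) relations for $T_i$; $\pi T_i\pi^{-1}=T_j$ if $\pi(\alpha_i)=\alpha_j$; $T_iX_b-X_{s_i(b)}T_i=(t_i^{1/2}-t_i^{-1/2})\frac{X_{s_i(b)}-X_b}{X_{\alpha_i}-1}$; $\pi X_b\pi^{-1}=X_{\pi(b)}$ ($\pi\in\Pi^\flat$). $T_{\hat w}=\pi_rT_{i_l}\cdots T_{i_1}$; $Y_b=T_b$ for $b\in B_+$, $Y_{b-c}=Y_bY_c^{-1}$. Polynomial representation on $K[X]$: $X_b$ acts by multiplication, $\pi(X_b)=X_{\pi(b)}$, $T_i=t_i^{1/2}s_i+(t_i^{1/2}-t_i^{-1/2})(X_{\alpha_i}-1)^{-1}(s_i-1)$. $\varepsilon$ is the ($*$-linear) involution of $\mathbb{H}$ with $X_b\leftrightarrow Y_b$, $T_i\mapsto T_i^{-1}$ ($1\le i\le n$), inverting $q,t$. $\eta$ is the $*$-linear involution $T_i\mapsto T_i^{-1}$ ($0\le i\le n$), $X_b\mapsto X_b^{-1}$, $\pi_r\mapsto\pi_r$; $\sigma=\varepsilon\circ\eta$ is a $K$-linear automorphism with $\sigma(X_b)=Y_b^{-1}$, $\sigma(T_i)=T_i$ ($i>0$). Intertwiners (in the localization by nonzero polynomials in $X$): $\Phi_i=T_i+(t_i^{1/2}-t_i^{-1/2})(X_{\alpha_i}-1)^{-1}$,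 $\phi_i=t_i^{1/2}+(t_i^{1/2}-t_i^{-1/2})(X_{\alpha_i}-1)^{-1}$, $G_i=\Phi_i\phi_i^{-1}$, $G_{\hat w}=\pi_rG_{i_l}\cdots G_{i_1}$. In $\varepsilon(G_{\hat w})(1)$ rational functions of $Y$ are evaluated at eigenvalues. Polynomials. $\mu=\prod_{\alpha\in R_+}\prod_{i\ge0}\frac{(1-X_\alpha q_\alpha^i)(1-X_\alpha^{-1}q_\alpha^{i+1})}{(1-X_\alpha t_\alpha q_\alpha^i)(1-X_\alpha^{-1}t_\alpha q_\alpha^{i+1})}$, expanded as a Laurent series with coefficients in $\mathbb{Q}[t][[q]]$; $\langle\cdot\rangle$ is the constant term; $\mu_\circ=\mu/\langle\mu\rangle$ (its coefficients are rational in $q,t$); $\langle f,g\rangle_\circ=\langle\mu_\circ fg^*\rangle$. Order: $c\ge b$ iff $c-b\in Q_+$; $c\succ b$ iff $c_->b_-$, or $c_-=b_-$ and $c>b$. Nonsymmetric Macdonald polynomials: $E_b-X_b\in\oplus_{c\succ b}KX_c$, $\langle E_b,X_c\rangle_\circ=0$ for $c\succ b$; $\mathcal{E}_b=E_b/E_b(q^{-\rho_k})$. Functional representation. $F_\#$ is the space of finitely supported functions $\pi_B\to K$ with the action $(X_ag)(\pi_b)=q^{(a,b_\#)}g(\pi_b)$, $(\pi g)(\pi_b)=g(\pi^{-1}\pi_b)$, $(T_ig)(\pi_b)=\frac{t_i^{1/2}x-t_i^{-1/2}}{x-1}g(s_i\pi_b)-\frac{t_i^{1/2}-t_i^{-1/2}}{x-1}g(\pi_b)$,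 $x=X_{\alpha_i}(q^{b_\#})$ (with $X_{\alpha_0}(q^z)=q^{1-(\vartheta,z)}$); the first term is absent (zero coefficient) if $s_i\pi_b\notin\pi_B$. $\mu_\bullet(\pi_b)=\prod\frac{t_\alpha^{-1/2}-t_\alpha^{1/2}q_\alpha^{(\alpha^\vee,\rho_k)+j}}{t_\alpha^{1/2}-t_\alpha^{-1/2}q_\alpha^{(\alpha^\vee,\rho_k)+j}}$ over $[\alpha,j]$ with $[-\alpha,\nu_\alpha j]\in\lambda(\pi_b)$. $\langle f,g\rangle_\#=\sum_{\pi_b}\mu_\bullet(\pi_b)f(\pi_b)g(\pi_b)^*$; $\delta^\pi_b=\mu_\bullet(\pi_b)^{-1}\times$ (characteristic function of $\pi_b$). *)

(* Defs.v *)
From HB Require Import structures.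
From mathcomp Require Import all_boot all_order all_algebra.
From mathcomp Require Import finmap.
From mathcomp Require Import boolp classical_sets functions cardinality fsbigop.
From mathcomp Require Import reals.
From mathcomp Require Import -(notations) mpoly.
From mathcomp Require Import monalg.

Set Implicit Arguments.
Unset Strict Implicit.
Unset Printing Implicit Defensive.

Import Order.TTheory GRing.Theory Num.Theory.
Import generic_quotient.
Local Open Scope ring_scope.

(* The group algebra of an additive group. [monalg] provides the module        *)
(* [{malg K[G]}] of finitely supported functions, but its product is restricted *)
(* to monoids in which only 1 is invertible.                                    *)
Definition galg (K : comNzRingType) (G : zmodType) : predArgType := {malg K[G]}.

Section GroupAlgebra.
Variables (K : comNzRingType) (G : zmodType).
Implicit Types (f g h : galg K G) (a b c : G).

HB.instance Definition _ := GRing.Lmodule.copy (galg K G) {malg K[G]}.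

Definition gone : galg K G := << 0 >>.

Definition gmul f g : galg K G :=
  \sum_(a <- msupp f) \sum_(b <- msupp g) << f@_a * g@_b *g a + b >>.

Lemma gmulw (d1 d2 : {fset G}) f g :
  fsubset (msupp f) d1 -> fsubset (msupp g) d2 ->
  gmul f g = \sum_(a <- d1) \sum_(b <- d2) << f@_a * g@_b *g a + b >>.
Proof.
move=> le1 le2; rewrite /gmul (big_fset_incl _ le1) /=.
  apply/eq_bigr=> a _; apply/big_fset_incl => // b _ /mcoeff_outdom ->.
  by rewrite mulr0 monalgU0.
move=> a _ /mcoeff_outdom fa.
by rewrite big1 => // b _; rewrite fa mul0r monalgU0.
Qed.

Lemma gmulC : commutative gmul.
Proof.
move=> f g; rewrite /gmul exchange_big /=.
by apply/eq_bigr=> b _; apply/eq_bigr=> a _; rewrite mulrC addrC.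
Qed.

Lemma gmulUU (x y : K) a b :
  gmul << x *g a >> << y *g b >> = << x * y *g a + b >>.
Proof. by rewrite (gmulw msuppU_le msuppU_le) !big_seq_fset1 !mcoeffUU. Qed.

Lemma gmul0g : left_zero 0 gmul.
Proof. by move=> g; rewrite /gmul msupp0 big_seq_fset0. Qed.

Lemma gmulDl : left_distributive gmul +%R.
Proof.
move=> f g h; rewrite [in RHS](gmulw (fsubsetUl _ (msupp g)) (fsubset_refl _)).
rewrite [in RHS](gmulw (fsubsetUr (msupp f) _) (fsubset_refl _)).
rewrite (gmulw (msuppD_le _ _) (fsubset_refl _)).
rewrite -big_split /=; apply/eq_bigr=> a _.
rewrite -big_split /=; apply/eq_bigr=> b _.
by rewrite mcoeffD mulrDl monalgUD.
Qed.

Lemma gmulDr : right_distributive gmul +%R.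
Proof. by move=> f g h; rewrite gmulC gmulDl !(gmulC f). Qed.

Lemma gmulg0 : right_zero 0 gmul.
Proof. by move=> g; rewrite gmulC gmul0g. Qed.

Lemma gmul_suml (I : Type) (r : seq I) (F : I -> galg K G) g :
  gmul (\sum_(i <- r) F i) g = \sum_(i <- r) gmul (F i) g.
Proof. exact: (big_morph (gmul^~ g) (fun _ _ => gmulDl _ _ _) (gmul0g g)). Qed.

Lemma gmul_sumr (I : Type) (r : seq I) (F : I -> galg K G) g :
  gmul g (\sum_(i <- r) F i) = \sum_(i <- r) gmul g (F i).
Proof. exact: (big_morph (gmul g) (fun _ _ => gmulDr _ _ _) (gmulg0 g)). Qed.

Lemma gmulEl f g : gmul f g = \sum_(a <- msupp f) gmul << f@_a *g a >> g.
Proof. by rewrite {1}[f]monalgE gmul_suml. Qed.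

Lemma gmulEr f g : gmul f g = \sum_(b <- msupp g) gmul f << g@_b *g b >>.
Proof. by rewrite {1}[g]monalgE gmul_sumr. Qed.

Lemma gmulA : associative gmul.
Proof.
move=> f g h; rewrite (gmulEl f (gmul g h)) (gmulEl f g) gmul_suml.
apply/eq_bigr => a _; rewrite (gmulEl g h) (gmulEr _ g) gmul_sumr gmul_suml.
apply/eq_bigr => b _; rewrite (gmulEr _ h) gmul_sumr (gmulEr (gmul _ _) h).
by apply/eq_bigr => c _; rewrite !gmulUU mulrA addrA.
Qed.

Lemma gmul1g : left_id gone gmul.
Proof.
move=> g; rewrite (gmulEr gone) [RHS]monalgE; apply/eq_bigr => a _.
by rewrite gmulUU mul1r add0r.
Qed.

Lemma gone_neq0 : gone != 0.
Proof.
by apply/eqP/malgP=> /(_ 0) /eqP; rewrite mcoeffUU mcoeff0 oner_eq0.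
Qed.

HB.instance Definition _ := GRing.Zmodule_isComNzRing.Build (galg K G)
  gmulA gmulC gmul1g gmulDl gone_neq0.

Lemma gscaleAl (k : K) f g : k *: (f * g) = k *: f * g.
Proof.
have ZU x a : k *: (<< x *g a >> : galg K G) = << k * x *g a >>.
  by apply/malgP=> b; rewrite mcoeffZ !mcoeffU mulrnAr.
change (k *: gmul f g = gmul (k *: f) g).
rewrite [in RHS](monalgE f) (gmulEl f) !scaler_sumr gmul_suml.
apply/eq_bigr => a _; rewrite (gmulEr _ g) scaler_sumr ZU (gmulEr _ g).
by apply/eq_bigr => b _; rewrite !gmulUU ZU mulrA.
Qed.

HB.instance Definition _ := GRing.Lmodule_isLalgebra.Build K (galg K G) gscaleAl.

End GroupAlgebra.

Section RootSystems.
Context {R : realType} {n : nat}.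
Local Notation V := 'cV[R]_n.

Definition dot (u v : V) : R := (u^T *m v) 0 0.

Definition nu (a : V) : R := dot a a / 2.

Definition coroot (a : V) : V := (nu a)^-1 *: a.

(* z |-> z - (z, a^vee) a *)
Definition refl (a : V) : 'M[R]_n := 1%:M - a *m (coroot a)^T.

Definition int_span (e : 'I_n -> V) (v : V) : Prop :=
  exists c : 'I_n -> int, v = \sum_i e i *~ c i.

Definition nat_span (e : 'I_n -> V) (v : V) : Prop :=
  exists c : 'I_n -> nat, v = \sum_i e i *+ c i.

End RootSystems.

Record rootSystem (R : realType) (n : nat) := RootSystem {
  roots :> seq 'cV[R]_n;
  simple : 'I_n -> 'cV[R]_n;
  roots_uniq : uniq roots;
  roots_neq0 : 0 \notin roots;
  roots_refl : forall a b, a \in roots -> b \in roots -> refl a *m b \in roots;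
  roots_int : forall a b, a \in roots -> b \in roots ->
    dot a (coroot b) \is a Num.int;
  roots_reduced : forall a (c : R), a \in roots -> c *: a \in roots ->
    c = 1 \/ c = -1;
  roots_irreducible : forall S : pred 'cV[R]_n,
    has S roots -> has (predC S) roots ->
    exists a b, [/\ a \in roots, b \in roots, S a, ~~ S b & dot a b != 0];
  simple_root : forall i, simple i \in roots;
  simple_free : forall c : 'I_n -> R,
    \sum_i c i *: simple i = 0 -> forall i, c i = 0;
  roots_signed : forall a, a \in roots ->
    nat_span simple a \/ nat_span simple (- a);
  short_normalized :
    (exists2 a, a \in roots & dot a a = 2) /\
    (forall a, a \in roots -> 2 <= dot a a)
}.

Section RootDatum.
Context {R : realType} {n : nat} (D : rootSystem R n).
Local Notation V := 'cV[R]_n.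

Definition fundweight (i : 'I_n) : V :=
  xget 0 [set w | forall j, dot w (coroot (simple D j)) = (i == j)%:R].

Definition in_Q : V -> Prop := int_span (simple D).
Definition in_Qp : V -> Prop := nat_span (simple D).
Definition in_P : V -> Prop := int_span fundweight.
Definition in_Pp : V -> Prop := nat_span fundweight.
Definition in_Pm (v : V) : Prop := in_Pp (- v).

Definition posroots : seq V := [seq a <- roots D | `[< in_Qp a >]].

Definition theta : V :=
  xget 0 [set t | [/\ t \in roots D, dot t t = 2 &
    forall a, a \in roots D -> dot a a = 2 -> in_Qp (t - a)]].

Definition in_W (w : 'M[R]_n) : Prop :=
  exists2 s : seq V, {subset s <= roots D} &
    w = foldr (fun a m => refl a *m m) 1%:M s.

(* A pair (w, b) stands for the element wb of the semidirect product of W and  *)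
(* the translations. A pair (z, x) stands for the affine vector [z, x].         *)
Definition affW : Type := ('M[R]_n * V)%type.
HB.instance Definition _ := Choice.on affW.
Definition affV : Type := (V * R)%type.
HB.instance Definition _ := GRing.Zmodule.on affV.

Definition aone : affW := (1%:M, 0).
Definition amul (x y : affW) : affW := (x.1 *m y.1, invmx y.1 *m x.2 + y.2).
Definition ainv (x : affW) : affW := (invmx x.1, - (x.1 *m x.2)).
Definition apow (x : affW) (m : nat) : affW := iter m (amul x) aone.
Definition lin (w : 'M[R]_n) : affW := (w, 0).
Definition tr (b : V) : affW := (1%:M, b).

Definition aact (x : affW) (z : affV) : affV := (x.1 *m z.1, z.2 - dot z.1 x.2).

Definition affpos (z : affV) : Prop :=
  z.1 \in roots D /\ exists2 j : int, z.2 = nu z.1 *~ j &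
    (0 < j \/ (j = 0 /\ z.1 \in posroots)).
Definition affneg (z : affV) : Prop := affpos (- z).

Definition lambda (x : affW) : set affV :=
  [set z | affpos z /\ affneg (aact x z)].

Definition len (x : affW) : nat := #|` fset_set (lambda x)|.

(* Indices 0, ..., n of the affine simple roots: None is 0. *)
Definition aidx : Type := option 'I_n.
HB.instance Definition _ := Finite.on aidx.

Definition aroot (i : aidx) : affV :=
  if i is Some j then (simple D j, 0) else (- theta, 1).

Definition saff (i : aidx) : affW :=
  if i is Some j then lin (refl (simple D j))
  else amul (tr theta) (lin (refl theta)).

(* aword p [:: i_l; ...; i_1] is p s_{i_l} ... s_{i_1} *)
Definition aword (p : affW) (w : seq aidx) : affW :=
  amul p (foldr (fun i x => amul (saff i) x) aone w).

Definition aorder (x : affW) (m : nat) : Prop :=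
  [/\ (0 < m)%N, apow x m = aone &
      forall k, (0 < k < m)%N -> apow x k <> aone].

Definition w0 : 'M[R]_n :=
  xget 1%:M [set w | in_W w /\
    forall w', in_W w' -> (len (lin w') <= len (lin w))%N].

(* b_- *)
Definition antidom (b : V) : V :=
  xget 0 [set c | in_Pm c /\ exists2 w, in_W w & c = w *m b].

(* u_b *)
Definition umin (b : V) : 'M[R]_n :=
  xget 1%:M [set w | [/\ in_W w, w *m b = antidom b &
    forall w', in_W w' -> w' *m b = antidom b ->
      (len (lin w) <= len (lin w'))%N]].

Definition piel (b : V) : affW := amul (tr b) (lin (invmx (umin b))).

Definition wt_lt (b c : V) : Prop := b <> c /\ in_Qp (c - b).
(* wt_succ c b is the relation "c succeeds b" *)
Definition wt_succ (c b : V) : Prop :=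
  wt_lt (antidom b) (antidom c) \/ (antidom c = antidom b /\ wt_lt b c).

(* The field of rational functions over Q in the independent variables        *)
(* t_nu^(1/2), one for each root length, and q^(1/(2 mtilde)): the latter is    *)
(* the variable of the univariate polynomials, the former are the variables    *)
(* of their coefficients. There is at least one length, so that predn below    *)
(* does not lose a case.                                                       *)
Definition lengths : seq R := undup [seq nu a | a <- roots D].

Definition coefring : idomainType := mpoly (size lengths).-1.+1 rat.

Definition Kqt : fieldType := {fraction {poly coefring}}.

Definition tvar (x : R) : coefring := mpolyX rat (mnm1 (inord (index x lengths))).

Definition embc (c : coefring) : Kqt := tofrac c%:P.

Definition thnu (x : R) : Kqt := embc (tvar x).

(* t_a^(1/2) *)
Definition th (a : V) : Kqt := thnu (nu a).

(* q^(1/(2 mtilde)) *)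
Definition vq : Kqt := tofrac 'X.

Definition thi (i : aidx) : Kqt := if i is Some j then th (simple D j) else th theta.

Definition star_coef (c : coefring) : Kqt :=
  mpoly.mmap (ratr : rat -> Kqt) (fun i => (embc (mpolyX rat (mnm1 i)))^-1) c.

Definition star_poly (p : {poly coefring}) : Kqt :=
  \sum_(i < size p) star_coef p`_i * vq^-1 ^+ i.

(* The substitution t_nu^(1/2) -> t_nu^(-1/2), q -> q^-1 in a rational function *)
Definition star (x : Kqt) : Kqt :=
  star_poly (\n_(repr x)) / star_poly (\d_(repr x)).

(* q^(rho_k, b) *)
Definition qrho (b : V) : Kqt :=
  \prod_(a <- posroots) th a ^ Num.floor (dot b (coroot a)).

(* Formal Laurent series: the value at (b, e) is the coefficient of X_b q^e.  *)
(* The sums in the product are over finite supports for the series used here. *)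
Definition lser : Type := (V * int)%type -> coefring.

Definition lone : lser := fun x => (x == 0)%:R.
Definition lmul (f g : lser) : lser := fun x => \sum_(y \in setT) f y * g (x - y).

(* 1 - X_b q^e, for (b, e) = x *)
Definition lbin (x : V * int) : lser := fun y => (y == 0)%:R - (y == x)%:R.
(* the geometric series expansion of 1 / (1 - c X_b q^e), for (b, e) = x *)
Definition lgeo (c : coefring) (x : V * int) : lser :=
  fun y => \sum_(m \in [set m : nat | y = x *+ m]) c ^+ m.

Definition mu_factor (a : V) (i : nat) : lser :=
  let nz := Num.floor (nu a) in
  let t := tvar (nu a) ^+ 2 in
  lmul (lmul (lbin (a, nz *+ i)) (lbin (- a, nz *+ i.+1)))
       (lmul (lgeo t (a, nz *+ i)) (lgeo t (- a, nz *+ i.+1))).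

Definition mu_trunc (N : nat) : lser :=
  \big[lmul/lone]_(a <- posroots) \big[lmul/lone]_(i < N) mu_factor a i.

(* The infinite product: the coefficients of mu_trunc N stabilize. *)
Definition mu : lser := fun x =>
  xget 0 [set c | exists N0, forall N, (N0 <= N)%N -> mu_trunc N x = c].

Section Lattice.
Variable B : zmodClosed V.

Record lat : predArgType := Lat { lat_val :> V; lat_mem : lat_val \in B }.

HB.instance Definition _ := [isSub for lat_val].
HB.instance Definition _ := [Choice of lat by <:].
HB.instance Definition _ := [SubChoice_isSubZmodule of lat by <:].

Definition toB (v : V) : lat := insubd (0 : lat) v.

Definition mtilde : nat :=
  xget 0%N [set m | [/\ (0 < m)%N,
    forall b c, b \in B -> c \in B -> m%:R * dot b c \is a Num.int &
    forall m', (0 < m' < m)%N ->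
      exists b c, [/\ b \in B, c \in B & m'%:R * dot b c \isn't a Num.int]]].

(* q^x, for x in Z / (2 mtilde) *)
Definition qpow (x : R) : Kqt := vq ^ Num.floor ((2 * mtilde)%:R * x).

Definition in_affW (x : affW) : Prop := in_W x.1 /\ x.2 \in B.

Definition in_Pi (x : affW) : Prop := in_affW x /\ len x = 0%N.

Definition reduced (x p : affW) (w : seq aidx) : Prop :=
  [/\ in_Pi p, x = aword p w & size w = len x].

Definition KX : predArgType := galg Kqt lat.
HB.instance Definition _ := GRing.ComNzRing.on KX.
HB.instance Definition _ := GRing.Lalgebra.on KX.

Definition Xp (b : lat) : KX := << b >>.

(* X_[b,j] = q^j X_b *)
Definition Xaff (z : affV) : KX := qpow z.2 *: Xp (toB z.1).

Definition wact (x : affW) (f : KX) : KX :=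
  \sum_(b <- msupp f) f@_b *: Xaff (aact x (lat_val b, 0)).

Definition starX (f : KX) : KX := \sum_(b <- msupp f) star f@_b *: Xp (- b).

(* f(q^(-rho_k)) *)
Definition eval_rho (f : KX) : Kqt := \sum_(b <- msupp f) f@_b / qrho b.

(* <mu X_(-b)>, as a power series in q^(1/(2 mtilde)) *)
Definition mu_ser (b : V) : nat -> coefring := fun k =>
  if (2 * mtilde %| k)%N then mu (b, Posz (k %/ (2 * mtilde))) else 0.

Definition pser_mul (p : {poly coefring}) (s : nat -> coefring) : nat -> coefring :=
  fun k => \sum_(i < k.+1) p`_i * s (k - i)%N.

(* The coefficient of X_b in mu / <mu>: the rational function whose expansion   *)
(* is the quotient of the two power series.                                   *)
Definition mu_circ (b : V) : Kqt :=
  xget 0 [set r | exists p d : {poly coefring},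
    [/\ d != 0, r = tofrac p / tofrac d &
        pser_mul d (mu_ser b) =1 pser_mul p (mu_ser 0)]].

(* <f mu_circ> *)
Definition ct (f : KX) : Kqt := \sum_(b <- msupp f) f@_b * mu_circ (- lat_val b).

Definition pairX (f g : KX) : Kqt := ct (f * starX g).

Definition is_macdonald (b : lat) (e : KX) : Prop :=
  (forall c, (e - Xp b)@_c != 0 -> wt_succ (lat_val c) (lat_val b)) /\
  (forall c : lat, wt_succ (lat_val c) (lat_val b) -> pairX e (Xp c) = 0).

Definition macdonald (b : lat) : KX := xget 0 [set e | is_macdonald b e].

Definition Ecal (b : lat) : KX := (eval_rho (macdonald b))^-1 *: macdonald b.

(* q^(a, b_#), with b_# = b - u_b^-1(rho_k) *)
Definition qsharp (a b : V) : Kqt := qpow (dot a b) / qrho (umin b *m a).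

(* X_[a,j](q^(b_#)) *)
Definition Xsharp (z : affV) (b : V) : Kqt := qpow z.2 * qsharp z.1 b.

Section Algebra.
Variable H : algType Kqt.

Definition XH (X : lat -> H) (f : KX) : H := \sum_(b <- msupp f) f@_b *: X b.

Fixpoint altprod (T : aidx -> H) (m : nat) (i j : aidx) : H :=
  if m is m'.+1 then T i * altprod T m' j i else 1.

Record daha_rel (T : aidx -> H) (X : lat -> H) (P : affW -> H) : Prop := DahaRel {
  rel_quad : forall i, (T i - (thi i)%:A) * (T i + ((thi i)^-1)%:A) = 0;
  rel_braid : forall i j m, i != j -> aorder (amul (saff i) (saff j)) m ->
    altprod T m i j = altprod T m j i;
  rel_X0 : X 0 = 1;
  rel_XD : forall b c, X (b + c) = X b * X c;
  rel_P1 : P aone = 1;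
  rel_PM : forall x y, in_Pi x -> in_Pi y -> P (amul x y) = P x * P y;
  rel_PT : forall x i j, in_Pi x -> aact x (aroot i) = aroot j ->
    P x * T i = T j * P x;
  (* g is (X_(s_i(b)) - X_b) / (X_(alpha_i) - 1) *)
  rel_TX : forall i b (g : KX),
    (Xaff (aroot i) - 1) * g = Xaff (aact (saff i) (lat_val b, 0)) - Xp b ->
    T i * X b - XH X (Xaff (aact (saff i) (lat_val b, 0))) * T i
    = (thi i - (thi i)^-1) *: XH X g;
  rel_PX : forall x b, in_Pi x ->
    P x * X b = XH X (Xaff (aact x (lat_val b, 0))) * P x
}.

End Algebra.

(* The double affine Hecke algebra, as the algebra presented by generators     *)
(* and relations. The values of gP outside the group Pi are irrelevant.        *)
Record daha := Daha {
  halg :> algType Kqt;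
  gT : aidx -> halg;
  gX : lat -> halg;
  gP : affW -> halg;
  daha_relP : daha_rel gT gX gP;
  daha_univ : forall (A : algType Kqt) (T : aidx -> A) (X : lat -> A)
      (P : affW -> A), daha_rel T X P ->
    exists2 f : {lrmorphism halg -> A},
      [/\ forall i, f (gT i) = T i, forall b, f (gX b) = X b &
          forall x, in_Pi x -> f (gP x) = P x] &
      forall g : {lrmorphism halg -> A},
        (forall i, g (gT i) = T i) -> (forall b, g (gX b) = X b) ->
        (forall x, in_Pi x -> g (gP x) = P x) -> g =1 f
}.

Section DAHA.
Variable H : daha.

Definition hinv (h : H) : H := xget 0 [set g | g * h = 1 /\ h * g = 1].

(* T_x for x in the extended affine Weyl group *)
Definition Tel (x : affW) : H :=
  xget 0 [set h | exists p w, reduced x p w /\ h = gP H p * \prod_(i <- w) gT H i].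

Definition Yel (b : lat) : H :=
  xget 0 [set y | exists c d : lat,
    [/\ in_Pp (lat_val c), in_Pp (lat_val d), b = c - d &
        y = Tel (tr (lat_val c)) * hinv (Tel (tr (lat_val d)))]].

Definition is_epsilon (eps : {rmorphism H -> H}) : Prop :=
  [/\ forall (c : Kqt) (h : H), eps (c *: h) = star c *: eps h,
      forall b, eps (gX H b) = Yel b,
      forall b, eps (Yel b) = gX H b,
      forall i : 'I_n, eps (gT H (Some i)) = hinv (gT H (Some i)) &
      forall h, eps (eps h) = h].

Definition is_eta (eta : {rmorphism H -> H}) : Prop :=
  [/\ forall (c : Kqt) (h : H), eta (c *: h) = star c *: eta h,
      forall i, eta (gT H i) = hinv (gT H i),
      forall b, eta (gX H b) = gX H (- b),
      forall x, in_Pi x -> eta (gP H x) = gP H x &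
      forall h, eta (eta h) = h].

Definition is_action (M : lmodType Kqt) (act : H -> M -> M) : Prop :=
  [/\ forall v, act 1 v = v,
      forall g h v, act (g * h) v = act g (act h v),
      forall c g h v, act (c *: g + h) v = c *: act g v + act h v &
      forall c h u v, act h (c *: u + v) = c *: act h u + act h v].

(* The last clause is T_i = t_i^(1/2) s_i                                     *)
(* + (t_i^(1/2) - t_i^(-1/2)) (X_(alpha_i) - 1)^-1 (s_i - 1)                   *)
(* with the denominator cleared in the domain K[X].                           *)
Definition is_polynomial_rep (act : H -> KX -> KX) : Prop :=
  [/\ is_action act,
      forall b f, act (gX H b) f = Xp b * f,
      forall x f, in_Pi x -> act (gP H x) f = wact x f &
      forall i f,
        (Xaff (aroot i) - 1) * (act (gT H i) f - thi i *: wact (saff i) f)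
        = (thi i - (thi i)^-1) *: (wact (saff i) f - f)].

End DAHA.

Definition piB : Type := {x : affW | `[< exists b : lat, x = piel (lat_val b) >]}.
HB.instance Definition _ := Choice.on piB.

Definition pib (b : lat) : piB :=
  exist _ (piel (lat_val b)) (asboolT (ex_intro _ b erefl)).

Definition Fsharp : predArgType := {malg Kqt[piB]}.
HB.instance Definition _ := GRing.Lmodule.on Fsharp.

(* extension by zero outside pi_B *)
Definition fval (g : Fsharp) (x : affW) : Kqt :=
  if insub x is Some y then g@_y else 0.

Definition is_functional_rep (H : daha) (act : H -> Fsharp -> Fsharp) : Prop :=
  [/\ is_action act,
      forall a g b, (act (gX H a) g)@_(pib b)
        = qsharp (lat_val a) (lat_val b) * g@_(pib b),
      forall x g b, in_Pi x ->
        (act (gP H x) g)@_(pib b) = fval g (amul (ainv x) (piel (lat_val b))) &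
      forall i g b,
        let x := Xsharp (aroot i) (lat_val b) in
        let t := thi i in
        (act (gT H i) g)@_(pib b)
        = (t * x - t^-1) / (x - 1) * fval g (amul (saff i) (piel (lat_val b)))
          - (t - t^-1) / (x - 1) * g@_(pib b)].

(* An element z of lambda(x) is [- a, nu_a j]; q_a^((a^vee, rho_k) + j) is     *)
(* q^((a, rho_k) + nu_a j).                                                    *)
Definition mu_bullet (x : affW) : Kqt :=
  \prod_(z <- fset_set (lambda x))
    let a := - z.1 in
    let y := qrho a * qpow z.2 in
    ((th a)^-1 - th a * y) / (th a - (th a)^-1 * y).

Definition pairF (f g : Fsharp) : Kqt :=
  \sum_(x <- msupp f) mu_bullet (val x) * f@_x * star g@_x.

Definition delta (b : lat) : Fsharp := << (mu_bullet (piel (lat_val b)))^-1 *g pib b >>.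

(* the product over nu of t_nu^(l_nu(w_0)/2) *)
Definition tw0 : Kqt :=
  \prod_(x <- lengths) thnu x ^+ count (fun a => nu a == x) posroots.

Section Intertwiners.
Variables (H : daha) (eps : {rmorphism H -> H}) (act : H -> KX -> KX).

(* Let G_i = Phi_i phi_i^-1 be the intertwiner, with                           *)
(*   Phi_i = T_i + (t_i^(1/2) - t_i^(-1/2)) (X_(alpha_i) - 1)^-1,               *)
(*   phi_i = t_i^(1/2) + (t_i^(1/2) - t_i^(-1/2)) (X_(alpha_i) - 1)^-1.         *)
(* If e is an eigenvector of eps(X_(alpha_i)) with eigenvalue y, then           *)
(* eps(G_i)(e) is computed by replacing eps(X_(alpha_i)) with y.                *)
(* epsG [:: i_l; ...; i_1] e means that e is the resulting value of             *)
(* eps(G_(i_l) ... G_(i_1))(1).                                                 *)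
Definition phi_eps (i : aidx) (y : Kqt) : Kqt :=
  star (thi i) + star (thi i - (thi i)^-1) * (y - 1)^-1.

Definition Phi_eps (i : aidx) (y : Kqt) (e : KX) : KX :=
  act (eps (gT H i)) e + (star (thi i - (thi i)^-1) * (y - 1)^-1) *: e.

Inductive epsG : seq aidx -> KX -> Prop :=
| epsG_nil : epsG [::] 1
| epsG_cons i w e y : epsG w e -> e != 0 ->
    act (eps (XH (gX H) (Xaff (aroot i)))) e = y *: e ->
    y != 1 -> phi_eps i y != 0 ->
    epsG (i :: w) ((phi_eps i y)^-1 *: Phi_eps i y e).

(* e = eps(G_x)(1), for every reduced decomposition of x *)
Definition is_epsG (x : affW) (e : KX) : Prop :=
  forall p w, reduced x p w ->
    exists2 e', epsG w e' & e = act (eps (gP H p)) e'.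

End Intertwiners.

End Lattice.
End RootDatum.

(* Main.v *)
(* The elements Y_a = eps(X_a) act triangularly on K[X] for the order on B, and their
eigenvalues separate the points of B, so the polynomials E_b are, up to scalars, their
joint eigenvectors. The intertwiners eps(Phi_i) map eigenvectors to eigenvectors; since
evaluation at q^(-rho_k) is multiplied by t_i^(-1/2) under every eps(T_i), i >= 0, and is
preserved by eps(Pi), evaluation determines the scalars and yields the normalized
polynomials eps(G_(pi_b))(1). The span of these is stable under the eps(T_i) and eps(Pi),
hence under the whole algebra, and contains 1, so it is K[X].

The constant term is handled through mu only: comparing a finite part of the product mu,
stable under s_i up to the factors of alpha_i, with its image under s_i shows that the
form f |-> <f mu> satisfies <T_i(f) mu> = t_i^(1/2) <f mu> and <pi(f) mu> = <f mu>. Since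
K[X] is spanned by 1 and the elements T_i(f) - t_i^(1/2) f and pi(f) - f, this makes the
coefficients of mu_circ rational; the form is determined by its value 1 at
1, and T_i, X_b, pi are unitary. Then <E_b, eps(T_i) f> is computed by moving the
intertwiner to E_b, which is the functional representation; the norms of the E_b follow by
induction on the length of pi_b and are the inverses of mu_bullet.

Statement (a) follows from (b) as phi_circ(f) = psi_circ(f^* ) and the involution f^*
intertwines the action with eta; (d) follows from the identity
E_b^* = prod_nu t_nu^(-l_nu(w_0)/2) T_(w_0)(E_(-w_0(b))), both sides having the same
eigenvalues. *)

From HB Require Import structures.
From mathcomp Require Import all_boot all_order all_algebra.
From mathcomp Require Import finmap boolp classical_sets reals.
From mathcomp Require Import functions cardinality fsbigop.
From mathcomp Require Import -(notations) mpoly.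
From mathcomp Require Import monalg.
From mathcomp Require Import ring lra zify.
Require Import Defs.

Set Implicit Arguments.
Unset Strict Implicit.
Unset Printing Implicit Defensive.

Import Order.TTheory GRing.Theory Num.Theory.
Local Open Scope ring_scope.

(** * Root systems *)

(** A value of [mu_circ] is meaningful only if a rational function with the prescribed expansion
    exists; otherwise it is a default. Nothing can be said about the inner product before
    rationality is known, and no formula for the constant term of mu is at hand. So the eigenbasis
    is built first, by algebra alone, with evaluation at q^(-rho_k) in the role usually played by
    orthogonality. It shows that modulo the elements T_i(f) - t_i^(1/2) f and pi(f) - f only
    constants survive, because for b <> 0 some Y_a distinguishes the eigenvector at b from 1.

    Genericity enters through exponents of monomials. The exponent of q separates the points of B;
    the exponent of t keeps the values of X_a at q^(-rho_k) away from 1 for every affine root a, and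
    distinguishes pi_b from pi_b s_j.

    The automorphism eps is prescribed on X_b, Y_b and T_i with i > 0. Its values on T_0 and Pi have
    to be extracted from the factorizations Y_theta = T_0 T_(s_theta) and Y_b = pi T_u, and this is
    one reason for the study of lengths of products. *)

Lemma seq_argmax (T : eqType) (R : realDomainType) (s : seq T) (f : T -> R)
    (P : T -> Prop) :
  (exists2 x, x \in s & P x) ->
  exists x, [/\ x \in s, P x & forall y, y \in s -> P y -> f y <= f x].
Proof.
elim: s => [[]//|a s IH] [x xs Px].
have [[y ys Py]|noP] := pselect (exists2 x, x \in s & P x); last first.
  have {}Px : P a.
    by move: xs; rewrite inE => /orP[/eqP<-//|xs]; case: noP; exists x.
  exists a; split; rewrite ?mem_head// => z; rewrite inE => /orP[/eqP->//|zs] Pz.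
  by case: noP; exists z.
have [|z [zs Pz zmax]] := IH; first by exists y.
have [[Pa az]|na] := pselect (P a /\ f z <= f a).
  exists a; split; rewrite ?mem_head// => u; rewrite inE => /orP[/eqP->//|us] Pu.
  exact: le_trans (zmax _ us Pu) az.
exists z; split; rewrite ?inE ?zs ?orbT// => u; rewrite inE => /orP[/eqP->|us] Pu.
  by rewrite leNgt; apply/negP => /ltW fz; apply: na.
exact: zmax.
Qed.

(** * The Euclidean form, coroots and reflections *)

Section Dot.
Context {R : realType} {n : nat}.
Implicit Types (u v w a b : 'cV[R]_n).

Lemma dotE u v : dot u v = \sum_i u i 0 * v i 0.
Proof. by rewrite /dot mxE; apply: eq_bigr => i _; rewrite mxE. Qed.

Lemma dotC u v : dot u v = dot v u.
Proof. by rewrite !dotE; apply: eq_bigr => i _; rewrite mulrC. Qed.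

Lemma dotDl u v w : dot (u + v) w = dot u w + dot v w.
Proof. by rewrite /dot linearD mulmxDl mxE. Qed.

Lemma dotDr u v w : dot w (u + v) = dot w u + dot w v.
Proof. by rewrite !(dotC w) dotDl. Qed.

Lemma dotZl c u v : dot (c *: u) v = c * dot u v.
Proof. by rewrite /dot linearZ -scalemxAl mxE. Qed.

Lemma dotZr c u v : dot u (c *: v) = c * dot u v.
Proof. by rewrite dotC dotZl dotC. Qed.

Lemma dot0l u : dot 0 u = 0.
Proof. by rewrite -(scale0r 0) dotZl mul0r. Qed.

Lemma dot0r u : dot u 0 = 0.
Proof. by rewrite dotC dot0l. Qed.

Lemma dotNl u v : dot (- u) v = - dot u v.
Proof. by rewrite -scaleN1r dotZl mulN1r. Qed.

Lemma dotNr u v : dot u (- v) = - dot u v.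
Proof. by rewrite dotC dotNl dotC. Qed.

Lemma dotBl u v w : dot (u - v) w = dot u w - dot v w.
Proof. by rewrite dotDl dotNl. Qed.

Lemma dotBr u v w : dot w (u - v) = dot w u - dot w v.
Proof. by rewrite dotDr dotNr. Qed.

Lemma dot_suml I (r : seq I) (P : pred I) (F : I -> 'cV[R]_n) v :
  dot (\sum_(i <- r | P i) F i) v = \sum_(i <- r | P i) dot (F i) v.
Proof. by apply: (big_morph (dot^~ v)) => [x y|]; rewrite ?dotDl ?dot0l. Qed.

Lemma dot_sumr I (r : seq I) (P : pred I) (F : I -> 'cV[R]_n) v :
  dot v (\sum_(i <- r | P i) F i) = \sum_(i <- r | P i) dot v (F i).
Proof. by rewrite dotC dot_suml; apply: eq_bigr => i _; rewrite dotC. Qed.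

Lemma dot_ge0 u : 0 <= dot u u.
Proof. by rewrite dotE sumr_ge0// => i _; rewrite -expr2 sqr_ge0. Qed.

Lemma dot_eq0 u : dot u u = 0 -> u = 0.
Proof.
rewrite dotE => /eqP; rewrite psumr_eq0 => [/allP u0|i _]; last first.
  by rewrite -expr2 sqr_ge0.
apply/matrixP => i j; rewrite (ord1 j) mxE.
by have /(_ (mem_index_enum i)) := u0 i; rewrite mulf_eq0 orbb => /eqP.
Qed.

Lemma dot_gt0 u : u != 0 -> 0 < dot u u.
Proof.
move=> u0; rewrite lt_def dot_ge0 andbT; apply: contraNneq u0 => /dot_eq0 ->.
exact: eqxx.
Qed.

Lemma dot_separates u v : (forall w, dot w u = dot w v) -> u = v.
Proof.
move=> uv; apply/eqP; rewrite -subr_eq0; apply/eqP/dot_eq0.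
by rewrite dotBr uv subrr.
Qed.

Lemma reflE a v : refl a *m v = v - dot v (coroot a) *: a.
Proof.
rewrite /refl mulmxBl mul1mx -mulmxA; congr (_ - _).
apply/matrixP => i j; rewrite !mxE big_ord1 (ord1 j) mulrC.
by congr (_ * _); rewrite dotC /dot.
Qed.

Lemma coroot_dot a v : dot v (coroot a) = 2 * dot v a / dot a a.
Proof. by rewrite dotZr /nu invf_div; ring. Qed.

Lemma coroot_self a : a != 0 -> dot a (coroot a) = 2.
Proof.
move=> /dot_gt0 a0; rewrite coroot_dot -mulrA divff ?mulr1//.
by rewrite gt_eqF.
Qed.

Lemma corootN a : coroot (- a) = - coroot a.
Proof. by rewrite /coroot /nu dotNl dotNr opprK scalerN. Qed.

Lemma nuN a : nu (- a) = nu a.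
Proof. by rewrite /nu dotNl dotNr opprK. Qed.

Lemma nu_gt0 a : a != 0 -> 0 < nu a.
Proof. by move=> /dot_gt0 a0; rewrite divr_gt0. Qed.

Lemma dot_nu a v : a != 0 -> dot v a = nu a * dot v (coroot a).
Proof. by move=> /nu_gt0 a0; rewrite dotZr mulrA divff ?mul1r// gt_eqF. Qed.

Lemma reflK a v : a != 0 -> refl a *m (refl a *m v) = v.
Proof.
move=> a0; rewrite !reflE dotBl dotZl coroot_self//; set x := dot v _.
by rewrite -addrA -opprD -scalerDl (_ : x + (x - _) = 0) ?scale0r ?subr0//; ring.
Qed.

Lemma refl_self a : a != 0 -> refl a *m a = - a.
Proof.
move=> a0; rewrite reflE coroot_self// -{1}[a]scale1r -scalerBl -scaleN1r.
by congr (_ *: _); ring.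
Qed.

Lemma reflN a : refl (- a) = refl a.
Proof. by rewrite /refl corootN [in LHS]raddfN mulNmx mulmxN opprK. Qed.

Lemma dot_refl a u v : a != 0 -> dot (refl a *m u) (refl a *m v) = dot u v.
Proof.
move=> a0; rewrite !reflE; set x := dot u _; set y := dot v _.
rewrite !dotBl !dotBr !dotZl !dotZr [dot a v]dotC !(dot_nu _ a0) -/x -/y.
by rewrite coroot_self//; ring.
Qed.

Lemma coroot_refl a b : a != 0 -> coroot (refl a *m b) = refl a *m coroot b.
Proof. by move=> a0; rewrite /coroot /nu dot_refl// -scalemxAr. Qed.

End Dot.

(** * Positive roots, heights and simple reflections *)

Section Roots.
Context {R : realType} {n : nat} (D : rootSystem R n).
Implicit Types (u v w a b : 'cV[R]_n) (i j : 'I_n).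
Local Notation al := (simple D).

Lemma root_neq0 a : a \in roots D -> a != 0.
Proof. by apply: contraTneq => ->; exact: roots_neq0. Qed.

Lemma simple_neq0 i : al i != 0.
Proof. exact/root_neq0/simple_root. Qed.

Lemma rootN a : a \in roots D -> - a \in roots D.
Proof.
by move=> aD; rewrite -(refl_self (root_neq0 aD)) roots_refl.
Qed.

Lemma rootNE a : (- a \in roots D) = (a \in roots D).
Proof. by apply/idP/idP => /rootN; rewrite ?opprK. Qed.

Definition simple_mx : 'M[R]_n := \matrix_(r, j) al j r 0.

Lemma simple_mxE (c : 'cV[R]_n) : simple_mx *m c = \sum_j c j 0 *: al j.
Proof.
apply/matrixP => r s; rewrite (ord1 s) mxE summxE; apply: eq_bigr => j _.
by rewrite !mxE mulrC.
Qed.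

(** There are n simple roots in dimension n, so freeness makes the matrix invertible, and every
    vector gets coordinates [cf]. *)
Lemma simple_mx_unit : simple_mx \in unitmx.
Proof.
rewrite -unitmx_tr -row_free_unit -kermx_eq0; apply/eqP/row_matrixP => i.
rewrite row0; move: (row i _) (row_sub i (kermx simple_mx^T)) => v /sub_kermxP vS.
have : simple_mx *m v^T = 0 by rewrite -[simple_mx]trmxK -trmx_mul vS trmx0.
rewrite simple_mxE => /simple_free v0; apply/rowP => j.
by have := v0 j; rewrite !mxE.
Qed.

Definition coefs v : 'cV[R]_n := invmx simple_mx *m v.
Definition cf v i : R := coefs v i 0.
Definition ht v : R := \sum_i cf v i.

Lemma cfE v : v = \sum_i cf v i *: al i.
Proof. by rewrite -simple_mxE mulmxA mulmxV ?mul1mx// simple_mx_unit. Qed.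

Lemma cfD u v i : cf (u + v) i = cf u i + cf v i.
Proof. by rewrite /cf /coefs mulmxDr mxE. Qed.

Lemma cfZ c v i : cf (c *: v) i = c * cf v i.
Proof. by rewrite /cf /coefs -scalemxAr mxE. Qed.

Lemma cfN v i : cf (- v) i = - cf v i.
Proof. by rewrite -scaleN1r cfZ mulN1r. Qed.

Lemma cf0 i : cf 0 i = 0.
Proof. by rewrite -(scale0r 0) cfZ mul0r. Qed.

Lemma cf_sum I (r : seq I) (P : pred I) (F : I -> 'cV[R]_n) i :
  cf (\sum_(k <- r | P k) F k) i = \sum_(k <- r | P k) cf (F k) i.
Proof. by apply: (big_morph (cf^~ i)) => [x y|]; rewrite ?cfD ?cf0. Qed.

Lemma cf_simple i j : cf (al i) j = (i == j)%:R.
Proof.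
have -> : al i = simple_mx *m delta_mx i 0.
  rewrite simple_mxE (bigD1 i)//= mxE !eqxx scale1r big1 ?addr0// => k ki.
  by rewrite mxE (negPf ki) scale0r.
rewrite /cf /coefs mulmxA mulVmx ?simple_mx_unit// mul1mx mxE eqxx andbT.
by rewrite eq_sym.
Qed.

Lemma cf_inj u v : (forall i, cf u i = cf v i) -> u = v.
Proof. by move=> uv; rewrite (cfE u) (cfE v); apply: eq_bigr => i _; rewrite uv. Qed.

Lemma htD u v : ht (u + v) = ht u + ht v.
Proof. by rewrite /ht -big_split; apply: eq_bigr => i _; exact: cfD. Qed.

Lemma htZ c v : ht (c *: v) = c * ht v.
Proof. by rewrite /ht mulr_sumr; apply: eq_bigr => i _; exact: cfZ. Qed.

Lemma ht_simple i : ht (al i) = 1.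
Proof.
rewrite /ht (bigD1 i)//= cf_simple eqxx big1 ?addr0// => j ji.
by rewrite cf_simple eq_sym (negPf ji).
Qed.

Lemma in_QE v : in_Q D v <-> forall i, cf v i \is a Num.int.
Proof.
split=> [[c ->] i|vi].
  rewrite cf_sum rpred_sum// => j _.
  by rewrite -scaler_int cfZ cf_simple rpredM ?intr_int// ?natr_int.
exists (fun i => Num.floor (cf v i)); rewrite {1}(cfE v); apply: eq_bigr => i _.
by rewrite -scaler_int; congr (_ *: _); move: (vi i); rewrite intrEfloor => /eqP.
Qed.

Lemma in_QpE v : in_Qp D v <-> forall i, cf v i \is a Num.nat.
Proof.
split=> [[c ->] i|vi].
  rewrite cf_sum rpred_sum// => j _.
  by rewrite -scaler_nat cfZ cf_simple rpredM ?natr_nat.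
exists (fun i => Num.trunc (cf v i)); rewrite {1}(cfE v); apply: eq_bigr => i _.
by rewrite -scaler_nat; congr (_ *: _); move: (vi i); rewrite natrEtruncn => /eqP.
Qed.

Lemma in_Qp_ge0 v : in_Qp D v <-> in_Q D v /\ forall i, 0 <= cf v i.
Proof.
rewrite in_QpE in_QE; split=> [h|[h1 h2] i].
  by split=> i; have := h i; rewrite natrEint => /andP[].
by rewrite natrEint h1 h2.
Qed.

Lemma root_in_Q a : a \in roots D -> in_Q D a.
Proof.
move=> /roots_signed[/in_Qp_ge0[]//|/in_Qp_ge0[/in_QE aQ _]]; apply/in_QE => i.
by have := aQ i; rewrite cfN rpredN.
Qed.

Lemma mem_pos a : (a \in posroots D) = (a \in roots D) && `[< in_Qp D a >].
Proof. by rewrite mem_filter andbC. Qed.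

Lemma pos_root a : a \in posroots D -> a \in roots D.
Proof. by rewrite mem_pos => /andP[]. Qed.

Lemma pos_cf_ge0 a i : a \in posroots D -> 0 <= cf a i.
Proof. by rewrite mem_pos => /andP[_ /asboolP/in_Qp_ge0[_]]. Qed.

Lemma root_pos a i : a \in roots D -> 0 < cf a i -> a \in posroots D.
Proof.
move=> aD ai; rewrite mem_pos aD; apply/asboolP.
have [//|/in_Qp_ge0[_ /(_ i)]] := roots_signed aD.
by rewrite cfN oppr_ge0 leNgt ai.
Qed.

Lemma root_neq0_cf a : a \in roots D -> exists i, cf a i != 0.
Proof.
move=> /root_neq0 a0; apply: contrapT => /forallNP h; move/eqP: a0; apply.
apply: cf_inj => i; rewrite cf0; apply/eqP/negPn/negP; exact: h.
Qed.

Lemma posN a : a \in posroots D -> - a \notin posroots D.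
Proof.
move=> aP; have [i] := root_neq0_cf (pos_root aP); apply: contra => naP.
by rewrite eq_le pos_cf_ge0// andbT -oppr_ge0 -cfN pos_cf_ge0.
Qed.

Lemma root_signP a : a \in roots D -> (a \in posroots D) || (- a \in posroots D).
Proof.
move=> aD; rewrite !mem_pos rootNE aD /=.
by have [h|h] := roots_signed aD; apply/orP; [left|right]; apply/asboolP.
Qed.

Lemma posNE a : a \in roots D -> (- a \in posroots D) = (a \notin posroots D).
Proof.
move=> aD; have := root_signP aD; case: (boolP (a \in posroots D)) => [/posN|_].
  by move=> /negPf->.
by move=> /= ->.
Qed.

Lemma simple_pos i : al i \in posroots D.
Proof. by apply: (@root_pos _ i (simple_root D i)); rewrite cf_simple eqxx. Qed.

Lemma pos_uniq : uniq (posroots D).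
Proof. exact/filter_uniq/roots_uniq. Qed.

Lemma cf_refl_simple i j v : j != i -> cf (refl (al i) *m v) j = cf v j.
Proof.
by move=> ji; rewrite reflE cfD cfN cfZ cf_simple eq_sym (negPf ji) mulr0 subr0.
Qed.

(** The reflection changes only the coefficient of [al i]. The system being reduced, a has another
    nonzero coefficient, and this one decides the sign of the image. *)
Lemma refl_simple_pos i a : a \in posroots D -> a != al i ->
  refl (al i) *m a \in posroots D.
Proof.
move=> aP ai; have aD := pos_root aP.
have sD : refl (al i) *m a \in roots D by rewrite roots_refl ?simple_root.
suff [j ji aj] : exists2 j, j != i & cf a j != 0.
  apply: (@root_pos _ j) => //; rewrite cf_refl_simple// lt_def aj.
  exact: pos_cf_ge0.
apply: contrapT => h; have aE : a = cf a i *: al i.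
  apply: cf_inj => j; rewrite cfZ cf_simple.
  case: (eqVneq i j) => [->|ij]; rewrite ?mulr1// mulr0.
  apply/eqP/negPn/negP => aj; apply: h; exists j => //; by rewrite eq_sym.
have := aD; rewrite aE => /(roots_reduced (simple_root D i)) [c1|c1].
  by move: ai; rewrite aE c1 scale1r eqxx.
by have := pos_cf_ge0 i aP; rewrite c1 ler0N1.
Qed.

(** Otherwise the positive root s_j(alpha_i) would have a negative coefficient at alpha_j. *)
Lemma simple_obtuse i j : i != j -> dot (al i) (al j) <= 0.
Proof.
move=> ij; rewrite (dot_nu _ (simple_neq0 j)) pmulr_rle0; last first.
  exact/nu_gt0/simple_neq0.
rewrite leNgt; apply/negP => ltk.
have sP : refl (al j) *m al i \in posroots D.
  apply: refl_simple_pos; first exact: simple_pos.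
  by apply: contraNneq ij => /(congr1 (cf^~ i)); rewrite !cf_simple eqxx;
    case: eqVneq => // _ /eqP; rewrite oner_eq0.
have := pos_cf_ge0 j sP; rewrite reflE cfD cfN cfZ !cf_simple eqxx mulr1 (negPf ij).
by rewrite add0r oppr_ge0 leNgt ltk.
Qed.

Lemma ht_pos a : a \in posroots D -> 1 <= ht a.
Proof.
move=> aP; have [i ai] := root_neq0_cf (pos_root aP).
have aQ : forall j, cf a j \is a Num.nat.
  by apply/in_QpE; move: aP; rewrite mem_pos => /andP[_ /asboolP].
rewrite /ht (bigD1 i)//= -[1]addr0 lerD ?sumr_ge0// => [|j _]; last first.
  exact: pos_cf_ge0.
have := aQ i; rewrite natrEtruncn => /eqP e; rewrite -e ler1n.
by rewrite lt0n; apply: contraNneq ai => e0; rewrite -e e0.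
Qed.

Lemma pos_dot_simple a : a \in posroots D -> exists i, 0 < dot a (al i).
Proof.
move=> aP; apply: contrapT => /forallNP h.
have := dot_gt0 (root_neq0 (pos_root aP)); rewrite ltNge => /negP; apply.
rewrite {2}(cfE a) dot_sumr sumr_le0// => i _; rewrite dotZr.
rewrite mulr_ge0_le0 ?pos_cf_ge0// leNgt; apply/negP; exact: h.
Qed.

(** Induction on the height: when (a, alpha_i) > 0 the reflection subtracts a positive integer
    multiple of alpha_i, and positive roots have height at least 1. *)
Lemma pos_root_ind (P : 'cV[R]_n -> Prop) :
  (forall i, P (al i)) ->
  (forall a i, a \in posroots D -> a != al i -> 0 < dot a (al i) ->
     P (refl (al i) *m a) -> P a) ->
  forall a, a \in posroots D -> P a.
Proof.
move=> P1 PS a aP; have [m] : exists m : nat, ht a < m%:R.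
  by exists (Num.truncn (ht a)).+1; exact: truncnS_gt.
elim: m => [|m IH] in a aP *.
  by move=> /(le_lt_trans (ht_pos aP)); rewrite ltr10.
move=> am; have [i ai] := pos_dot_simple aP.
have [->//|nai] := eqVneq a (al i).
apply: (PS _ i) => //; apply: IH; first exact: refl_simple_pos.
rewrite reflE htD -scaleN1r htZ htZ ht_simple mulr1 mulN1r.
have : 1 <= dot a (coroot (al i)).
  have := roots_int (pos_root aP) (simple_root D i); rewrite intrEfloor => /eqP e.
  rewrite -e -[1]/(1%:~R) ler_int -gtz0_ge1 -(@ltr0z R) e.
  by rewrite -(pmulr_rgt0 _ (nu_gt0 (simple_neq0 i))) -dot_nu// simple_neq0.
by move: am; rewrite -natr1; lra.
Qed.

(** Every positive coroot is reached from a simple one by simple reflections. These are moved over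
    to v, which is therefore generalized; integrality on the simple coroots survives because the
    Cartan numbers are integers. *)
Lemma coroot_int v : (forall i, dot v (coroot (al i)) \is a Num.int) ->
  forall a, a \in roots D -> dot v (coroot a) \is a Num.int.
Proof.
move=> vi a aD.
suff H a' : a' \in posroots D -> forall v,
    (forall i, dot v (coroot (al i)) \is a Num.int) -> dot v (coroot a') \is a Num.int.
  have /orP[aP|aP] := root_signP aD; first exact: H.
  by have := H _ aP _ vi; rewrite corootN dotNr rpredN.
move: a'; apply: pos_root_ind => [//|{aD vi v}a i aP ai _ IH] v vi.
have a0 := simple_neq0 i.
rewrite -(dot_refl _ _ a0) -coroot_refl//; apply: IH => j.
rewrite reflE dotBl dotZl rpredB// rpredM// (@roots_int _ _ D) ?simple_root//.
Qed.

End Roots.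

(** * Dominance and the highest short root *)

Section HighestShortRoot.
Context {R : realType} {n : nat} (D : rootSystem R n).
Implicit Types (u v w a b : 'cV[R]_n) (i j : 'I_n).
Local Notation al := (simple D).

Definition dominant v := forall i, 0 <= dot v (al i).

Lemma dot_pos_dominant a v : a \in posroots D -> dominant v -> 0 <= dot a v.
Proof.
move=> aP vd; rewrite (cfE D a) dot_suml sumr_ge0// => i _.
by rewrite dotZl mulr_ge0 ?(pos_cf_ge0 _ aP)// dotC.
Qed.

Lemma in_QpD u v : in_Qp D u -> in_Qp D v -> in_Qp D (u + v).
Proof. by rewrite !in_QpE => uQ vQ i; rewrite cfD rpredD. Qed.

Lemma in_Qp0 : in_Qp D 0.
Proof. by apply/in_QpE => i; rewrite cf0. Qed.

(** Take a root of maximal height among those of the same length above a: reflecting at a simple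
    root with negative product would raise the height further. *)
Lemma root_dominated a : a \in roots D -> exists b,
  [/\ b \in roots D, dot b b = dot a a, dominant b & in_Qp D (b - a)].
Proof.
move=> aD.
have [|b [bD [bl ba] bmax]] := @seq_argmax _ R (roots D) (ht D)
    (fun b => dot b b = dot a a /\ in_Qp D (b - a)).
  by exists a => //; rewrite subrr; split=> //; exact: in_Qp0.
exists b; split=> // i; rewrite leNgt; apply/negP => bi.
have a0 := simple_neq0 D i.
set c := - dot b (coroot (al i)).
have c0 : 0 < c.
  by rewrite oppr_gt0 -(pmulr_rlt0 _ (nu_gt0 a0)) -dot_nu.
have sE : refl (al i) *m b = b + c *: al i by rewrite reflE scaleNr.
have := bmax (refl (al i) *m b); rewrite roots_refl ?simple_root// dot_refl// bl.
rewrite sE htD htZ ht_simple mulr1 -subr_ge0 => /(_ isT) h.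
suff /h : dot a a = dot a a /\ in_Qp D (b + c *: al i - a).
  by rewrite opprD addNKr oppr_ge0 leNgt c0.
split=> //; rewrite addrAC; apply: in_QpD => //; apply/in_QpE => j.
rewrite cfZ cf_simple rpredM ?natr_nat// natrEint ltW// rpredN.
by rewrite (@roots_int _ _ D) ?simple_root.
Qed.

Lemma dominant_root_pos b : b \in roots D -> dominant b -> b \in posroots D.
Proof.
move=> bD bd; have /orP[//|/pos_dot_simple[i]] := root_signP bD.
by rewrite dotNl oppr_gt0 ltNge bd.
Qed.

(** A simple reflection in one of two orthogonal components preserves the roots supported there and
    fixes those supported in the other, so induction over simple reflections never mixes the two. *)
Lemma orthogonal_split (S : pred 'I_n) a :
  (forall i j, S i -> ~~ S j -> dot (al i) (al j) = 0) -> a \in posroots D ->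
  (forall k, S k -> cf D a k = 0) \/ (forall k, ~~ S k -> cf D a k = 0).
Proof.
move=> orth; have fixed (T : pred 'I_n) i b :
    (forall k, T k -> dot (al k) (al i) = 0) ->
    (forall k, ~~ T k -> cf D (refl (al i) *m b) k = 0) -> refl (al i) *m b = b.
  move=> oT hT; have s0 : dot (refl (al i) *m b) (coroot (al i)) = 0.
    rewrite dotZr (cfE D (_ *m b)) dot_suml big1 ?mulr0// => k _.
    rewrite dotZl; have [kT|/hT->] := boolP (T k); last by rewrite mul0r.
    by rewrite oT ?mulr0.
  by rewrite -[RHS](reflK _ (simple_neq0 D i)) (reflE _ (_ *m b)) s0 scale0r subr0.
move: a; apply: pos_root_ind => [i|a i aP ai _ IH].
  by have [Si|nSi] := boolP (S i); [right|left] => k kS; rewrite cf_simple;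
    case: eqVneq kS => // <-; rewrite ?Si ?(negPf nSi).
have cfk k : k != i -> cf D a k = cf D (refl (al i) *m a) k.
  by move=> ki; rewrite cf_refl_simple.
have [Si|nSi] := boolP (S i); case: IH => IH.
- left => k kS; rewrite -(fixed (predC S) i a) ?IH// => [j jS|j].
    by rewrite dotC orth.
  by rewrite /= negbK => /IH.
- right => k kS; rewrite cfk ?IH//; by apply: contraNneq kS => ->.
- left => k kS; rewrite cfk ?IH//; by apply: contraNneq nSi => <-.
- right => k kS; rewrite -(fixed S i a) ?IH// => j jS; exact: orth.
Qed.

(** The support of a dominant root is orthogonal to its complement: for j outside it all terms of
    (b, alpha_j) are nonpositive while their sum is nonnegative. A proper support would contradict
    irreducibility. *)
Lemma dominant_root_full b i : b \in roots D -> dominant b -> 0 < cf D b i.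
Proof.
move=> bD bd; have bP := dominant_root_pos bD bd.
pose S k := cf D b k != 0.
have orth k j : S k -> ~~ S j -> dot (al k) (al j) = 0.
  move=> Sk; rewrite negbK => /eqP bj.
  have le0 l : cf D b l * dot (al l) (al j) <= 0.
    case: (eqVneq l j) => [->|lj]; first by rewrite bj mul0r.
    by rewrite mulr_ge0_le0 ?(pos_cf_ge0 _ bP)// simple_obtuse.
  have : \sum_l - (cf D b l * dot (al l) (al j)) = 0.
    apply/eqP; rewrite eq_le sumr_ge0 ?andbT => [|l _]; last by rewrite oppr_ge0.
    rewrite sumrN oppr_le0; have := bd j; rewrite {1}(cfE D b) dot_suml.
    by under eq_bigr do rewrite dotZl.
  move=> /eqP; rewrite psumr_eq0 => [/allP/(_ k (mem_index_enum k))|l _]; last first.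
    by rewrite oppr_ge0.
  by rewrite oppr_eq0 mulf_eq0 (negPf Sk) => /eqP.
rewrite lt_def (pos_cf_ge0 _ bP) andbT; apply/negP => bi.
(* The roots supported in S. By [orthogonal_split] every other root has zero coefficients on S. *)
pose S' a := [forall k, ~~ S k ==> (cf D a k == 0)].
have [||c [d [cD dD /forallP Sc nSd]]] := @roots_irreducible _ _ D S'.
- by apply/hasP; exists b => //; apply/forallP => k; apply/implyP; rewrite negbK.
- apply/hasP; exists (al i); first exact: simple_root.
  apply/negP => /forallP/(_ i); rewrite /S negbK bi cf_simple eqxx/=.
  by rewrite oner_eq0.
have {}nSd k : S k -> cf D d k = 0.
  wlog dP : d dD nSd / d \in posroots D.
    move=> H; have /orP[dP|dP] := root_signP dD; first exact: H.
    move=> Sk; apply: oppr_inj; rewrite -cfN oppr0; apply: H => //.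
      by rewrite rootNE.
    by apply: contra nSd => /forallP h; apply/forallP => l;
      have := h l; rewrite cfN oppr_eq0.
  have [h|h] := orthogonal_split orth dP; first exact: h.
  by move: nSd => /negP[]; apply/forallP => l; apply/implyP => /h->.
rewrite (cfE D c) (cfE D d) dot_suml big1 ?eqxx// => k _.
rewrite dotZl; have [Sk|nSk] := boolP (S k); last first.
  by have := Sc k; rewrite nSk => /eqP->; rewrite mul0r.
rewrite dot_sumr big1 ?mulr0// => l _; rewrite dotZr.
have [Sl|nSl] := boolP (S l); first by rewrite nSd ?mul0r.
by rewrite orth ?mulr0.
Qed.

Lemma dominant_roots_acute a b : a \in roots D -> b \in roots D ->
  dominant a -> dominant b -> 0 < dot a b.
Proof.
move=> aD bD ad bd; have [i bi] := pos_dot_simple (dominant_root_pos bD bd).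
rewrite {1}(cfE D a) dot_suml (bigD1 i)//= ltr_pwDl//.
  by rewrite dotZl mulr_gt0 ?dominant_root_full// dotC.
apply: sumr_ge0 => j _; rewrite dotZl; apply: mulr_ge0.
  exact/ltW/dominant_root_full.
by rewrite dotC; exact: bd.
Qed.

Lemma short_coroot a : dot a a = 2 -> coroot a = a.
Proof. by move=> a2; rewrite /coroot /nu a2 divff ?invr1 ?scale1r// pnatr_eq0. Qed.

(** Strict Cauchy-Schwarz. As g has the minimal square length 2, the inequality (a, a) c^2 < 8 with
    (a, a) >= 2 leaves c^2 < 4 for the integer c. *)
Lemma short_coroot_le g a : g \in roots D -> dot g g = 2 -> a \in roots D ->
  a != g -> a != - g -> `|dot g (coroot a)| <= 1.
Proof.
move=> gD g2 aD ag aNg.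
have a2 : 2 <= dot a a by have [_] := short_normalized D; apply.
have a0 := root_neq0 aD; set c := dot g (coroot a).
have cint : c \is a Num.int by rewrite (@roots_int _ _ D).
(* The component of g orthogonal to a. It vanishes only for proportional roots, that is for a = g or
   a = -g. *)
have gca : g - (c / 2) *: a != 0.
  rewrite subr_eq0; apply/eqP => gE; move: (gD); rewrite gE.
  move=> /(roots_reduced aD)[e|e]; move: gE; rewrite e ?scale1r ?scaleN1r => gE.
    by rewrite gE eqxx in ag.
  by rewrite gE opprK eqxx in aNg.
have := dot_gt0 gca; rewrite !dotBl !dotBr !dotZl !dotZr [dot a g]dotC.
have -> : dot g a = dot a a / 2 * c by rewrite (dot_nu _ a0) /nu.
have c2 : c ^+ 2 <= 1 -> `|c| <= 1.
  by move=> h; rewrite -(ler_pXn2r (n := 2)) ?nnegrE// expr1n real_normK ?num_real.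
move: cint; rewrite intrEfloor => /eqP; move: (Num.floor c) => m mE.
rewrite g2 => h; have {}h : dot a a * c ^+ 2 < 8 by nra.
rewrite -mE; have : c ^+ 2 < 4.
  by have := sqr_ge0 c; nra.
rewrite -mE -intr_norm -[4]/(4%:~R) -[1]/(1%:~R) -rmorphXn /= ltr_int ler_int.
by move=> {}h; nia.
Qed.

(** For distinct dominant short roots (a, b) = 1, so a - b = s_b(a) is a root. It pairs to -1 with b
    and its negative pairs to -1 with a, so neither of them can be positive. *)
Lemma dominant_short_unique a b : a \in roots D -> b \in roots D ->
  dot a a = 2 -> dot b b = 2 -> dominant a -> dominant b -> a = b.
Proof.
move=> aD bD a2 b2 ad bd; apply/eqP/negPn/negP => ab.
have aP := dominant_root_pos aD ad; have bP := dominant_root_pos bD bd.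
have aNb : b != - a by apply: contraTneq bP => ->; rewrite posN.
have dab := dominant_roots_acute aD bD ad bd.
have := short_coroot_le aD a2 bD _ aNb; rewrite eq_sym ab (short_coroot b2) => /(_ isT).
have : dot a b \is a Num.int by rewrite -{1}(short_coroot b2) (@roots_int _ _ D).
rewrite intrEfloor => /eqP; move: (Num.floor _) => m mE.
rewrite gtr0_norm// -mE -[1]/(1%:~R) ler_int => m1.
have : (0 < m) by rewrite -(@ltr0z R) mE.
move=> m0; have {m0 m1 m} {}mE : dot a b = 1 by rewrite -mE (_ : m = 1)//; lia.
have sD : a - b \in roots D.
  have <- : refl b *m a = a - b by rewrite reflE short_coroot// mE scale1r.
  exact: roots_refl.
have /orP[sP|sP] := root_signP sD.
  by have := dot_pos_dominant sP bd; rewrite dotBl mE b2; lra.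
by have := dot_pos_dominant sP ad; rewrite dotNl dotBl a2 [dot b a]dotC mE; lra.
Qed.

Local Notation th0 := (theta D).

(** Every short root lies below a dominant short root, and there is only one of these. *)
Lemma theta_spec : [/\ th0 \in roots D, dot th0 th0 = 2 &
  forall a, a \in roots D -> dot a a = 2 -> in_Qp D (th0 - a)].
Proof.
rewrite /theta; case: xgetP => [t _ //|noT].
have [[a aD a2] _] := short_normalized D.
have [b [bD b2 bd _]] := root_dominated aD; case: (noT b).
split=> //=; first by rewrite b2.
move=> c cD c2; have [d [dD d2 dd]] := root_dominated cD.
by rewrite (@dominant_short_unique d b)//; rewrite ?d2 ?b2 ?c2.
Qed.

Lemma theta_root : th0 \in roots D. Proof. by have [] := theta_spec. Qed.
Lemma theta_dot : dot th0 th0 = 2. Proof. by have [] := theta_spec. Qed.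
Lemma theta_coroot : coroot th0 = th0. Proof. exact/short_coroot/theta_dot. Qed.
Lemma nu_theta : nu th0 = 1.
Proof. by rewrite /nu theta_dot divff// pnatr_eq0. Qed.

Lemma theta_dominant : dominant th0.
Proof.
move=> i; have [tD t2 tmax] := theta_spec; have a0 := simple_neq0 D i.
have := tmax (refl (al i) *m th0); rewrite roots_refl ?simple_root// dot_refl//.
move=> /(_ isT t2)/in_Qp_ge0[_ /(_ i)].
rewrite reflE opprB addrCA subrr addr0 cfZ cf_simple eqxx mulr1.
by rewrite (dot_nu _ a0) => h; rewrite mulr_ge0// ltW// nu_gt0.
Qed.

Lemma theta_pos : th0 \in posroots D.
Proof. exact: dominant_root_pos theta_root theta_dominant. Qed.

(** It suffices to treat a dominant b other than theta. Then (theta, b^vee) = 1, and nu_b theta - b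
    = -s_theta(b) is a root, positive because its product with theta is nu_b. This gives the affine
    roots [a, nu_a j] with j > 0 nonnegative coefficients in the simple affine roots. *)
Lemma theta_dominates a : a \in roots D ->
  nu a \is a Num.int /\ in_Qp D (nu a *: th0 - a).
Proof.
move=> aD; have [b [bD ba bd bQ]] := root_dominated aD.
suff [bi bt] : nu b \is a Num.int /\ in_Qp D (nu b *: th0 - b).
  have -> : nu a = nu b by rewrite /nu ba.
  by split=> //; rewrite -(subrKA b); exact: in_QpD.
have [->|bt] := eqVneq b th0.
  by rewrite nu_theta scale1r subrr; split; [exact: rpred1|exact: in_Qp0].
have b0 := root_neq0 bD.
have bNt : b != - th0.
  by apply: contraTneq (dominant_root_pos bD bd) => ->; rewrite posN// theta_pos.
have c1 : dot th0 (coroot b) = 1.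
  have := dominant_roots_acute theta_root bD theta_dominant bd.
  rewrite (dot_nu _ b0) (pmulr_rgt0 _ (nu_gt0 b0)) => c0.
  have := short_coroot_le theta_root theta_dot bD bt bNt.
  have := roots_int theta_root bD; rewrite intrEfloor => /eqP e.
  move: c0; rewrite -e ltr0z => c0; rewrite gtr0_norm ?ltr0z//.
  rewrite -[1]/(1%:~R) ler_int => c1; congr (_%:~R); lia.
have btE : dot b th0 = nu b by rewrite dotC (dot_nu _ b0) c1 mulr1.
split; first by rewrite -btE -{1}theta_coroot (@roots_int _ _ D) ?theta_root.
have sD : nu b *: th0 - b \in roots D.
  rewrite -rootNE opprB -btE -{1}theta_coroot -reflE roots_refl//.
  exact: theta_root.
have : nu b *: th0 - b \in posroots D.
  have /orP[//|sP] := root_signP sD.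
  have := dot_pos_dominant sP theta_dominant.
  rewrite opprB dotBl btE dotZl theta_dot => h; have := nu_gt0 b0; lra.
by rewrite mem_pos => /andP[_ /asboolP].
Qed.

Lemma fundweight_spec i j :
  dot (fundweight D i) (coroot (al j)) = (i == j)%:R.
Proof.
rewrite /fundweight; case: xgetP => [w _ /(_ j)//|noW].
pose w := invmx (simple_mx D)^T *m (nu (al i) *: delta_mx i 0 : 'cV[R]_n).
case: (noW w) => k; rewrite dotC dotZl.
have -> : dot (al k) w = ((simple_mx D)^T *m w) k 0.
  by rewrite mxE dotE; apply: eq_bigr => r _; rewrite !mxE.
rewrite mulmxA mulmxV ?unitmx_tr ?simple_mx_unit// mul1mx !mxE eqxx andbT eq_sym.
case: eqVneq => [->|_]; last by rewrite !mulr0.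
by rewrite mulr1 mulVf// gt_eqF// nu_gt0// simple_neq0.
Qed.

Lemma coroot_separates v w :
  (forall i, dot v (coroot (al i)) = dot w (coroot (al i))) -> v = w.
Proof.
move=> vw; apply: dot_separates => u; rewrite (cfE D u) !dot_suml.
apply: eq_bigr => i _; rewrite !dotZl ![dot (al i) _]dotC.
by rewrite !(dot_nu _ (simple_neq0 D i)) vw.
Qed.

Lemma in_PE v : in_P D v <-> forall i, dot v (coroot (al i)) \is a Num.int.
Proof.
split=> [[c ->] i|vi].
  rewrite dot_suml rpred_sum// => j _.
  by rewrite -scaler_int dotZl fundweight_spec rpredM ?intr_int ?natr_int.
exists (fun i => Num.floor (dot v (coroot (al i)))); apply: coroot_separates => i.
rewrite dot_suml (bigD1 i)//= big1 => [|j ji]; last first.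
  by rewrite -scaler_int dotZl fundweight_spec (negPf ji) mulr0.
rewrite -scaler_int dotZl fundweight_spec eqxx mulr1 addr0.
by have := vi i; rewrite intrEfloor => /eqP.
Qed.

Lemma in_PpE v : in_Pp D v <-> forall i, dot v (coroot (al i)) \is a Num.nat.
Proof.
split=> [[c ->] i|vi].
  rewrite dot_suml rpred_sum// => j _.
  by rewrite -scaler_nat dotZl fundweight_spec rpredM ?natr_nat.
exists (fun i => Num.trunc (dot v (coroot (al i)))); apply: coroot_separates => i.
rewrite dot_suml (bigD1 i)//= big1 => [|j ji]; last first.
  by rewrite -scaler_nat dotZl fundweight_spec (negPf ji) mulr0.
rewrite -scaler_nat dotZl fundweight_spec eqxx mulr1 addr0.
by have := vi i; rewrite natrEtruncn => /eqP.
Qed.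

Lemma in_Pp_dominant v : in_Pp D v <-> in_P D v /\ dominant v.
Proof.
rewrite in_PpE in_PE; split=> [h|[h1 h2] i].
  split=> i; have := h i; rewrite natrEint => /andP[]//.
  by move=> _ h0; rewrite (dot_nu _ (simple_neq0 D i)) mulr_ge0// ltW// nu_gt0// simple_neq0.
have := h2 i; rewrite (dot_nu _ (simple_neq0 D i)) pmulr_rge0; last first.
  exact/nu_gt0/simple_neq0.
by move=> h0; rewrite natrEint h1 h0.
Qed.

End HighestShortRoot.

(** * The field of rational functions in q and t *)

(** [star] is computed on the chosen representative of a fraction; this identity ties that
    representative to the fraction. *)
Lemma mulf_den (I : idomainType) (x : {fraction I}) :
  x * FracField.tofrac \d_(generic_quotient.repr x) =
  FracField.tofrac \n_(generic_quotient.repr x).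
Proof.
set r := generic_quotient.repr x; have d0 := denom_ratioP r.
have := FracField.pi_mul r (Ratio (\d_r) 1); rewrite generic_quotient.reprK => E.
unlock FracField.tofrac; rewrite -[LHS]/(FracField.mul x _) -E.
apply/eqP; rewrite FracField.equivf_def /FracField.mulf.
by rewrite !numden_Ratio ?mulf_neq0 ?oner_neq0// !mulr1 mulrC.
Qed.

Section CoefficientField.
Context {R : realType} {n : nat} (D : rootSystem R n).
Local Notation A := (coefring D).
Local Notation K := (Kqt D).
Local Notation N := (size (lengths D)).-1.+1.
Implicit Types (c : A) (p : {poly A}) (x y : K).

Definition embrat (a : rat) : K := embc (mpolyC N a).

HB.instance Definition _ := GRing.RMorphism.copy (@embc R n D)
  (@FracField.tofrac {poly A} \o polyC).
HB.instance Definition _ := GRing.RMorphism.copy embrat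
  ((@embc R n D) \o (@mpolyC N rat)).

Lemma embc_eq0 c : (embc c == 0) = (c == 0).
Proof. by rewrite /embc tofrac_eq0 polyC_eq0. Qed.

Lemma ratr_embrat a : ratr a = embrat a.
Proof. by rewrite -[in RHS](divq_num_den a) fmorph_div !rmorph_int. Qed.

Definition tgen (i : 'I_N) : K := embc (mpolyX rat (mnm1 i)).

Lemma mpolyX_neq0 m : mpolyX rat m != 0 :> A.
Proof. by rewrite -mpoly.msupp_eq0 msuppX. Qed.

Lemma tgen_neq0 i : tgen i != 0.
Proof. by rewrite embc_eq0 mpolyX_neq0. Qed.

Lemma vq_neq0 : vq D != 0.
Proof. by rewrite /vq tofrac_eq0 polyX_eq0. Qed.

Definition starc : A -> K := mpoly.mmap embrat (fun i => (tgen i)^-1).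

HB.instance Definition _ := GRing.RMorphism.copy starc
  (mpoly.mmap embrat (fun i => (tgen i)^-1)).

Lemma star_coefE c : star_coef c = starc c.
Proof. by rewrite /star_coef /starc /mpoly.mmap; under eq_bigr do rewrite ratr_embrat. Qed.

Definition starp : {poly A} -> K :=
  horner_morph (fun c => mulrC (vq D)^-1 (starc c)).

HB.instance Definition _ := GRing.RMorphism.copy starp
  (horner_morph (fun c => mulrC (vq D)^-1 (starc c))).

Lemma star_polyE p : star_poly p = starp p.
Proof.
rewrite /star_poly /starp /horner_morph /map_poly horner_poly.
by apply: eq_bigr => i _; rewrite star_coefE.
Qed.

Lemma starpC c : starp c%:P = starc c.
Proof. exact: horner_morphC. Qed.

Lemma starpX : starp 'X = (vq D)^-1.
Proof. exact: horner_morphX. Qed.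

Definition rev_mnm (k : nat) (m : multinom N) : multinom N :=
  Multinom [tuple (k - m i)%N | i < N].

(* Clearing the inverse variables reverses the exponents. *)
Definition rev_coef (k : nat) c : A :=
  \sum_(m <- mpoly.msupp c) mpoly.mcoeff m c *: mpolyX rat (rev_mnm k m).

Lemma rev_coefE k c : (mpoly.msize c <= k)%N ->
  embc (rev_coef k c) = (\prod_i tgen i) ^+ k * starc c.
Proof.
move=> ck; rewrite /rev_coef raddf_sum mulr_sumr big_seq [RHS]big_seq /=.
apply: eq_bigr => m mc; rewrite -mul_mpolyC rmorphM mulrCA; congr (_ * _).
rewrite /mmap1 -prodrXl -big_split /= mpolyXE_id rmorph_prod; apply: eq_bigr => i _.
rewrite rmorphXn mnmE -/(tgen i) expfB_cond ?exprVn//.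
have := mpoly.msize_mdeg_lt mc; move/leq_trans/(_ ck)/ltnW => mk.
by rewrite (negPf (tgen_neq0 i)) add0n (leq_trans _ mk)// mpoly.mdegE (bigD1 i) ?leq_addr.
Qed.

Lemma rev_coef_eq0 k c : (mpoly.msize c <= k)%N -> rev_coef k c = 0 -> c = 0.
Proof.
move=> ck c0; apply/mpolyP => m; rewrite mpoly.mcoeff0; apply/eqP; rewrite mpoly.mcoeff_eq0.
apply/negP => mc; have ltm m' i : m' \in mpoly.msupp c -> (m' i <= k)%N.
  move=> m'c; have := mpoly.msize_mdeg_lt m'c; move/leq_trans/(_ ck)/ltnW; apply: leq_trans.
  by rewrite mpoly.mdegE (bigD1 i) ?leq_addr.
have := congr1 (mpoly.mcoeff (rev_mnm k m)) c0.
rewrite mpoly.mcoeff0 /rev_coef raddf_sum (bigD1_seq m) ?msupp_uniq//= big_seq_cond big1.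
  by move/eqP; rewrite mpoly.mcoeffZ mcoeffX eqxx mulr1 addr0 mpoly.mcoeff_eq0 mc.
move=> m' /andP[m'c m'm]; rewrite mpoly.mcoeffZ mcoeffX (_ : (_ == _) = false) ?mulr0//.
apply: contraNF m'm => /eqP/mnmP e; apply/eqP/mnmP => i.
by have := e i; rewrite !mnmE; have := ltm _ i mc; have := ltm _ i m'c; lia.
Qed.

(** Multiplication by suitable powers of the variables turns the substitution into a reversal of
    exponents, which loses nothing. Injectivity is what lets the substitution pass to fractions. *)
Lemma starp_eq0 p : starp p = 0 -> p = 0.
Proof.
(* A common bound for the degrees of the coefficients, so that one power of the product of the
   t-variables clears every denominator. *)
move=> p0; pose k := \max_(i < size p) mpoly.msize p`_i.
have ck i : (mpoly.msize p`_i <= k)%N.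
  have [ip|ip] := ltnP i (size p); first exact: (leq_bigmax (Ordinal ip)).
  by rewrite nth_default// mpoly.msize0.
suff P0 : \sum_(i < size p) (rev_coef k p`_i)%:P * 'X^(size p - i) = 0 :> {poly A}.
  apply/polyP => i; rewrite coef0; have [ip|ip] := ltnP i (size p); last first.
    by rewrite nth_default.
  apply: (rev_coef_eq0 (ck i)).
  have := congr1 (fun P : {poly A} => P`_(size p - i)) P0; rewrite coef0 coef_sum.
  rewrite (bigD1 (Ordinal ip))//= coefCM coefXn eqxx mulr1 big1 ?addr0// => j ji.
  rewrite coefCM coefXn (_ : (_ == _) = false) ?mulr0//.
  by apply: contraNF ji => /eqP e; apply/eqP/val_inj => /=; have := ltn_ord j; lia.
apply/eqP; rewrite -tofrac_eq0 rmorph_sum /=.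
have -> : \sum_(i < size p) tofrac ((rev_coef k p`_i)%:P * 'X^(size p - i)) =
    (\prod_i tgen i) ^+ k * vq D ^+ size p * starp p; last by rewrite p0 mulr0.
rewrite -star_polyE /star_poly mulr_sumr; apply: eq_bigr => i _.
rewrite rmorphM rmorphXn /= (rev_coefE (ck i) : tofrac _ = _) star_coefE -/(vq D).
rewrite expfB_cond ?(negPf vq_neq0) ?add0n; last by rewrite ltnW.
by rewrite exprVn mulrACA.
Qed.

Lemma frac_repr x : x = tofrac (\n_(generic_quotient.repr x)) / tofrac (\d_(generic_quotient.repr x)).
Proof.
have d0 := denom_ratioP (generic_quotient.repr x).
apply: (mulIf (_ : tofrac (\d_(generic_quotient.repr x)) != 0 :> K)).
  by rewrite tofrac_eq0.
by rewrite divfK ?tofrac_eq0// mulf_den.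
Qed.

Lemma tofrac_numden x : exists p q : {poly A}, q != 0 /\ x = tofrac p / tofrac q.
Proof.
exists (\n_(generic_quotient.repr x)), (\d_(generic_quotient.repr x)); split; first exact: denom_ratioP.
exact: frac_repr.
Qed.

Lemma starp_neq0 p : p != 0 -> starp p != 0.
Proof. by move=> p0; apply: contraNneq p0 => /starp_eq0 ->. Qed.

Lemma starE p q : q != 0 -> star (tofrac p / tofrac q : K) = starp p / starp q.
Proof.
move=> q0; set x := _ / _; have d0 := denom_ratioP (generic_quotient.repr x).
rewrite /star !star_polyE; apply/eqP; rewrite eqr_div ?starp_neq0//.
rewrite -!rmorphM /=; apply/eqP; congr (starp _); apply/eqP.
rewrite -(@tofrac_eq {poly A}) !rmorphM /= -eqr_div ?tofrac_eq0//; apply/eqP.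
by rewrite -frac_repr.
Qed.

Lemma star_tofrac p : star (tofrac p : K) = starp p.
Proof.
have := starE p (oner_neq0 _); rewrite rmorph1 invr1 !mulr1 => ->.
by rewrite rmorph1 invr1 mulr1.
Qed.

Lemma star_is_zmod_morphism : zmod_morphism (@star R n D).
Proof.
move=> x y; have [p [q [q0 ->]]] := tofrac_numden x.
have [r [s [s0 ->]]] := tofrac_numden y.
rewrite -mulNr addf_div ?tofrac_eq0// -!rmorphN -!rmorphM -rmorphD /=.
rewrite !starE ?mulf_neq0// rmorphD !rmorphM rmorphN /=.
by rewrite -mulNr addf_div ?starp_neq0.
Qed.

Lemma star_is_monoid_morphism : monoid_morphism (@star R n D).
Proof.
split=> [|x y]; first by rewrite -[1]/(tofrac 1) star_tofrac rmorph1.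
have [p [q [q0 ->]]] := tofrac_numden x; have [r [s [s0 ->]]] := tofrac_numden y.
by rewrite mulf_div -!rmorphM /= !starE ?mulf_neq0// !rmorphM /= mulf_div.
Qed.

HB.instance Definition _ := GRing.isZmodMorphism.Build _ _ (@star R n D)
  star_is_zmod_morphism.
HB.instance Definition _ := GRing.isMonoidMorphism.Build _ _ (@star R n D)
  star_is_monoid_morphism.

Lemma star_vq : star (vq D) = (vq D)^-1.
Proof. by rewrite star_tofrac starpX. Qed.

Lemma star_embc c : star (embc c) = starc c.
Proof. by rewrite star_tofrac starpC. Qed.

Lemma star_tgen i : star (tgen i) = (tgen i)^-1.
Proof. by rewrite star_embc /starc mmapX mmap1U. Qed.

Lemma star_embrat a : star (embrat a) = embrat a.
Proof. by rewrite star_embc /starc mpoly.mmapC. Qed.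

Lemma embcE c : embc c = \sum_(m <- mpoly.msupp c)
  embrat (mpoly.mcoeff m c) * \prod_i tgen i ^+ m i.
Proof.
rewrite {1}[c]mpolyE raddf_sum /=; apply: eq_bigr => m _.
rewrite -mul_mpolyC rmorphM /= mpolyXE_id rmorph_prod; congr (_ * _).
by apply: eq_bigr => i _; rewrite rmorphXn.
Qed.

Lemma star_starc c : star (starc c) = embc c.
Proof.
rewrite embcE /starc /mpoly.mmap rmorph_sum; apply: eq_bigr => m _.
rewrite rmorphM /= star_embrat; congr (_ * _).
rewrite /mmap1 rmorph_prod; apply: eq_bigr => i _.
by rewrite rmorphXn fmorphV /= star_tgen invrK.
Qed.

Lemma starK : involutive (@star R n D).
Proof.
move=> x; have [p [q [q0 ->]]] := tofrac_numden x.
have E r : star (starp r) = tofrac r.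
  rewrite -star_polyE /star_poly rmorph_sum -[in RHS](coefK r) poly_def rmorph_sum.
  apply: eq_bigr => i _; rewrite rmorphM rmorphXn fmorphV /= star_vq invrK.
  by rewrite star_coefE star_starc -mul_polyC rmorphM rmorphXn.
by rewrite starE// fmorph_div /= !E.
Qed.

(** The exponent k of q^(1/(2 mtilde)) and the total degree d in all t^(1/2) are additive and
    determined by x. Nearly every later use of genericity compares these two integers. *)
Definition monomial x (k d : int) := exists m1 m2 : multinom N,
  x = vq D ^ k * (embc (mpolyX rat m1) / embc (mpolyX rat m2)) /\
  d = (mpoly.mdeg m1)%:Z - (mpoly.mdeg m2)%:Z.

Lemma embX_neq0 m : embc (mpolyX rat m) != 0 :> K.
Proof. by rewrite embc_eq0 mpolyX_neq0. Qed.

Lemma monomial_neq0 x k d : monomial x k d -> x != 0.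
Proof.
move=> [m1 [m2 [-> _]]].
apply: mulf_neq0; first exact/expfz_neq0/vq_neq0.
by apply: mulf_neq0; rewrite ?invr_eq0 embX_neq0.
Qed.

Lemma monomial_embX m : monomial (embc (mpolyX rat m)) 0 (mpoly.mdeg m).
Proof.
exists m, (@mnm0 N); rewrite mpolyX0 rmorph1 invr1 mulr1 expr0z mul1r; split=> //.
by rewrite mpoly.mdeg0 subr0.
Qed.

Lemma monomial1 : monomial 1 0 0.
Proof. by have := monomial_embX (@mnm0 N); rewrite mpolyX0 rmorph1 mpoly.mdeg0. Qed.

Lemma monomial_vq k : monomial (vq D ^ k) k 0.
Proof.
by exists (@mnm0 N), (@mnm0 N); rewrite mpolyX0 rmorph1 divr1 mulr1 subrr.
Qed.

Lemma monomialM x y k d l e : monomial x k d -> monomial y l e ->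
  monomial (x * y) (k + l) (d + e).
Proof.
move=> [m1 [m2 [-> ->]]] [m3 [m4 [-> ->]]]; exists (mnm_add m1 m3), (mnm_add m2 m4).
rewrite !mpolyXD !rmorphM /= !invfM expfzDr ?vq_neq0// !mpoly.mdegD !PoszD; split.
  by rewrite mulrACA; congr (_ * _); rewrite mulrACA.
by rewrite opprD addrACA.
Qed.

Lemma monomialV x k d : monomial x k d -> monomial x^-1 (- k) (- d).
Proof.
move=> [m1 [m2 [-> ->]]]; exists m2, m1.
rewrite !invfM invrK invr_expz opprB; split=> //; congr (_ * _); exact: mulrC.
Qed.

Lemma monomialX x k d (j : int) : monomial x k d -> monomial (x ^ j) (k * j) (d * j).
Proof.
move=> xm; have H (i : nat) : monomial (x ^+ i) (k * i) (d * i).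
  elim: i => [|i IH]; first by rewrite !mulr0; exact: monomial1.
  by rewrite exprS -[i.+1]add1n PoszD !mulrDr !mulr1; exact: monomialM.
case: j => j; first by rewrite -exprnP; exact: H.
by rewrite NegzE -exprnN !mulrN; exact/monomialV/H.
Qed.

Lemma monomial_prod I (r : seq I) (F : I -> K) (e : I -> int) :
  (forall i, monomial (F i) 0 (e i)) ->
  monomial (\prod_(i <- r) F i) 0 (\sum_(i <- r) e i).
Proof.
move=> H; elim: r => [|i r IH]; first by rewrite !big_nil; exact: monomial1.
by rewrite !big_cons -[0]addr0; exact: monomialM.
Qed.

Lemma mpolyX_inj m1 m2 : mpolyX rat m1 = mpolyX rat m2 :> A -> m1 = m2.
Proof.
move=> /(congr1 (mpoly.mcoeff m2)); rewrite !mcoeffX eqxx.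
by case: (m1 =P m2) => // _ /esym/eqP; rewrite oner_eq0.
Qed.

Lemma monomial_eq1 k d : monomial 1 k d -> k = 0 /\ d = 0.
Proof.
wlog k0 : k d / 0 <= k.
  move=> H; have [k0|k0] := leP 0 k; first exact: H.
  move=> /monomialV; rewrite invr1 => m1.
  have [|/eqP + /eqP] := H _ _ _ m1; first by rewrite oppr_ge0 ltW.
  by rewrite !oppr_eq0 => /eqP + /eqP.
case: k k0 => // k _ [m1 [m2 [E ->]]]; move: E; rewrite mulrA => /esym/(canRL (mulfVK _)).
rewrite mul1r -exprnP /embc /vq -rmorphXn -rmorphM => /(_ (embX_neq0 m2))/eqP.
rewrite tofrac_eq => /eqP E; have := congr1 (size \o @polyseq _) E => /=.
rewrite size_polyC mpolyX_neq0 mulrC size_Cmul ?mpolyX_neq0// size_polyXn.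
move=> [k0]; move: E; rewrite k0 expr0 mul1r => /polyC_inj/mpolyX_inj ->.
by rewrite subrr.
Qed.

Lemma monomial_uniq x k d l e : monomial x k d -> monomial x l e -> k = l /\ d = e.
Proof.
move=> xk xl; have x0 := monomial_neq0 xk.
have := monomialM xk (monomialV xl); rewrite divff// => /monomial_eq1[/eqP + /eqP].
by rewrite !subr_eq0 => /eqP + /eqP.
Qed.

(** A monomial has coefficient 1 and exponents form a torsion-free group, which rules out -1. *)
Lemma monomial_sqr1 x k d : monomial x k d -> x ^+ 2 = 1 -> x = 1.
Proof.
move=> xm x1; have := monomialM xm xm; rewrite -expr2 x1 => /monomial_eq1[k0 _].
have {}k0 : k = 0 by lia.
case: xm x1 => m1 [m2 [-> _]]; rewrite k0 expr0z mul1r expr_div_n => /divr1_eq.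
rewrite !expr2 -!rmorphM -!mpolyXD => /eqP; rewrite tofrac_eq => /eqP/polyC_inj/mpolyX_inj E.
have -> : m1 = m2 by apply/mnmP => i; move/mnmP/(_ i): E; rewrite !mnmDE; lia.
by rewrite divff ?embX_neq0.
Qed.

Lemma monomial_thnu r : monomial (thnu D r) 0 1.
Proof. by have := monomial_embX (mnm1 (inord (index r (lengths D)))); rewrite mpoly.mdeg1. Qed.

Lemma monomial_th a : monomial (th D a) 0 1. Proof. exact: monomial_thnu. Qed.

Lemma th_neq0 a : th D a != 0. Proof. exact: monomial_neq0 (monomial_th a). Qed.

Lemma star_th a : star (th D a) = (th D a)^-1. Proof. exact: star_tgen. Qed.

Lemma thE a b : nu a = nu b -> th D a = th D b.
Proof. by rewrite /th => ->. Qed.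

End CoefficientField.

(** * Group algebras *)

Section GalgComAlgebra.
Variables (K : comNzRingType) (G : zmodType).

HB.instance Definition _ :=
  GRing.LSemiAlgebra_isComSemiAlgebra.Build K (galg K G).

Lemma galg_ZU (x : K) (b : G) : x *: (<< b >> : galg K G) = << x *g b >>.
Proof. by apply/malgP => c; rewrite mcoeffZ !mcoeffU mulrnAr mulr1. Qed.

Lemma galgUD (b c : G) :
  (<< b + c >> : galg K G) = (<< b >> : galg K G) * (<< c >> : galg K G).
Proof. by rewrite -[_ * _]/(gmul << b >> << c >>) gmulUU mulr1. Qed.

Lemma galg_expand (f : galg K G) :
  f = \sum_(b <- msupp f) f@_b *: (<< b >> : galg K G).
Proof. by rewrite {1}[f]monalgE; apply: eq_bigr => b _; rewrite galg_ZU. Qed.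

End GalgComAlgebra.

(* A group algebra with its basis X, coordinates and supports, as an abstract    *)
(* structure: unification must not unfold the finite maps of [malg].             *)
Record galgebra (K : idomainType) (L : zmodType) := GAlgebra {
  gA :> comAlgType K;
  gM : L -> gA;
  gcoef : gA -> L -> K;
  gsupp : gA -> seq L;
  gM0 : gM 0 = 1;
  gMD : forall b c, gM (b + c) = gM b * gM c;
  gcoefD : forall f g b, gcoef (f + g) b = gcoef f b + gcoef g b;
  gcoefZ : forall x f b, gcoef (x *: f) b = x * gcoef f b;
  gcoefM : forall b c, gcoef (gM b) c = (b == c)%:R;
  gsupp_uniq : forall f, uniq (gsupp f);
  gsuppE : forall f b, (b \in gsupp f) = (gcoef f b != 0);
  gexpand : forall f, f = \sum_(b <- gsupp f) gcoef f b *: gM b }.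

Definition galgebra_galg (K : idomainType) (L : zmodType) : galgebra K L.
Proof.
apply: (@GAlgebra K L (galg K L) (fun b => << b >>) (fun f b => f@_b)
  (fun f => enum_fset (msupp f))) => //.
- exact: galgUD.
- by move=> f g b; rewrite mcoeffD.
- by move=> x f b; rewrite mcoeffZ.
- by move=> b c; rewrite mcoeffU.
- by move=> f; rewrite fset_uniq.
- by move=> f b; rewrite mcoeff_neq0.
- exact: galg_expand.
Defined.

Section GAlgebraTheory.
Variables (K : idomainType) (L : zmodType) (A : galgebra K L).
Implicit Types (f g : A) (b c : L) (x : K).

Lemma gcoef0 b : gcoef (0 : A) b = 0.
Proof. by rewrite -(scale0r 0) gcoefZ mul0r. Qed.

Lemma gcoefN f b : gcoef (- f) b = - gcoef f b.
Proof. by rewrite -scaleN1r gcoefZ mulN1r. Qed.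

Lemma gcoef_sum I (r : seq I) (F : I -> A) b :
  gcoef (\sum_(i <- r) F i) b = \sum_(i <- r) gcoef (F i) b.
Proof.
by apply: (big_morph (fun f => gcoef f b)) => [f g|]; rewrite ?gcoefD ?gcoef0.
Qed.

Lemma gcoef_inj f g : (forall b, gcoef f b = gcoef g b) -> f = g.
Proof.
move=> fg; apply/eqP; rewrite -subr_eq0; apply/eqP.
by rewrite [f - g]gexpand big1_seq// => b _; rewrite gcoefD gcoefN fg subrr scale0r.
Qed.

Lemma galgebra_ind (P : A -> Prop) : P 0 -> (forall f g, P f -> P g -> P (f + g)) ->
  (forall x b, P (x *: gM A b)) -> forall f, P f.
Proof. by move=> P0 PD PZ f; rewrite [f]gexpand; elim/big_ind: _. Qed.

Lemma galgebra_additive_eq (M : zmodType) (F F' : A -> M) :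
  (forall f g, F (f + g) = F f + F g) -> (forall f g, F' (f + g) = F' f + F' g) ->
  (forall x b, F (x *: gM A b) = F' (x *: gM A b)) -> forall f, F f = F' f.
Proof.
move=> FD F'D FU; apply: galgebra_ind => [|f g IH IH'|//]; last by rewrite FD F'D IH IH'.
have E (H : A -> M) : (forall f g, H (f + g) = H f + H g) -> H 0 = 0.
  by move=> HD; apply: (addIr (H 0)); rewrite -HD addr0 add0r.
by rewrite !E.
Qed.

Lemma gcoef_mulM b c f : gcoef (gM A b * f) c = gcoef f (c - b).
Proof.
move: f; apply: galgebra_additive_eq => [f g|f g|x d].
- by rewrite mulrDr gcoefD.
- by rewrite gcoefD.
rewrite -scalerAr -gMD !gcoefZ !gcoefM addrC.
by rewrite [d == _]eq_sym subr_eq [c == _]eq_sym.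
Qed.

Section Lift.
Variables (K' : idomainType) (M : lmodType K') (s : {rmorphism K -> K'}) (X : L -> M).

Definition glift f : M := \sum_(b <- gsupp f) s (gcoef f b) *: X b.

Lemma glift_wide (d : seq L) f : uniq d -> {subset gsupp f <= d} ->
  glift f = \sum_(b <- d) s (gcoef f b) *: X b.
Proof.
move=> du fd; rewrite /glift; have p : perm_eq (gsupp f) [seq b <- d | b \in gsupp f].
  apply: uniq_perm; rewrite ?gsupp_uniq ?filter_uniq// => b.
  by rewrite mem_filter; case: (boolP (b \in gsupp f)) => // /fd ->.
rewrite (perm_big _ p) big_filter [RHS](bigID (fun b => b \in gsupp f)) /=.
rewrite [X in _ + X]big1 ?addr0// => b; rewrite gsuppE negbK => /eqP ->.
by rewrite rmorph0 scale0r.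
Qed.

Lemma gliftD f g : glift (f + g) = glift f + glift g.
Proof.
pose d := undup (gsupp f ++ gsupp g ++ gsupp (f + g)).
rewrite !(@glift_wide d) ?undup_uniq//; try by move=> b bs; rewrite mem_undup !mem_cat bs ?orbT.
by rewrite -big_split; apply: eq_bigr => b _; rewrite gcoefD rmorphD scalerDl.
Qed.

Lemma glift0 : glift 0 = 0.
Proof. by apply: (addIr (glift 0)); rewrite -gliftD addr0 add0r. Qed.

Lemma gliftZ x f : glift (x *: f) = s x *: glift f.
Proof.
pose d := undup (gsupp f ++ gsupp (x *: f)).
rewrite !(@glift_wide d) ?undup_uniq//; try by move=> b bs; rewrite mem_undup !mem_cat bs ?orbT.
by rewrite scaler_sumr; apply: eq_bigr => b _; rewrite gcoefZ rmorphM scalerA.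
Qed.

Lemma gliftM b : glift (gM A b) = X b.
Proof.
rewrite (@glift_wide [:: b])// => [|c]; first by rewrite big_seq1 gcoefM eqxx rmorph1 scale1r.
by rewrite gsuppE gcoefM inE [c == b]eq_sym; case: (b == c); rewrite ?eqxx.
Qed.

End Lift.

Lemma glift_mul (C : algType K) (s : {rmorphism K -> K}) (X : L -> C) f g :
  (forall b c, X (b + c) = X b * X c) ->
  glift s X (f * g) = glift s X f * glift s X g.
Proof.
move=> XD; move: f; apply: galgebra_additive_eq => [f f'|f f'|x b].
- by rewrite mulrDl gliftD.
- by rewrite gliftD mulrDl.
move: g; apply: galgebra_additive_eq => [f f'|f f'|y c].
- by rewrite mulrDr gliftD.
- by rewrite gliftD mulrDr.
rewrite -scalerAl -scalerAr -gMD !gliftZ !gliftM XD.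
by rewrite -scalerAl -scalerAr.
Qed.

Lemma gcoef_mul f g b :
  gcoef (f * g) b = \sum_(c <- gsupp f) gcoef f c * gcoef g (b - c).
Proof.
rewrite {1}[f]gexpand mulr_suml gcoef_sum; apply: eq_bigr => c _.
by rewrite -scalerAl gcoefZ gcoef_mulM.
Qed.

(** The restriction to [S] is there because q^e is multiplicative only on the exponents that mtilde
    allows. *)
Lemma glift_mul_on (K' : idomainType) (C : algType K') (s : {rmorphism K -> K'})
    (X : L -> C) (S : L -> Prop) f g :
  (forall b c, S b -> S c -> X (b + c) = X b * X c) ->
  (forall b, gcoef f b != 0 -> S b) -> (forall b, gcoef g b != 0 -> S b) ->
  glift s X (f * g) = glift s X f * glift s X g.
Proof.
move=> XD fS gS; rewrite {1}[f]gexpand {1}[g]gexpand mulr_suml.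
rewrite (big_morph _ (gliftD s X) (glift0 s X)) {2}/glift mulr_suml !big_seq.
apply: eq_bigr => b; rewrite gsuppE => /fS Sb; rewrite mulr_sumr.
rewrite (big_morph _ (gliftD s X) (glift0 s X)) {2}/glift mulr_sumr !big_seq.
apply: eq_bigr => c; rewrite gsuppE => /gS Sc.
rewrite -scalerAl -scalerAr -gMD !gliftZ gliftM XD//.
by rewrite -scalerAl -scalerAr.
Qed.

(** A nonzero f would have its support stable under translation by b, which has infinite order. *)
Lemma gM_subr1_reg x b f : x != 0 -> (forall k : nat, b *+ k.+1 != 0) ->
  (x *: gM A b - 1) * f = 0 -> f = 0.
Proof.
move=> x0 bk /eqP; rewrite mulrBl mul1r subr_eq0 => /eqP E.
apply: gcoef_inj => c; rewrite gcoef0; apply/eqP/negPn/negP => fc.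
have fk (k : nat) : gcoef f (c + b *+ k) != 0.
  elim: k => [|k IH]; first by rewrite addr0.
  by rewrite -E -scalerAl gcoefZ gcoef_mulM mulrSr addrA addrK mulf_neq0.
pose s := [seq c + b *+ k | k <- iota 0 (size (gsupp f)).+1].
have su : uniq s.
  rewrite map_inj_in_uniq ?iota_uniq// => k l _ _ /addrI kl.
  wlog kll : k l kl / (k <= l)%N.
    by move=> H; have [/H->//|/ltnW/H->] := leqP k l.
  apply/eqP; rewrite eqn_leq kll leqNgt /=; apply/negP => ltkl.
  have := bk (l - k).-1; rewrite prednK ?subn_gt0// => /eqP[].
  by apply: (addrI (b *+ k)); rewrite -mulrnDr subnKC// addr0 kl.
have : (size s <= size (gsupp f))%N.
  apply: uniq_leq_size => // d /mapP[k _ ->]; rewrite gsuppE; exact: fk.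
by rewrite size_map size_iota ltnn.
Qed.

End GAlgebraTheory.

Lemma mulmx_ext (R : nzRingType) (m n : nat) (M N : 'M[R]_(m, n)) :
  (forall v : 'cV_n, M *m v = N *m v) -> M = N.
Proof.
move=> MN; apply/matrixP => i j; have := MN (delta_mx j 0).
by rewrite -!colE => /matrixP/(_ i 0); rewrite !mxE.
Qed.

(** * The affine Weyl group *)

Section WeylGroup.
Context {R : realType} {n : nat} (D : rootSystem R n).
Implicit Types (u v a b : 'cV[R]_n) (w m : 'M[R]_n) (i j : 'I_n).
Local Notation al := (simple D).

Lemma in_W1 : in_W D 1%:M.
Proof. by exists [::]. Qed.

Lemma in_W_cons a w : a \in roots D -> in_W D w -> in_W D (refl a *m w).
Proof.
by move=> aD [s sD ->]; exists (a :: s) => // b; rewrite inE => /orP[/eqP->|/sD].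
Qed.

Lemma in_W_ind (P : 'M[R]_n -> Prop) : P 1%:M ->
  (forall a w, a \in roots D -> in_W D w -> P w -> P (refl a *m w)) ->
  forall w, in_W D w -> P w.
Proof.
move=> P1 PS w [s sD ->]; elim: s sD => //= a s IH sD.
have sD' : {subset s <= roots D} by move=> b bs; rewrite sD// inE bs orbT.
by apply: PS; rewrite ?sD ?mem_head//; [exists s|exact: IH].
Qed.

Lemma in_W_refl a : a \in roots D -> in_W D (refl a).
Proof. by move=> aD; rewrite -[refl a]mulmx1; apply: in_W_cons => //; exact: in_W1. Qed.

Lemma in_W_mul w m : in_W D w -> in_W D m -> in_W D (w *m m).
Proof.
move=> wW mW; move: w wW; apply: in_W_ind => [|a w aD wW IH]; first by rewrite mul1mx.
by rewrite -mulmxA; exact: in_W_cons.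
Qed.

Lemma refl_mulK a : a != 0 -> refl a *m refl a = 1%:M.
Proof.
by move=> a0; apply: mulmx_ext => v; rewrite -mulmxA reflK// mul1mx.
Qed.

Lemma in_W_unit w : in_W D w -> w \in unitmx.
Proof.
move: w; apply: in_W_ind => [|a w aD _ wu]; first exact: unitmx1.
by rewrite unitmx_mul wu (mulmx1_unit (refl_mulK (root_neq0 aD))).1.
Qed.

Lemma invmx_unique w m : w *m m = 1%:M -> invmx w = m.
Proof.
by move=> wm; rewrite -[RHS]mul1mx -(mulVmx (mulmx1_unit wm).1) -mulmxA wm mulmx1.
Qed.

Lemma invmx_refl a : a != 0 -> invmx (refl a) = refl a.
Proof. by move=> /refl_mulK/invmx_unique. Qed.

Lemma in_W_inv w : in_W D w -> in_W D (invmx w).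
Proof.
move: w; apply: in_W_ind => [|a w aD wW IH]; first by rewrite invmx1; exact: in_W1.
rewrite (@invmx_unique _ (invmx w *m refl a)); last first.
  by rewrite -mulmxA mulKVmx ?in_W_unit// refl_mulK// (root_neq0 aD).
by apply: in_W_mul => //; exact: in_W_refl.
Qed.

Lemma W_mulK w v : in_W D w -> invmx w *m (w *m v) = v.
Proof. by move=> /in_W_unit wu; rewrite mulKmx. Qed.

Lemma W_mulVK w v : in_W D w -> w *m (invmx w *m v) = v.
Proof. by move=> /in_W_unit wu; rewrite mulKVmx. Qed.

Lemma dot_W w u v : in_W D w -> dot (w *m u) (w *m v) = dot u v.
Proof.
move: w; apply: in_W_ind => [|a w aD _ IH]; first by rewrite !mul1mx.
by rewrite -!mulmxA dot_refl// (root_neq0 aD).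
Qed.

Lemma dot_WV w u v : in_W D w -> dot (invmx w *m u) v = dot u (w *m v).
Proof. by move=> wW; rewrite -(dot_W _ _ wW) W_mulVK. Qed.

Lemma coroot_W w a : in_W D w -> coroot (w *m a) = w *m coroot a.
Proof. by move=> wW; rewrite /coroot /nu dot_W// scalemxAr. Qed.

Lemma nu_W w a : in_W D w -> nu (w *m a) = nu a.
Proof. by move=> wW; rewrite /nu dot_W. Qed.

Lemma root_W w a : in_W D w -> a \in roots D -> w *m a \in roots D.
Proof.
move=> wW aD; move: w wW; apply: in_W_ind => [|b w bD _ IH]; first by rewrite mul1mx.
by rewrite -mulmxA roots_refl.
Qed.

End WeylGroup.

Section AffineWeylGroup.
Context {R : realType} {n : nat} (D : rootSystem R n).
Variable B : zmodClosed 'cV[R]_n.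
Hypothesis QB : forall v, in_Q D v -> v \in B.
Hypothesis BP : forall v, v \in B -> in_P D v.
Implicit Types (u v a b : 'cV[R]_n).
Implicit Types (x y z : @affW R n) (r : @affV R n).
Local Notation al := (simple D).
Local Notation G := (in_affW D B).

Lemma root_in_B a : a \in roots D -> a \in B.
Proof. by move=> /root_in_Q/QB. Qed.

Lemma B_coroot b a : b \in B -> a \in roots D -> dot b (coroot a) \is a Num.int.
Proof. by move=> /BP/in_PE bP aD; exact: (coroot_int (D := D)). Qed.

Lemma B_scale b (c : R) : b \in B -> c \is a Num.int -> c *: b \in B.
Proof. by move=> bB /intrP[k ->]; rewrite scaler_int rpredMz. Qed.

Lemma B_W w b : in_W D w -> b \in B -> w *m b \in B.
Proof.
move=> wW bB; move: w wW; apply: in_W_ind => [|a w aD wW IH]; first by rewrite mul1mx.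
by rewrite -mulmxA reflE rpredB// B_scale ?root_in_B// B_coroot.
Qed.

Lemma aone_G : G (aone (R := R) (n := n)).
Proof. by split; [exact: in_W1|exact: rpred0]. Qed.

Lemma amul_G x y : G x -> G y -> G (amul x y).
Proof.
move=> [x1 x2] [y1 y2]; split; first exact: in_W_mul.
by rewrite rpredD// B_W//; exact: in_W_inv.
Qed.

Lemma ainv_G x : G x -> G (ainv x).
Proof. by move=> [x1 x2]; split; [exact: in_W_inv|rewrite /= rpredN B_W]. Qed.

Lemma tr_G b : b \in B -> G (tr b).
Proof. by move=> bB; split=> //; exact: in_W1. Qed.

Lemma lin_G w : in_W D w -> G (lin w).
Proof. by move=> wW; split=> //; exact: rpred0. Qed.

Lemma saff_G i : G (saff D i).
Proof.
case: i => [i|] /=; first exact/lin_G/in_W_refl/simple_root.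
apply: amul_G; first by apply: tr_G; exact/root_in_B/theta_root.
exact/lin_G/in_W_refl/theta_root.
Qed.

Lemma aactM x y r : G y -> aact (amul x y) r = aact x (aact y r).
Proof.
move=> [y1 _]; rewrite /aact /= mulmxA; congr (_, _).
by rewrite dotDr -[dot r.1 (invmx _ *m _)]dotC (dot_WV _ _ y1) [dot x.2 _]dotC; ring.
Qed.

Lemma affV_eq (r s : @affV R n) : r.1 = s.1 -> r.2 = s.2 -> r = s.
Proof. by case: r s => ? ? [? ?] /= -> ->. Qed.

Lemma aact1 r : aact aone r = r.
Proof. by case: r => r1 r2; rewrite /aact mul1mx dot0r subr0. Qed.

Lemma aact_inj x y : (forall r, aact x r = aact y r) -> x = y.
Proof.
move=> xy; case: x y xy => x1 x2 [y1 y2] xy; congr (_, _).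
  by apply: mulmx_ext => v; have [] := xy (v, 0).
by apply: dot_separates => v; have [_] := xy (v, 0); rewrite !add0r => /oppr_inj.
Qed.

Lemma aactK x r : G x -> aact (ainv x) (aact x r) = r.
Proof.
move=> [x1 _]; case: r => r1 r2; rewrite /aact /= (W_mulK _ x1); congr (_, _).
by rewrite dotNr (dot_W _ _ x1) opprK subrK.
Qed.

Lemma aactVK x r : G x -> aact x (aact (ainv x) r) = r.
Proof.
move=> [x1 _]; case: r => r1 r2; rewrite /aact /= (W_mulVK _ x1); congr (_, _).
by rewrite dotNr (dot_WV _ _ x1) opprK addrK.
Qed.

Lemma amulA x y z : G y -> G z -> amul x (amul y z) = amul (amul x y) z.
Proof.
by move=> yG zG; apply: aact_inj => r; rewrite !aactM//; exact: amul_G.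
Qed.

Lemma amul1x x : G x -> amul aone x = x.
Proof. by move=> xG; apply: aact_inj => r; rewrite aactM// aact1. Qed.

Lemma amulx1 x : amul x aone = x.
Proof. by apply: aact_inj => r; rewrite aactM ?aact1//; exact: aone_G. Qed.

Lemma amulVx x : G x -> amul (ainv x) x = aone.
Proof. by move=> xG; apply: aact_inj => r; rewrite aactM// aactK// aact1. Qed.

Lemma amulxV x : G x -> amul x (ainv x) = aone.
Proof.
by move=> xG; apply: aact_inj => r; rewrite aactM ?aactVK ?aact1//; exact: ainv_G.
Qed.

Lemma ainvK x : G x -> ainv (ainv x) = x.
Proof.
move=> xG; have xVG := ainv_G xG.
by rewrite -[LHS]amulx1 -(amulVx xG) amulA// amulVx// amul1x.
Qed.

Lemma ainvM x y : G x -> G y -> ainv (amul x y) = amul (ainv y) (ainv x).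
Proof.
move=> xG yG; have xVG := ainv_G xG; have yVG := ainv_G yG.
have xyG := amul_G xG yG; have xyVG := ainv_G xyG; apply: aact_inj => r.
have E : r = aact (amul x y) (aact (amul (ainv y) (ainv x)) r).
  by rewrite !aactM// !aactVK.
by rewrite {1}E aactK.
Qed.

Lemma ainv1 : ainv (aone (R := R) (n := n)) = aone.
Proof. by rewrite -[LHS]amulx1 amulVx//; exact: aone_G. Qed.

Lemma aactD x r (s : @affV R n) : aact x (r + s) = aact x r + aact x s.
Proof.
by apply: affV_eq; rewrite /= ?mulmxDr// dotDl; ring.
Qed.

Lemma aactN x r : aact x (- r) = - aact x r.
Proof. by apply: affV_eq; rewrite /= ?mulmxN// dotNl; ring. Qed.

Lemma aactB x r (s : @affV R n) : aact x (r - s) = aact x r - aact x s.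
Proof. by rewrite aactD aactN. Qed.

Definition ascale (c : R) r : @affV R n := (c *: r.1, c * r.2).

Lemma aactZ c x r : aact x (ascale c r) = ascale c (aact x r).
Proof. by apply: affV_eq; rewrite /= -?scalemxAr// dotZl; ring. Qed.

(* <r, alpha_i^vee> *)
Definition apair r i : R := dot r.1 (coroot (aroot D i).1).

Lemma saffE i r : aact (saff D i) r = r - ascale (apair r i) (aroot D i).
Proof.
case: i r => [i|] [r1 r2] /=.
  by apply: affV_eq; rewrite /apair /= ?reflE// dot0r mulr0.
apply: affV_eq; rewrite /apair /= corootN theta_coroot ?mulr1.
  by rewrite mul1mx reflE theta_coroot dotNr scalerN scaleNr opprK.
have t0 := root_neq0 (theta_root D).
by rewrite addr0 (invmx_refl t0) (refl_self t0) !dotNr.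
Qed.

Lemma apair_root i : apair (aroot D i) i = 2.
Proof.
case: i => [i|]; rewrite /apair /= coroot_self ?simple_neq0//.
by rewrite oppr_eq0 (root_neq0 (theta_root D)).
Qed.

Lemma saff_root i : aact (saff D i) (aroot D i) = - aroot D i.
Proof.
rewrite saffE apair_root; apply: affV_eq => /=; last by ring.
by rewrite scaler_nat mulr2n opprD addNKr.
Qed.

Lemma saff2 i : amul (saff D i) (saff D i) = aone.
Proof.
apply: aact_inj => r; rewrite aactM ?aact1; last exact: saff_G.
rewrite (saffE i r) aactB aactZ saff_root (saffE i r).
by apply: affV_eq => /=; [rewrite scalerN opprK subrK|ring].
Qed.

Lemma saffK i r : aact (saff D i) (aact (saff D i) r) = r.
Proof. by rewrite -aactM ?saff2 ?aact1//; exact: saff_G. Qed.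

Lemma ainv_saff i : ainv (saff D i) = saff D i.
Proof.
have sG := saff_G i.
by rewrite -[LHS]amulx1 -(saff2 i) amulA// amulVx// amul1x.
Qed.

Lemma saff_mulK i x : G x -> amul (saff D i) (amul (saff D i) x) = x.
Proof. by move=> xG; rewrite amulA ?saff2 ?amul1x//; exact: saff_G. Qed.

(** * Affine roots, their signs and the length function *)

Definition affroot r := r.1 \in roots D /\ exists k : int, r.2 = nu r.1 *~ k.

Lemma affpos_root r : affpos D r -> affroot r.
Proof. by case=> rD [k rk _]; split=> //; exists k. Qed.

Lemma affrootN r : affroot r -> affroot (- r).
Proof.
case: r => r1 r2 [/= rD [k rk]]; split; rewrite /= ?rootNE//; exists (- k).
by rewrite nuN rk mulrNz.
Qed.

Lemma nu_mulz_inj a (k l : int) : a \in roots D -> nu a *~ k = nu a *~ l -> k = l.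
Proof.
move=> /root_neq0/nu_gt0 a0; rewrite -[_ *~ k]mulrzr -[_ *~ l]mulrzr => /(mulfI (lt0r_neq0 a0)).
exact: intr_inj.
Qed.

Lemma affposN r : affpos D r -> affpos D (- r) -> False.
Proof.
case: r => r1 r2 [/= rD [k rk kP]] [/= _ [l rl lP]].
have /(nu_mulz_inj rD) lk : nu r1 *~ l = nu r1 *~ (- k).
  by rewrite mulrNz -rk rl nuN.
case: kP lP => [kP|[k0 rP]] [lP|[l0 rN]]; try lia.
by move: rN; apply/negP/posN.
Qed.

Lemma affroot_sign r : affroot r -> affpos D r \/ affpos D (- r).
Proof.
case: r => r1 r2 [/= rD [k rk]]; have [k0|k0|k0] := ltgtP k 0.
- right; split; rewrite /= ?rootNE//; exists (- k); first by rewrite nuN rk mulrNz.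
  by left; rewrite oppr_gt0.
- by left; split=> //; exists k => //; left.
- case/orP: (root_signP rD) => rP; [left|right]; split; rewrite /= ?rootNE//;
    by exists 0; rewrite ?rk ?k0 ?mulr0z ?oppr0//; right.
Qed.

Lemma affroot_act x r : G x -> affroot r -> affroot (aact x r).
Proof.
move=> [x1 x2] [rD [k rk]]; split; rewrite /= ?root_W//.
have := B_coroot x2 rD; rewrite (nu_W _ x1) => /intrP[l xl]; exists (k - l).
by rewrite rk dotC (dot_nu _ (root_neq0 rD)) xl mulrzBr mulrzr.
Qed.

Lemma aroot_pos i : affpos D (aroot D i).
Proof.
case: i => [i|]; split; rewrite /= ?rootNE ?simple_root ?theta_root//.
  by exists 0; rewrite ?mulr0z//; right; split=> //; exact: simple_pos.
by exists 1; [rewrite nuN nu_theta|left].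
Qed.

Lemma aroot_affroot i : affroot (aroot D i).
Proof. exact/affpos_root/aroot_pos. Qed.

(** For i = 0 the level k of [a, nu_a k] changes by (theta, a^vee), which is at least -1 unless a =
    -theta. There it is -2, and the only dangerous level, 1, belongs to alpha_0 itself. *)
Lemma affpos_saff i r : affpos D r -> r <> aroot D i -> affpos D (aact (saff D i) r).
Proof.
move=> rP ri; have rR := affpos_root rP.
have := affroot_act (saff_G i) rR; move: rP ri rR; rewrite saffE.
case: i r => [i|] [a c] [/= aD [k ck kP]] ri [_ _] [].
  have -> : (a, c) - ascale (apair (a, c) (Some i)) (aroot D (Some i)) =
      (refl (al i) *m a, c).
    by apply: affV_eq; rewrite /apair /= ?reflE ?mulr0 ?subr0.
  move=> sD _; split=> //; exists k => /=.
    by rewrite (nu_W _ (in_W_refl (simple_root D i))).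
  case: kP => [|[k0 aP]]; [by left|right; split=> //].
  apply: refl_simple_pos => //; apply/eqP => ai; apply: ri.
  by rewrite ai ck k0 mulr0z.
have t0 := root_neq0 (theta_root D); have tD := theta_root D.
have a0 := root_neq0 aD.
have -> : (a, c) - ascale (apair (a, c) None) (aroot D None) =
    (refl (theta D) *m a, c + dot a (theta D)).
  apply: affV_eq; rewrite /apair /= corootN theta_coroot dotNr ?mulr1 ?opprK//.
  by rewrite scalerN scaleNr opprK reflE theta_coroot.
move=> sD [l /= sl]; split=> //=; exists l => //.
have tE := dot_nu (theta D) a0; set e := dot (theta D) (coroot a) in tE.
have /intrP[e' eE] : e \is a Num.int by exact: (@roots_int _ _ D).
have lE : l = k + e'.
  apply: (nu_mulz_inj aD).
  rewrite -[in LHS](nu_W a (in_W_refl tD)) -sl mulrzDr -ck; congr (_ + _).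
  by rewrite dotC tE eE mulrzr.
have [e0|e0] := boolP (0 <= e').
  case: kP => [k0|[k0 aP]]; first by left; lia.
  have [l0|l0] := boolP (0 < l); [by left|right; split; first by lia].
  rewrite reflE theta_coroot dotC tE eE (_ : e' = 0); last by lia.
  by rewrite mulr0 scale0r subr0.
have ltae : dot a (theta D) < 0.
  by rewrite dotC tE eE pmulr_rlt0 ?nu_gt0// ltrz0 ltNge.
(* The product with theta changes sign under s_theta and has become positive, so level 0 is still
   allowed for the image. *)
have sP : refl (theta D) *m a \in posroots D.
  have /orP[//|sN] := root_signP sD.
  have := dot_pos_dominant sN (@theta_dominant _ _ D).
  rewrite dotNl reflE theta_coroot dotBl dotZl theta_dot; lra.
have {kP} k0 : 0 < k.
  case: kP => [//|[k0 aP]].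
  by have := dot_pos_dominant aP (@theta_dominant _ _ D); rewrite leNgt ltae.
have [l0|l0] := boolP (0 < l); [by left|right; split=> //].
have [aE|aNt] := eqVneq a (- theta D).
  have e2 : e' = - 2.
    apply: (@intr_inj R); rewrite -eE /e aE corootN theta_coroot dotNr theta_dot.
    by rewrite rmorphN.
  have k1 : k != 1; last by lia.
  by apply/eqP => k1; apply: ri; rewrite ck k1 aE nuN nu_theta.
have [aE|at'] := eqVneq a (theta D).
  by move: ltae; rewrite aE theta_dot ltrn0.
have := short_coroot_le tD (theta_dot D) aD at'.
move=> /(_ aNt); rewrite -/e eE -intr_norm -[1]/(1%:~R) ler_int.
by lia.
Qed.

Lemma affpos_saffE i r : affpos D r -> affpos D (- aact (saff D i) r) ->
  r = aroot D i.
Proof.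
move=> rP srN; apply: contrapT => /(affpos_saff rP) srP.
exact: affposN srP srN.
Qed.

(** The coefficient of alpha_0 must be the second coordinate e, and the remaining vector a + e theta
    is nonnegative by [theta_dominates]. *)
Lemma affpos_decomp r : affpos D r -> exists c0 (c : 'I_n -> R),
  [/\ 0 <= c0, forall k, 0 <= c k &
   r = ascale c0 (aroot D None) + \sum_k ascale (c k) (aroot D (Some k))].
Proof.
case: r => a e [/= aD [k ek kP]].
have sumE (c : 'I_n -> R) : \sum_k ascale (c k) (aroot D (Some k)) =
    (\sum_k c k *: al k, 0).
  elim/big_rec2: _ => // i u1 u2 _ ->.
  by apply: affV_eq; rewrite //= mulr0 addr0.
have nu0 := nu_gt0 (root_neq0 aD).
have k0 : 0 <= k by case: kP => [/ltW|[->]].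
exists e, (cf D (a + e *: theta D)); rewrite sumE -cfE.
have e0 : 0 <= e by rewrite ek mulrz_ge0// ltW.
split=> //; last first.
  by apply: affV_eq; rewrite /= ?mulr1 ?addr0// scalerN addrC addrK.
move=> i; rewrite cfD cfZ; have t0 := pos_cf_ge0 i (theta_pos D).
have /orP[aP|aN] := root_signP aD; first by rewrite addr_ge0 ?mulr_ge0 ?(pos_cf_ge0 _ aP).
have k1 : 1 <= k.
  by case: kP => [|[_ aP]]; [rewrite gtz0_ge1|move: aN; rewrite (negPf (posN aP))].
have [_ /in_Qp_ge0[_ /(_ i)]] := theta_dominates (rootN aD).
rewrite nuN cfD cfN cfZ cfN opprK => h; apply: le_trans h _.
rewrite [X in _ <= X]addrC lerD2r ler_wpM2r// ek -mulrzr.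
by rewrite ler_peMr ?(ltW nu0)// (ler_int R 1).
Qed.

(* Stability under nonnegative real combinations is what makes the sign of an  *)
(* affine root readable from a decomposition into simple affine roots.          *)
Definition acone r := 0 <= r.2 /\ (r.2 = 0 -> forall k, 0 <= cf D r.1 k).

Lemma acone_pos r : affpos D r -> acone r.
Proof.
case: r => a e [/= aD [k ek kP]]; have nu0 := nu_gt0 (root_neq0 aD).
have k0 : 0 <= k by case: kP => [/ltW|[->]].
split=> [|/= e0 i]; first by rewrite /= ek mulrz_ge0// ltW.
case: kP => [k1|[_ /pos_cf_ge0//]].
by move: e0; rewrite ek => /eqP; rewrite -mulrzr mulf_eq0 gt_eqF//= intr_eq0 => /eqP k2; lia.
Qed.

Lemma acone_neg r : affpos D (- r) -> acone r -> False.
Proof.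
case: r => a e rN [/= e0 ac]; have [/= e0' ac'] := acone_pos rN.
have {e0 e0'} e0 : e = 0 by apply/eqP; rewrite eq_le e0 andbT -oppr_ge0.
have aD : a \in roots D by case: rN; rewrite /= rootNE.
have [i] := root_neq0_cf aD; rewrite eq_le ac// andbT -oppr_ge0 -cfN.
by move/negP; apply; apply: ac'; rewrite e0 oppr0.
Qed.

Lemma aconeD r s : acone r -> acone s -> acone (r + s).
Proof.
case: r s => a e [b f] [/= e0 ae] [/= f0 bf]; split=> /=; first exact: addr_ge0.
move=> ef i; rewrite cfD addr_ge0 ?ae ?bf//; lra.
Qed.

Lemma aconeZ c r : 0 <= c -> acone r -> acone (ascale c r).
Proof.
case: r => a e c0 [/= e0 ae]; split=> /=; first exact: mulr_ge0.
move=> /eqP; rewrite mulf_eq0 => /orP[/eqP->|/eqP e1] i; rewrite cfZ ?mul0r//.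
by rewrite mulr_ge0// ae.
Qed.

(** Nonnegative combinations of the images of the simple affine roots stay in the cone [acone],
    where no negative root lies. *)
Lemma lambda0 x : G x -> (forall i, affpos D (aact x (aroot D i))) ->
  lambda D x = set0.
Proof.
move=> xG xi; rewrite -subset0 => r [/affpos_decomp[c0 [c [c00 cP ->]]]].
rewrite /affneg => /acone_neg; apply; rewrite aactD aactZ; apply: aconeD.
  by apply: aconeZ => //; exact/acone_pos/xi.
elim/big_rec: _ => [|i s _ sc]; first by rewrite /aact /= mulmx0 dot0l subr0; split=> //= _ j; rewrite cf0.
rewrite aactD; apply: aconeD => //; rewrite aactZ; apply: aconeZ => //.
exact/acone_pos/xi.
Qed.

(** A positive root [a, nu_a k] turns negative only if k is at most (x.2, a^vee). *)
Lemma lambda_finite x : G x -> finite_set (lambda D x).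
Proof.
move=> xG; have [x1 x2] := xG.
pose N a := Num.truncn `|dot x.2 (coroot a)|.
pose S := [seq (a, nu a *~ Posz k) : @affV R n | a <- roots D, k <- iota 0 (N a).+1].
apply: (@sub_finite_set _ _ [set` S]); last exact: finite_seq.
move=> [a e] [[/= aD [k ek kP]] [_ [l el lP]]] /=.
have nu0 := nu_gt0 (root_neq0 aD).
have k0 : 0 <= k by case: kP => [/ltW|[->]].
have l0 : 0 <= l by case: lP => [/ltW|[->]].
have kN : k <= Posz (N a).
  have /intrP[d dE] := B_coroot x2 aD.
  have dE' : dot a x.2 = nu a * dot x.2 (coroot a) by rewrite dotC dot_nu// (root_neq0 aD).
  have := el => /= {}el; rewrite ek in el.
  have kd : k <= d.
    rewrite -(@ler_int R) -(ler_pM2l nu0) -dE -dE' -subr_ge0 -opprB mulrzr el.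
    by rewrite mulrz_ge0// nuN (nu_W _ x1) ltW.
  rewrite /N dE; have d0 : 0 <= d by lia.
  case: d d0 kd {dE} => // d _ kd; rewrite -intr_norm.
  by have -> : Num.truncn (`|Posz d|%:~R : R) = d by exact: natrK.
apply/allpairsPdep; exists a, `|k|%N; split=> //; last by rewrite gez0_abs// -ek.
by rewrite mem_iota add0n ltnS /=; lia.
Qed.

(** [aroot D i] is the only positive affine root whose sign s_i changes, so passing to s_i x adds
    exactly its preimage. Products over lambda are computed letter by letter in this way. *)
Lemma lambda_saff i x : G x -> affpos D (aact (ainv x) (aroot D i)) ->
  fset_set (lambda D (amul (saff D i) x)) =
  (aact (ainv x) (aroot D i) |` fset_set (lambda D x))%fset /\
  aact (ainv x) (aroot D i) \notin fset_set (lambda D x).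
Proof.
move=> xG pos; set r0 := aact _ _ in pos *; have sG := saff_G i.
have xr0 : aact x r0 = aroot D i by rewrite aactVK.
have fx := lambda_finite xG; split; last first.
  rewrite in_fset_set// notin_setE => -[_]; rewrite /affneg xr0.
  exact/affposN/aroot_pos.
have -> : lambda D (amul (saff D i) x) = (r0 |` lambda D x)%classic; last first.
  by rewrite fset_setU1.
apply/seteqP; split=> r.
  move=> [rP]; rewrite /affneg aactM// => rN; have rR := affpos_root rP.
  have [xP|xN] := affroot_sign (affroot_act xG rR); last by right.
  by left; rewrite /= /r0 -(affpos_saffE xP rN) aactK.
move=> [->|[rP rN]]; first by split; rewrite // /affneg aactM// xr0 saff_root opprK; exact: aroot_pos.
split=> //; rewrite /affneg aactM// -aactN; apply: affpos_saff => // xE.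
apply: (affposN rP); rewrite -(aactK (- r) xG) aactN xE; exact: pos.
Qed.

Lemma len_saff i x : G x -> affpos D (aact (ainv x) (aroot D i)) ->
  len D (amul (saff D i) x) = (len D x).+1.
Proof. by move=> xG /(lambda_saff xG)[E nin]; rewrite /len E cardfsU1 nin. Qed.

Lemma len_saffN i x : G x -> affpos D (- aact (ainv x) (aroot D i)) ->
  len D x = (len D (amul (saff D i) x)).+1.
Proof.
move=> xG neg; rewrite -(len_saff (i := i)) ?saff_mulK//; first exact/amul_G/xG/saff_G.
rewrite ainvM ?ainv_saff//; last exact: saff_G.
by rewrite aactM ?saff_root ?aactN//; exact: saff_G.
Qed.

Lemma aactV_sign i x : G x -> affpos D (aact (ainv x) (aroot D i)) \/
  affpos D (- aact (ainv x) (aroot D i)).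
Proof. by move=> xG; apply/affroot_sign/affroot_act/aroot_affroot/ainv_G. Qed.

Lemma len_ainv x : G x -> len D (ainv x) = len D x.
Proof.
move=> xG; have fx := lambda_finite xG; rewrite /len.
have -> : lambda D (ainv x) = ((fun r => - aact x r) @` lambda D x)%classic.
  apply/seteqP; split=> [r [rP rN]|_ [r [rP rN] <-]].
    exists (- aact (ainv x) r); last by rewrite aactN aactVK// opprK.
    by split=> //; rewrite /affneg aactN opprK aactVK.
  by split=> //; rewrite /affneg aactN opprK aactK.
rewrite fset_set_image// card_imfset//= => r s /oppr_inj /(congr1 (aact (ainv x))).
by rewrite !aactK.
Qed.

Lemma len_saffr i x : G x -> affpos D (- aact x (aroot D i)) ->
  len D x = (len D (amul x (saff D i))).+1.
Proof.
move=> xG neg; have sG := saff_G i; rewrite -[LHS]len_ainv// (len_saffN (i := i)).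
- by congr _.+1; rewrite -[RHS]len_ainv ?ainvM ?ainv_saff//; exact: amul_G.
- exact: ainv_G.
- by rewrite ainvK.
Qed.

Lemma len_gt0_descent x : G x -> (0 < len D x)%N ->
  exists i, affpos D (- aact x (aroot D i)).
Proof.
move=> xG; rewrite /len; case: (pselect (exists i, affpos D (- aact x (aroot D i)))) => //.
move=> /forallNP h; rewrite lambda0 ?fset_set0// => i.
have rR := affroot_act xG (aroot_affroot i).
by have [//|/h] := affroot_sign rR.
Qed.

Lemma len1 : len D (aone (R := R) (n := n)) = 0%N.
Proof.
rewrite /len lambda0 ?fset_set0//; first exact: aone_G.
by move=> i; rewrite aact1; exact: aroot_pos.
Qed.

Lemma len0_pos x r : G x -> len D x = 0%N -> affpos D r -> affpos D (aact x r).
Proof.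
move=> xG l0 rP; have rR := affroot_act xG (affpos_root rP).
have [//|rN] := affroot_sign rR.
have : r \in fset_set (lambda D x) by rewrite in_fset_set ?inE//; exact: lambda_finite.
by move: l0; rewrite /len => /eqP; rewrite cardfs_eq0 => /eqP->.
Qed.

(** s_i x^-1 has length 1, hence a descent alpha_j. As x^-1 keeps alpha_j positive, it must map it
    to alpha_i. *)
Lemma len0_simple x i : G x -> len D x = 0%N ->
  exists j, aact x (aroot D i) = aroot D j.
Proof.
move=> xG l0; have xVG := ainv_G xG; have sG := saff_G i.
have yG : G (amul (saff D i) (ainv x)) by exact: amul_G.
have l1 : len D (amul (saff D i) (ainv x)) = 1%N.
  by rewrite len_saff ?len_ainv ?l0 ?ainvK//; exact/len0_pos/aroot_pos.
have [|j] := len_gt0_descent yG; first by rewrite l1.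
rewrite aactM// => h; have P : affpos D (aact (ainv x) (aroot D j)).
  by apply: len0_pos; rewrite ?len_ainv//; exact: aroot_pos.
by exists j; rewrite -(affpos_saffE P h) aactVK.
Qed.

Implicit Types (w : seq (@aidx n)).

(** * Words and the exchange condition *)

Definition wel (w : seq (@aidx n)) : @affW R n :=
  foldr (fun i x => amul (saff D i) x) aone w.

Definition rw (w : seq (@aidx n)) : Prop := len D (wel w) = size w.

Lemma wel_G (w : seq (@aidx n)) : G (wel w).
Proof.
elim: w => [|i w IH] /=; first exact: aone_G.
by apply: amul_G => //; exact: saff_G.
Qed.

Lemma wel_cat w1 w2 : wel (w1 ++ w2) = amul (wel w1) (wel w2).
Proof.
elim: w1 => [|i w1 IH] /=; first by rewrite (amul1x (wel_G _)).
by rewrite IH amulA//; exact: wel_G.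
Qed.

Lemma wel_rev w : wel (rev w) = ainv (wel w).
Proof.
elim: w => [|i w IH] /=; first by rewrite ainv1.
rewrite rev_cons -cats1 wel_cat IH /= amulx1.
by rewrite (ainvM (saff_G i) (wel_G w)) ainv_saff.
Qed.

Lemma len_saff_cases i x : G x ->
  len D (amul (saff D i) x) = (len D x).+1 /\
    affpos D (aact (ainv x) (aroot D i)) \/
  len D x = (len D (amul (saff D i) x)).+1 /\
    affpos D (- aact (ainv x) (aroot D i)).
Proof.
move=> xG; have [P|N] := aactV_sign i xG; [left|right]; split=> //.
  exact: len_saff.
exact: len_saffN.
Qed.

Lemma len_wel w : (len D (wel w) <= size w)%N.
Proof.
elim: w => [|i w IH] /=; first by rewrite len1.
by have [[->]|[E]] := len_saff_cases i (wel_G w); rewrite ?ltnS//; lia.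
Qed.

Lemma rw_cons i w : rw (i :: w) ->
  rw w /\ affpos D (aact (ainv (wel w)) (aroot D i)).
Proof.
rewrite /rw /= => E; have := len_wel w.
by have [[E'] P|[E'] P] := len_saff_cases i (wel_G w); split=> //; lia.
Qed.

Lemma rw_consl i w : rw w -> affpos D (aact (ainv (wel w)) (aroot D i)) ->
  rw (i :: w).
Proof. by rewrite /rw /= => <- P; rewrite len_saff//; exact: wel_G. Qed.

Lemma rw_descent i w : rw (i :: w) ->
  affpos D (- aact (ainv (wel (i :: w))) (aroot D i)).
Proof.
move=> /rw_cons[_ P] /=; rewrite (ainvM (saff_G i) (wel_G w)) ainv_saff.
by rewrite (aactM _ _ (saff_G i)) saff_root aactN opprK.
Qed.

Lemma saff_conj i j x : G x -> aact x (aroot D j) = aroot D i ->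
  amul (saff D i) x = amul x (saff D j).
Proof.
move=> xG xj; apply: aact_inj => r; rewrite !aactM//; last exact: saff_G.
rewrite !saffE aactB aactZ xj; congr (_ - ascale _ _).
by rewrite /apair -xj /= (coroot_W _ xG.1) (dot_W _ _ xG.1).
Qed.

(** Undoing the letters one by one, the positive root r becomes negative at some letter; just
    before, it is the simple root of that letter. *)
Lemma exchange_root w r : affpos D r -> affpos D (- aact (ainv (wel w)) r) ->
  exists w1 i w2, w = w1 ++ i :: w2 /\ aact (wel w1) (aroot D i) = r.
Proof.
elim: w r => [|i w IH] r rP /=; first by rewrite ainv1 aact1 => /(affposN rP).
rewrite (ainvM (saff_G i) (wel_G w)) ainv_saff (aactM _ _ (saff_G i)).
have [->|ri] := pselect (r = aroot D i).
  by move=> _; exists [::], i, w; rewrite aact1.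
move=> /(IH _ (affpos_saff rP ri))[w1 [j [w2 [-> E]]]].
by exists (i :: w1), j, w2; rewrite /= aactM ?E ?saffK//; exact: wel_G.
Qed.

Lemma exchange w i : affpos D (- aact (ainv (wel w)) (aroot D i)) ->
  exists w1 j w2, [/\ w = w1 ++ j :: w2,
    amul (saff D i) (wel w1) = amul (wel w1) (saff D j) &
    amul (saff D i) (wel w) = wel (w1 ++ w2)].
Proof.
move=> /(exchange_root (aroot_pos i))[w1 [j [w2 [-> E]]]].
exists w1, j, w2; have C := saff_conj (wel_G w1) E; split=> //.
rewrite !wel_cat /= amulA ?C; [|exact: wel_G|exact: wel_G (j :: w2)].
by rewrite -amulA ?saff_mulK//; [exact: wel_G|exact: saff_G|exact: wel_G (j :: w2)].
Qed.

(** The subset clause ensures that a word in the s_i with i > 0 shortens to a reduced word in these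
    alone. *)
Lemma rw_exists w : exists w', [/\ rw w', wel w' = wel w & {subset w' <= w}].
Proof.
elim: w => [|i w [w' [rw' E S]]]; first by exists [::]; split=> //; exact: len1.
have [[L P]|[L N]] := len_saff_cases i (wel_G w').
  exists (i :: w'); split=> /=; rewrite /rw /= ?E// -?E ?L ?rw'// => c.
  by rewrite !inE => /orP[->//|/S->]; rewrite orbT.
have [w1 [j [w2 [w'E _ EE]]]] := exchange N.
exists (w1 ++ w2); split; last 1 first.
- move=> c cw; rewrite inE S ?orbT// w'E; move: cw.
  by rewrite !mem_cat inE => /orP[->//|->]; rewrite !orbT.
- apply: succn_inj; rewrite /rw -EE -L rw' w'E !size_cat /=; lia.
- by rewrite -EE E.
Qed.

Lemma wel_len0 w : len D (wel w) = 0%N -> wel w = aone.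
Proof. by have [w' [rw' <- _]] := rw_exists w; rewrite rw' => /size0nil ->. Qed.

(** * Alternating words and braid moves *)

Fixpoint alt (k : nat) i j : seq (@aidx n) :=
  if k is k'.+1 then i :: alt k' j i else [::].

Lemma size_alt k i j : size (alt k i j) = k.
Proof. by elim: k i j => //= k IH i j; rewrite IH. Qed.

Lemma alt_cat k l i j :
  alt (k + l) i j = alt k i j ++ (if odd k then alt l j i else alt l i j).
Proof.
elim: k i j => // k IH i j; rewrite addSn /= IH.
by case: (odd k).
Qed.

Lemma rev_alt k i j : rev (alt k i j) = if odd k then alt k i j else alt k j i.
Proof.
elim: k i j => // k IH i j; rewrite [alt k.+1 i j in LHS]/= rev_cons IH -cats1.
have -> : odd k.+1 = ~~ odd k by [].
by rewrite -addn1 !alt_cat; case: (odd k).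
Qed.

Lemma alt_dbl k i j : alt (k + k) i j = alt k i j ++ rev (alt k j i).
Proof. by rewrite alt_cat rev_alt. Qed.

Lemma apow_alt k i j : apow (amul (saff D i) (saff D j)) k = wel (alt (k + k) i j).
Proof.
elim: k => // k IH; rewrite addnS /= -IH /apow /= -/(apow _ _) -amulA//.
  exact: saff_G.
by rewrite IH; exact: wel_G.
Qed.

Lemma alt_swap k i j :
  wel (alt k i j) = wel (alt k j i) <-> apow (amul (saff D i) (saff D j)) k = aone.
Proof.
rewrite apow_alt alt_dbl wel_cat wel_rev; have xG := wel_G (alt k i j).
have yG := wel_G (alt k j i); split=> [->|E]; first exact: amulxV.
have yVG := ainv_G yG.
by rewrite -[LHS]amulx1 -(amulVx yG) amulA// E amul1x.
Qed.

(** Apply the exchange condition to the descent j. If the deleted letter lies in the alternating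
    prefix, the two alternating words agree at some length at most k + 1. If it lies in the tail,
    the prefix grows by the letter j and the tail shrinks, and induction on the tail applies with i
    and j exchanged. *)
Lemma dihedral_descent t k i j : rw (alt k.+1 i j ++ t) ->
  affpos D (- aact (ainv (wel (alt k.+1 i j ++ t))) (aroot D j)) ->
  exists m t', [/\ (0 < m)%N, aorder (amul (saff D i) (saff D j)) m,
    aorder (amul (saff D j) (saff D i)) m,
    wel (alt m i j ++ t') = wel (alt k.+1 i j ++ t) /\ rw (alt m i j ++ t') &
    wel (alt m j i ++ t') = wel (alt k.+1 i j ++ t) /\ rw (alt m j i ++ t')].
Proof.
have [N] := ubnP (size t); elim: N => // N IH in t k i j *; rewrite ltnS => tN rwt neg.
have [w1 [c [w2 [E C EE]]]] := exchange neg.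
have [lek|ltk] := leqP (size w1) k.
  have w1E : w1 = alt (size w1) i j /\ c = if odd (size w1) then j else i.
    have := E; rewrite -[k.+1](subnKC (leqW lek)) alt_cat -catA subSn//= => /eqP.
    rewrite eqseq_cat ?size_alt// => /andP[/eqP e h]; split; first by rewrite e.
    by move: h; case: odd => /eqP[].
  move: w1E => [w1E cE]; set p := size w1 in w1E cE lek.
  have S : wel (alt p.+1 j i) = wel (alt p.+1 i j).
    rewrite [LHS]/= -w1E C w1E cE -addn1 alt_cat wel_cat.
    by case: odd; rewrite /= amulx1.
  (* The least length at which the two alternating words agree is the order of s_i s_j. *)
  have ex : exists m, (0 < m)%N && `[< wel (alt m i j) = wel (alt m j i) >].
    by exists p.+1; apply/asboolP.
  case: (ex_minnP ex) => m /andP[m0 /asboolP mE] mmin.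
  have mk : (m <= k.+1)%N by apply: leq_trans (mmin p.+1 _) _ => //; apply/asboolP.
  pose t' := drop m (alt k.+1 i j) ++ t.
  have zE : alt m i j ++ t' = alt k.+1 i j ++ t.
    rewrite /t' catA; congr (_ ++ _); rewrite -[RHS](cat_take_drop m).
    by rewrite -{2}(subnKC mk) alt_cat take_size_cat ?size_alt.
  have ord i' j' : (forall l, wel (alt l i j) = wel (alt l j i) <->
      wel (alt l i' j') = wel (alt l j' i')) -> aorder (amul (saff D i') (saff D j')) m.
    move=> ij; split=> // [|l /andP[l0 lm]]; rewrite -alt_swap -ij// => lE.
    by have := mmin l; rewrite l0 leqNgt lm => /(_ (introT (asboolP _) lE)).
  exists m, t'; split=> //; first by apply: ord => l; split=> ->.
  - by apply: ord => l; split=> ->.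
  - by rewrite zE.
  - have e : wel (alt m j i ++ t') = wel (alt k.+1 i j ++ t).
      by rewrite -zE !wel_cat mE.
    by split=> //; rewrite /rw e rwt -zE !size_cat !size_alt.
have yE : exists w1', w1 = alt k.+1 i j ++ w1' /\ t = w1' ++ c :: w2.
  exists (drop k.+1 w1); have := E; rewrite -{1}(cat_take_drop k.+1 w1) -catA => /eqP.
  rewrite eqseq_cat ?size_alt ?size_takel// => /andP[/eqP e /eqP ->].
  by split=> //; rewrite {1}e cat_take_drop.
case: yE => w1' [w1E yE].
have e : wel (alt k.+2 j i ++ w1' ++ w2) = wel (alt k.+1 i j ++ t).
  rewrite -[LHS]/(amul (saff D j) (wel (alt k.+1 i j ++ w1' ++ w2))) catA -w1E.
  by rewrite -EE saff_mulK//; exact: wel_G.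
have rwe : rw (alt k.+2 j i ++ w1' ++ w2).
  by rewrite /rw e rwt yE !size_cat !size_alt /=; lia.
have [|//||m [t' [m0 o1 o2 [e1 r1] [e2 r2]]]] := IH (w1' ++ w2) k.+1 j i.
- by move: tN; rewrite yE !size_cat /=; lia.
- rewrite e; have := rw_descent (w := alt k j i ++ t) (i := i); exact.
by exists m, t'; rewrite -e; split.
Qed.

Lemma wel_cons_inj i (u v : seq (@aidx n)) : wel (i :: u) = wel (i :: v) -> wel u = wel v.
Proof.
by move=> /= E; rewrite -[LHS](saff_mulK i (wel_G u)) E saff_mulK//; exact: wel_G.
Qed.

Section Braid.
Variables (A : pzSemiRingType) (T : @aidx n -> A).
Hypothesis braid : forall i j k, i != j ->
  aorder (amul (saff D i) (saff D j)) k ->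
  \prod_(c <- alt k i j) T c = \prod_(c <- alt k j i) T c.

(* Matsumoto's theorem *)
Lemma braid_word w w' : rw w -> rw w' -> wel w = wel w' ->
  \prod_(i <- w) T i = \prod_(i <- w') T i.
Proof.
have [N] := ubnP (size w); elim: N => // N IH in w w' *; rewrite ltnS => wN rww rww' E.
have sE : size w = size w' by rewrite -rww -rww' E.
have same i (u v : seq (@aidx n)) : (size u < N)%N -> rw (i :: u) -> rw (i :: v) ->
    wel (i :: u) = wel (i :: v) ->
    \prod_(c <- i :: u) T c = \prod_(c <- i :: v) T c.
  move=> uN /rw_cons[ru _] /rw_cons[rv _] /wel_cons_inj e.
  by rewrite !big_cons (IH u v).
case: w w' => [|i u] [|j v]// in wN rww rww' E sE *.
have [ij|ij] := eqVneq i j; first by rewrite -ij in rww' E *; exact: same.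
have neg : affpos D (- aact (ainv (wel (i :: u))) (aroot D j)).
  by rewrite E; exact: rw_descent.
have := @dihedral_descent u 0 i j rww neg.
move=> [[|m] [z [// _ o1 o2 [e1 r1] [e2 r2]]]].
rewrite (same i u (alt m j i ++ z))//.
have -> : \prod_(c <- i :: alt m j i ++ z) T c = \prod_(c <- alt m.+1 j i ++ z) T c.
  by rewrite -cat_cons -[i :: _]/(alt m.+1 i j) !big_cat (braid ij o1).
apply: same => //; last by rewrite -E -[RHS]e2.
by have := congr1 (len D) e2; rewrite r2 rww /= size_cat; move: wN; rewrite /=; lia.
Qed.

End Braid.

(** * Additive lengths and the group Pi *)

Implicit Types (g h : 'M[R]_n).

(** Under this condition lambda(xy) is the disjoint union of lambda(y) and the preimage of lambda(x)
    under y. *)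
Lemma len_amul x y : G x -> G y ->
  (forall r, affpos D r -> affneg D (aact y r) -> affneg D (aact x (aact y r))) ->
  len D (amul x y) = (len D x + len D y)%N.
Proof.
move=> xG yG H; have xyG := amul_G xG yG; rewrite /len.
have fx := lambda_finite xG; have fy := lambda_finite yG.
have -> : lambda D (amul x y) = (lambda D y `|` aact (ainv y) @` lambda D x)%classic.
  apply/seteqP; split=> r.
    move=> [rP]; rewrite /affneg aactM// => rN.
    have [yP|yN] := affroot_sign (affroot_act yG (affpos_root rP)); last by left.
    by right; exists (aact y r) => //; rewrite aactK.
  move=> [[rP rN]|[s [sP sN] <-]].
    by split=> //; rewrite /affneg aactM//; exact: H.
  have sR := affroot_act (ainv_G yG) (affpos_root sP).
  split; last by rewrite /affneg aactM// aactVK.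
  have [//|sM] := affroot_sign sR; have := H _ sM.
  rewrite /affneg !aactN aactVK// !opprK => /(_ sP) sP'.
  by case: (affposN sP' sN).
rewrite fset_setU//; last exact: finite_image.
rewrite fset_set_image// cardfsU (_ : (_ `&` _)%fset = fset0); last first.
  apply/fsetP => r; rewrite !inE; apply/negP => /andP[]; rewrite in_fset_set// inE.
  move=> [_ rN] /imfsetP[s /=]; rewrite in_fset_set// inE => -[sP _] rE.
  by move: rN; rewrite rE /affneg aactVK//; exact: affposN.
rewrite cardfs0 subn0 addnC card_imfset//= => r s /(congr1 (aact y)).
by rewrite !aactVK.
Qed.

Lemma in_Pi_G x : in_Pi D B x -> G x. Proof. by case. Qed.

Lemma Pi_pos x r : in_Pi D B x -> affpos D r -> affpos D (aact x r).
Proof. by move=> [xG x0]; exact: len0_pos. Qed.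

Lemma len_Pi x y : in_Pi D B x -> G y -> len D (amul x y) = len D y.
Proof.
move=> xP yG; have [xG x0] := xP; rewrite len_amul ?x0// => r _ yr.
by rewrite /affneg -aactN; exact: Pi_pos.
Qed.

Lemma Pi_inv x : in_Pi D B x -> in_Pi D B (ainv x).
Proof. by move=> [xG x0]; split; rewrite ?len_ainv//; exact: ainv_G. Qed.

Lemma Pi_mul x y : in_Pi D B x -> in_Pi D B y -> in_Pi D B (amul x y).
Proof.
move=> xP [yG y0]; split; last by rewrite len_Pi.
by apply: amul_G => //; exact: in_Pi_G.
Qed.

Lemma Pi1 : in_Pi D B (aone : @affW R n).
Proof. by split; [exact: aone_G|exact: len1]. Qed.

Lemma Pi_simple x i : in_Pi D B x -> exists j, aact x (aroot D i) = aroot D j.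
Proof. by move=> [xG x0]; exact: len0_simple. Qed.

Lemma awordE x w : aword D x w = amul x (wel w). Proof. by []. Qed.

Lemma reduced_rw x p w : reduced D B x p w -> rw w.
Proof.
move=> [pP -> sw]; rewrite /rw sw awordE len_Pi//; exact: wel_G.
Qed.

Lemma rw_reduced p w : in_Pi D B p -> rw w -> reduced D B (amul p (wel w)) p w.
Proof. by move=> pP rw'; split=> //; rewrite len_Pi//; exact: wel_G. Qed.

Lemma reduced_exists x : G x -> exists p w, reduced D B x p w.
Proof.
have [N] := ubnP (len D x); elim: N => // N IH in x *; rewrite ltnS => xN xG.
have [l0|] := posnP (len D x).
  by exists x, [::]; split; rewrite ?l0//; rewrite awordE amulx1.
move=> /(len_gt0_descent xG)[i xi]; have sG := saff_G i.
have xsG := amul_G xG sG; have lE := len_saffr xG xi.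
have [|p [w [pP E sE]]] := IH _ _ xsG; first by rewrite -ltnS -lE ltnS.
exists p, (rcons w i); split=> //; last by rewrite size_rcons sE.
rewrite awordE -cats1 wel_cat /= amulx1 amulA ?sG//; last exact: wel_G.
rewrite -awordE -E -amulA ?saff2 ?amulx1//.
Qed.

(** p'^-1 p is a product of simple reflections and has length 0, hence it is trivial. *)
Lemma aword_inj p w p' w' : in_Pi D B p -> in_Pi D B p' ->
  amul p (wel w) = amul p' (wel w') -> p = p' /\ wel w = wel w'.
Proof.
move=> pP p'P E; have pG := in_Pi_G pP; have p'G := in_Pi_G p'P.
have wG := wel_G w; have w'G := wel_G w'.
have E' : amul (ainv p') p = wel (w' ++ rev w).
  rewrite wel_cat wel_rev -[wel w'](amul1x w'G) -(amulVx p'G).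
  rewrite -[amul _ (wel w')]amulA// -E.
  rewrite -amulA//; first by rewrite -amulA ?amulxV ?amulx1//; exact: ainv_G.
    by apply: amul_G.
  exact: ainv_G.
have pp : p = p'.
  have e1 : amul (ainv p') p = aone.
    rewrite E'; apply: wel_len0; rewrite -E' len_Pi//; last exact: Pi_inv.
    by case: pP.
  by rewrite -[p]amul1x// -(amulxV p'G) -amulA// ?e1 ?amulx1//; exact: ainv_G.
split=> //; move: E; rewrite pp => /(congr1 (amul (ainv p'))).
by rewrite !amulA// amulVx// !amul1x.
Qed.

(** * The finite Weyl group *)

Lemma lin_amul g h : in_W D h -> amul (lin g) (lin h) = lin (g *m h).
Proof. by move=> hW; rewrite /amul /= mulmx0 addr0. Qed.

Lemma ainv_lin g : ainv (lin g) = lin (invmx g).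
Proof. by rewrite /ainv /= mulmx0 oppr0. Qed.

Lemma refl_wel a : a \in posroots D -> exists s, lin (refl a) = wel (map some s).
Proof.
move: a; apply: pos_root_ind => [i|a i aP ai _ [s sE]].
  by exists [:: i]; rewrite /= amulx1.
exists (i :: rcons s i); rewrite /= map_rcons -cats1 wel_cat -sE /= amulx1.
rewrite !lin_amul; try by [apply: in_W_refl; rewrite ?roots_refl ?simple_root ?(pos_root aP)].
  congr lin; apply: mulmx_ext => v; have a0 := simple_neq0 D i.
  rewrite -!mulmxA [refl (_ *m a) *m _]reflE coroot_refl// dot_refl//.
  by rewrite mulmxBr -scalemxAr !reflK// reflE.
apply: in_W_mul; apply: in_W_refl; rewrite ?roots_refl ?simple_root ?(pos_root aP)//.
Qed.

Lemma in_W_wel g : in_W D g -> exists2 s, rw (map some s) & lin g = wel (map some s).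
Proof.
move=> gW; have [s sE] : exists s, lin g = wel (map some s).
  move: g gW; apply: in_W_ind => [|a g aD gW [s sE]]; first by exists [::].
  have [t tE] : exists s, lin (refl a) = wel (map some s).
    have /orP[aP|aN] := root_signP aD; first exact: refl_wel.
    by rewrite -reflN; exact: refl_wel.
  by exists (t ++ s); rewrite map_cat wel_cat -tE -sE lin_amul.
have [w [rw' wE ws]] := rw_exists (map some s).
have E : map some (pmap id w) = w.
  by rewrite pmapS_filter map_id; apply/all_filterP/allP => c /ws /mapP[i _ ->].
by exists (pmap id w); rewrite E// wE.
Qed.

Lemma lin_reduced g : in_W D g ->
  exists s, reduced D B (lin g) aone (map some s) /\ rw (map some s).
Proof.
move=> gW; have [s rws E] := in_W_wel gW; exists s; split=> //.
by rewrite E -[wel _]amul1x; [apply: rw_reduced => //; exact: Pi1|exact: wel_G].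
Qed.

Lemma aact_lin g a (c : R) : aact (lin g) (a, c) = (g *m a, c).
Proof. by rewrite /aact /= dot0r subr0. Qed.

Lemma affpos_fin a : affpos D (a, 0) <-> a \in posroots D.
Proof.
split=> [[/= aD [k k0 [kP|[_ //]]]]|aP].
  move: k0 => /esym/eqP; rewrite -mulrzr mulf_eq0 gt_eqF ?nu_gt0 ?(root_neq0 aD)//.
  by rewrite intr_eq0 => /eqP k0; rewrite k0 in kP.
by split; [exact: pos_root|exists 0; rewrite ?mulr0z//; right].
Qed.

Lemma affneg_fin a : affpos D (- (a, 0) : @affV R n) <-> - a \in posroots D.
Proof. by rewrite -affpos_fin /= -[- (a, 0)]/(- a, - 0) oppr0. Qed.

Lemma affpos_ge0 r : affpos D r -> 0 <= r.2.
Proof. by move=> /acone_pos[]. Qed.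

Lemma affroot_gt0 r : affroot r -> 0 < r.2 -> affpos D r.
Proof.
move=> /affroot_sign[//|/affpos_ge0]; rewrite /= oppr_ge0 => h1 h2.
by move: (lt_le_trans h2 h1); rewrite ltxx.
Qed.

(** The last letter i of a nonempty reduced word would make alpha_i negative. *)
Lemma in_W_pos1 g : in_W D g -> (forall i, g *m al i \in posroots D) -> g = 1%:M.
Proof.
move=> gW gi; have [s rws E] := in_W_wel gW; have gG := lin_G gW.
case: (lastP s) => [|s' i] in rws E *; first by case: E.
have := rw_descent (w := rev (map some s')) (i := Some i).
rewrite -[Some i :: _]rev_rcons -map_rcons wel_rev -E ainvK// aact_lin affneg_fin.
rewrite (negPf (posN (gi i))) => H; suff /H : rw (rev (map some (rcons s' i))) by [].
by rewrite /rw wel_rev -E len_ainv// E rws size_rev.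
Qed.

(** Induction on the length: at a descent i of g, passing from g s_i to g adds to the difference a
    nonnegative multiple of the positive root -g(alpha_i). *)
Lemma W_pos_dominant g v : in_W D g -> dominant D (- v) ->
  forall i, 0 <= cf D (g *m v - v) i.
Proof.
move=> gW vd; have [N] := ubnP (len D (lin g)).
elim: N => // N IH in g gW *; rewrite ltnS => gN k.
have gG := lin_G gW.
have [[i gi]|ng] := pselect (exists i, - (g *m al i) \in posroots D); last first.
  rewrite (in_W_pos1 gW) ?mul1mx ?subrr ?cf0// => i; apply: contrapT => gi; apply: ng.
  by exists i; rewrite posNE ?root_W ?simple_root//; apply/negP.
have sW := in_W_refl (simple_root D i); have hW := in_W_mul gW sW.
have := len_saffr (i := Some i) gG; rewrite aact_lin affneg_fin => /(_ gi).
rewrite lin_amul// => lE.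
have hN : (len D (lin (g *m refl (al i))) < N)%N by rewrite -lE.
have h := IH _ hW hN k.
have {1}-> : v = refl (al i) *m v + dot v (coroot (al i)) *: al i by rewrite reflE subrK.
rewrite mulmxDr mulmxA addrAC cfD addr_ge0// -scalemxAr -[g *m _]opprK scalerN -scaleNr cfZ.
rewrite mulr_ge0 ?(pos_cf_ge0 _ gi)// -dotNl -(pmulr_rge0 _ (nu_gt0 (simple_neq0 D i))).
by rewrite -dot_nu ?simple_neq0//; exact: vd.
Qed.

Lemma antidominant_uniq g v : in_W D g -> dominant D (- v) ->
  dominant D (- (g *m v)) -> g *m v = v.
Proof.
move=> gW vd gvd; apply: (@cf_inj _ _ D) => i; apply/eqP; rewrite -subr_eq0 -cfN -cfD.
rewrite eq_le W_pos_dominant// andbT.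
have := W_pos_dominant (in_W_inv gW) gvd i; rewrite (W_mulK _ gW) -opprB cfN.
by rewrite oppr_ge0.
Qed.

Lemma refl_rem_perm i :
  perm_eq [seq refl (al i) *m a | a <- rem (al i) (posroots D)]
    (rem (al i) (posroots D)).
Proof.
have a0 := simple_neq0 D i; have aP := simple_pos D i.
have ps : perm_eq (posroots D) (al i :: rem (al i) (posroots D)) by exact: perm_to_rem.
set s := rem _ _ in ps *.
have /andP[ns su] : uniq (al i :: s) by rewrite -(perm_uniq ps) pos_uniq.
have key b : b \in s -> refl (al i) *m b \in s.
  move=> bs; have bP : b \in posroots D by rewrite (perm_mem ps) inE bs orbT.
  have bi : b != al i by apply: contraTneq bs => ->.
  have := refl_simple_pos bP bi; rewrite (perm_mem ps) inE => /orP[/eqP e|//].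
  by have := posN aP; rewrite -(refl_self a0) -{2}e reflK// bP.
apply: uniq_perm => [||a] //.
  by rewrite map_inj_uniq// => u v /(congr1 (mulmx (refl (al i)))); rewrite !reflK.
apply/mapP/idP => [[b bs ->]|as']; first exact: key.
by exists (refl (al i) *m a); [exact: key|rewrite reflK].
Qed.

Lemma perm_pos_rem i : perm_eq (posroots D) (al i :: rem (al i) (posroots D)).
Proof. exact/perm_to_rem/simple_pos. Qed.

(** * Antidominant weights and the elements pi_b *)

Lemma pos_refl_count i (P : 'cV[R]_n -> bool) :
  (count (fun a => P (refl (al i) *m a)) (posroots D) + P (al i) =
   count P (posroots D) + P (- al i))%N.
Proof.
have a0 := simple_neq0 D i; set s := rem (al i) (posroots D).
rewrite !(permP (perm_pos_rem i)) /= refl_self// -/s -[in RHS](permP (refl_rem_perm i)).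
by rewrite count_map -[count (preim _ _) s]/(count (fun a => P (refl (al i) *m a)) s); lia.
Qed.

(** Choose g minimizing the number of positive roots that pair positively with g(v); a simple
    reflection at a positive product would lower this number by one. *)
Lemma antidominant_exists v : exists2 g, in_W D g & dominant D (- (g *m v)).
Proof.
pose N g := count (fun a => 0 < dot (g *m v) a) (posroots D).
have ex : exists k, `[< exists2 g, in_W D g & N g = k >].
  by exists (N 1%:M); apply/asboolP; exists 1%:M => //; exact: in_W1.
case: (ex_minnP ex) => k /asboolP[g gW gk] kmin; exists g => // i.
rewrite dotNl oppr_ge0 leNgt; apply/negP => gi.
have sW := in_W_refl (simple_root D i).
have := kmin (N (refl (al i) *m g)); have -> : `[< exists2 h, in_W D h & N h = N (refl (al i) *m g) >].
  by apply/asboolP; exists (refl (al i) *m g) => //; exact: in_W_mul.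
move=> /(_ isT); have := pos_refl_count i (fun a => 0 < dot (g *m v) a).
rewrite gi dotNr oppr_gt0 ltNge (ltW gi) /= addn1 addn0 -/(N g) gk => <-.
have -> : N (refl (al i) *m g) = count (fun a => 0 < dot (g *m v) (refl (al i) *m a)) (posroots D).
  by apply: eq_count => a; rewrite -mulmxA -{2}[g *m v](reflK _ (simple_neq0 D i)) dot_refl ?simple_neq0.
by rewrite ltnn.
Qed.

Lemma antidom_spec b : b \in B ->
  dominant D (- antidom D b) /\ exists2 g, in_W D g & antidom D b = g *m b.
Proof.
move=> bB; rewrite /antidom; case: xgetP => [c _ [/in_Pp_dominant[_ cd] cg]|no] //.
have [g gW gd] := antidominant_exists b; case: (no (g *m b)); split; last by exists g.
apply/in_Pp_dominant; split=> //; apply: BP; rewrite rpredN; exact: B_W.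
Qed.

Lemma antidom_unique b g : b \in B -> in_W D g -> dominant D (- (g *m b)) ->
  antidom D b = g *m b.
Proof.
move=> bB gW gd; have [hd [h hW hE]] := antidom_spec bB.
have E : antidom D b = (h *m invmx g) *m (g *m b) by rewrite -mulmxA (W_mulK _ gW).
have kW := in_W_mul hW (in_W_inv gW).
by rewrite E; apply: antidominant_uniq; rewrite -?E.
Qed.

Lemma antidom_W b g : b \in B -> in_W D g -> antidom D (g *m b) = antidom D b.
Proof.
move=> bB gW; have [hd [h hW hE]] := antidom_spec bB.
have E : antidom D b = (h *m invmx g) *m (g *m b) by rewrite -mulmxA (W_mulK _ gW).
rewrite E; apply: antidom_unique; rewrite -?E//; first exact: B_W.
exact/in_W_mul/in_W_inv.
Qed.

Lemma umin_spec b : b \in B -> [/\ in_W D (umin D b), umin D b *m b = antidom D b &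
  forall g, in_W D g -> g *m b = antidom D b ->
    (len D (lin (umin D b)) <= len D (lin g))%N].
Proof.
move=> bB; rewrite /umin; case: xgetP => [g _ //|no].
have [_ [g gW gE]] := antidom_spec bB.
have ex : exists k, `[< exists g, [/\ in_W D g, g *m b = antidom D b & len D (lin g) = k] >].
  by exists (len D (lin g)); apply/asboolP; exists g.
case: (ex_minnP ex) => k /asboolP[h [hW hE hk]] kmin.
case: (no h); split=> // g' g'W g'E; rewrite hk; apply: kmin.
by apply/asboolP; exists g'.
Qed.

Lemma umin_W b : b \in B -> in_W D (umin D b).
Proof. by move=> /umin_spec[]. Qed.

Lemma pielE b : b \in B -> piel D b = (invmx (umin D b), antidom D b).
Proof.
move=> bB; have [uW uE _] := umin_spec bB.
by rewrite /piel /amul /= mul1mx addr0 -uE invmxK.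
Qed.

Lemma piel_G b : b \in B -> G (piel D b).
Proof.
move=> bB; have [uW uE _] := umin_spec bB.
by rewrite pielE//; split; [exact: in_W_inv|rewrite -uE /= B_W].
Qed.

(** If (alpha_i, b_-) < 0 the second coordinate is already positive. If it is 0, then
    u_b^-1(alpha_i) must be positive, for otherwise s_i u_b would be a shorter element with the same
    image of b. *)
Lemma piel_simple b i : b \in B -> affpos D (aact (piel D b) (al i, 0)).
Proof.
move=> bB; have [uW uE umin'] := umin_spec bB; have [ad _] := antidom_spec bB.
have pR := affroot_act (piel_G bB) (aroot_affroot (Some i)).
have ai : dot (al i) (antidom D b) <= 0 by have := ad i; rewrite dotNl oppr_ge0 dotC.
have [ai0|] := eqVneq (dot (al i) (antidom D b)) 0; last first.
  by move=> ai0; apply: affroot_gt0 => //; rewrite pielE//= sub0r oppr_gt0 lt_def eq_sym ai0.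
rewrite pielE// /aact /= ai0 subr0; apply/affpos_fin; apply: contrapT => neg.
have sR := simple_root D i; have sW := in_W_refl sR; have uG := lin_G uW.
have := len_saffN (i := Some i) uG; rewrite /= ainv_lin aact_lin affneg_fin posNE; last first.
  by apply: root_W => //; exact: in_W_inv.
move/negP: neg => -> /(_ isT); rewrite lin_amul// => lE.
have := umin' (refl (al i) *m umin D b) (in_W_mul sW uW).
rewrite -mulmxA uE reflE dotZr dotC ai0 mulr0 scale0r subr0 => /(_ erefl).
by rewrite lE ltnn.
Qed.

Lemma piel_pos b a : b \in B -> a \in posroots D -> affpos D (aact (piel D b) (a, 0)).
Proof.
move=> bB aP; have pG := piel_G bB.
have [//|pN] := affroot_sign (affroot_act pG (affpos_root ((affpos_fin a).2 aP))).
have /affpos_ge0 := pN; rewrite /= sub0r opprK => p0.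
exfalso; apply: acone_neg pN _.
have -> : (a, 0) = \sum_k ascale (cf D a k) (aroot D (Some k)) :> @affV R n.
  rewrite {1}(cfE D a); elim/big_rec2: _ => // i u v _ <-.
  by apply: affV_eq; rewrite //= mulr0 addr0.
elim/big_rec: _ => [|i s _ sc].
  by rewrite /aact /= mulmx0 dot0l subr0; split=> //= _ j; rewrite cf0.
rewrite aactD; apply: aconeD => //; rewrite aactZ; apply: aconeZ.
  exact: pos_cf_ge0 aP.
exact/acone_pos/piel_simple.
Qed.

Lemma piel_act b : b \in B -> (piel D b).1 *m (piel D b).2 = b.
Proof.
by move=> bB; have [uW uE _] := umin_spec bB; rewrite pielE//= -uE (W_mulK _ uW).
Qed.

(** Together with [piel_simple] this identifies pi_B with the minimal representatives of the cosets
    xW, so membership is tested on the finite simple roots. *)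
Lemma piel_unique x : G x -> (forall i, affpos D (aact x (al i, 0))) ->
  x = piel D (x.1 *m x.2).
Proof.
move=> xG xi; have [x1 x2] := xG; set b := x.1 *m x.2.
have bB : b \in B by exact: B_W.
have x2d : dominant D (- x.2).
  by move=> i; have /affpos_ge0 := xi i; rewrite /= sub0r -dotNr dotC.
have E2 : antidom D b = x.2.
  by rewrite (antidom_unique bB (in_W_inv x1)) (W_mulK _ x1).
have pG := piel_G bB; have [uW uE _] := umin_spec bB.
have gW : in_W D (umin D b *m x.1) by exact: in_W_mul.
suff g1 : umin D b *m x.1 = 1%:M.
  rewrite pielE// E2 (surjective_pairing x); congr (_, _) => /=.
  by rewrite -[RHS]mulmx1 -g1 mulKmx ?in_W_unit// (in_W_unit uW).
apply: in_W_pos1 => // i; apply: contrapT => /negP; rewrite -posNE; last first.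
  by apply: root_W => //; exact: simple_root.
have gv : umin D b *m x.1 *m x.2 = x.2 by rewrite -mulmxA uE E2.
move=> /(piel_pos bB); rewrite pielE// /aact /= E2 dotNl sub0r opprK mulmxN.
rewrite -[X in dot _ X]gv (dot_W _ _ gW) -mulmxA (W_mulK _ uW).
move=> N; apply: (affposN (xi i)); congr (affpos D _): N.
by apply: affV_eq; rewrite //= sub0r opprK.
Qed.

Lemma antidominant_le0 a v : a \in posroots D -> dominant D (- v) -> dot a v <= 0.
Proof. by move=> aP /(dot_pos_dominant aP); rewrite dotNr oppr_ge0. Qed.

Lemma affroot_lt0 r : affroot r -> r.2 < 0 -> affneg D r.
Proof.
move=> rR r0; apply: affroot_gt0; first exact: affrootN.
by case: r rR r0 => a e /= _; rewrite oppr_gt0.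
Qed.

(** A zero product counts as positive because u_b has minimal length. The same convention decides
    the signs in the eigenvalues of the Y_a. *)
Lemma umin_pos b a : b \in B -> a \in posroots D ->
  (umin D b *m a \in posroots D) = (dot b a <= 0).
Proof.
move=> bB aP; have [uW uE _] := umin_spec bB; have [ad _] := antidom_spec bB.
have aD := pos_root aP; have uaD := root_W uW aD.
have E : dot b a = dot (umin D b *m a) (antidom D b) by rewrite -uE (dot_W _ _ uW) dotC.
have [uaP|] := boolP (umin D b *m a \in posroots D).
  by rewrite E antidominant_le0.
rewrite -posNE// => uaN; apply/esym/negbTE; rewrite -ltNge lt_def E.
have le0 := antidominant_le0 uaN ad; rewrite dotNl oppr_le0 in le0.
rewrite le0 andbT; apply/eqP => e0; have := piel_pos bB uaN.
rewrite pielE// /aact /= mulmxN (W_mulK _ uW) dotNl e0 oppr0 subr0 affpos_fin.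
by apply/negP/posN.
Qed.

(** * The longest element *)

Lemma len_lin g : in_W D g -> (len D (lin g) <= size (posroots D))%N.
Proof.
move=> gW; rewrite /len -(size_map (fun a => (a, 0) : @affV R n)).
apply: uniq_leq_size; first exact: fset_uniq.
move=> [a e]; rewrite in_fset_set ?inE; last exact/lambda_finite/lin_G.
move=> [rP]; rewrite /affneg aact_lin => /affpos_ge0 /= e0.
have /= e0' := affpos_ge0 rP; have {e0 e0'} e0 : e = 0.
  by apply/eqP; rewrite eq_le e0' -oppr_ge0 e0.
by rewrite e0 in rP *; apply/mapP; exists a => //; apply/affpos_fin.
Qed.

(** If some w_0(alpha_i) were positive, w_0 s_i would be longer. *)
Lemma w0_spec : in_W D (w0 D) /\ forall a, a \in posroots D -> - (w0 D *m a) \in posroots D.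
Proof.
have [wW wmax] : in_W D (w0 D) /\
    forall g, in_W D g -> (len D (lin g) <= len D (lin (w0 D)))%N.
  rewrite /w0; case: xgetP => [g _ []//|no].
  have ex : exists k, `[< exists2 g, in_W D g & len D (lin g) = k >].
    by exists (len D (lin 1%:M)); apply/asboolP; exists 1%:M => //; exact: in_W1.
  have bnd k : `[< exists2 g, in_W D g & len D (lin g) = k >] -> (k <= size (posroots D))%N.
    by move=> /asboolP[g gW <-]; exact: len_lin.
  case: (ex_maxnP ex bnd) => k /asboolP[g gW gk] kmax; case: (no g); split=> // h hW.
  by rewrite gk; apply: kmax; apply/asboolP; exists h.
split=> //; have wG := lin_G wW.
have wi i : - (w0 D *m al i) \in posroots D.
  have sW := in_W_refl (simple_root D i).
  rewrite posNE ?root_W ?simple_root//; apply/negP => wiP.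
  have := wmax _ (in_W_mul wW sW).
  have yG := lin_G (in_W_mul wW sW).
  rewrite (len_saffr (i := Some i) yG) ?aact_lin ?affneg_fin.
    rewrite lin_amul// -mulmxA refl_mulK ?mulmx1 ?ltnn// simple_neq0//.
  by rewrite -mulmxA refl_self ?simple_neq0// mulmxN opprK.
move=> a aP; have [k ak] := root_neq0_cf (pos_root aP).
have wD : - (w0 D *m a) \in roots D by rewrite rootNE root_W// pos_root.
have E : - (w0 D *m a) = \sum_k cf D a k *: - (w0 D *m al k).
  rewrite {1}(cfE D a) mulmx_sumr -sumrN; apply: eq_bigr => l _.
  by rewrite -scalemxAr scalerN.
have ge0 l : 0 <= cf D (- (w0 D *m a)) l.
  rewrite E cf_sum sumr_ge0// => j _; rewrite cfZ mulr_ge0//.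
    exact: pos_cf_ge0 aP.
  exact: pos_cf_ge0 (wi j).
have [l wl] := root_neq0_cf wD; apply: (@root_pos _ _ _ _ l) => //.
by rewrite lt_def wl ge0.
Qed.

Lemma w0_W : in_W D (w0 D). Proof. by case: w0_spec. Qed.

Lemma w0_pos a : a \in posroots D -> - (w0 D *m a) \in posroots D.
Proof. by case: w0_spec => _; apply. Qed.

Lemma w0K : w0 D *m w0 D = 1%:M.
Proof.
apply: in_W_pos1 => [|i]; first exact/in_W_mul/w0_W/w0_W.
rewrite -mulmxA -[w0 D *m al i]opprK mulmxN.
by apply/w0_pos/w0_pos/simple_pos.
Qed.

Lemma w0_mulK v : w0 D *m (w0 D *m v) = v.
Proof. by rewrite mulmxA w0K mul1mx. Qed.

Lemma invmx_w0 : invmx (w0 D) = w0 D.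
Proof. exact/invmx_unique/w0K. Qed.

Lemma lambda_w0 r : lambda D (lin (w0 D)) r <-> exists2 a, a \in posroots D & r = (a, 0).
Proof.
split=> [|[a aP ->]]; last first.
  split; first exact/affpos_fin.
  by rewrite /affneg aact_lin affneg_fin w0_pos.
case: r => a e [rP]; rewrite /affneg aact_lin => /affpos_ge0 /= e0.
have /= e0' := affpos_ge0 rP; have {e0 e0'} e0 : e = 0.
  by apply/eqP; rewrite eq_le e0' -oppr_ge0 e0.
by rewrite e0 in rP *; exists a => //; apply/affpos_fin.
Qed.

(** * Translations *)

Lemma aact_tr b a (c : R) : aact (tr b) (a, c) = (a, c - dot a b).
Proof. by rewrite /aact /= mul1mx. Qed.

Lemma tr_amul b c : amul (tr b) (tr c) = tr (b + c).
Proof. by rewrite /amul /= mul1mx invmx1 mul1mx. Qed.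

Lemma lambda_tr_dominant c a (e : R) : c \in B -> dominant D c ->
  lambda D (tr c) (a, e) <->
  [/\ affroot (a, e), a \in posroots D, 0 <= e & e < dot a c].
Proof.
move=> cB cd; have tG := tr_G cB; split=> [[rP]|[rR aP e0 ec]].
  have rR := affpos_root rP; have /= e0 := affpos_ge0 rP; have aD := rR.1.
  rewrite /affneg aact_tr => rN; have /= le0 := affpos_ge0 rN.
  rewrite oppr_ge0 subr_le0 in le0.
  have [aP|aN] := boolP (a \in posroots D); last first.
    rewrite -posNE// in aN; have := dot_pos_dominant aN cd.
    rewrite dotNl oppr_ge0 => ac; have e00 : e = 0.
      by apply/eqP; rewrite eq_le e0 (le_trans le0 ac).
    by move: rP aN; rewrite e00 affpos_fin => /posN/negPf->.
  split=> //; rewrite lt_def le0 andbT; apply/eqP => eE.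
  by move: rN; rewrite -eE subrr affneg_fin; apply/negP/posN.
have rP : affpos D (a, e).
  have [->|e1] := eqVneq e 0; first exact/affpos_fin.
  by apply: affroot_gt0 => //=; rewrite lt_def e1.
split=> //; apply: affroot_lt0; first exact: affroot_act.
by rewrite aact_tr /= subr_lt0.
Qed.

Lemma len_trD b c : b \in B -> c \in B -> dominant D b -> dominant D c ->
  len D (tr (b + c)) = (len D (tr b) + len D (tr c))%N.
Proof.
move=> bB cB bd cd; have bG := tr_G bB; have cG := tr_G cB.
rewrite -tr_amul len_amul// => -[a e] rP rN.
have /lambda_tr_dominant[//|//|rR aP e0 ec] : lambda D (tr c) (a, e) by [].
apply: affroot_lt0; first by apply: affroot_act => //; exact: affroot_act.
by rewrite !aact_tr /= -addrA -opprD subr_lt0 ltr_wpDr// (dot_pos_dominant aP bd).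
Qed.

(** The roots of lambda with vector part a are [a, nu_a k] for 0 <= k < (c, a^vee), so a positive
    root a is counted (c, a^vee) times. *)
Lemma prod_lambda_tr (S : comPzRingType) (F : 'cV[R]_n -> S) c : c \in B -> dominant D c ->
  \prod_(z <- fset_set (lambda D (tr c))) F z.1 =
  \prod_(a <- posroots D) F a ^+ Num.truncn (dot c (coroot a)).
Proof.
move=> cB cd; pose N a := Num.truncn (dot c (coroot a)).
pose L := [seq (a, nu a *~ Posz k) : @affV R n | a <- posroots D, k <- iota 0 (N a)].
have NE a : a \in posroots D -> dot c (coroot a) = (N a)%:R.
  move=> aP; have aD := pos_root aP; have : dot c (coroot a) \is a Num.nat.
    rewrite natrEint B_coroot//= -(pmulr_rge0 _ (nu_gt0 (root_neq0 aD))).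
    by rewrite -dot_nu ?(root_neq0 aD)// dotC (dot_pos_dominant aP cd).
  by rewrite natrEtruncn => /eqP.
have LE r : r \in L <-> lambda D (tr c) r.
  case: r => a e; rewrite lambda_tr_dominant//; split.
    move=> /allpairsPdep[b [k [bP kN [-> ->]]]]; have bD := pos_root bP.
    have nu0 := nu_gt0 (root_neq0 bD).
    split=> //; first by split=> //; exists k.
      by rewrite mulrz_ge0// ltW.
    rewrite dotC (dot_nu _ (root_neq0 bD)) -mulrzr ltr_pM2l// NE//.
    by move: kN; rewrite mem_iota add0n /= -(ltr_nat R).
  move=> [[/= aD [k ek]] aP e0 ec]; have nu0 := nu_gt0 (root_neq0 aD).
  have k0 : 0 <= k by move: e0; rewrite ek -mulrzr pmulr_rge0// ler0z.
  apply/allpairsPdep; exists a, `|k|%N; split=> //; last by rewrite gez0_abs// -ek.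
  rewrite mem_iota add0n /= -(ltr_nat R) -NE// -[_%:R]/((Posz `|k|)%:~R) gez0_abs//.
  by move: ec; rewrite dotC (dot_nu _ (root_neq0 aD)) ek -mulrzr ltr_pM2l.
have fl := lambda_finite (tr_G cB).
rewrite (perm_big L) /=; last first.
  apply: uniq_perm; first exact: fset_uniq.
    apply: allpairs_uniq_dep => [|a _|]; rewrite ?pos_uniq ?iota_uniq//.
    move=> [a k] [b l] /allpairsPdep[a' [k' [aP _ [-> ->]]]] _ /= [<-].
    move=> /(nu_mulz_inj (pos_root aP)) [->]//.
  by move=> r; apply/idP/idP; rewrite in_fset_set// inE LE.
rewrite big_allpairs_dep; apply: eq_bigr => a _ /=.
by rewrite big_const_seq count_predT size_iota iter_mulr_1.
Qed.

(** With [theta_affpos] this gives Y_theta = T_0 T_(s_theta), from which eps(T_0) is computed. *)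
Lemma tr_theta : tr (theta D) = amul (saff D None) (lin (refl (theta D))).
Proof.
have t0 := root_neq0 (theta_root D); have tW := in_W_refl (theta_root D).
by rewrite /= -amulA ?lin_amul ?refl_mulK ?amulx1//; exact: lin_G.
Qed.

Lemma theta_affpos :
  affpos D (aact (ainv (lin (refl (theta D)))) (aroot D None)).
Proof.
have t0 := root_neq0 (theta_root D).
rewrite ainv_lin invmx_refl// aact_lin mulmxN refl_self// opprK.
split; first exact: theta_root.
by exists 1; [rewrite /= nu_theta|left].
Qed.

(** The factorization becomes pi = Y_b T_u^-1 with u the inverse of the linear part of pi, from
    which eps(pi) is computed. *)
Lemma Pi_tr x : in_Pi D B x -> let b := x.1 *m x.2 in
  [/\ b \in B, dominant D b & tr b = amul x (lin (invmx x.1))].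
Proof.
move=> xP; have [xG x0] := xP; have [x1 x2] := xG; set b := _ *m _ => /=.
have bB : b \in B by exact: B_W.
have E : tr b = amul x (lin (invmx x.1)).
  by rewrite /amul /= mulmxV ?in_W_unit ?invmxK ?addr0// (in_W_unit x1).
split=> // i; rewrite leNgt; apply/negP => bi.
(* At level 1 this root stays positive under W and then under x, so the translation lowers its level
   by at most 1; a drop by exactly 1 would leave the negative root -alpha_i. *)
have iR : affroot (- al i, nu (al i) *~ 1).
  by split=> /=; rewrite ?rootNE ?simple_root//; exists 1; rewrite nuN.
have iP : affpos D (- al i, nu (al i) *~ 1).
  by apply: affroot_gt0 => //=; rewrite nu_gt0// simple_neq0.
have yG := lin_G (in_W_inv x1).
have := affroot_act yG iR; rewrite aact_lin => yR.
have : affpos D (aact (tr b) (- al i, nu (al i) *~ 1)).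
  rewrite E aactM//; apply: Pi_pos => //; rewrite aact_lin; apply: affroot_gt0 => //=.
  by rewrite nu_gt0// simple_neq0.
rewrite aact_tr dotNl opprK => P; have /= := affpos_ge0 P.
have a0 := simple_neq0 D i; have nu0 := nu_gt0 a0.
rewrite dotC (dot_nu _ a0) mulr1z -{1}[nu (al i)]mulr1 -mulrDr pmulr_rge0//.
have /intrP[k kE] := B_coroot bB (simple_root D i).
move: bi; rewrite (dot_nu _ a0) pmulr_rlt0// kE ltrz0 => k0.
rewrite -[1]/(1%:~R) -rmorphD ler0z => k1.
have {k0 k1} k1 : k = -1 by lia.
move: P; rewrite dotC (dot_nu _ a0) kE k1 rmorphN mulrN mulr1 mulr1z subrr affpos_fin.
by apply/negP/posN/simple_pos.
Qed.

(** * The order on weights *)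

Lemma W_sub_Q b g : b \in B -> in_W D g -> in_Q D (g *m b - b).
Proof.
move=> bB gW; move: g gW; apply: in_W_ind => [|a g aD gW IH].
  by rewrite mul1mx subrr; apply/in_QE => i; rewrite cf0 rpred0.
rewrite -mulmxA reflE addrAC; apply/in_QE => i.
rewrite cfD cfN cfZ rpredB//; first by move: i; apply/in_QE.
rewrite rpredM ?(B_coroot (B_W gW bB))//.
by move: i; apply/in_QE/root_in_Q.
Qed.

Lemma wt_lt_trans a b c : wt_lt D a b -> wt_lt D b c -> wt_lt D a c.
Proof.
move=> [ab abQ] [bc bcQ]; split; last by rewrite -(subrKA b); exact: in_QpD.
move=> ac; apply: ab; apply: (@cf_inj _ _ D) => i.
have /in_Qp_ge0[_ /(_ i)] := abQ; have /in_Qp_ge0[_ /(_ i)] := bcQ.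
rewrite -ac !cfD !cfN; lra.
Qed.

Lemma wt_succ_trans a b c : wt_succ D c b -> wt_succ D b a -> wt_succ D c a.
Proof.
move=> [cb|[cb bc]] [ba|[ba ab]].
- by left; exact: wt_lt_trans ba cb.
- by left; rewrite -ba.
- by left; rewrite cb.
- by right; split; [rewrite cb|exact: wt_lt_trans ab bc].
Qed.

Lemma wt_succ_irr a : ~ wt_succ D a a.
Proof. by move=> [[]|[_ []]]. Qed.

Lemma antidom_cf_le b g i : b \in B -> in_W D g -> 0 <= cf D (g *m b - antidom D b) i.
Proof.
move=> bB gW; have [hd [h hW hE]] := antidom_spec bB.
have -> : g *m b = (g *m invmx h) *m antidom D b by rewrite hE -mulmxA (W_mulK _ hW).
by apply: W_pos_dominant => //; exact/in_W_mul/in_W_inv.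
Qed.

(** c - k a lies strictly between c and s_a(c). Being a convex combination of the two, it has all
    its W-images above c_- in every coordinate; being strictly shorter than c, it lies in another
    orbit. The hypothesis on k covers both signs of m. *)
Lemma wt_succ_between c a (k m : int) : c \in B -> a \in posroots D ->
  dot c (coroot a) = m%:~R -> 0 < k * (m - k) -> wt_succ D (c - k%:~R *: a) c.
Proof.
move=> cB aP mE km; have aD := pos_root aP; have a0 := root_neq0 aD.
set d := c - _; left.
have dB : d \in B by rewrite rpredB// B_scale ?root_in_B ?intr_int.
have [dd [g gW gE]] := antidom_spec dB; have [cd [h hW hE]] := antidom_spec cB.
have norm : dot d d < dot c c.
  rewrite /d !dotBl !dotBr !dotZl !dotZr [dot a c]dotC (dot_nu c a0) mE.
  rewrite (dot_nu a a0) coroot_self//; have nu0 := nu_gt0 a0.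
  have := mulr_gt0 nu0 (_ : 0 < (k * (m - k))%:~R :> R); rewrite ltr0z => /(_ km).
  by rewrite rmorphM rmorphB /=; lra.
split.
  by move=> cd'; move: norm; rewrite -(dot_W d d gW) -(dot_W c c hW) -gE -hE cd' ltxx.
apply/in_Qp_ge0; split.
  apply/in_QE => i.
  have -> : antidom D d - antidom D c = (g *m d - d) - (h *m c - c) - k%:~R *: a.
    rewrite gE hE; move: (g *m d) (h *m c) => u v; rewrite /d.
    by apply/matrixP => r s; rewrite !mxE; ring.
  rewrite cfD cfN cfZ rpredB//.
    rewrite cfD cfN rpredB//; [move: i; apply/in_QE/W_sub_Q => //|].
    by move: i; apply/in_QE/W_sub_Q.
  by rewrite rpredM ?intr_int//; move: i; apply/in_QE/root_in_Q.
move=> i; have sW := in_W_refl aD.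
have h1 := antidom_cf_le i cB gW; have h2 := antidom_cf_le i cB (in_W_mul gW sW).
have m0 : m != 0.
  by apply: contraTneq km => ->; rewrite sub0r mulrN -expr2 oppr_gt0 -leNgt sqr_ge0.
have mR : m%:~R != 0 :> R by rewrite intr_eq0.
(* The position of c - k a on the segment from c to s_a(c). *)
pose t : R := k%:~R / m%:~R.
have t01 : 0 <= t <= 1.
  have m2 : 0 < (m%:~R : R) ^+ 2 by rewrite exprn_even_gt0.
  have e1 : t * m%:~R ^+ 2 = (k * m)%:~R by rewrite /t rmorphM expr2 mulrA divfK.
  have e2 : (1 - t) * m%:~R ^+ 2 = ((m - k) * m)%:~R.
    by rewrite mulrBl mul1r e1 -rmorphXn -rmorphB /=; congr _%:~R; ring.
  rewrite -(pmulr_lge0 _ m2) e1 ler0z -[t <= 1]subr_ge0 -(pmulr_lge0 _ m2) e2 ler0z.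
  have : 0 < k < m \/ m < k < 0.
    move: km; have [k0|k0|->] := ltgtP k 0; last by rewrite mul0r.
      by rewrite nmulr_rgt0// subr_lt0; right; apply/andP.
    by rewrite pmulr_rgt0// subr_gt0; left; apply/andP.
  move=> [] /andP[h3 h4]; have h5 := lt_trans h3 h4.
    by rewrite !mulr_ge0 ?subr_ge0 ?ltW.
  by rewrite !mulr_le0 ?subr_le0 ?ltW.
have -> : antidom D d - antidom D c = (1 - t) *: (g *m c - antidom D c) +
    t *: (g *m refl a *m c - antidom D c).
  rewrite gE /d -mulmxA reflE mE !mulmxBr -!scalemxAr.
  rewrite !scalerBr !scalerBl !scale1r scalerA divfK//.
  by apply/matrixP => r s; rewrite !mxE; ring.
rewrite cfD !cfZ; case/andP: t01 => t0 t1.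
apply: addr_ge0; apply: mulr_ge0 => //; by rewrite subr_ge0.
Qed.

Lemma wt_succ_refl c a (m : int) : c \in B -> a \in posroots D ->
  dot c (coroot a) = m%:~R -> m < 0 -> wt_succ D (c - m%:~R *: a) c.
Proof.
move=> cB aP mE m0; have aD := pos_root aP; have sW := in_W_refl aD.
rewrite -mE -reflE; right; split; first exact: antidom_W.
have sE : refl a *m c - c = (- m)%:~R *: a.
  by rewrite reflE mE addrAC subrr add0r rmorphN scaleNr.
split; last first.
  rewrite sE; apply/in_QpE => i; rewrite cfZ rpredM//.
    by rewrite natrEint intr_int ler0z oppr_ge0 ltW.
  by move: i; apply/in_QpE; move: aP; rewrite mem_pos => /andP[_ /asboolP].
move=> cE; move: sE; rewrite -cE subrr => /esym/eqP; rewrite scaler_eq0.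
by rewrite (negPf (root_neq0 aD)) orbF intr_eq0 oppr_eq0 lt_eqF.
Qed.

(** * Powers of q and values at rho_k *)

Local Notation K := (Kqt D).

(** By the adjugate formula the determinant of the Cartan matrix clears the denominators of [cf]. *)
Lemma cartan_denominator : exists2 d : nat, (0 < d)%N &
  forall b, b \in B -> forall i, d%:R * cf D b i \is a Num.int.
Proof.
pose C : 'M[R]_n := \matrix_(i, j) dot (al i) (coroot (al j)).
pose Z : 'M[int]_n := \matrix_(i, j) Num.floor (C i j).
have CZ : C = map_mx intr Z.
  apply/matrixP => i j; rewrite !mxE; apply/esym/eqP; rewrite -intrEfloor.
  by rewrite (@roots_int _ _ D) ?simple_root.
have CE b j : ((coefs D b)^T *m C) 0 j = dot b (coroot (al j)).
  rewrite mxE [in RHS](cfE D b) dot_suml; apply: eq_bigr => i _.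
  by rewrite dotZl [C i j]mxE [_^T _ _]mxE.
have C0 : \det C != 0.
  rewrite -unitfE -unitmxE -row_free_unit -kermx_eq0; apply/eqP/row_matrixP => i.
  rewrite row0; move: (row i _) (row_sub i (kermx C)) => v /sub_kermxP vC.
  pose b := simple_mx D *m v^T.
  have bE : coefs D b = v^T by rewrite /coefs mulKmx ?simple_mx_unit.
  have b0 : b = 0.
    by apply: (@coroot_separates _ _ D) => j; rewrite -CE bE trmxK vC mxE dot0l.
  by rewrite -[v]trmxK -bE b0 /coefs mulmx0 trmx0.
have detZ : \det C = (\det Z)%:~R by rewrite CZ det_map_mx.
exists `|\det Z|%N; first by rewrite absz_gt0; apply: contraNneq C0 => Z0; rewrite detZ Z0.
move=> b bB i; have bC : (coefs D b)^T *m C *m \adj C = (coefs D b)^T *m (\det C)%:M.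
  by rewrite -mulmxA mul_mx_adj.
have : \det C * cf D b i \is a Num.int.
  have -> : \det C * cf D b i = ((coefs D b)^T *m (\det C)%:M) 0 i.
    by rewrite mul_mx_scalar mxE [_^T _ _]mxE.
  rewrite -bC mxE rpred_sum// => j _; rewrite CE rpredM//.
    by rewrite B_coroot// simple_root.
  by rewrite CZ -map_mx_adj mxE intr_int.
rewrite detZ; case: (\det Z) => m //= h; rewrite -[_%:R]/((Posz m.+1)%:~R).
by move: h; rewrite NegzE rmorphN mulNr rpredN.
Qed.

Lemma dot_root_int b a : b \in B -> a \in roots D -> dot b a \is a Num.int.
Proof.
move=> bB aD; rewrite (dot_nu _ (root_neq0 aD)) rpredM ?B_coroot//.
by case: (theta_dominates aD).
Qed.

Lemma mtilde_spec : (0 < mtilde B)%N /\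
  forall b c, b \in B -> c \in B -> (mtilde B)%:R * dot b c \is a Num.int.
Proof.
rewrite /mtilde; case: xgetP => [m _ []//|no].
pose Q m := (0 < m)%N /\ forall b c, b \in B -> c \in B -> m%:R * dot b c \is a Num.int.
have ex : exists m, `[< Q m >].
  have [d d0 dP] := cartan_denominator; exists d; apply/asboolP; split=> // b c bB cB.
  rewrite [b](cfE D b) dot_suml mulr_sumr rpred_sum// => i _.
  by rewrite dotZl mulrA rpredM ?dP// dotC dot_root_int// simple_root.
case: (ex_minnP ex) => m /asboolP[m0 mP] mmin; case: (no m); split=> // m' /andP[m'0 m'm].
apply: contrapT => h; have : (m <= m')%N; last by rewrite leqNgt m'm.
apply: mmin; apply/asboolP; split=> // b c bB cB; apply/negPn/negP => hn.
by apply: h; exists b, c.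
Qed.

(** [qpow] takes an integer part, so it is q^e only for these exponents. *)
Definition qint (e : R) := (2 * mtilde B)%:R * e \is a Num.int.

Local Notation qp := (qpow D B).

Lemma qint_int e : e \is a Num.int -> qint e.
Proof. by move=> ei; rewrite /qint rpredM// natr_int. Qed.

Lemma qint_dot b c : b \in B -> c \in B -> qint (dot b c).
Proof.
move=> bB cB; rewrite /qint natrM -mulrA rpredM ?natr_int//.
by apply: mtilde_spec.2.
Qed.

Lemma qintD e f : qint e -> qint f -> qint (e + f).
Proof. by rewrite /qint mulrDr; exact: rpredD. Qed.

Lemma qintN e : qint e -> qint (- e).
Proof. by rewrite /qint mulrN rpredN. Qed.

Lemma monomial_qpow e : monomial (qp e) (Num.floor ((2 * mtilde B)%:R * e)) 0.
Proof. exact: monomial_vq. Qed.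

Lemma qpow_neq0 e : qp e != 0. Proof. exact: monomial_neq0 (monomial_qpow e). Qed.

Lemma qpowD e f : qint e -> qint f -> qp (e + f) = qp e * qp f.
Proof. by move=> ei fi; rewrite /qpow mulrDr floorDzr// expfzDr ?vq_neq0. Qed.

Lemma qpow0 : qp 0 = 1. Proof. by rewrite /qpow mulr0 floor0 expr0z. Qed.

Lemma qpowN e : qint e -> qp (- e) = (qp e)^-1.
Proof. by move=> ei; rewrite /qpow mulrN floorN// invr_expz. Qed.

Lemma star_qpow e : star (qp e) = (qp e)^-1.
Proof. by rewrite /qpow fmorphXz /= star_vq exprz_inv invr_expz. Qed.

Lemma floor_coroot b c a : b \in B -> c \in B -> a \in roots D ->
  Num.floor (dot (b + c) (coroot a)) =
  Num.floor (dot b (coroot a)) + Num.floor (dot c (coroot a)).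
Proof. by move=> bB cB aD; rewrite dotDl floorDzr// B_coroot. Qed.

Lemma qrhoD b c : b \in B -> c \in B -> qrho D (b + c) = qrho D b * qrho D c.
Proof.
move=> bB cB; rewrite /qrho -big_split /= !big_seq; apply: eq_bigr => a /pos_root aD.
by rewrite floor_coroot// expfzDr// th_neq0.
Qed.

Lemma monomial_qrho b : exists d, monomial (qrho D b) 0 d.
Proof.
eexists; apply: monomial_prod => a; rewrite -[0](mul0r (Num.floor (dot b (coroot a)))).
exact/monomialX/monomial_th.
Qed.

Lemma qrho_neq0 b : qrho D b != 0.
Proof. by have [d /monomial_neq0] := monomial_qrho b. Qed.

Lemma qrho0 : qrho D 0 = 1.
Proof. by rewrite /qrho big1// => a _; rewrite dot0l floor0 expr0z. Qed.

Lemma qrhoN b : b \in B -> qrho D (- b) = (qrho D b)^-1.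
Proof.
move=> bB; apply: (mulfI (qrho_neq0 b)); rewrite -qrhoD ?rpredN// subrr qrho0.
by rewrite divff ?qrho_neq0.
Qed.

Lemma qrho_mulz b (k : int) : b \in B -> qrho D (b *~ k) = qrho D b ^ k.
Proof.
move=> bB; have H (m : nat) : qrho D (b *+ m) = qrho D b ^+ m.
  elim: m => [|m IH]; first by rewrite mulr0n qrho0.
  by rewrite mulrS qrhoD ?rpredMn// IH exprS.
case: k => m; first exact: H.
by rewrite NegzE mulrNz qrhoN ?rpredMz// -pmulrn H exprnN.
Qed.

Lemma star_qrho b : star (qrho D b) = (qrho D b)^-1.
Proof.
rewrite /qrho rmorph_prod -prodfV; apply: eq_bigr => a _ /=.
by rewrite fmorphXz /= star_th exprz_inv invr_expz.
Qed.

(** s_i permutes the positive roots other than alpha_i and negates alpha_i, so their joint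
    contribution P equals its own inverse; a monomial with this property is 1. *)
Lemma qrho_simple i : qrho D (al i) = th D (al i) ^+ 2.
Proof.
pose P b : K := \prod_(a <- rem (al i) (posroots D)) th D a ^ Num.floor (dot b (coroot a)).
have a0 := simple_neq0 D i; have aD := simple_root D i.
rewrite /qrho (perm_big _ (perm_pos_rem i)) big_cons /= coroot_self//.
rewrite (_ : Num.floor 2 = 2); last by rewrite -[2 in LHS]/(2%:~R) intrKfloor.
suff E : P (al i) = 1 by rewrite -[X in _ * X]/(P (al i)) E mulr1.
have Ps b : P (refl (al i) *m b) = P b.
  rewrite /P -(perm_big _ (refl_rem_perm i)) big_map; apply: eq_bigr => a _.
  by rewrite (coroot_refl _ a0) (dot_refl _ _ a0) (thE D (nu_W a (in_W_refl aD))).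
have PN b : b \in B -> P (- b) = (P b)^-1.
  move=> bB; rewrite /P -prodfV !big_seq; apply: eq_bigr => a /mem_rem/pos_root bD.
  by rewrite dotNl floorN ?B_coroot// invr_expz.
have [d Pm] : exists d, monomial (P (al i)) 0 d.
  eexists; apply: monomial_prod => a; rewrite -[0](mul0r (Num.floor (dot (al i) (coroot a)))).
  exact/monomialX/monomial_th.
apply: (monomial_sqr1 Pm); rewrite expr2 -{2}[P _]invrK -PN ?root_in_B//.
by rewrite -refl_self// Ps divff// (monomial_neq0 Pm).
Qed.

(** The positive degree in t keeps X_a(q^(-rho_k)) different from 1 for finite roots, where q
    contributes nothing. *)
Lemma monomial_qrho_pos a : a \in posroots D ->
  exists2 d : int, 0 < d & monomial (qrho D a) 0 d.
Proof.
have qsm i : monomial (qrho D (al i)) 0 2.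
  by rewrite qrho_simple; have := monomialX 2 (monomial_th D (al i)); rewrite mul0r mul1r.
move: a; apply: pos_root_ind => [i|a i aP ai ai0 [d d0 dm]]; first by exists 2.
have aD := pos_root aP; have iD := simple_root D i.
have /intrP[k kE] : dot a (coroot (al i)) \is a Num.int by apply: (@roots_int _ _ D).
have k0 : 0 < k by rewrite -(ltr0z R) -kE -(pmulr_rgt0 _ (nu_gt0 (root_neq0 iD))) -dot_nu ?(root_neq0 iD).
exists (d + 2 * k); first by rewrite addr_gt0// mulr_gt0.
have -> : a = refl (al i) *m a + al i *~ k by rewrite reflE kE scaler_int subrK.
rewrite qrhoD ?qrho_mulz ?rpredMz ?root_in_B ?roots_refl//.
by have := monomialM dm (monomialX k (qsm i)); rewrite mul0r addr0.
Qed.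

(** The value of X_r at q^(-rho_k). *)
Definition ev r : K := qp r.2 / qrho D r.1.
Definition Lam r := r.1 \in B /\ qint r.2.

Lemma LamD r (s : @affV R n) : Lam r -> Lam s -> Lam (r + s).
Proof. by move=> [r1 r2] [s1 s2]; split; [exact: rpredD|exact: qintD]. Qed.

Lemma LamN r : Lam r -> Lam (- r).
Proof. by move=> [r1 r2]; split; [rewrite /= rpredN|exact: qintN]. Qed.

Lemma Lam_act x r : G x -> Lam r -> Lam (aact x r).
Proof.
move=> [x1 x2] [r1 r2]; split; first exact: B_W.
by apply: qintD => //; apply: qintN; exact: qint_dot.
Qed.

Lemma Lam_affroot r : affroot r -> Lam r.
Proof.
move=> [rD [k rk]]; split; first exact: root_in_B.
apply: qint_int; rewrite rk -mulrzr rpredM ?intr_int//.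
by case: (theta_dominates rD).
Qed.

Lemma Lam_aroot i : Lam (aroot D i).
Proof. exact/Lam_affroot/aroot_affroot. Qed.

Lemma Lam_B b : b \in B -> Lam (b, 0).
Proof. by move=> bB; split=> //; exact/qint_int/rpred0. Qed.

Lemma ev_root_monomial r : affroot r -> exists2 d, d != 0 &
  monomial (ev r) (Num.floor ((2 * mtilde B)%:R * r.2)) d.
Proof.
move=> rR; have rD := rR.1; have key a : a \in roots D -> exists2 d, d != 0 & monomial (qrho D a) 0 d.
  move=> aD; have /orP[aP|aN] := root_signP aD.
    by have [d d0 dm] := monomial_qrho_pos aP; exists d; rewrite ?gt_eqF.
  have [d d0 dm] := monomial_qrho_pos aN; exists (- d); rewrite ?oppr_eq0 ?gt_eqF//.
  by have := monomialV dm; rewrite qrhoN ?root_in_B// invrK oppr0.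
have [d d0 dm] := key _ rD; exists (- d); first by rewrite oppr_eq0.
have := monomialM (monomial_qpow r.2) (monomialV dm).
by rewrite oppr0 addr0 add0r.
Qed.

Lemma ev_root_neq1 r : affroot r -> ev r != 1.
Proof.
move=> /ev_root_monomial[d d0 dm]; apply: contraNneq d0 => e1; apply/eqP.
by move: dm; rewrite e1 => /monomial_eq1[].
Qed.

(** A nonzero level gives a nonzero exponent of q, which no t can cancel. At level 0 the conclusion
    fails for r = alpha_i and t = t_i. *)
Lemma ev_root_thi r (t : K) : affroot r -> r.2 != 0 -> monomial t 0 2 -> ev r * t != 1.
Proof.
move=> rR r20 tm; have [d d0 dm] := ev_root_monomial rR.
apply/eqP => e1; have := monomialM dm tm; rewrite e1 => /monomial_eq1[].
rewrite addr0 => /eqP e0 _; move/eqP: r20; apply.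
have [rB] := Lam_affroot rR; rewrite /qint intrEfloor (eqP e0) eq_sym.
rewrite mulf_eq0 pnatr_eq0 -leqn0 leqNgt muln_gt0 (mtilde_spec).1 /=.
by move/eqP.
Qed.

Lemma Xsharp_ev r b : Lam r -> b \in B ->
  Xsharp D B r b = ev (aact (ainv (piel D b)) r).
Proof.
move=> [r1 r2] bB; have [uW uE _] := umin_spec bB.
rewrite /Xsharp /qsharp /ev pielE// /aact /= invmxK dotNr opprK -uE (W_mulK _ uW).
by rewrite qpowD ?qint_dot// mulrA.
Qed.

Lemma prod_qrho_W g b : in_W D g -> b \in B ->
  qrho D (g *m b) = \prod_(a <- posroots D)
    (if g *m a \in posroots D then th D a else (th D a)^-1) ^ Num.floor (dot b (coroot a)).
Proof.
move=> gW bB; pose sg a := if g *m a \in posroots D then g *m a else - (g *m a).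
have thN a : th D (- a) = th D a by rewrite /th /nu dotNl dotNr opprK.
have thW a : th D (g *m a) = th D a by rewrite /th (nu_W _ gW).
have sgP a : a \in posroots D -> sg a \in posroots D.
  rewrite /sg; case: ifP => // /negbT ga aP.
  by rewrite posNE ?ga //; exact: root_W (pos_root aP).
have p : perm_eq [seq sg a | a <- posroots D] (posroots D).
  have si : {in posroots D &, injective sg}.
    move=> a c aP cP; rewrite /sg.
    have bad u v : u \in posroots D -> v \in posroots D -> g *m u <> - (g *m v).
      move=> uP vP; rewrite -mulmxN => /(congr1 (mulmx (invmx g))).
      by rewrite !(W_mulK _ gW) => E; move: uP; rewrite E posNE ?(pos_root vP)// vP.
    have gI u v : g *m u = g *m v -> u = v.
      by move=> /(congr1 (mulmx (invmx g))); rewrite !(W_mulK _ gW).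
    case: ifP => _; case: ifP => _ E; [exact: gI| | |exact/gI/oppr_inj].
      by case: (bad a c).
    by case: (bad c a) => //; rewrite -E.
  have su : uniq [seq sg a | a <- posroots D] by rewrite map_inj_in_uniq ?pos_uniq.
  apply: uniq_perm; rewrite ?pos_uniq//.
  apply: (uniq_min_size su _ _).2; last by rewrite size_map.
  by move=> _ /mapP[a aP ->]; exact: sgP.
rewrite /qrho; transitivity (\prod_(a <- [seq sg a | a <- posroots D])
    th D a ^ Num.floor (dot (g *m b) (coroot a))); first by rewrite (perm_big _ p).
rewrite big_map !big_seq; apply: eq_bigr => a aP.
rewrite /sg; case: ifP => ga.
  by rewrite thW (coroot_W _ gW) (dot_W _ _ gW).
rewrite thN thW exprz_inv; congr (_ ^ _).
have -> : coroot (- (g *m a)) = - (g *m coroot a).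
  by rewrite -(coroot_W _ gW) /coroot /nu dotNl dotNr opprK scalerN.
rewrite dotNr (dot_W _ _ gW); have := B_coroot bB (pos_root aP).
rewrite intrEfloor => /eqP E; rewrite -E -mulrNz !intrKfloor.
by [].
Qed.

(** The left side is the t-part of the leading coefficient of Y_c on X_b, one factor per root. As
    u_b(a) > 0 exactly when (b, a) <= 0, the signs are those occurring in q^(rho_k, u_b(c)). *)
Lemma th_lambda_umin c b : c \in B -> dominant D c -> b \in B ->
  \prod_(z <- fset_set (lambda D (tr c)))
    (if 0 < dot b z.1 then (th D z.1)^-1 else th D z.1) = qrho D (umin D b *m c).
Proof.
move=> cB cd bB.
rewrite (prod_lambda_tr (fun a => if 0 < dot b a then (th D a)^-1 else th D a) cB cd).
rewrite (prod_qrho_W (umin_W bB) cB) !big_seq.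
apply: eq_bigr => a aP; have aD := pos_root aP; have a0 := root_neq0 aD.
rewrite umin_pos// exprnP leNgt if_neg; congr (_ ^ _).
have : dot c (coroot a) \is a Num.nat.
  rewrite natrEint B_coroot//= -(pmulr_rge0 _ (nu_gt0 a0)) -dot_nu// dotC.
  exact: dot_pos_dominant aP cd.
rewrite natrEtruncn => /eqP e; rewrite -[in RHS]e -[X in Num.floor X]/((Posz _)%:~R).
by rewrite intrKfloor.
Qed.

(* The field K with what is used of q and t: pqp e is q^e, prho b is q^(rho_k,b), *)
(* pth a is t_a^(1/2). Reasoning over an abstract field keeps conversion away     *)
(* from the fraction field [Kqt].                                                 *)
Record params := Params {
  pK :> fieldType;
  pstar : {rmorphism pK -> pK};
  pqp : R -> pK;
  prho : 'cV[R]_n -> pK;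
  pth : 'cV[R]_n -> pK;
  pstarK : involutive pstar;
  pstar_qp : forall e, pstar (pqp e) = (pqp e)^-1;
  pstar_rho : forall b, pstar (prho b) = (prho b)^-1;
  pstar_th : forall a, pstar (pth a) = (pth a)^-1;
  pqp0 : pqp 0 = 1;
  pqpD : forall e f, qint e -> qint f -> pqp (e + f) = pqp e * pqp f;
  pqpN : forall e, qint e -> pqp (- e) = (pqp e)^-1;
  pqp_neq0 : forall e, pqp e != 0;
  prho0 : prho 0 = 1;
  prhoD : forall b c, b \in B -> c \in B -> prho (b + c) = prho b * prho c;
  prhoN : forall b, b \in B -> prho (- b) = (prho b)^-1;
  prho_neq0 : forall b, prho b != 0;
  prho_simple : forall i, prho (al i) = pth (al i) ^+ 2;
  pth_neq0 : forall a, pth a != 0;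
  pth_nu : forall a b, nu a = nu b -> pth a = pth b;
  pth_order : forall a, pth a ^+ 4 != 1;
  pth_lambda_tr : forall c b, c \in B -> dominant D c -> b \in B ->
    \prod_(z <- fset_set (lambda D (tr c))) (if 0 < dot b z.1 then (pth z.1)^-1 else pth z.1) =
    prho (umin D b *m c);
  pev_neq1 : forall r, affroot r -> pqp r.2 / prho r.1 != 1;
  pev_th : forall r a, affroot r -> r.2 != 0 -> pqp r.2 / prho r.1 * pth a ^+ 2 != 1;
  psep : forall a b c u v, a \in B -> b \in B -> c \in B ->
    pqp (dot a b) / prho u = pqp (dot a c) / prho v -> dot a b = dot a c }.

(** * The polynomial algebra over abstract parameters *)

Section AbstractParameters.
Variable pd : params.
Local Notation K := (pK pd).
Local Notation qp := (pqp pd).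
Local Notation rho := (prho pd).
Local Notation star := (pstar pd).
Variable KX : galgebra K (lat B).
Local Notation XpG := (gM KX).
Implicit Types (f : KX) (c : K).

Definition XaffG r : KX := qp r.2 *: XpG (toB B r.1).
Definition evG r : K := qp r.2 / rho r.1.
Definition wactG x f : KX := glift idfun (fun b : lat B => XaffG (aact x (lat_val b, 0))) f.
Definition starG f : KX := glift star (fun b : lat B => XpG (- b)) f.
Definition evalG f : K := glift idfun (fun b : lat B => (rho (lat_val b))^-1 : K^o) f.

Lemma evGD r (s : @affV R n) : Lam r -> Lam s -> evG (r + s) = evG r * evG s.
Proof.
by move=> [r1 r2] [s1 s2]; rewrite /evG /= pqpD// prhoD// invfM mulrACA.
Qed.

Lemma evGN r : Lam r -> evG (- r) = (evG r)^-1.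
Proof. by move=> [r1 r2]; rewrite /evG /= pqpN// prhoN// invfM. Qed.

Lemma evG_neq0 r : evG r != 0.
Proof. by apply: mulf_neq0; rewrite ?invr_eq0 ?pqp_neq0 ?prho_neq0. Qed.

Lemma star_evG r : star (evG r) = (evG r)^-1.
Proof. by rewrite /evG rmorphM fmorphV /= pstar_qp pstar_rho invfM invrK. Qed.

Lemma toBK b : b \in B -> lat_val (toB B b) = b.
Proof. exact: insubdK. Qed.

Lemma toB_val (b : lat B) : toB B (lat_val b) = b.
Proof. exact: valKd. Qed.

Lemma lat_valD (b b' : lat B) : lat_val (b + b') = lat_val b + lat_val b'.
Proof. exact: (raddfD (val : lat B -> _)). Qed.

Lemma lat_valN (b : lat B) : lat_val (- b) = - lat_val b.
Proof. exact: (raddfN (val : lat B -> _)). Qed.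

Lemma lat_val0 : lat_val (0 : lat B) = 0.
Proof. exact: (raddf0 (val : lat B -> _)). Qed.

Lemma lat_val_inj (b b' : lat B) : lat_val b = lat_val b' -> b = b'.
Proof. exact: val_inj. Qed.

Lemma toBD b b' : b \in B -> b' \in B -> toB B (b + b') = toB B b + toB B b'.
Proof.
by move=> bB b'B; apply: lat_val_inj; rewrite lat_valD !toBK// rpredD.
Qed.

Lemma toBN b : b \in B -> toB B (- b) = - toB B b.
Proof. by move=> bB; apply: lat_val_inj; rewrite lat_valN !toBK// rpredN. Qed.

Lemma XaffD r (s : @affV R n) : Lam r -> Lam s -> XaffG (r + s) = XaffG r * XaffG s.
Proof.
move=> [r1 r2] [s1 s2]; rewrite /XaffG /= pqpD// toBD// gMD -scalerAl -scalerA.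
by rewrite scalerAr.
Qed.

Lemma Xaff_B (b : lat B) : XaffG (lat_val b, 0) = XpG b.
Proof. by rewrite /XaffG /= pqp0 scale1r toB_val. Qed.

Lemma Xaff0 : XaffG 0 = 1.
Proof. by rewrite -[0]/(0, 0) -lat_val0 Xaff_B gM0. Qed.

Lemma Lam_lat (b : lat B) : Lam (lat_val b, 0).
Proof. exact/Lam_B/lat_mem. Qed.

Lemma aact_pair x b b' : aact x (b + b', 0) = aact x (b, 0) + aact x (b', 0).
Proof. by rewrite -aactD; congr (aact x _); apply: affV_eq => //=; rewrite addr0. Qed.

Lemma aact0 x : aact x 0 = 0.
Proof. by apply: affV_eq; rewrite /= ?mulmx0 ?dot0l ?subr0. Qed.

Lemma wact_key0 x : XaffG (aact x (lat_val (0 : lat B), 0)) = 1.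
Proof. by rewrite lat_val0 -[(0, 0)]/(0 : affV) aact0 Xaff0. Qed.

Lemma wact_keyD x : G x -> forall b b' : lat B,
  XaffG (aact x (lat_val (b + b'), 0)) =
  XaffG (aact x (lat_val b, 0)) * XaffG (aact x (lat_val b', 0)).
Proof.
move=> xG b b'; rewrite lat_valD aact_pair XaffD//; exact/Lam_act/Lam_lat.
Qed.

Lemma wactD x f f' : wactG x (f + f') = wactG x f + wactG x f'.
Proof. exact: gliftD. Qed.

Lemma wact0 x : wactG x 0 = 0 :> KX.
Proof. exact: glift0. Qed.

Lemma wactZ x c f : wactG x (c *: f) = c *: wactG x f.
Proof. exact: gliftZ. Qed.

Lemma wactM x f f' : G x -> wactG x (f * f') = wactG x f * wactG x f'.
Proof.
by move=> xG; apply: glift_mul; exact: wact_keyD.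
Qed.

Lemma wact1 x : wactG x 1 = 1 :> KX.
Proof. by rewrite -[X in wactG _ X](gM0 KX) /wactG gliftM wact_key0. Qed.

Lemma wactXp x (b : lat B) : wactG x (XpG b) = XaffG (aact x (lat_val b, 0)).
Proof. exact: gliftM. Qed.

Lemma qpow_aact x r : G x -> Lam r ->
  qp (aact x r).2 = qp r.2 * qp (aact x (r.1, 0)).2.
Proof.
by move=> [x1 x2] [r1 r2]; rewrite /= sub0r pqpD//; exact/qintN/qint_dot.
Qed.

Lemma wactXaffG x r : G x -> Lam r -> wactG x (XaffG r) = XaffG (aact x r).
Proof.
move=> xG rL; rewrite [in LHS]/XaffG.
rewrite wactZ.
rewrite wactXp (toBK rL.1).
rewrite [in LHS]/XaffG scalerA -(qpow_aact xG rL).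
exact: erefl.
Qed.

Lemma wact_amul x y f : G x -> G y -> wactG (amul x y) f = wactG x (wactG y f).
Proof.
move=> xG yG; move: f; apply: galgebra_additive_eq => [f f'|f f'|c b].
- exact: wactD.
- by rewrite (wactD y) (wactD x).
rewrite (wactZ y) (wactZ x) wactZ !wactXp (aactM _ _ yG) (wactXaffG xG)//.
exact/Lam_act/Lam_lat.
Qed.

Lemma wact_aone f : wactG aone f = f.
Proof.
move: f; apply: galgebra_additive_eq => [f f'|//|c b]; first exact: wactD.
by rewrite wactZ wactXp aact1 Xaff_B.
Qed.

Lemma wact_saffK i f : wactG (saff D i) (wactG (saff D i) f) = f.
Proof. by rewrite -wact_amul ?saff2 ?wact_aone//; exact: saff_G. Qed.

Lemma starXD f f' : starG (f + f') = starG f + starG f'.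
Proof. exact: gliftD. Qed.

Lemma starXZ c f : starG (c *: f) = star c *: starG f.
Proof. exact: gliftZ. Qed.

Lemma starXM f f' : starG (f * f') = starG f * starG f'.
Proof.
by apply: glift_mul => b b'; rewrite opprD gMD.
Qed.

Lemma starXU c (b : lat B) : starG (c *: XpG b) = star c *: XpG (- b).
Proof. by rewrite starXZ /starG gliftM. Qed.

Lemma starX0 : starG (0 : KX) = 0. Proof. exact: glift0. Qed.

Lemma starX1 : starG (1 : KX) = 1.
Proof. by rewrite -[X in starG X](gM0 KX) /starG gliftM oppr0 gM0. Qed.

Lemma starXN f : starG (- f) = - starG f.
Proof. by rewrite -scaleN1r starXZ rmorphN1 scaleN1r. Qed.

Lemma starXB f f' : starG (f - f') = starG f - starG f'.
Proof. by rewrite starXD starXN. Qed.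

Lemma starXK f : starG (starG f) = f.
Proof.
move: f; apply: galgebra_additive_eq => [f f'|//|c b]; first by rewrite (starXD f) starXD.
by rewrite !starXU pstarK opprK.
Qed.

Lemma starX_XaffG r : Lam r -> starG (XaffG r) = XaffG (- r).
Proof.
move=> [r1 r2]; rewrite [in LHS]/XaffG starXU pstar_qp -(toBN r1) -(pqpN pd r2).
exact: erefl.
Qed.

Lemma starX_wactG x f : G x -> starG (wactG x f) = wactG x (starG f).
Proof.
move=> xG; move: f; apply: galgebra_additive_eq => [f f'|f f'|c b].
- by rewrite (wactD x f) starXD.
- by rewrite (starXD f) wactD.
rewrite (wactZ x c (XpG b)).
rewrite starXZ.
rewrite starXU.
rewrite (wactZ x (star c) (XpG (- b))).
rewrite wactXp.
rewrite wactXp.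
rewrite starX_XaffG; last exact/Lam_act/Lam_lat.
congr (_ *: XaffG _); rewrite -aactN; congr (aact x _).
by apply: affV_eq; rewrite /= ?lat_valN ?oppr0.
Qed.

Lemma eval_rhoD f f' : evalG (f + f') = evalG f + evalG f'.
Proof. exact: (gliftD (M:=K^o)). Qed.

Lemma eval_rhoZ c f : evalG (c *: f) = c * evalG f.
Proof. exact: (gliftZ (M:=K^o)). Qed.

Lemma eval_rhoM f f' : evalG (f * f') = evalG f * evalG f'.
Proof.
apply: (@glift_mul _ _ KX K^o) => b b'.
by rewrite lat_valD prhoD ?lat_mem// invfM.
Qed.

Lemma eval_rhoU c (b : lat B) : evalG (c *: XpG b) = c / rho b.
Proof. by rewrite eval_rhoZ /evalG gliftM. Qed.

Lemma eval_rho0 : evalG (0 : KX) = 0.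
Proof. exact: (@glift0 _ _ KX _ K^o). Qed.

Lemma eval_rho1 : evalG (1 : KX) = 1.
Proof. by rewrite -[X in evalG X](gM0 KX) -[gM KX 0]scale1r eval_rhoU lat_val0 prho0 divr1. Qed.

Lemma eval_rhoB f f' : evalG (f - f') = evalG f - evalG f'.
Proof. by rewrite eval_rhoD -scaleN1r eval_rhoZ mulN1r. Qed.

Lemma eval_XaffG r : Lam r -> evalG (XaffG r) = evG r.
Proof. by move=> [r1 r2]; rewrite /XaffG eval_rhoU (toBK r1). Qed.

Lemma eval_starG f : evalG (starG f) = star (evalG f).
Proof.
move: f; apply: galgebra_additive_eq => [f f'|f f'|c b].
- by rewrite (starXD f) eval_rhoD.
- by rewrite eval_rhoD rmorphD.
rewrite starXU (eval_rhoU _ b) rmorphM fmorphV /= pstar_rho eval_rhoU.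
by rewrite -[lat_val (- b)]/(\val (- b)) raddfN (prhoN pd (lat_mem b)).
Qed.

Lemma XaffG_subr1_reg r f : Lam r -> r.1 != 0 -> (XaffG r - 1) * f = 0 -> f = 0.
Proof.
move=> [r1 r2] r0; apply: gM_subr1_reg => [|k]; first exact: pqp_neq0.
apply: contraNneq r0 => /(congr1 (val : lat B -> _)); rewrite raddfMn raddf0 /= toBK//.
by move=> /eqP; rewrite -scaler_nat scaler_eq0 pnatr_eq0 => /eqP ->.
Qed.

(** Formulas with the denominator X_(alpha_i) - 1 are proved after multiplication by it; here it is
    cancelled. *)
Lemma Xaroot_reg i f f' :
  (XaffG (aroot D i) - 1) * f = (XaffG (aroot D i) - 1) * f' -> f = f'.
Proof.
move=> /eqP; rewrite -subr_eq0 -mulrBr => /eqP/XaffG_subr1_reg E.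
apply/eqP; rewrite -subr_eq0; apply/eqP/E; first exact: Lam_aroot.
exact/root_neq0/(aroot_affroot i).1.
Qed.

(** * Demazure-Lusztig operators *)

Definition thiG (i : @aidx n) : K :=
  if i is Some j then pth pd (al j) else pth pd (theta D).
Definition kap i : K := thiG i - (thiG i)^-1.

Lemma thiG_neq0 i : thiG i != 0.
Proof. by case: i => [j|]; exact: pth_neq0. Qed.

Lemma star_thiG i : star (thiG i) = (thiG i)^-1.
Proof. by case: i => [j|]; exact: pstar_th. Qed.

Lemma star_kap i : star (kap i) = - kap i.
Proof. by rewrite /kap rmorphB fmorphV star_thiG invrK opprB. Qed.

Lemma kap_neq0 i : kap i != 0.
Proof.
have t0 := thiG_neq0 i; apply/eqP => /eqP; rewrite subr_eq0 => /eqP E.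
have : thiG i ^+ 4 != 1 by case: i t0 E => [j|] _ _; exact: pth_order.
have E2 : thiG i * thiG i = 1 by rewrite {1}E mulVf.
by rewrite (exprM _ 2 2) (expr2 (thiG i)) E2 expr1n eqxx.
Qed.

Lemma Lam0 : Lam 0. Proof. exact: (Lam_B (rpred0 B)). Qed.

Lemma LamMn r (k : nat) : Lam r -> Lam (r *+ k).
Proof. by move=> rL; elim: k => [|k IH]; [exact: Lam0|rewrite mulrS; exact: LamD]. Qed.

Lemma affV1Mn r (k : nat) : (r *+ k).1 = r.1 *+ k.
Proof. by elim: k => // k IH; rewrite !mulrS /= IH. Qed.

Lemma affV2Mn r (k : nat) : (r *+ k).2 = r.2 *+ k.
Proof. by elim: k => // k IH; rewrite !mulrS /= IH. Qed.

Lemma affV1Mz r (k : int) : (r *~ k).1 = r.1 *~ k.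
Proof. by case: k => k; rewrite ?NegzE ?mulrNz -!pmulrn -affV1Mn. Qed.

Lemma affV2Mz r (k : int) : (r *~ k).2 = r.2 *~ k.
Proof. by case: k => k; rewrite ?NegzE ?mulrNz -!pmulrn -affV2Mn. Qed.

Lemma ascale_int r (k : int) : ascale k%:~R r = r *~ k.
Proof.
apply: affV_eq.
  by rewrite affV1Mz -[LHS]/(k%:~R *: r.1) scaler_int.
by rewrite affV2Mz -[LHS]/(k%:~R * r.2) mulrzl.
Qed.

Lemma saff_int i r (k : int) : apair r i = k%:~R ->
  aact (saff D i) r = r - aroot D i *~ k.
Proof. by move=> rk; rewrite saffE rk ascale_int. Qed.

Lemma saff_lin i u :
  (saff D i).1 *m u = u - dot u (coroot (aroot D i).1) *: (aroot D i).1.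
Proof. by have := congr1 fst (saffE i (u, 0)). Qed.

Lemma apair_int i r : Lam r -> exists k : int, apair r i = k%:~R.
Proof.
move=> [r1 r2]; have := B_coroot r1 (aroot_affroot i).1.
by rewrite intrEfloor => /eqP E; exists (Num.floor (apair r i)); rewrite E.
Qed.

(* The quotient of X_(r - k s) - X_r by X_s - 1 *)
Definition gquot (k : int) r (s : @affV R n) : KX :=
  match k with
  | Posz k => - \sum_(j < k) XaffG (r - s *+ j.+1)
  | Negz k => \sum_(j < k.+1) XaffG (r + s *+ j)
  end.

Lemma gquotP (k : int) r (s : @affV R n) : Lam r -> Lam s ->
  (XaffG s - 1) * gquot k r s = XaffG (r - s *~ k) - XaffG r.
Proof.
move=> rL sL; have sk (k : nat) := LamMn k sL; case: k => k /=.
  rewrite -pmulrn; elim: k => [|k IH]; first by rewrite big_ord0 subr0 subrr oppr0 mulr0.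
  rewrite big_ord_recr /= opprD mulrDr IH mulrBl mul1r mulrN -XaffD//; last first.
    by apply: LamD => //; exact: LamN.
  have -> : s + (r - s *+ k.+1) = r - s *+ k by rewrite mulrS opprD addrCA addNKr.
  by rewrite opprK; ring.
rewrite NegzE mulrNz opprK -pmulrn; elim: k => [|k IH].
  rewrite big_ord1 mulr0n addr0 mulrBl mul1r -XaffD// mulr1n.
  by rewrite [s + r]addrC.
rewrite big_ord_recr /= mulrDr IH mulrBl mul1r -XaffD//; last exact: LamD.
have -> : s + (r + s *+ k.+1) = r + s *+ k.+2 by rewrite addrCA -mulrS.
by ring.
Qed.

Definition DL i (F : KX -> KX) : Prop :=
  [/\ forall f f', F (f + f') = F f + F f', forall c f, F (c *: f) = c *: F f &
      forall f, (XaffG (aroot D i) - 1) * (F f - thiG i *: wactG (saff D i) f) =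
        kap i *: (wactG (saff D i) f - f)].

Lemma DL_Xaff i F r (k : int) : DL i F -> Lam r -> apair r i = k%:~R ->
  F (XaffG r) = thiG i *: XaffG (aact (saff D i) r) + kap i *: gquot k r (aroot D i).
Proof.
move=> [_ _ FE] rL rk; apply/eqP; rewrite addrC -subr_eq; apply/eqP.
apply: (Xaroot_reg (i := i)); rewrite -(wactXaffG (saff_G i) rL) FE -scalerAr.
rewrite (gquotP _ rL (Lam_aroot i)) (wactXaffG (saff_G i) rL).
by rewrite (saff_int rk).
Qed.

Lemma DL_algebra (x s g a b : KX) (t t' : K) :
  (x - 1) * (a - t' *: s) = (t - t') *: (x * (s - g)) ->
  (x - 1) * (b - t *: s) = (t - t') *: (s - g) ->
  (x - 1) * a = (x - 1) * (b - (t - t') *: g).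
Proof.
have Z c (y : KX) : c *: y = c%:A * y by rewrite mulr_algl.
rewrite (Z t') (Z _ (x * _)) (Z t) (Z _ (s - g)) (Z _ g) scalerBl.
move: (t%:A) (t'%:A) => p p' E2 E3.
apply/eqP; rewrite -subr_eq0; apply/eqP.
transitivity (((x - 1) * (a - p' * s) - (p - p') * (x * (s - g))) -
  ((x - 1) * (b - p * s) - (p - p') * (s - g))); first by ring.
by rewrite E2 E3 !subrr.
Qed.

(** By the quadratic relation the right side is T_i^-1 of the starred f. Starring the defining
    formula inverts X_(alpha_i) and t_i, and multiplication by -X_(alpha_i) restores the
    denominator. *)
Lemma DL_inv i F f : DL i F ->
  starG (F f) = F (starG f) - kap i *: starG f.
Proof.
move=> [_ _ FE]; have aL := Lam_aroot i; apply: (Xaroot_reg (i := i)).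
have E1 := congr1 starG (FE f); have E2 := FE (starG f).
rewrite starXM starXB starXB (starXZ _ (wactG _ _)) starX1 (starX_XaffG aL) in E1.
rewrite (starXZ (kap i)) starXB (starX_wactG _ (saff_G i)) in E1.
rewrite star_thiG star_kap in E1.
set s := wactG _ (starG f) in E1 E2 *; set A := starG (F f) in E1 *.
set B' := F _ in E2 *; set g := starG f in E1 E2 *.
have XX : XaffG (aroot D i) * XaffG (- aroot D i) = 1.
  by rewrite -XaffD ?subrr ?Xaff0//; exact: LamN.
move: XX E1 E2; set x := XaffG (aroot D i); set y := XaffG (- _) => XX E1 E2.
have E3 : (x - 1) * (A - (thiG i)^-1 *: s) = kap i *: (x * (s - g)).
  have -> : x - 1 = - x * (y - 1) by rewrite mulrBr mulNr XX mulr1 opprK addrC.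
  by rewrite -mulrA E1 scaleNr mulrN mulNr opprK scalerAr.
exact: DL_algebra E3 E2.
Qed.

(** At q^(-rho_k) the variable x = X_(alpha_j) takes the value t_j^-1, where the coefficient
    (t_j^(1/2) x - t_j^(-1/2)) / (x - 1) of s_j(f) vanishes. For i = 0 there is no such zero. *)
Lemma DL_eval (j : 'I_n) F f : DL (Some j) F -> evalG (F f) = thiG (Some j) * evalG f.
Proof.
move=> [_ _ FE]; have X := eval_XaffG (Lam_aroot (Some j)).
move: FE X; move: (XaffG _) => x FE X.
have := congr1 evalG (FE f).
rewrite eval_rhoM !eval_rhoB !eval_rhoZ !eval_rhoB eval_rho1 X /evG /=.
rewrite pqp0 mul1r prho_simple.
have := kap_neq0 (Some j); have := thiG_neq0 (Some j); rewrite /kap /thiG.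
move: (evalG (F f)) (evalG (wactG _ f)) (evalG f) (pth pd (al j)) => A S C t t0 k0 E.
apply: (mulfI (mulf_neq0 (invr_neq0 t0) k0)); apply/eqP; rewrite -subr_eq0; apply/eqP.
transitivity ((t - t^-1) * (S - C) - (t ^- 2 - 1) * (A - t * S)); last by rewrite E subrr.
by field.
Qed.

(** * Triangularity of words in the T_i *)

Definition supp_in (S : lat B -> Prop) f : Prop := forall b : lat B, gcoef f b != 0 -> S b.

Lemma supp_in0 S : supp_in S 0.
Proof. by move=> b; rewrite gcoef0 eqxx. Qed.

Lemma supp_inD S f f' : supp_in S f -> supp_in S f' -> supp_in S (f + f').
Proof.
move=> Sf Sf' b; rewrite gcoefD; have [f0|/Sf//] := eqVneq (gcoef f b) 0.
by rewrite f0 add0r => /Sf'.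
Qed.

Lemma supp_inZ S c f : supp_in S f -> supp_in S (c *: f).
Proof. by move=> Sf b; rewrite gcoefZ mulf_eq0 negb_or => /andP[_ /Sf]. Qed.

Lemma supp_in_sum S I (s : seq I) (P : pred I) (F : I -> KX) :
  (forall i, P i -> supp_in S (F i)) -> supp_in S (\sum_(i <- s | P i) F i).
Proof. by move=> SF; elim/big_ind: _ => //; [exact: supp_in0|exact: supp_inD]. Qed.

Lemma supp_in_Xaff (S : lat B -> Prop) r : Lam r ->
  (forall b : lat B, lat_val b = r.1 -> S b) -> supp_in S (XaffG r).
Proof.
move=> [r1 _] Sr b; rewrite /XaffG gcoefZ gcoefM; case: (eqVneq (toB B r.1) b) => [E _|_].
  by apply: Sr; rewrite -E toBK.
by rewrite mulr0 eqxx.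
Qed.

Lemma supp_in_expand (S S' : lat B -> Prop) (F : KX -> KX) f :
  (forall f f', F (f + f') = F f + F f') -> (forall c f, F (c *: f) = c *: F f) ->
  (forall b : lat B, S b -> supp_in S' (F (XpG b))) -> supp_in S f -> supp_in S' (F f).
Proof.
move=> FD FZ FS Sf; have F0 : F 0 = 0 by rewrite -[X in F X](scale0r 0) FZ scale0r.
rewrite [f]gexpand (big_morph F FD F0) big_seq; apply: supp_in_sum => b.
by rewrite gsuppE => /Sf /FS h; rewrite FZ; exact: supp_inZ.
Qed.

Section Triangularity.
Variable T : @aidx n -> KX -> KX.
Hypothesis TDL : forall i, DL i (T i).

(** Error terms are recorded by the weight e before the linear part of x is applied, because the
    order on weights is not invariant under W. *)
Definition above x (d b : lat B) : Prop :=
  exists2 e : lat B, wt_succ D e d & lat_val b = x.1 *m lat_val e.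

(** The quotient in T_i runs along the segment from the weight to its reflection. Interior points
    succeed d by [wt_succ_between]. For a positive product with d the reflected end point occurs and
    changes the leading coefficient; for a negative one the other end occurs and succeeds d by
    [wt_succ_refl]. *)
Lemma T_tri i x r (d : lat B) : G x -> Lam r -> r.1 = x.1 *m lat_val d ->
  (aact (ainv x) (aroot D i)).1 \in posroots D ->
  exists2 f, T i (XaffG r) = (if 0 < dot (lat_val d) (aact (ainv x) (aroot D i)).1
      then (thiG i)^-1 else thiG i) *: XaffG (aact (saff D i) r) + f &
    supp_in (above (amul (saff D i) x) d) f.
Proof.
move=> xG rL rd; set z := aact (ainv x) _ => zP.
have aL := Lam_aroot i; have [k rk] := apair_int i rL.
have xz : x.1 *m z.1 = (aroot D i).1 by have := congr1 fst (aactVK (aroot D i) xG).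
have dz : dot (lat_val d) (coroot z.1) = k%:~R.
  by rewrite -rk /apair rd -xz (coroot_W _ xG.1) (dot_W _ _ xG.1).
have zB := root_in_B (pos_root zP).
(* Pulled back by s_i x, the weight r.1 - (k - m) alpha_i becomes d - m z. *)
have above_shift (m : int) : wt_succ D (lat_val d - m%:~R *: z.1) (lat_val d) ->
    forall b : lat B, lat_val b = r.1 - (k - m)%:~R *: (aroot D i).1 ->
    above (amul (saff D i) x) d b.
  move=> m_succ b bE; exists (toB B (lat_val d - m%:~R *: z.1)).
    by rewrite toBK// rpredB ?lat_mem//; exact: (B_scale zB (intr_int _ _)).
  rewrite toBK ?rpredB ?lat_mem//; last exact: (B_scale zB (intr_int _ _)).
  rewrite bE -[(amul _ _).1]/((saff D i).1 *m x.1) -mulmxA mulmxBr -rd -scalemxAr xz.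
  rewrite mulmxBr -scalemxAr !saff_lin -[dot r.1 _]/(apair r i) rk.
  have -> : dot (aroot D i).1 (coroot (aroot D i).1) = 2 by exact: apair_root.
  move: (aroot D i).1 r.1 => s u; rewrite -addrA; congr (_ + _).
  by apply/colP => q; rewrite !mxE rmorphB /=; ring.
rewrite (DL_Xaff (TDL i) rL rk); have c0 : 0 < nu z.1 by apply: nu_gt0; exact: root_neq0 (pos_root zP).
have dk : dot (lat_val d) z.1 = nu z.1 * k%:~R by rewrite dot_nu ?dz//; exact: root_neq0 (pos_root zP).
have -> : (0 < dot (lat_val d) z.1) = (0 < k) by rewrite dk pmulr_rgt0// ltr0z.
case: k rk dz above_shift {dk} => [[|k]|k] rk dz above_shift.
- by exists 0; [rewrite ltxx /= big_ord0 oppr0 scaler0|exact: supp_in0].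
(* The last summand sits at the reflected weight, and t^(1/2) - (t^(1/2) - t^(-1/2)) leaves
   t^(-1/2). *)
- rewrite ltz_nat /= big_ord_recr /= (saff_int rk).
  exists (- kap i *: \sum_(j < k) XaffG (r - aroot D i *+ j.+1)).
    rewrite opprD scalerDr scalerN addrCA scaleNr; rewrite addrC; congr (_ + _).
    by rewrite -pmulrn scalerN -scalerBl /kap opprB addrC subrK.
  apply: supp_inZ; apply: supp_in_sum => j _; apply: supp_in_Xaff.
    by apply: LamD => //; exact/LamN/LamMn.
  move=> b bE; apply: (above_shift (Posz k.+1 - Posz j.+1)).
    apply: wt_succ_between (lat_mem d) zP dz _.
    by have := ltn_ord j; nia.
  have -> : Posz k.+1 - (Posz k.+1 - Posz j.+1) = Posz j.+1 by lia.
  by rewrite bE /= affV1Mn -scaler_nat.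
exists (kap i *: gquot (Negz k) r (aroot D i)) => //; apply: supp_inZ.
apply: supp_in_sum => j _; apply: supp_in_Xaff; first by apply: LamD => //; exact: LamMn.
move=> b bE; apply: (above_shift (Negz k + Posz j)).
  case: (posnP j) => [->|j0]; first by rewrite addr0; exact: wt_succ_refl (lat_mem d) zP dz _.
  apply: wt_succ_between (lat_mem d) zP dz _.
  by have := ltn_ord j; rewrite NegzE; nia.
rewrite bE /= affV1Mn; have -> : Negz k - (Negz k + Posz j) = - Posz j by lia.
by rewrite rmorphN /= scaleNr opprK -scaler_nat.
Qed.

Definition Tword w f : KX := foldr T f w.

Fixpoint tri_ok w : Prop := if w is i :: w'
  then (aact (ainv (wel w')) (aroot D i)).1 \in posroots D /\ tri_ok w' else True.

Fixpoint tri_coef w (d : 'cV[R]_n) : K := if w is i :: w'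
  then (if 0 < dot d (aact (ainv (wel w')) (aroot D i)).1
        then (thiG i)^-1 else thiG i) * tri_coef w' d else 1.

Lemma Tword_tri w (d : lat B) : tri_ok w -> exists2 f,
  Tword w (XpG d) = tri_coef w (lat_val d) *: wactG (wel w) (XpG d) + f &
  supp_in (above (wel w) d) f.
Proof.
elim: w => [_|i w IH [zP /IH[f fE fS]]].
  by exists 0; [rewrite /= wact_aone scale1r addr0|exact: supp_in0].
have wG := wel_G w; have [TD TZ _] := TDL i.
have rL := Lam_act wG (Lam_lat d).
have [f1 f1E f1S] := T_tri (d := d) wG rL erefl zP.
exists (tri_coef w (lat_val d) *: f1 + T i f).
  rewrite /= fE TD TZ wactXp f1E scalerDr scalerA addrA mulrC.
  by rewrite wactXp -(aactM _ _ wG).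
apply: supp_inD; first exact: supp_inZ.
apply: (supp_in_expand TD TZ _ fS) => b [e ed bE].
have [f2 f2E f2S] := T_tri (d := e) wG (Lam_lat b) bE zP.
rewrite -Xaff_B f2E; apply: supp_inD.
  apply: supp_inZ; apply: supp_in_Xaff; first exact: (Lam_act (saff_G i) (Lam_lat b)).
  move=> b' b'E; exists e => //; rewrite b'E.
  by rewrite -[(aact _ _).1]/((saff D i).1 *m lat_val b) bE mulmxA.
move=> b' /f2S[e' e'e b'E]; exists e' => //; exact: wt_succ_trans e'e ed.
Qed.

End Triangularity.

Lemma pth_nuW g a : in_W D g -> pth pd (g *m a) = pth pd a.
Proof. by move=> gW; apply: pth_nu; rewrite (nu_W _ gW). Qed.

Lemma thiG_act x i : G x -> pth pd (aact x (aroot D i)).1 = thiG i.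
Proof.
move=> xG; rewrite [LHS](pth_nuW _ xG.1); case: i => [j|] //=; apply: pth_nu.
by rewrite /nu dotNl dotNr opprK.
Qed.

Fixpoint prodw (S : comPzRingType) (F : @affV R n -> S) w : S :=
  if w is i :: w' then F (aact (ainv (wel w')) (aroot D i)) * prodw F w' else 1.

Lemma lambda_word (S : comPzRingType) (F : @affV R n -> S) w : rw w ->
  \prod_(z <- fset_set (lambda D (wel w))) F z = prodw F w.
Proof.
elim: w => [_|i w IH /rw_cons[rww zP]]; rewrite /=.
  suff -> : lambda D aone = classical_sets.set0 by rewrite fset_set0 big_seq_fset0.
  by apply: (lambda0 aone_G) => j; rewrite aact1; exact: aroot_pos.
have [-> zN] := lambda_saff (wel_G w) zP.
by rewrite big_fsetU1//= IH.
Qed.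

Lemma lambda_Pi p x : in_Pi D B p -> G x -> lambda D (amul p x) = lambda D x.
Proof.
move=> pP xG; have pG := in_Pi_G pP.
rewrite /lambda; apply/seteqP; split=> z /= [zP zN]; split=> //; move: zN.
  rewrite (aactM _ _ xG) /affneg -aactN => /(Pi_pos (Pi_inv pP)).
  by rewrite (aactK _ pG).
by move=> h; rewrite (aactM _ _ xG) /affneg -aactN; exact: Pi_pos pP h.
Qed.

Lemma lambda_word_pos w : rw w ->
  (forall r, affpos D r -> affneg D (aact (wel w) r) -> r.1 \in posroots D) -> tri_ok w.
Proof.
elim: w => // i w IH /rw_cons[rww zP] H; have wG := wel_G w; split.
  apply: (H _ zP); rewrite (aactM _ _ wG) (aactVK _ wG) saff_root /affneg opprK.
  exact: aroot_pos.
apply: IH => // z zp zn; apply: H => //; rewrite (aactM _ _ wG) /affneg -aactN.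
apply: affpos_saff => // E; apply: (affposN zp).
suff -> : - z = aact (ainv (wel w)) (aroot D i) by [].
by rewrite -E aactN (aactK _ wG).
Qed.

(** Add a large multiple of the sum of the positive roots, which pairs to 2 with every simple
    coroot. *)
Lemma dominant_shift a : a \in B -> exists c : 'cV[R]_n,
  [/\ c \in B, dominant D c & dominant D (a + c)].
Proof.
move=> aB; pose d := \sum_(a <- posroots D) a.
have dB : d \in B.
  by rewrite /d big_seq; apply: rpred_sum => c /pos_root; exact: root_in_B.
have d2 i : dot d (coroot (al i)) = 2.
  have E : refl (al i) *m d = d - 2 *: al i.
    have si : refl (al i) *m al i = - al i by exact/refl_self/simple_neq0.
    pose s := \sum_(a <- rem (al i) (posroots D)) a.
    have dE : d = al i + s by rewrite /d (perm_big _ (perm_pos_rem i)) big_cons.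
    have sE : refl (al i) *m s = s.
      by rewrite mulmx_sumr -[RHS](perm_big _ (refl_rem_perm i)) big_map.
    by rewrite dE mulmxDr si sE; apply/colP => q; rewrite !mxE; ring.
  have := E; rewrite reflE => /addrI/oppr_inj/eqP.
  rewrite -subr_eq0 -scalerBl scaler_eq0 (negPf (simple_neq0 D i)) orbF subr_eq0.
  by move=> /eqP.
have n0 i : 0 < nu (al i) by exact/nu_gt0/simple_neq0.
pose N := (\sum_i Num.bound `|dot a (coroot (al i))|)%N.
exists (N%:R *: d); split.
- exact: B_scale dB (natr_int _ _).
- move=> i; rewrite dotZl dot_nu ?simple_neq0// d2.
  by apply: mulr_ge0; [exact: ler0n|apply: mulr_ge0; first exact: ltW].
move=> i; rewrite dotDl dotZl !(dot_nu _ (simple_neq0 D i)) d2.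
rewrite mulrCA -mulrDr; apply: mulr_ge0; first exact: ltW.
have bN : (Num.bound `|dot a (coroot (al i))| <= N)%N.
  by rewrite /N (bigD1 i)//= leq_addr.
have h1 := archi_boundP (normr_ge0 (dot a (coroot (al i)))).
rewrite -(ler_nat R) in bN.
have h2 := le_trans (ler_norm (- dot a (coroot (al i)))) (_ : _ <= N%:R).
have {h2}h2 : - dot a (coroot (al i)) <= N%:R.
  by apply: h2; rewrite normrN ltW// (lt_le_trans h1).
have : 0 <= N%:R :> R by exact: ler0n.
move: h2; move: (dot a _) (N%:R) => u v; lra.
Qed.

Definition qsharpG a b : K := qp (dot a b) / rho (umin D b *m a).

(** Only exponents of q are compared, so the t-parts u and v stay arbitrary. Dominant a are enough:
    if c and b - b' + c are dominant, the two equalities give (b - b', b - b') = 0. *)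
Lemma qsharpG_sep b b' : b \in B -> b' \in B ->
  (forall a, a \in B -> dominant D a -> exists u v,
     qp (dot a b) / rho u = qp (dot a b') / rho v) -> b = b'.
Proof.
move=> bB bB' E.
have H a : a \in B -> dominant D a -> dot a b = dot a b'.
  by move=> aB ad; have [u [v]] := E a aB ad; exact: psep.
have [c [cB cd bcd]] := dominant_shift (rpredB bB bB').
have [e eE] : exists e, e = b - b' by exists (b - b').
have := H (e + c); rewrite !dotDl (H c cB cd) eE => /(_ (rpredD (rpredB bB bB') cB) bcd).
by move=> /addIr/eqP; rewrite -subr_eq0 -dotBr => /eqP/dot_eq0/eqP; rewrite subr_eq0 => /eqP.
Qed.

Lemma qsharpG_ev a b : a \in B -> b \in B ->
  qsharpG a b = evG (aact (ainv (piel D b)) (a, 0)).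
Proof.
move=> aB bB; have [uW uE _] := umin_spec bB.
by rewrite /qsharpG /evG pielE// /aact /= invmxK dotNr opprK -uE (W_mulK _ uW) add0r.
Qed.

Lemma umin0 : umin D 0 = 1%:M.
Proof.
have B0 := rpred0 B; apply: in_W_pos1; first exact: umin_W.
by move=> i; rewrite umin_pos ?simple_pos// dot0l.
Qed.

Lemma piel0 : piel D 0 = aone.
Proof.
have [_ E _] := umin_spec (rpred0 B).
by rewrite pielE ?rpred0// umin0 invmx1 -E mulmx0.
Qed.

(** * Representations of the double affine Hecke algebra *)

Section Hecke.
Variable H : algType K.
Variables (gT : @aidx n -> H) (gX : lat B -> H) (gP : @affW R n -> H).
Definition XHG f : H := glift idfun gX f.
Hypothesis quadH : forall i, (gT i - (thiG i)%:A) * (gT i + ((thiG i)^-1)%:A) = 0.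
Hypothesis braidH : forall i j k, i != j ->
  aorder (amul (saff D i) (saff D j)) k ->
  \prod_(m <- alt k i j) gT m = \prod_(m <- alt k j i) gT m.
Hypothesis X0H : gX 0 = 1.
Hypothesis XDH : forall b b' : lat B, gX (b + b') = gX b * gX b'.
Hypothesis P1H : gP aone = 1.
Hypothesis PMH : forall x y, in_Pi D B x -> in_Pi D B y -> gP (amul x y) = gP x * gP y.
Hypothesis PTH : forall x i j, in_Pi D B x -> aact x (aroot D i) = aroot D j ->
  gP x * gT i = gT j * gP x.

Definition Tinv i : H := gT i - (kap i)%:A.

Lemma TTinv i : gT i * Tinv i = 1 /\ Tinv i * gT i = 1.
Proof.
have t0 := thiG_neq0 i.
have AC (c : K) (h : H) : h * c%:A = c%:A * h by rewrite -scalerAr mulr1 -scalerAl mul1r.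
have E : gT i * gT i - (kap i)%:A * gT i = 1.
  have := quadH i; rewrite mulrDr !mulrBl AC -!scalerAl !mul1r scalerA mulfV// scale1r.
  move=> /eqP; rewrite addrACA addrA subr_eq0 => /eqP <-.
  by rewrite /kap scalerBl opprB addrA addrAC.
by rewrite /Tinv mulrBr mulrBl AC E.
Qed.

Definition hinvG (h : H) : H := classical_sets.xget 0 (fun k : H => k * h = 1 /\ h * k = 1).

Lemma hinvGE (h k : H) : k * h = 1 -> h * k = 1 -> hinvG h = k.
Proof.
move=> kh hk; rewrite /hinvG; case: classical_sets.xgetP => [g _ [gh hg]|/(_ k)[]//].
by rewrite -[g]mulr1 -hk mulrA gh mul1r.
Qed.

Definition telG x : H := classical_sets.xget 0 (fun h : H =>
  exists p w, reduced D B x p w /\ h = gP p * \prod_(i <- w) gT i).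

(** The factor in Pi is unique and any two reduced words of the rest are related by braid moves, so
    the choice in [telG] does not matter. *)
Lemma telGE x p w : reduced D B x p w -> telG x = gP p * \prod_(i <- w) gT i.
Proof.
move=> r; rewrite /telG; case: classical_sets.xgetP => [h _ [p' [w' [r' ->]]]|]; last first.
  by move=> /(_ (gP p * \prod_(i <- w) gT i)) []; exists p, w.
have rw' := reduced_rw r'; have rww := reduced_rw r.
case: r r' => [pP xE _] [pP' xE' _].
have [|-> e] := aword_inj (p := p') (w := w') (p' := p) (w' := w) pP' pP.
  by rewrite -!awordE -xE.
by congr (_ * _); exact: (braid_word braidH).
Qed.

Lemma telG_Pi p : in_Pi D B p -> telG p = gP p.
Proof.
move=> pP; rewrite (@telGE p p [::]) ?big_nil ?mulr1//; split=> //; last by case: pP.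
by rewrite awordE amulx1.
Qed.

Lemma telG1 : telG aone = 1.
Proof. by rewrite (telG_Pi Pi1). Qed.

Lemma telG_wel w : rw w -> telG (wel w) = \prod_(i <- w) gT i.
Proof.
move=> rww; rewrite -[wel w](amul1x (wel_G w)) (telGE (rw_reduced Pi1 rww)).
by rewrite P1H mul1r.
Qed.

Lemma word_Pi p w : in_Pi D B p -> exists w', [/\ size w' = size w,
  amul (wel w) p = amul p (wel w') &
  (\prod_(i <- w) gT i) * gP p = gP p * \prod_(i <- w') gT i].
Proof.
move=> pP; have pG := in_Pi_G pP; elim: w => [|i w [w' [sE wE TE]]].
  by exists [::]; rewrite !big_nil mulr1 mul1r (amul1x pG) amulx1.
have [j pj] := Pi_simple i (Pi_inv pP).
have pji : aact p (aroot D j) = aroot D i by rewrite -pj (aactVK _ pG).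
exists (j :: w'); split; rewrite ?big_cons /= ?sE//.
  rewrite -(amulA _ (wel_G w) pG) wE (amulA _ pG (wel_G w')) (saff_conj pG pji).
  by rewrite -(amulA _ (saff_G j) (wel_G w')).
by rewrite -mulrA TE !mulrA (PTH pP pji).
Qed.

Lemma telGM x y : G x -> G y -> len D (amul x y) = (len D x + len D y)%N ->
  telG (amul x y) = telG x * telG y.
Proof.
move=> xG yG lE; have [p [w rx]] := reduced_exists xG.
have [p' [w' ry]] := reduced_exists yG.
rewrite (telGE rx) (telGE ry); case: rx ry => [pP xE sE] [pP' yE sE'].
have [v [vs vE TE]] := word_Pi w pP'; have pG' := in_Pi_G pP'; have pG := in_Pi_G pP.
rewrite (@telGE _ (amul p p') (v ++ w')); first by rewrite (PMH pP pP') big_cat /= -!mulrA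
  (mulrA (\prod_(i <- w) _)) TE -!mulrA.
split; [exact: Pi_mul| |by rewrite size_cat vs sE sE' lE].
rewrite awordE wel_cat xE yE !awordE.
have wG := wel_G w; have wG' := wel_G w'; have vG := wel_G v.
rewrite -(amulA _ wG (amul_G pG' wG')) (amulA _ pG' wG') vE.
by rewrite -(amulA _ vG wG') -(amulA _ pG' (amul_G vG wG')).
Qed.

Lemma prod_word_inv w : (\prod_(i <- w) gT i) * (\prod_(i <- rev w) Tinv i) = 1 /\
  (\prod_(i <- rev w) Tinv i) * (\prod_(i <- w) gT i) = 1.
Proof.
elim: w => [|i w [IH1 IH2]]; first by rewrite !big_nil mulr1.
have [e1 e2] := TTinv i; rewrite rev_cons -cats1 big_cat big_seq1 big_cons /=.
rewrite mulrA -(mulrA (gT i)) IH1 mulr1 e1 mulrA -(mulrA (\prod_(j <- rev w) _)) e2.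
by rewrite mulr1 IH2.
Qed.

Lemma gP_inv p : in_Pi D B p -> gP p * gP (ainv p) = 1 /\ gP (ainv p) * gP p = 1.
Proof.
move=> pP; have pG := in_Pi_G pP; have pI := Pi_inv pP.
by rewrite -(PMH pP pI) -(PMH pI pP) (amulVx pG) (amulxV pG).
Qed.

Definition telV x : H := hinvG (telG x).

Lemma telG_inv x : G x -> telG x * telV x = 1 /\ telV x * telG x = 1.
Proof.
move=> /reduced_exists[p [w r]]; have [a1 a2] := prod_word_inv w.
have [b1 b2] : gP p * gP (ainv p) = 1 /\ gP (ainv p) * gP p = 1 by case: r => pP _ _; exact: gP_inv.
rewrite /telV (telGE r) (@hinvGE _ ((\prod_(i <- rev w) Tinv i) * gP (ainv p))).
- by split; rewrite -mulrA ?(mulrA (\prod_(i <- w) _)) ?a1 ?mul1r// (mulrA (gP (ainv p))) b2 mul1r.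
- by rewrite -mulrA (mulrA (gP (ainv p))) b2 mul1r.
by rewrite -mulrA (mulrA (\prod_(i <- w) _)) a1 mul1r.
Qed.

Definition yelG (b : lat B) : H := classical_sets.xget 0 (fun y : H => exists c d : lat B,
  [/\ in_Pp D (lat_val c), in_Pp D (lat_val d), b = c - d &
      y = telG (tr (lat_val c)) * hinvG (telG (tr (lat_val d)))]).

(** For another decomposition b = c - d the translation by c is the product of those by b and d with
    additive lengths, so the factor for d cancels. *)
Lemma yelG_dom (b : lat B) : dominant D (lat_val b) -> yelG b = telG (tr (lat_val b)).
Proof.
move=> bd; have Pd (c : lat B) : in_Pp D (lat_val c) -> dominant D (lat_val c).
  by move=> /in_Pp_dominant[].
have bP : in_Pp D (lat_val b) by apply/in_Pp_dominant; split=> //; exact/BP/lat_mem.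
rewrite /yelG; case: classical_sets.xgetP => [y _ [c [d [cP dP bE ->]]]|]; last first.
  move=> /(_ (telG (tr (lat_val b)))) []; exists b, 0; split=> //.
  - by apply/in_Pp_dominant; split=> [|i]; rewrite lat_val0 ?dot0l//; exact/BP/rpred0.
  - by rewrite subr0.
  by rewrite lat_val0 -[tr 0]/aone telG1 (@hinvGE 1 1) ?mulr1.
have -> : c = b + d by rewrite bE subrK.
have [e1 _] := telG_inv (tr_G (lat_mem d)).
rewrite lat_valD -tr_amul telGM; try exact: tr_G (lat_mem _).
  by rewrite -mulrA e1 mulr1.
by rewrite tr_amul; exact: (len_trD (lat_mem b) (lat_mem d) bd (Pd _ dP)).
Qed.

Hypothesis TXH : forall i (b : lat B) f,
  (XaffG (aroot D i) - 1) * f = XaffG (aact (saff D i) (lat_val b, 0)) - XpG b ->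
  gT i * gX b - XHG (XaffG (aact (saff D i) (lat_val b, 0))) * gT i = kap i *: XHG f.
Hypothesis PXH : forall x (b : lat B), in_Pi D B x ->
  gP x * gX b = XHG (XaffG (aact x (lat_val b, 0))) * gP x.
Variable act : H -> KX -> KX.
Hypothesis act1 : forall f, act 1 f = f.
Hypothesis actM : forall (h k : H) f, act (h * k) f = act h (act k f).
Hypothesis act_linl : forall c (h k : H) f, act (c *: h + k) f = c *: act h f + act k f.
Hypothesis act_linr : forall c (h : H) f f', act h (c *: f + f') = c *: act h f + act h f'.
Hypothesis actX : forall (b : lat B) f, act (gX b) f = XpG b * f.
Hypothesis actP : forall x f, in_Pi D B x -> act (gP x) f = wactG x f.
Hypothesis actT : forall i f, (XaffG (aroot D i) - 1) *
  (act (gT i) f - thiG i *: wactG (saff D i) f) = kap i *: (wactG (saff D i) f - f).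
Variable eps : {rmorphism H -> H}.
Hypothesis epsZ : forall c (h : H), eps (c *: h) = star c *: eps h.
Hypothesis epsX : forall b : lat B, eps (gX b) = yelG b.
Hypothesis epsY : forall b : lat B, eps (yelG b) = gX b.
Hypothesis epsT : forall j : 'I_n, eps (gT (Some j)) = hinvG (gT (Some j)).

Lemma act0l f : act 0 f = 0.
Proof. by have := act_linl (-1) 0 0 f; rewrite scaler0 addr0 scaleN1r addNr. Qed.

Lemma actDl (h k : H) f : act (h + k) f = act h f + act k f.
Proof. by have := act_linl 1 h k f; rewrite !scale1r. Qed.

Lemma actZl c (h : H) f : act (c *: h) f = c *: act h f.
Proof. by have := act_linl c h 0 f; rewrite act0l !addr0. Qed.

Lemma act0r (h : H) : act h 0 = 0.
Proof. by have := act_linr (-1) h 0 0; rewrite scaler0 addr0 scaleN1r addNr. Qed.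

Lemma actDr (h : H) f f' : act h (f + f') = act h f + act h f'.
Proof. by have := act_linr 1 h f f'; rewrite !scale1r. Qed.

Lemma actZr c (h : H) f : act h (c *: f) = c *: act h f.
Proof. by have := act_linr c h f 0; rewrite act0r !addr0. Qed.

Lemma actBl (h k : H) f : act (h - k) f = act h f - act k f.
Proof. by rewrite -scaleN1r actDl actZl scaleN1r. Qed.

Lemma act_DL i : DL i (act (gT i)).
Proof. by split=> *; rewrite ?actDr ?actZr ?actT. Qed.

Lemma act_word w f : act (\prod_(i <- w) gT i) f = Tword (fun i => act (gT i)) w f.
Proof.
by elim: w => [|i w IH]; rewrite ?big_nil ?act1 ?big_cons ?actM ?IH.
Qed.

Lemma act_Tinv i f : act (Tinv i) f = act (gT i) f - kap i *: f.
Proof. by rewrite actBl actZl act1. Qed.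

Lemma eps_Tfin (j : 'I_n) : eps (gT (Some j)) = Tinv (Some j).
Proof. by have [e1 e2] := TTinv (Some j); rewrite epsT (hinvGE e2 e1). Qed.

Lemma eps_word s : eps (\prod_(i <- map some s) gT i) = \prod_(i <- map some s) Tinv i.
Proof. by rewrite rmorph_prod !big_map; apply: eq_bigr => j _; exact: eps_Tfin. Qed.

Lemma yelG0 : yelG 0 = 1. Proof. by rewrite -epsX X0H rmorph1. Qed.

Lemma yelGD (b b' : lat B) : yelG (b + b') = yelG b * yelG b'.
Proof. by rewrite -!epsX XDH rmorphM. Qed.

(* The group generated by the X_b and the T_i with i > 0, as pairs of inverse      *)
(* elements. It contains eps(T_0) and eps(Pi), which makes the action and the      *)
(* adjoints of these elements computable.                                          *)
Inductive Ugrp : H -> H -> Prop :=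
| UgrpX (b : lat B) : Ugrp (gX b) (gX (- b))
| UgrpT (j : 'I_n) : Ugrp (gT (Some j)) (Tinv (Some j))
| UgrpV (j : 'I_n) : Ugrp (Tinv (Some j)) (gT (Some j))
| UgrpM (h h' k k' : H) : Ugrp h h' -> Ugrp k k' -> Ugrp (h * k) (k' * h').

Lemma Ugrp_inv (h h' : H) : Ugrp h h' -> h * h' = 1 /\ h' * h = 1.
Proof.
elim=> [b|j|j|h1 h1' k k' _ [e1 e2] _ [e3 e4]].
- by rewrite -!XDH subrr addNr X0H.
- exact: (TTinv (Some j)).
- by have [] := TTinv (Some j).
by rewrite mulrA -(mulrA h1) e3 mulr1 e1 mulrA -(mulrA k') e2 mulr1 e4.
Qed.

Lemma Ugrp_sym (h h' : H) : Ugrp h h' -> Ugrp h' h.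
Proof.
elim=> [b|j|j|h1 h1' k k' _ U1 _ U2].
- by have := UgrpX (- b); rewrite opprK.
- exact: UgrpV.
- exact: UgrpT.
exact: UgrpM.
Qed.

Lemma Ugrp1 : Ugrp 1 1.
Proof. by have := UgrpX 0; rewrite oppr0 X0H. Qed.

Lemma Ugrp_word s :
  Ugrp (\prod_(i <- map some s) Tinv i) (\prod_(i <- rev (map some s)) gT i).
Proof.
elim: s => [|j s IH]; first by rewrite !big_nil; exact: Ugrp1.
rewrite /= rev_cons -cats1 big_cat big_cons big_seq1; exact: (UgrpM (UgrpV j)).
Qed.

Lemma inv_unique (h k k' : H) : k * h = 1 -> h * k' = 1 -> k = k'.
Proof. by move=> kh hk; rewrite -[k]mulr1 -hk mulrA kh mul1r. Qed.

Lemma eval_actX (b : lat B) f : evalG (act (gX b) f) = (rho (lat_val b))^-1 * evalG f.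
Proof. by rewrite actX eval_rhoM -[gM KX b]scale1r eval_rhoU mul1r. Qed.

Lemma eval_actT j f : evalG (act (gT (Some j)) f) = thiG (Some j) * evalG f.
Proof. exact/DL_eval/act_DL. Qed.

Lemma eval_act_word s f : evalG (act (\prod_(i <- map some s) gT i) f) =
  (\prod_(i <- map some s) thiG i) * evalG f.
Proof.
elim: s => [|j s IH]; first by rewrite !big_nil act1 mul1r.
by rewrite /= !big_cons actM eval_actT IH mulrA.
Qed.

Lemma eval_eps_word s f : evalG (act (eps (\prod_(i <- map some s) gT i)) f) =
  (\prod_(i <- map some s) thiG i)^-1 * evalG f.
Proof.
have [e1 e2] := Ugrp_inv (Ugrp_word s); rewrite eps_word.
elim: s {e1 e2} => [|j s IH]; first by rewrite !big_nil act1 invr1 mul1r.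
rewrite /= !big_cons actM; have [e1 e2] := TTinv (Some j).
set g := act _ f.
have -> : evalG (act (Tinv (Some j)) g) = (thiG (Some j))^-1 * evalG g.
  apply: (mulfI (thiG_neq0 (Some j))); rewrite mulrA mulfV ?thiG_neq0// mul1r.
  by rewrite -eval_actT -actM e1 act1.
by rewrite IH invfM mulrA.
Qed.

Lemma prodw_thi w : prodw (fun z : @affV R n => pth pd z.1) w = \prod_(i <- w) thiG i.
Proof.
elim: w => [|i w IH]; first by rewrite big_nil.
by rewrite /= big_cons IH (thiG_act _ (ainv_G (wel_G w))).
Qed.

Lemma rho_reduced (b : lat B) p w : dominant D (lat_val b) ->
  reduced D B (tr (lat_val b)) p w -> rho (lat_val b) = \prod_(i <- w) thiG i.
Proof.
move=> bd r; rewrite -prodw_thi -(lambda_word _ (reduced_rw r)).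
have [pP E _] := r; rewrite -(lambda_Pi pP (wel_G w)) -awordE -E.
have := pth_lambda_tr pd (lat_mem b) bd (rpred0 B); rewrite umin0 mul1mx => <-.
by apply: eq_bigr => z _; rewrite dot0l ltxx.
Qed.

(* If tr b = p [v] g with g in W and lengths adding up, then Y_b = (gP p T_v) T_g, *)
(* so that eps (gP p T_v) = X_b eps(T_g)^-1.                                      *)
Lemma eps_prefix (b : lat B) p (v : seq (@aidx n)) s : dominant D (lat_val b) ->
  reduced D B (tr (lat_val b)) p (v ++ map some s) ->
  let hv := gP p * \prod_(i <- v) gT i in
  (exists k, Ugrp (eps hv) k) /\
  forall f, evalG (act (eps hv) f) = (\prod_(i <- v) thiG i)^-1 * evalG f.
Proof.
move=> bd r hv; set e := \prod_(i <- map some s) gT i.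
have E : eps hv * eps e = gX b.
  by rewrite -rmorphM -epsY (yelG_dom bd) (telGE r) big_cat mulrA.
have Ue := Ugrp_word s; have [e1 e2] := Ugrp_inv Ue; move: Ue e1 e2.
rewrite -eps_word -/e; set e' := \prod_(i <- rev _) _ => Ue e1 e2.
have hE : eps hv = gX b * e' by rewrite -E -mulrA e1 mulr1.
split; first by exists (eps e * gX (- b)); rewrite hE; apply: UgrpM (UgrpX b) (Ugrp_sym Ue).
move=> f; have -> : f = act (eps e) (act e' f) by rewrite -actM e1 act1.
rewrite -actM E eval_actX eval_eps_word mulrA; congr (_ * _).
by rewrite (rho_reduced bd r) big_cat /= invfM.
Qed.

(** For i = 0, Y_theta = T_0 T_(s_theta) shows that eps(T_0) is X_theta times a product of T_j with
    j > 0. *)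
Lemma eps_T i : (exists k, Ugrp (eps (gT i)) k) /\
  forall f, evalG (act (eps (gT i)) f) = (thiG i)^-1 * evalG f.
Proof.
case: i => [j|].
  split; first by rewrite eps_Tfin; exists (gT (Some j)); exact: UgrpV.
  by move=> f; have := eval_eps_word [:: j] f; rewrite /= !big_seq1.
have tW : in_W D (refl (theta D)) by apply: in_W_refl; exact: theta_root.
have [s [r rs]] := lin_reduced tW.
have tB : theta D \in B by exact/root_in_B/theta_root.
pose b := toB B (theta D).
have bd : dominant D (lat_val b) by rewrite /b toBK//; exact: theta_dominant.
have sE : lin (refl (theta D)) = wel (map some s).
  by case: r => _ -> _; rewrite awordE (amul1x (wel_G _)).
have rr : reduced D B (tr (lat_val b)) aone ([:: None] ++ map some s).
  rewrite /b toBK// tr_theta sE -[amul (saff D None) _]/(wel (None :: map some s)).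
  rewrite -[wel _](amul1x (wel_G _)); apply: (rw_reduced Pi1).
  by apply: rw_consl => //; rewrite -sE; exact: theta_affpos.
have [U Ev] := eps_prefix bd rr.
by rewrite P1H mul1r big_seq1 in U Ev; split=> // f; rewrite Ev big_seq1.
Qed.

(** The case of an empty word v: Y_b = pi T_u shows that eps(pi) is X_b times a product of T_j with
    j > 0. *)
Lemma eps_P p : in_Pi D B p -> (exists k, Ugrp (eps (gP p)) k) /\
  forall f, evalG (act (eps (gP p)) f) = evalG f.
Proof.
move=> pP; have [bB bd trE] := Pi_tr pP; have pG := in_Pi_G pP.
have [s [r rs]] := lin_reduced (in_W_inv pG.1).
have sE : lin (invmx p.1) = wel (map some s).
  by case: r => _ -> _; rewrite awordE (amul1x (wel_G _)).
pose b := toB B (p.1 *m p.2); have bE : lat_val b = p.1 *m p.2 by rewrite toBK.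
have rr : reduced D B (tr (lat_val b)) p ([::] ++ map some s).
  by rewrite bE trE sE; exact: rw_reduced.
have [|U Ev] := eps_prefix _ rr; first by rewrite bE.
rewrite big_nil mulr1 in U Ev; split=> // f; by rewrite Ev big_nil invr1 mul1r.
Qed.

(** * Joint eigenvectors of the Y_a *)

Lemma tri_coef_prodw w (d : 'cV[R]_n) : tri_coef w d =
  prodw (fun z : @affV R n => if 0 < dot d z.1 then (pth pd z.1)^-1 else pth pd z.1) w.
Proof. by elim: w => //= i w ->; rewrite (thiG_act _ (ainv_G (wel_G w))). Qed.

(** The leading coefficient collects one factor per root of lambda(tr a), and [pth_lambda_tr]
    evaluates their product. A translation has trivial linear part, so the weights recorded by
    [above] are the actual ones in the end. *)
Lemma Y_tri (a d : lat B) : dominant D (lat_val a) -> exists2 f,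
  act (yelG a) (XpG d) = (qsharpG (lat_val a) (lat_val d))^-1 *: XpG d + f &
  supp_in (fun b : lat B => wt_succ D (lat_val b) (lat_val d)) f.
Proof.
move=> ad; have [p [w r]] := reduced_exists (tr_G (lat_mem a)).
have [pP E _] := r; have rww := reduced_rw r; have wG := wel_G w; have pG := in_Pi_G pP.
rewrite awordE in E.
have tok : tri_ok w.
  apply: (lambda_word_pos rww) => z zp zn.
  have : lambda D (tr (lat_val a)) z by rewrite E (lambda_Pi pP wG).
  by case: z {zp zn} => z1 z2 /(lambda_tr_dominant _ _ (lat_mem a) ad)[].
have [f fE fS] := Tword_tri act_DL d tok.
rewrite (yelG_dom ad) (telGE r) actM act_word fE (actP _ pP) wactD wactZ.
rewrite -(wact_amul _ pG wG) -E wactXp.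
exists (wactG p f).
  congr (_ + _); rewrite /XaffG scalerA; congr (_ *: gM KX _); last first.
    by apply: lat_val_inj; rewrite toBK /= mul1mx// lat_mem.
  rewrite /qsharpG invf_div tri_coef_prodw -(lambda_word _ rww) -(lambda_Pi pP wG) -E.
  rewrite (pth_lambda_tr pd (lat_mem a) ad (lat_mem d)) /= sub0r dotC.
  by rewrite (pqpN pd (qint_dot (lat_mem a) (lat_mem d))).
apply: (supp_in_expand (S := above (wel w) d)) fS => [g g'|c g|b [e ed bE]].
- exact: wactD.
- exact: wactZ.
rewrite wactXp; apply: supp_in_Xaff; first exact: (Lam_act pG (Lam_lat b)).
move=> b' ->; rewrite /= bE mulmxA.
have -> : p.1 *m (wel w).1 = 1%:M by have := congr1 fst E; rewrite /= => <-.
by rewrite mul1mx.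
Qed.

Lemma rel_min (U : eqType) (r : U -> U -> Prop) (s : seq U) (u : U) :
  (forall v : U, ~ r v v) -> (forall v1 v2 v3 : U, r v1 v2 -> r v2 v3 -> r v1 v3) -> u \in s ->
  exists2 m : U, m \in s & (m = u \/ r u m) /\ forall v : U, v \in s -> ~ r m v.
Proof.
move=> irr tr us; have [N] := ubnP (count (fun v : U => `[< r u v >]) s).
elim: N u us => // N IH u us; rewrite ltnS => cN.
have [[v vs ruv]|no] := pselect (exists2 v : U, v \in s & r u v); last first.
  by exists u => //; split; [left|move=> v vs ruv; apply: no; exists v].
have [|m ms [mv mm]] := IH v vs.
  apply: leq_trans cN; rewrite -!size_filter.
  pose F (u : U) := [seq v : U <- s | `[< r u v >]].
  rewrite -[X in (X < _)%N]/(size (F v)).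
  have : subseq (F v) (F u).
    rewrite /F; have -> : [seq y : U <- s | `[< r v y >]] =
       [seq y : U <- [seq y : U <- s | `[< r u y >]] | `[< r v y >]].
      rewrite -filter_predI; apply: eq_filter => y /=; apply/idP/andP => [/asboolP vy|[]//].
      by split; apply/asboolP => //; exact: tr ruv vy.
    exact: filter_subseq.
  move=> ss; rewrite ltn_neqAle size_subseq// andbT; apply/negP => /eqP e.
  have E : F v = F u by apply/eqP; rewrite -(size_subseq_leqif ss) e.
  have : v \in F v by rewrite E mem_filter vs andbT; exact/asboolP.
  by rewrite mem_filter => /andP[/asboolP/irr].
exists m => //; split=> //; right; case: mv => [->//|]; exact: tr ruv.
Qed.

(** For x = pi_b the eigenvalue is q^(-(a, b_#)). General x is allowed because intertwiners multiply
    x on the left and may leave pi_B. *)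
Definition ychar x f : Prop := forall a : lat B,
  act (yelG a) f = (evG (aact (ainv x) (lat_val a, 0)))^-1 *: f.

(** At a weight m of f that succeeds no other weight of f, only X_m contributes to the coefficient
    of X_m in Y_a(f), so m determines the eigenvalues. As these separate weights, there is just one
    such m, and all other weights of f succeed it. *)
Lemma Y_spec f (chi : lat B -> K) : f != 0 ->
  (forall a : lat B, dominant D (lat_val a) -> act (yelG a) f = chi a *: f) ->
  exists d : lat B, [/\ gcoef f d != 0,
    forall a : lat B, dominant D (lat_val a) -> chi a = (qsharpG (lat_val a) (lat_val d))^-1 &
    forall b : lat B, gcoef f b != 0 -> b = d \/ wt_succ D (lat_val b) (lat_val d)].
Proof.
move=> f0 fchi.
have [b0 b0f] : exists b : lat B, b \in gsupp f.
  have [s sE] : exists s, s = gsupp f by exists (gsupp f).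
  case: s sE => [|b s] sE; last by exists b; rewrite -sE mem_head.
  by move: f0; rewrite [f]gexpand -sE big_nil eqxx.
pose r (u v : lat B) := wt_succ D (lat_val u) (lat_val v).
have rt (u v w : lat B) : r u v -> r v w -> r u w by move=> uv vw; exact: wt_succ_trans uv vw.
have ri (u : lat B) : ~ r u u by exact: wt_succ_irr.
have minE (m : lat B) : m \in gsupp f -> (forall v : lat B, v \in gsupp f -> ~ r m v) ->
    forall a : lat B, dominant D (lat_val a) -> chi a = (qsharpG (lat_val a) (lat_val m))^-1.
  move=> mf mm a ad; rewrite gsuppE in mf; apply: (mulIf mf).
  rewrite -gcoefZ -fchi// {1}[f]gexpand.
  have -> : act (yelG a) (\sum_(b <- gsupp f) gcoef f b *: XpG b) =
      \sum_(b <- gsupp f) gcoef f b *: act (yelG a) (XpG b).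
    by rewrite (big_morph _ (actDr _) (act0r _)); apply: eq_bigr => b _; exact: actZr.
  rewrite gcoef_sum (bigD1_seq m) ?gsuppE ?gsupp_uniq//= big1_seq => [|b /andP[bm bf]].
    have [g gE gS] := Y_tri m ad; rewrite addr0 gcoefZ gE gcoefD gcoefZ gcoefM eqxx mulr1.
    have [->|/gS/ri//] := eqVneq (gcoef g m) 0; by rewrite addr0 mulrC.
  have [g gE gS] := Y_tri b ad; rewrite gcoefZ gE gcoefD gcoefZ gcoefM (negPf bm) mulr0 add0r.
  by have [->|/gS/(mm _ bf)//] := eqVneq (gcoef g m) 0; rewrite mulr0.
have [d df [_ dm]] := rel_min ri rt b0f.
exists d; split; [by rewrite -gsuppE|exact: minE|] => b; rewrite -gsuppE => bf.
have [m mf [mb mm]] := rel_min ri rt bf.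
suff -> : d = m by case: mb => [->|]; [left|right].
apply: lat_val_inj; apply: qsharpG_sep; try exact: lat_mem.
move=> a aB ad; have ad' : dominant D (lat_val (toB B a)) by rewrite toBK.
have := minE d df dm _ ad'; rewrite (minE m mf mm _ ad') toBK// => /invr_inj.
by rewrite /qsharpG => e; exists (umin D (lat_val d) *m a), (umin D (lat_val m) *m a).
Qed.

(** * Intertwiners and the eigenbasis *)

Definition PhiG i (y : K) f : KX := act (eps (gT i)) f + (star (kap i) * (y - 1)^-1) *: f.
Definition phiG i (y : K) : K := star (thiG i) + star (kap i) * (y - 1)^-1.

Lemma XHGD f f' : XHG (f + f') = XHG f + XHG f'.
Proof. exact: gliftD. Qed.

Lemma XHGZ c f : XHG (c *: f) = c *: XHG f.
Proof. exact: gliftZ. Qed.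

Lemma XHG_Xp (b : lat B) : XHG (XpG b) = gX b.
Proof. exact: gliftM. Qed.

Lemma Xaff_act x r : G x -> Lam r ->
  XaffG (aact x r) = qp r.2 *: XaffG (aact x (lat_val (toB B r.1), 0)).
Proof.
by move=> xG [r1 r2]; rewrite (toBK r1) /XaffG (qpow_aact xG)// scalerA.
Qed.

Lemma TXr i r f : Lam r ->
  (XaffG (aroot D i) - 1) * f = XaffG (aact (saff D i) r) - XaffG r ->
  gT i * XHG (XaffG r) - XHG (XaffG (aact (saff D i) r)) * gT i = kap i *: XHG f.
Proof.
move=> rL E; have q0 := pqp_neq0 pd r.2.
have E2 : (XaffG (aroot D i) - 1) * ((qp r.2)^-1 *: f) =
    XaffG (aact (saff D i) (lat_val (toB B r.1), 0)) - XpG (toB B r.1).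
  rewrite -scalerAr E (Xaff_act (saff_G i) rL) /XaffG -[X in _ *: (_ - X)]/(qp r.2 *: _).
  by rewrite -scalerBr scalerA mulVf// scale1r.
have := TXH E2; rewrite (Xaff_act (saff_G i) rL) {E E2}; move: (XaffG (aact _ _)) => Xs.
rewrite [XaffG r]/(qp r.2 *: _) (XHGZ _ Xs) (XHGZ _ (XpG _)) (XHGZ _ f) XHG_Xp.
rewrite -scalerAr -scalerAl -scalerBr => ->.
by rewrite !scalerA mulrCA mulfV// mulr1.
Qed.

Lemma PXr p r : in_Pi D B p -> Lam r ->
  gP p * XHG (XaffG r) = XHG (XaffG (aact p r)) * gP p.
Proof.
move=> pP rL; rewrite (Xaff_act (in_Pi_G pP) rL); have := PXH (toB B r.1) pP.
move: (XaffG (aact _ _)) => Xs E.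
rewrite [XaffG r]/(qp r.2 *: _) (XHGZ _ Xs) (XHGZ _ (XpG _)) XHG_Xp.
by rewrite -scalerAr E -scalerAl.
Qed.

Definition yev x f : K := glift star (fun a : lat B => (evG (aact (ainv x) (lat_val a, 0)))^-1 : K^o) f.

Lemma yev_key x (a a' : lat B) : G x -> evG (aact (ainv x) (lat_val (a + a'), 0)) =
  evG (aact (ainv x) (lat_val a, 0)) * evG (aact (ainv x) (lat_val a', 0)).
Proof.
move=> xG; have vG := ainv_G xG; rewrite lat_valD aact_pair evGD//; exact: (Lam_act vG (Lam_lat _)).
Qed.

Lemma yevM x f f' : G x -> yev x (f * f') = yev x f * yev x f'.
Proof. by move=> xG; apply: (@glift_mul _ _ KX K^o) => a a'; rewrite (yev_key _ _ xG) invfM. Qed.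

Lemma yevB x f f' : yev x (f - f') = yev x f - yev x f'.
Proof.
rewrite /yev (@gliftD _ _ KX _ K^o) -scaleN1r (@gliftZ _ _ KX _ K^o) rmorphN1.
by rewrite -[_ *: _]/(-1 * _) mulN1r.
Qed.

Lemma yev_Xaff x r : G x -> Lam r -> yev x (XaffG r) = (evG (aact (ainv x) r))^-1.
Proof.
move=> xG rL; have vG := ainv_G xG.
rewrite /yev /XaffG (@gliftZ _ _ KX _ K^o) (@gliftM _ _ KX _ K^o) pstar_qp.
rewrite -[_ *: _]/((qp r.2)^-1 * _) (toBK rL.1) /evG (qpow_aact vG rL) /=.
by rewrite -invfM mulrA.
Qed.

Lemma yev1 x : G x -> yev x 1 = 1.
Proof.
move=> xG; rewrite -(Xaff0 : XaffG 0 = _) (yev_Xaff xG Lam0) aact0.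
by rewrite /evG /= pqp0 prho0 divr1 invr1.
Qed.

Lemma eps_XH x e f : ychar x e -> act (eps (XHG f)) e = yev x f *: e.
Proof.
move=> ex; move: f; apply: galgebra_additive_eq => [f f'|f f'|c a].
- by rewrite XHGD rmorphD actDl.
- by rewrite /yev (@gliftD _ _ KX _ K^o) scalerDl.
rewrite XHGZ XHG_Xp epsZ actZl epsX ex /yev (@gliftZ _ _ KX _ K^o) (@gliftM _ _ KX _ K^o).
by rewrite scalerA.
Qed.

Definition yroot x i : K := (evG (aact (ainv x) (aroot D i)))^-1.

Lemma yroot_neq1 x i : G x -> yroot x i != 1.
Proof.
move=> xG; rewrite /yroot invr_eq1; apply: (pev_neq1 pd).
exact: (affroot_act (ainv_G xG) (aroot_affroot i)).
Qed.

(** Apply eps to the relation between T_i and X_b in order to move Y_a past eps(T_i). On the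
    eigenvector e the quotient in that relation becomes a number, and the correction term of [PhiG]
    absorbs it. *)
Lemma ychar_Phi x i e : G x -> ychar x e ->
  ychar (amul (saff D i) x) (PhiG i (yroot x i) e).
Proof.
move=> xG ex a; have sG := saff_G i; have vG := ainv_G xG; set y := yroot x i.
pose r := aact (saff D i) (lat_val a, 0); have rL : Lam r := Lam_act sG (Lam_lat a).
have sr : aact (saff D i) r = (lat_val a, 0) by rewrite /r saffK.
have [k rk] := apair_int i rL; have aL := Lam_aroot i.
pose g := gquot k r (aroot D i).
have gE : (XaffG (aroot D i) - 1) * g = XaffG (aact (saff D i) r) - XaffG r.
  by rewrite (gquotP _ rL aL) (saff_int rk).
have E1 := TXr rL gE; have := congr1 (fun k => act (eps k) e) E1.
have y1 : y - 1 != 0 by rewrite subr_eq0; exact: yroot_neq1.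
have E2 := congr1 (yev x) gE.
rewrite (yevM _ _ xG) !yevB (yev1 xG) (yev_Xaff xG aL) -/y in E2.
rewrite -[(evG _)^-1]/y in E2.
rewrite sr Xaff_B in E2 *; rewrite XHG_Xp.
rewrite rmorphB actBl !rmorphM !actM epsX (eps_XH _ ex) actZr epsZ actZl (eps_XH _ ex).
rewrite (yev_Xaff xG rL) in E2 *.
have rE : aact (ainv (amul (saff D i) x)) (lat_val a, 0) = aact (ainv x) r.
  by rewrite (ainvM sG xG) ainv_saff (aactM _ _ sG).
rewrite rE /PhiG actDr actZr (ex a) => /eqP; rewrite subr_eq addrC -subr_eq => /eqP <-.
have yE : yev x (XpG a) = (evG (aact (ainv x) (lat_val a, 0)))^-1.
  by rewrite -Xaff_B (yev_Xaff xG (Lam_lat a)).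
rewrite yE in E2; move: E2; set yr := (evG (aact _ r))^-1; set ya := (evG _)^-1.
move: (yev x g) (act (eps (gT i)) e) (star (kap i)) => yg te kk E2.
rewrite scalerDr addrAC -addrA; congr (_ + _); rewrite !scalerA -scalerBl; congr (_ *: _).
have -> : yg = (ya - yr) / (y - 1) by rewrite -E2 mulrC mulKf.
by field.
Qed.

Lemma ychar_P p x e : in_Pi D B p -> G x -> ychar x e ->
  ychar (amul p x) (act (eps (gP p)) e).
Proof.
move=> pP xG ex a; have pG := in_Pi_G pP; have vG := ainv_G pG.
pose r := aact (ainv p) (lat_val a, 0); have rL : Lam r := Lam_act vG (Lam_lat a).
have pr : aact p r = (lat_val a, 0) by rewrite /r (aactVK _ pG).
have := congr1 (fun k => act (eps k) e) (PXr pP rL).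
rewrite pr Xaff_B XHG_Xp !rmorphM !actM epsX (eps_XH _ ex) actZr (yev_Xaff xG rL) => <-.
by rewrite (ainvM pG xG) (aactM _ _ vG).
Qed.

Lemma eval_Phi i (y : K) f : evalG f = 1 -> evalG (PhiG i y f) = phiG i y.
Proof.
move=> f1; rewrite /PhiG eval_rhoD eval_rhoZ f1 (eps_T i).2 f1 !mulr1.
by rewrite /phiG star_thiG.
Qed.

(** T_i(1) = t_i^(1/2), so for dominant b the value Y_b(1) is the product of the t_i^(1/2) over a
    reduced word, which is q^(rho_k, b). Other weights are differences of dominant ones. *)
Lemma ychar1 : ychar aone 1.
Proof.
move=> a; rewrite -[in LHS](act1 1).
have dom (b : lat B) : dominant D (lat_val b) -> act (yelG b) 1 = (qsharpG (lat_val b) 0)^-1 *: 1.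
  move=> bd; have [p [w r]] := reduced_exists (tr_G (lat_mem b)).
  have T1 i : act (gT i) 1 = thiG i *: 1.
    have [_ _ E] := act_DL i; apply: (Xaroot_reg (i := i)).
    apply/eqP; rewrite -subr_eq0 -mulrBr; have := E 1; rewrite wact1 => ->.
    by rewrite subrr scaler0.
  have W1 w' : Tword (fun i => act (gT i)) w' 1 = (\prod_(i <- w') thiG i) *: 1.
    elim: w' => [|i w' IH]; first by rewrite big_nil scale1r.
    by rewrite /= IH actZr T1 scalerA big_cons mulrC.
  rewrite (yelG_dom bd) (telGE r) actM act_word W1 actZr.
  have [pP _ _] := r; rewrite (actP _ pP) wact1 -(rho_reduced bd r).
  by rewrite /qsharpG umin0 mul1mx dot0r pqp0 mul1r invrK.
have [c [cB cd acd]] := dominant_shift (lat_mem a).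
pose c' := toB B c; have c'E : lat_val c' = c by rewrite toBK.
have E1 := dom (a + c'); rewrite lat_valD c'E in E1; have {}E1 := E1 acd.
have E2 := dom c'; rewrite c'E in E2; have {}E2 := E2 cd.
have zB := rpred0 B; have aB := lat_mem a.
have qn (b : 'cV[R]_n) : b \in B -> qsharpG b 0 != 0.
  by move=> bB; rewrite qsharpG_ev// evG_neq0.
move: E1; rewrite yelGD actM E2 actZr act1.
have -> : qsharpG (lat_val a + c) 0 = qsharpG (lat_val a) 0 * qsharpG c 0.
  rewrite /qsharpG !dot0r pqp0 !mul1r mulmxDr (prhoD pd) ?invfM//; exact: (B_W (umin_W zB)).
move: (qsharpG c 0) (qn c cB) => qc qc0 /(congr1 (fun f => qc *: f)).
rewrite invfM !scalerA mulfV// scale1r mulrCA mulfV// mulr1 => ->.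
by rewrite (qsharpG_ev aB zB) piel0.
Qed.

(** The difference of the two sides has no X_d but the same eigenvalues; if nonzero, it would have
    the lowest weight d by [Y_spec]. *)
Lemma Y_coef (chi : lat B -> K) f f' (d : lat B) :
  (forall a : lat B, dominant D (lat_val a) -> act (yelG a) f = chi a *: f) ->
  (forall a : lat B, dominant D (lat_val a) -> act (yelG a) f' = chi a *: f') ->
  gcoef f' d != 0 ->
  (forall b : lat B, gcoef f' b != 0 -> b = d \/ wt_succ D (lat_val b) (lat_val d)) ->
  f = (gcoef f d / gcoef f' d) *: f'.
Proof.
move=> fx f'x d0 dmin; apply/eqP; rewrite -subr_eq0; apply/negPn/negP => g0.
have f'0 : f' != 0 by apply: contraNneq d0 => ->; rewrite gcoef0.
have [a ad|d2 [dn dchi _]] := Y_spec g0 (chi := chi).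
  by rewrite -scaleNr actDr actZr (fx a ad) (f'x a ad) scalerDr !scalerA mulrC.
have [d3 [d3n d3chi d3min]] := Y_spec f'0 f'x.
have E2 : d2 = d3.
  apply: lat_val_inj; apply: qsharpG_sep; try exact: lat_mem.
  move=> a aB ad; have ad' : dominant D (lat_val (toB B a)) by rewrite toBK.
  have := dchi _ ad'; rewrite (d3chi _ ad') toBK// => /invr_inj.
  by rewrite /qsharpG => e; exists (umin D (lat_val d2) *m a), (umin D (lat_val d3) *m a).
have E3 : d3 = d.
  have [->//|h1] := d3min _ d0; have [//|h2] := dmin _ d3n.
  by case: (wt_succ_irr (wt_succ_trans h1 h2)).
by move: dn; rewrite E2 E3 gcoefD gcoefN gcoefZ divfK// subrr eqxx.
Qed.

Lemma Y_unique (chi : lat B -> K) f f' :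
  (forall a : lat B, dominant D (lat_val a) -> act (yelG a) f = chi a *: f) ->
  (forall a : lat B, dominant D (lat_val a) -> act (yelG a) f' = chi a *: f') ->
  evalG f = 1 -> evalG f' = 1 -> f = f'.
Proof.
move=> fx f'x f1 f'1.
have f'0 : f' != 0.
  by apply/eqP => E; move: f'1; rewrite E eval_rho0 => /esym/eqP; rewrite oner_eq0.
have [d [dn _ dmin]] := Y_spec f'0 f'x.
have E := Y_coef fx f'x dn dmin; move: f1; rewrite {1}E eval_rhoZ f'1 mulr1 => e.
by rewrite E e scale1r.
Qed.

Lemma piel_lat x : G x -> (forall i, affpos D (aact x (al i, 0))) ->
  exists b : lat B, x = piel D (lat_val b).
Proof.
move=> xG xp; exists (toB B (x.1 *m x.2)).
by rewrite toBK; [exact: piel_unique|exact: B_W xG.1 xG.2].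
Qed.

(** Either s_i pi_b is again minimal in its coset or s_i pi_b = pi_b s_j. In the first case the root
    has nonzero level, which keeps the normalizing factor phi_i from vanishing. *)
Lemma saff_piel (b : lat B) i :
  (exists2 c : lat B, amul (saff D i) (piel D (lat_val b)) = piel D (lat_val c) &
     (aact (ainv (piel D (lat_val b))) (aroot D i)).2 != 0) \/
  exists j, aact (piel D (lat_val b)) (al j, 0) = aroot D i.
Proof.
have bB := lat_mem b; set x := piel D (lat_val b); have xG : G x := piel_G bB.
have [[j jE]|no] := pselect (exists j, aact x (al j, 0) = aroot D i); first by right; exists j.
left; have sG := saff_G i.
have [j|c cE] := piel_lat (amul_G sG xG).
  rewrite (aactM _ _ xG); apply: affpos_saff; first exact: piel_simple.
  by move=> E; apply: no; exists j.
exists c => //; set z := aact _ _; apply/eqP => z2.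
have [zr _] : affroot z := affroot_act (ainv_G xG) (aroot_affroot i).
have zE : z = (z.1, 0) by apply: affV_eq.
have xz : aact x z = aroot D i by rewrite (aactVK _ xG).
have zP : z.1 \in posroots D.
  case/orP: (root_signP zr) => // zn; have := piel_pos bB zn.
  have -> : (- z.1, 0) = - z :> affV by apply: affV_eq => //; rewrite -[RHS]/(- z.2) z2 oppr0.
  by rewrite -/x aactN xz => /affposN; case; rewrite opprK; exact: aroot_pos.
have := piel_pos (lat_mem c) zP; rewrite -zE -cE (aactM _ _ xG) xz saff_root.
exact: (affposN (aroot_pos i)).
Qed.

Lemma phiG_neq0 x i : G x -> (aact (ainv x) (aroot D i)).2 != 0 -> phiG i (yroot x i) != 0.
Proof.
move=> xG z2; have y1 := yroot_neq1 i xG; have t0 := thiG_neq0 i.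
have := pev_th pd (aroot D i).1 (affroot_act (ainv_G xG) (aroot_affroot i)) z2.
have -> : pth pd (aroot D i).1 = thiG i by rewrite -(thiG_act i aone_G) aact1.
rewrite -[qp _ / _]/(evG _); apply: contraNneq; move: y1; rewrite /yroot.
have := evG_neq0 (aact (ainv x) (aroot D i)); set z := evG _ => z0.
rewrite /phiG star_kap star_thiG /kap => y1.
have y1' : z^-1 - 1 != 0 by rewrite subr_eq0.
move: (thiG i) t0 => t t0 /(congr1 (fun u : K => u * (z^-1 - 1) * (z * t))).
rewrite !mul0r mulrDl divfK// => E; rewrite -subr_eq0; apply/eqP.
by rewrite -oppr0 -E; field; rewrite z0 t0.
Qed.

(** A nonzero image would have the eigenvalues attached to pi_b s_j. Their q-parts force its lowest
    weight to be b, and then the t-parts on u_b^-1(alpha_j) would give t_j^2 = 1. *)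
Lemma Phi_simple (b : lat B) i j e : aact (piel D (lat_val b)) (al j, 0) = aroot D i ->
  ychar (piel D (lat_val b)) e -> PhiG i (yroot (piel D (lat_val b)) i) e = 0.
Proof.
move=> jE ex; have bB := lat_mem b; set x := piel D (lat_val b) in jE ex *.
have xG : G x := piel_G bB; have sG := saff_G i; have vG := ainv_G xG.
have Px := ychar_Phi i xG ex; apply/eqP/negPn/negP => P0.
have [a _|d [_ dchi _]] := Y_spec P0
  (chi := fun a : lat B => (evG (aact (ainv (amul (saff D i) x)) (lat_val a, 0)))^-1); first exact: Px.
have [uW _ _] := umin_spec bB.
have sgG := saff_G (Some j).
have E a : a \in B -> dominant D a ->
    qp (dot a (lat_val b)) / rho (refl (al j) *m (umin D (lat_val b) *m a)) =
    qp (dot a (lat_val d)) / rho (umin D (lat_val d) *m a).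
  move=> aB ad; have ad' : dominant D (lat_val (toB B a)) by rewrite toBK.
  have := dchi _ ad'; rewrite toBK// => /invr_inj; rewrite /qsharpG => <-.
  have -> : aact (ainv (amul (saff D i) x)) (a, 0) = aact (saff D (Some j)) (aact (ainv x) (a, 0)).
    rewrite (saff_conj xG (jE : aact x (aroot D (Some j)) = _)).
    by rewrite (ainvM xG sgG) ainv_saff (aactM _ _ vG).
  have [_ uE _] := umin_spec bB.
  rewrite /evG /x pielE// /= invmxK dot0r subr0 dotNr opprK -uE (W_mulK _ uW) add0r.
  by [].
have bd : lat_val b = lat_val d.
  apply: qsharpG_sep => // [|a aB ad]; first exact: lat_mem.
  by exists (refl (al j) *m (umin D (lat_val b) *m a)), (umin D (lat_val d) *m a); exact: E.
(* On this weight the two t-parts are q^(rho_k, alpha_j) and its inverse. It need not be dominant,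
   so it is reached as a difference of dominant weights. *)
pose a0 := invmx (umin D (lat_val b)) *m al j.
have alB : al j \in B by exact/root_in_B/simple_root.
have a0B : a0 \in B by exact: B_W (in_W_inv uW) alB.
have [c [cB cd acd]] := dominant_shift a0B.
have E' a : a \in B -> dominant D a -> rho (refl (al j) *m (umin D (lat_val b) *m a)) =
    rho (umin D (lat_val b) *m a).
  move=> aB ad; have := E a aB ad; rewrite -bd => /(mulfI (pqp_neq0 pd _)); exact: invr_inj.
have rW : in_W D (refl (al j)) by apply: in_W_refl; exact: simple_root.
have ucB : umin D (lat_val b) *m c \in B by exact: B_W uW cB.
have := E' _ (rpredD a0B cB) acd; rewrite !mulmxDr (W_mulVK _ uW).
rewrite !(prhoD pd)//; try exact: (B_W rW).
rewrite (E' c cB cd) => /(mulIf (prho_neq0 pd _)).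
rewrite refl_self ?simple_neq0// (prhoN pd alB) prho_simple => h.
have := pth_order pd (al j); rewrite (exprM _ 2 2) (expr2 (pth pd (al j) ^+ 2)) -{1}h mulVf ?eqxx//.
by rewrite expf_neq0// pth_neq0.
Qed.

Section Words.
Variable E : seq (@aidx n) -> KX -> Prop.
Hypothesis Enil : E [::] 1.
Hypothesis Econs : forall i w f (y : K), E w f -> f != 0 ->
  act (eps (XHG (XaffG (aroot D i)))) f = y *: f -> y != 1 -> phiG i y != 0 ->
  E (i :: w) ((phiG i y)^-1 *: PhiG i y f).

(** The suffixes of the word are again minimal coset representatives, so no step meets a vanishing
    phi_i. [E] is any relation recording the steps: [epsG] in the end, and the trivial one for bare
    existence. *)
Lemma intertwiner_word w : rw w -> (forall j, affpos D (aact (wel w) (al j, 0))) ->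
  exists f, [/\ E w f, ychar (wel w) f & evalG f = 1].
Proof.
elim: w => [_ _|i w IH /rw_cons[rww zP] pos].
  by exists 1; split=> //; [exact: ychar1|exact: eval_rho1].
have wG := wel_G w; have xG := saff_G i.
have pos' j : affpos D (aact (wel w) (al j, 0)).
  have jL : affroot (aact (wel w) (al j, 0)) by exact: (affroot_act wG (aroot_affroot (Some j))).
  case: (affroot_sign jL) => // np; have := pos j; rewrite (aactM _ _ wG) => p1.
  case: (pselect (- aact (wel w) (al j, 0) = aroot D i)) => [E1|ne].
    have := zP; rewrite -E1 aactN (aactK _ wG) => h.
    by case: (affposN (aroot_pos (Some j)) h).
  by have := affpos_saff np ne; rewrite aactN => /(affposN p1).
have [f [fE fx f1]] := IH rww pos'.
have [b bE] := piel_lat wG pos'.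
have f0 : f != 0 by apply/eqP => f0; move: f1; rewrite f0 eval_rho0 => /esym/eqP; rewrite oner_eq0.
case: (saff_piel b i) => [[c cE z2]|[j jE]]; last first.
  have := pos j; rewrite (aactM _ _ wG) bE jE saff_root.
  by move=> /(affposN (aroot_pos i)).
rewrite -bE in z2; have p0 := phiG_neq0 wG z2.
exists ((phiG i (yroot (wel w) i))^-1 *: PhiG i (yroot (wel w) i) f); split.
- apply: Econs => //; last exact: yroot_neq1.
  by rewrite (eps_XH _ fx) (yev_Xaff wG (Lam_aroot i)).
- by move=> a; rewrite actZr (ychar_Phi i wG fx) !scalerA mulrC.
by rewrite eval_rhoZ (eval_Phi _ _ f1) mulVf.
Qed.

Lemma intertwiner_exists (b : lat B) p w : reduced D B (piel D (lat_val b)) p w ->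
  exists f, [/\ E w f, ychar (piel D (lat_val b)) (act (eps (gP p)) f) &
    evalG (act (eps (gP p)) f) = 1].
Proof.
move=> r; have [pP xE _] := r; have rww := reduced_rw r; have wG := wel_G w.
rewrite awordE in xE; have pG := in_Pi_G pP.
have [j|f [fE fx f1]] := intertwiner_word rww.
  have := Pi_pos (Pi_inv pP) (piel_simple j (lat_mem b)).
  by rewrite xE (aactM _ _ wG) (aactK _ pG).
exists f; split=> //; first by rewrite xE; exact: ychar_P.
by rewrite (eps_P pP).2.
Qed.

End Words.

Lemma ybasis_exists (b : lat B) : exists f, evalG f = 1 /\ ychar (piel D (lat_val b)) f.
Proof.
have [p [w r]] := reduced_exists (piel_G (lat_mem b)).
have [//|//|f [_ fx f1]] := @intertwiner_exists (fun _ _ => True) _ _ b p w r.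
by exists (act (eps (gP p)) f).
Qed.

(** * The inner product *)

Variable L : KX -> K.
Hypothesis LD : forall f f', L (f + f') = L f + L f'.
Hypothesis LZ : forall c f, L (c *: f) = c * L f.
Hypothesis L1 : L 1 = 1.
Hypothesis LT : forall i f, L (act (gT i) f) = thiG i * L f.
Hypothesis LP : forall p f, in_Pi D B p -> L (wactG p f) = L f.

Definition pairG f f' : K := L (f * starG f').

Lemma pairDl f f'' f' : pairG (f + f'') f' = pairG f f' + pairG f'' f'.
Proof. by rewrite /pairG mulrDl LD. Qed.

Lemma pairZl c f f' : pairG (c *: f) f' = c * pairG f f'.
Proof. by rewrite /pairG -scalerAl LZ. Qed.

Lemma pairDr f f' f'' : pairG f (f' + f'') = pairG f f' + pairG f f''.
Proof. by rewrite /pairG starXD mulrDr LD. Qed.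

Lemma pairZr c f f' : pairG f (c *: f') = star c * pairG f f'.
Proof. by rewrite /pairG starXZ -scalerAr LZ. Qed.

Lemma pair0l f : pairG 0 f = 0.
Proof. by rewrite -(scale0r (0 : KX)) pairZl mul0r. Qed.

Lemma pair0r f : pairG f 0 = 0.
Proof. by rewrite -(scale0r (0 : KX)) pairZr rmorph0 mul0r. Qed.

Lemma pairBl f f'' f' : pairG (f - f'') f' = pairG f f' - pairG f'' f'.
Proof. by rewrite pairDl -scaleN1r pairZl mulN1r. Qed.

Lemma pairBr f f' f'' : pairG f (f' - f'') = pairG f f' - pairG f f''.
Proof. by rewrite pairDr -scaleN1r pairZr rmorphN1 mulN1r. Qed.

Lemma pair_suml I (s : seq I) (F : I -> KX) f :
  pairG (\sum_(i <- s) F i) f = \sum_(i <- s) pairG (F i) f.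
Proof. by apply: (big_morph (pairG^~ f)) => [g g'|]; rewrite ?pairDl ?pair0l. Qed.

Lemma pair_sumr I (s : seq I) (F : I -> KX) f :
  pairG f (\sum_(i <- s) F i) = \sum_(i <- s) pairG f (F i).
Proof. by apply: (big_morph (pairG f)) => [g g'|]; rewrite ?pairDr ?pair0r. Qed.

Lemma DL_bilinear_algebra (x sf f sh g tf tg tu : KX) (t k : K) :
  (x - 1) * (tf - t *: sf) = k *: (sf - f) -> (x - 1) * (tg - t *: sh) = k *: (sh - g) ->
  (x - 1) * (tu - t *: (sf * g)) = k *: (sf * g - f * sh) ->
  (x - 1) * (tf * g) = (x - 1) * (f * tg + (tu - t *: (f * sh))).
Proof.
have Z c (y : KX) : c *: y = c%:A * y by rewrite mulr_algl.
rewrite (Z t sf) (Z t sh) (Z t (sf * g)) (Z t (f * sh)) (Z _ (sf - f)) (Z _ (sh - g)).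
rewrite (Z _ (sf * g - f * sh)); move: (t%:A) (k%:A) => p q E1 E2 E3.
apply/eqP; rewrite -subr_eq0; apply/eqP.
transitivity (((x - 1) * (tf - p * sf) - q * (sf - f)) * g -
  f * ((x - 1) * (tg - p * sh) - q * (sh - g)) -
  ((x - 1) * (tu - p * (sf * g)) - q * (sf * g - f * sh))); first by ring.
by rewrite E1 E2 E3 !subrr mulr0 mul0r !subr0.
Qed.

(** T_i(f) f' - f T_i(f') is T_i - t_i^(1/2) applied to f s_i(f'), which [L] kills. *)
Lemma L_T_selfadj i f f' : L (act (gT i) f * f') = L (f * act (gT i) f').
Proof.
have sG := saff_G i.
suff -> : act (gT i) f * f' = f * act (gT i) f' +
    (act (gT i) (f * wactG (saff D i) f') - thiG i *: (f * wactG (saff D i) f')).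
  by rewrite !LD -scaleN1r !LZ LT mulN1r subrr addr0.
apply: (Xaroot_reg (i := i)).
apply: (DL_bilinear_algebra (actT i f) (actT i f')).
by have := actT i (f * wactG (saff D i) f'); rewrite (wactM _ _ sG) wact_saffK.
Qed.

Definition adj (h k : H) : Prop := forall f f', pairG (act h f) f' = pairG f (act k f').

Lemma adjM (h h' k k' : H) : adj h k -> adj h' k' -> adj (h * h') (k' * k).
Proof. by move=> a1 a2 f f'; rewrite !actM a1 a2. Qed.

Lemma adj1 : adj 1 1. Proof. by move=> f f'; rewrite !act1. Qed.

Lemma adj_sym (h k : H) : adj h k -> h * k = 1 -> k * h = 1 -> adj k h.
Proof.
move=> a hk kh f f'; rewrite -[in RHS](act1 f) -hk actM a -actM kh act1.
by [].
Qed.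

Lemma adj_T i : adj (gT i) (Tinv i).
Proof.
move=> f f'; rewrite /pairG L_T_selfadj; congr (L (f * _)).
have [e1 e2] := TTinv i.
have := DL_inv (act (Tinv i) f') (act_DL i); rewrite -actM e1 act1 => ->.
have -> : forall g : KX, act (gT i) g - kap i *: g = act (Tinv i) g by move=> g; rewrite act_Tinv.
by rewrite -actM e1 act1.
Qed.

Lemma adj_V i : adj (Tinv i) (gT i).
Proof. by have [e1 e2] := TTinv i; exact: adj_sym (adj_T i) e1 e2. Qed.

Lemma adj_X (b : lat B) : adj (gX b) (gX (- b)).
Proof.
move=> f f'; rewrite /pairG !actX starXM.
have -> : starG (XpG (- b)) = XpG b by rewrite -[gM KX (- b)]scale1r starXU rmorph1 scale1r opprK.
by rewrite mulrCA mulrA.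
Qed.

Lemma adj_P p : in_Pi D B p -> adj (gP p) (gP (ainv p)).
Proof.
move=> pP f f'; have pG := in_Pi_G pP; have vP := Pi_inv pP; have vG := in_Pi_G vP.
rewrite /pairG (actP _ pP) (actP _ vP) (starX_wactG _ vG) -[RHS](LP _ pP).
by rewrite (wactM _ _ pG) -(wact_amul _ pG vG) (amulxV pG) wact_aone.
Qed.

Lemma adj_U (h k : H) : Ugrp h k -> adj h k.
Proof.
elim=> [b|j|j|h1 h2 k1 k2 _ a1 _ a2]; [exact: adj_X|exact: adj_T|exact: adj_V|].
exact: adjM.
Qed.

Lemma adj_word w : adj (\prod_(i <- w) gT i) (\prod_(i <- rev w) Tinv i).
Proof.
elim: w => [|i w IH]; first by rewrite !big_nil; exact: adj1.
by rewrite rev_cons -cats1 big_cat big_cons big_seq1; exact: adjM (adj_T i) IH.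
Qed.

Lemma telVE x p w : reduced D B x p w -> telV x = (\prod_(i <- rev w) Tinv i) * gP (ainv p).
Proof.
move=> r; have [a1 a2] := prod_word_inv w.
have [b1 b2] : gP p * gP (ainv p) = 1 /\ gP (ainv p) * gP p = 1.
  by case: r => pP _ _; exact: gP_inv.
rewrite /telV (telGE r); apply: hinvGE.
  by rewrite -mulrA (mulrA (gP (ainv p))) b2 mul1r.
by rewrite -mulrA (mulrA (\prod_(i <- w) _)) a1 mul1r.
Qed.

Lemma adj_tel x : G x -> adj (telG x) (telV x).
Proof.
move=> /reduced_exists[p [w r]]; rewrite (telGE r) (telVE r).
by case: r => pP _ _; exact: adjM (adj_P pP) (adj_word w).
Qed.

Lemma yelG_inv (a : lat B) : yelG a * yelG (- a) = 1.
Proof. by rewrite -yelGD subrr yelG0. Qed.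

Lemma yelGN_dom (a : lat B) : dominant D (lat_val a) -> yelG (- a) = telV (tr (lat_val a)).
Proof.
move=> ad; have [e1 e2] := telG_inv (tr_G (lat_mem a)).
apply/esym/(inv_unique e2); rewrite -(yelG_dom ad); exact: yelG_inv.
Qed.

Lemma adj_Y (a : lat B) : adj (yelG a) (yelG (- a)).
Proof.
have dom (b : lat B) : dominant D (lat_val b) -> adj (yelG b) (yelG (- b)).
  by move=> bd; rewrite (yelG_dom bd) (yelGN_dom bd); exact: adj_tel (tr_G (lat_mem b)).
have [c [cB cd acd]] := dominant_shift (lat_mem a); pose c' := toB B c.
have c'E : lat_val c' = c by rewrite toBK.
have E1 : yelG a = yelG (a + c') * yelG (- c') by rewrite -yelGD addrK.
have E2 : yelG (- a) = yelG c' * yelG (- (a + c')).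
  by rewrite -yelGD opprD addrCA subrr addr0.
rewrite E1 E2; apply: adjM; first by apply: dom; rewrite lat_valD c'E.
have e := yelG_inv c'; have e' := yelG_inv (- c'); rewrite opprK in e'.
by apply: adj_sym e e'; apply: dom; rewrite c'E.
Qed.

Variable ebas : lat B -> KX.
Hypothesis ebasP : forall b : lat B, evalG (ebas b) = 1 /\ ychar (piel D (lat_val b)) (ebas b).

Lemma ychar_ebas (b : lat B) f : ychar (piel D (lat_val b)) f -> evalG f = 1 -> f = ebas b.
Proof.
have [e1 ex] := ebasP b; move=> fx f1.
pose chi (a : lat B) := (evG (aact (ainv (piel D (lat_val b))) (lat_val a, 0)))^-1.
exact: (Y_unique (chi := chi) (fun (a : lat B) _ => fx a) (fun (a : lat B) _ => ex a) f1 e1).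
Qed.

Lemma Y_ebas (a b : lat B) :
  act (yelG a) (ebas b) = (qsharpG (lat_val a) (lat_val b))^-1 *: ebas b.
Proof. by rewrite (ebasP b).2 (qsharpG_ev (lat_mem a) (lat_mem b)). Qed.

Lemma qsharpG_neq0 (a b : lat B) : qsharpG (lat_val a) (lat_val b) != 0.
Proof. by rewrite (qsharpG_ev (lat_mem a) (lat_mem b)) evG_neq0. Qed.

Lemma star_qsharpG (a b : lat B) :
  star (qsharpG (lat_val a) (lat_val b)) = (qsharpG (lat_val a) (lat_val b))^-1.
Proof. by rewrite (qsharpG_ev (lat_mem a) (lat_mem b)) star_evG. Qed.

Lemma qsharpGN (a b : lat B) :
  qsharpG (lat_val (- a)) (lat_val b) = (qsharpG (lat_val a) (lat_val b))^-1.
Proof.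
have vG := ainv_G (piel_G (lat_mem b)); rewrite !qsharpG_ev ?lat_mem//.
rewrite -(evGN (Lam_act vG (Lam_lat a))) -aactN; congr (evG (aact _ _)).
by apply: affV_eq; rewrite /= ?oppr0 ?lat_valN.
Qed.

(** The Y_a are unitary, starring inverts their eigenvalues, and the eigenvalues at b and c
    differ. *)
Lemma ebas_orth (b c : lat B) : b != c -> pairG (ebas b) (ebas c) = 0.
Proof.
move=> bc; apply/eqP/negPn/negP => p0; case/eqP: bc; apply: lat_val_inj.
apply: qsharpG_sep; try exact: lat_mem.
move=> a aB _; pose a' := toB B a; have a'E : lat_val a' = a by rewrite toBK.
have := adj_Y a' (ebas b) (ebas c); rewrite !Y_ebas pairZl pairZr => /(mulIf p0).
rewrite qsharpGN invrK star_qsharpG a'E => /invr_inj.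
by rewrite /qsharpG => e; exists (umin D (lat_val b) *m a), (umin D (lat_val c) *m a).
Qed.

(** The suffixes of a reduced word of pi_b lie in pi_B again, so a statement about b can be carried
    along simple reflections and a final element of Pi. *)
Lemma piel_ind (Q : lat B -> Prop) :
  (forall b : lat B, piel D (lat_val b) = aone -> Q b) ->
  (forall i (b c : lat B), amul (saff D i) (piel D (lat_val b)) = piel D (lat_val c) ->
    affpos D (aact (ainv (piel D (lat_val b))) (aroot D i)) ->
    (aact (ainv (piel D (lat_val b))) (aroot D i)).2 != 0 -> Q b -> Q c) ->
  (forall p (b c : lat B), in_Pi D B p -> amul p (piel D (lat_val b)) = piel D (lat_val c) ->
    Q b -> Q c) -> forall b : lat B, Q b.
Proof.
move=> Q1 QT QP.
have Hw w : rw w -> (forall j, affpos D (aact (wel w) (al j, 0))) ->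
    forall b : lat B, piel D (lat_val b) = wel w -> Q b.
  elim: w => [_ _ b|i w IH /rw_cons[rww zP] pos c cE]; first exact: Q1.
  have wG := wel_G w.
  have pos' j : affpos D (aact (wel w) (al j, 0)).
    have jL : affroot (aact (wel w) (al j, 0)) by exact: (affroot_act wG (aroot_affroot (Some j))).
    case: (affroot_sign jL) => // np; have := pos j; rewrite (aactM _ _ wG) => p1.
    case: (pselect (- aact (wel w) (al j, 0) = aroot D i)) => [E1|ne].
      have := zP; rewrite -E1 aactN (aactK _ wG) => hn.
      by case: (affposN (aroot_pos (Some j)) hn).
    by have := affpos_saff np ne; rewrite aactN => /(affposN p1).
  have [b bE] := piel_lat wG pos'.
  have Qb := IH rww pos' b (esym bE); rewrite bE in zP.
  apply: (QT i b c _ zP _ Qb); first by rewrite -bE cE.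
  case: (saff_piel b i) => [[c' _ //]|[j jE]].
  have := pos j; rewrite (aactM _ _ wG) bE jE saff_root.
  by move=> /(affposN (aroot_pos i)).
move=> b; have [p [w r]] := reduced_exists (piel_G (lat_mem b)).
have [pP xE _] := r; have rww := reduced_rw r; have wG := wel_G w.
rewrite awordE in xE; have pG := in_Pi_G pP.
have pos j : affpos D (aact (wel w) (al j, 0)).
  have := Pi_pos (Pi_inv pP) (piel_simple j (lat_mem b)).
  by rewrite xE (aactM _ _ wG) (aactK _ pG).
have [c cE] := piel_lat wG pos.
by apply: (QP p c b pP); [rewrite -cE xE|apply: (Hw w rww pos); rewrite cE].
Qed.

Lemma Pi_piel p (b : lat B) : in_Pi D B p ->
  exists c : lat B, amul p (piel D (lat_val b)) = piel D (lat_val c).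
Proof.
move=> pP; have pG := in_Pi_G pP; have bG := piel_G (lat_mem b).
apply: piel_lat; first exact: amul_G.
by move=> j; rewrite (aactM _ _ bG); exact: Pi_pos pP (piel_simple j (lat_mem b)).
Qed.

Lemma epsP_ebas p (b c : lat B) : in_Pi D B p ->
  amul p (piel D (lat_val b)) = piel D (lat_val c) -> act (eps (gP p)) (ebas b) = ebas c.
Proof.
move=> pP E; have [e1 ex] := ebasP b; apply: ychar_ebas; last by rewrite (eps_P pP).2.
by rewrite -E; exact: ychar_P pP (piel_G (lat_mem b)) ex.
Qed.

Lemma Phi_ebas i (b c : lat B) : let x := piel D (lat_val b) in
  amul (saff D i) x = piel D (lat_val c) -> (aact (ainv x) (aroot D i)).2 != 0 ->
  PhiG i (yroot x i) (ebas b) = phiG i (yroot x i) *: ebas c.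
Proof.
move=> x E z2; have [e1 ex] := ebasP b; have xG : G x := piel_G (lat_mem b).
have p0 := phiG_neq0 xG z2.
rewrite -(@ychar_ebas c ((phiG i (yroot x i))^-1 *: PhiG i (yroot x i) (ebas b))).
- by rewrite scalerA mulfV// scale1r.
- by rewrite -E => a; rewrite actZr (ychar_Phi i xG ex) !scalerA mulrC.
by rewrite eval_rhoZ (eval_Phi _ _ e1) mulVf.
Qed.

Lemma epsT_ebas i (b : lat B) : let y := yroot (piel D (lat_val b)) i in
  act (eps (gT i)) (ebas b) = PhiG i y (ebas b) - (star (kap i) * (y - 1)^-1) *: ebas b.
Proof. by move=> y; rewrite /PhiG addrK. Qed.

(** * The eigenvectors span *)

Definition in_span f : Prop := exists (s : seq (lat B)) (d : lat B -> K),
  f = \sum_(b <- s) d b *: ebas b.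

Lemma in_spanP f : in_span f -> exists s : seq (lat B), exists2 d : lat B -> K,
  uniq s & f = \sum_(b <- s) d b *: ebas b.
Proof.
move=> [s [d ->]]; exists (undup s), (fun b : lat B => d b *+ count_mem b s); first exact: undup_uniq.
rewrite -[LHS]big_undup_iterop_count; apply: eq_bigr => b _; exact: scalerMnl.
Qed.

Lemma in_spanD f f' : in_span f -> in_span f' -> in_span (f + f').
Proof.
move=> [s [d ->]] [s' [d' ->]].
exists (undup (s ++ s')), (fun b : lat B => d b *+ count_mem b s + d' b *+ count_mem b s').
have W (t t' : seq (lat B)) (k : lat B -> K) : {subset t <= t'} -> 
    \sum_(b <- t) k b *: ebas b = \sum_(b <- undup t') (k b *+ count_mem b t) *: ebas b.
  move=> tt'; rewrite -[LHS]big_undup_iterop_count.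
  transitivity (\sum_(b <- undup t) (k b *+ count_mem b t) *: ebas b).
    by apply: eq_bigr => b _; exact: scalerMnl.
  have p : perm_eq (undup t) [seq b : lat B <- undup t' | b \in t].
    apply: uniq_perm; rewrite ?filter_uniq ?undup_uniq// => b.
    by rewrite mem_filter !mem_undup; case: (boolP (b \in t)) => // /tt' ->.
  rewrite (perm_big _ p) big_filter [RHS](bigID (fun b : lat B => b \in t)) /=.
  rewrite [X in _ = _ + X]big1 ?addr0// => b /count_memPn ->.
  by rewrite mulr0n scale0r.
rewrite (W s (s ++ s')); last by move=> b bs; rewrite mem_cat bs.
rewrite (W s' (s ++ s')); last by move=> b bs; rewrite mem_cat bs orbT.
by rewrite -big_split; apply: eq_bigr => b _; rewrite scalerDl.
Qed.

Lemma in_span_ebas (b : lat B) : in_span (ebas b).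
Proof. by exists [:: b], (fun=> 1); rewrite big_seq1 scale1r. Qed.

Lemma in_spanZ c f : in_span f -> in_span (c *: f).
Proof.
move=> [s [d ->]]; exists s, (fun b : lat B => c * d b).
by rewrite scaler_sumr; apply: eq_bigr => b _; rewrite scalerA.
Qed.

Lemma in_span0 : in_span 0.
Proof. by exists [::], (fun=> 0); rewrite big_nil. Qed.

Lemma in_span_sum I (s : seq I) (F : I -> KX) :
  (forall i, in_span (F i)) -> in_span (\sum_(i <- s) F i).
Proof. by move=> SF; elim/big_ind: _ => //; [exact: in_span0|exact: in_spanD]. Qed.

Definition span_stable (k : H) : Prop := forall f, in_span f -> in_span (act (eps k) f).

Lemma span_stable_ebas (k : H) : (forall b : lat B, in_span (act (eps k) (ebas b))) -> span_stable k.
Proof.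
move=> kS f [s [d ->]]; rewrite (big_morph _ (actDr _) (act0r _)).
by apply: in_span_sum => b; rewrite actZr; exact/in_spanZ/kS.
Qed.

Lemma span_stableM (k k' : H) : span_stable k -> span_stable k' -> span_stable (k * k').
Proof. by move=> S S' f /S'/S; rewrite rmorphM actM. Qed.

Lemma span_stable_T i : span_stable (gT i).
Proof.
apply: span_stable_ebas => b; rewrite epsT_ebas; apply: in_spanD; last first.
  by rewrite -scaleNr; exact/in_spanZ/in_span_ebas.
case: (saff_piel b i) => [[c cE z2]|[j jE]].
  by rewrite (Phi_ebas cE z2); exact/in_spanZ/in_span_ebas.
by rewrite (Phi_simple jE (ebasP b).2); exact: in_span0.
Qed.

Lemma span_stable_V i : span_stable (Tinv i).
Proof.
move=> f fS; rewrite /Tinv rmorphB epsZ rmorph1 actBl actZl act1.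
by apply: in_spanD; [exact: span_stable_T|rewrite -scaleNr; exact: in_spanZ].
Qed.

Lemma span_stable_P p : in_Pi D B p -> span_stable (gP p).
Proof.
move=> pP; apply: span_stable_ebas => b; have [c cE] := Pi_piel b pP.
by rewrite (epsP_ebas pP cE); exact: in_span_ebas.
Qed.

Lemma span_stable1 : span_stable 1.
Proof. by move=> f fS; rewrite rmorph1 act1. Qed.

Lemma span_stable_tel x : G x -> span_stable (telG x) /\ span_stable (telV x).
Proof.
move=> /reduced_exists[p [w r]]; rewrite (telGE r) (telVE r).
have [pP _ _] := r; split; apply: span_stableM; try exact: span_stable_P.
- by elim: w {r} => [|i w IH]; rewrite ?big_nil ?big_cons; [exact: span_stable1|apply: span_stableM; [exact: span_stable_T|]].
- by elim: (rev w) => [|i v IH]; rewrite ?big_nil ?big_cons; [exact: span_stable1|apply: span_stableM; [exact: span_stable_V|]].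
exact/span_stable_P/Pi_inv.
Qed.

Lemma ebas1 (b : lat B) : piel D (lat_val b) = aone -> ebas b = 1.
Proof. by move=> bE; apply/esym/ychar_ebas; [rewrite bE; exact: ychar1|exact: eval_rho1]. Qed.

(** X_a = eps(Y_a), and Y_a is T_x times an inverse T_y; the images of these under eps preserve the
    span. It contains 1, hence also X_a applied to 1. *)
Lemma in_span_all f : in_span f.
Proof.
rewrite [f]gexpand; apply: in_span_sum => a; apply: in_spanZ.
have S0 : in_span 1.
  by rewrite -(@ebas1 0) ?lat_val0; [exact: in_span_ebas|exact: piel0].
have [c [cB cd acd]] := dominant_shift (lat_mem a); pose c' := toB B c.
have c'E : lat_val c' = c by rewrite toBK.
have [_ Sc] := span_stable_tel (tr_G (lat_mem c')).
have [Sac _] := span_stable_tel (tr_G (lat_mem (a + c'))).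
have := Sac _ (Sc _ S0).
rewrite -yelGN_dom ?c'E// -yelG_dom ?lat_valD ?c'E// !epsY -actM -XDH addrK actX mulr1.
by [].
Qed.

(** * Norms and the functional representation *)

Definition Psi f (b : lat B) : K := pairG (ebas b) f.
Definition nrm (b : lat B) : K := pairG (ebas b) (ebas b).

Lemma Psi_ebas (b c : lat B) : Psi (ebas c) b = nrm b *+ (b == c).
Proof. by rewrite /Psi /nrm; case: eqVneq => [->//|/ebas_orth]. Qed.

Definition mubF (z : @affV R n) : K := let a := - z.1 in let y := rho a * qp z.2 in
  ((pth pd a)^-1 - pth pd a * y) / (pth pd a - (pth pd a)^-1 * y).
Definition mubG x : K := \prod_(z <- fset_set (lambda D x)) mubF z.

Lemma mub_lin_neq0 x i : G x -> (aact (ainv x) (aroot D i)).2 != 0 ->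
  (thiG i * yroot x i - (thiG i)^-1 != 0) /\ ((thiG i)^-1 * yroot x i - thiG i != 0).
Proof.
move=> xG z2; have t0 := thiG_neq0 i; have zr := affroot_act (ainv_G xG) (aroot_affroot i).
have tE : pth pd (aroot D i).1 = thiG i by rewrite -(thiG_act i aone_G) aact1.
have h1 := pev_th pd (aroot D i).1 zr z2.
have z2' : (- aact (ainv x) (aroot D i)).2 != 0 by rewrite oppr_eq0.
have h2 := pev_th pd (aroot D i).1 (affrootN zr) z2'.
rewrite -[qp _ / _]/(evG (- aact (ainv x) (aroot D i))) in h2.
rewrite -[qp _ / _]/(evG _) in h1; rewrite tE in h1 h2.
rewrite (evGN (Lam_affroot zr)) in h2; have z0 := evG_neq0 (aact (ainv x) (aroot D i)).
rewrite /yroot; move: (evG _) (thiG i) z0 t0 h1 h2 => e t e0 t0 h1 h2; split.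
  apply: contraNneq h2 => E; apply/eqP.
  have -> : e^-1 * t ^+ 2 = (t * e^-1 - t^-1) * t + 1 by field; rewrite t0 e0.
  by rewrite E mul0r add0r.
apply: contraNneq h1 => E; apply/eqP; apply/esym/eqP; rewrite -subr_eq0; apply/eqP.
have -> : 1 - e * t ^+ 2 = (t^-1 * e^-1 - t) * (t * e) by field; rewrite t0 e0.
by rewrite E mul0r.
Qed.

(** Compute the product of eps(T_i)(E_b) with E_c in two ways, the second time moving eps(T_i) to
    its inverse on E_c. By orthogonality each side reduces to one norm. *)
Lemma nrm_step i (b c : lat B) : amul (saff D i) (piel D (lat_val b)) = piel D (lat_val c) ->
  (aact (ainv (piel D (lat_val b))) (aroot D i)).2 != 0 ->
  let y := yroot (piel D (lat_val b)) i in
  nrm c * ((thiG i)^-1 * y - thiG i) = nrm b * (thiG i * y - (thiG i)^-1).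
Proof.
set x := piel D (lat_val b) => cE z2 y; have xG : G x := piel_G (lat_mem b).
have sG := saff_G i.
have bc : b != c.
  apply/eqP => bc; have := cE; rewrite -bc -/x => E.
  have := congr1 (fun u : affW => aact u (aact (ainv x) (aroot D i))) E.
  rewrite (aactM _ _ xG) (aactVK _ xG) saff_root => E2.
  have := aroot_pos i; rewrite -E2 => h; exact: (affposN (aroot_pos i) h).
have zE : aact (ainv (piel D (lat_val c))) (aroot D i) = - aact (ainv x) (aroot D i).
  by rewrite -cE (ainvM sG xG) ainv_saff (aactM _ _ sG) saff_root aactN.
have y1 := yroot_neq1 i xG; have yc : yroot (piel D (lat_val c)) i = y^-1.
  have zL : Lam (aact (ainv x) (aroot D i)) by exact: Lam_act (ainv_G xG) (Lam_aroot i).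
  by rewrite /yroot zE (evGN zL).
have E1 := Phi_ebas cE z2; have E2 := epsT_ebas i b; have E4 := epsT_ebas i c.
have cE' : amul (saff D i) (piel D (lat_val c)) = piel D (lat_val b).
  by rewrite -cE (saff_mulK i xG).
have z2' : (aact (ainv (piel D (lat_val c))) (aroot D i)).2 != 0.
  by rewrite zE oppr_eq0.
have E3 := Phi_ebas cE' z2'.
have [[k Uk] _] := eps_T i; have [k1 k2] := Ugrp_inv Uk.
have [e1 e2] := TTinv i.
have kE : k = eps (Tinv i) by apply: (inv_unique k2); rewrite -rmorphM e1 rmorph1.
have A := adj_U Uk (ebas b) (ebas c).
move: A; rewrite kE /Tinv rmorphB epsZ rmorph1 actBl actZl act1.
rewrite E2 E4 E1 E3 -/x -/y yc.
have B1 (u v : K) : pairG (u *: ebas c - v *: ebas b) (ebas c) = u * nrm c.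
  by rewrite pairBl (pairZl u) (pairZl v) (ebas_orth bc) mulr0 subr0.
have B2 (u v v' : K) : pairG (ebas b) (u *: ebas b - v *: ebas c - v' *: ebas c) =
    star u * nrm b.
  by rewrite !pairBr (pairZr u) (pairZr v) (pairZr v') (ebas_orth bc) !mulr0 !subr0.
rewrite B1 B2.
have sy : star y = y^-1 by rewrite /y /yroot fmorphV /= star_evG invrK.
have -> : star (phiG i y^-1) = thiG i + kap i * (y - 1)^-1.
  by rewrite /phiG rmorphD rmorphM /= !pstarK fmorphV /= rmorphB rmorph1 fmorphV /= sy invrK.
have -> : phiG i y = (thiG i)^-1 + - kap i * (y - 1)^-1 by rewrite /phiG star_thiG star_kap.
have y0 : y != 0 by rewrite invr_eq0 evG_neq0.
have t0 := thiG_neq0 i; have y1' : y - 1 != 0 by rewrite subr_eq0.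
rewrite /kap; move: (thiG i) (nrm b) (nrm c) t0 => t Nb Nc t0.
move: y y0 y1' {y1 E1 E2 E3 E4 yc sy B1 B2} => y y0 y1' E.
transitivity ((t^-1 + - (t - t^-1) * (y - 1)^-1) * Nc * (y - 1)).
  by field; rewrite t0 y1'.
by rewrite E; field; rewrite t0 y1'.
Qed.

(** Each simple reflection adds one root to lambda, hence one factor of mu_bullet, and [nrm_step]
    gives the inverse ratio of norms. Elements of Pi change neither. *)
Lemma nrm_mub (b : lat B) : nrm b * mubG (piel D (lat_val b)) = 1.
Proof.
move: b; apply: piel_ind => [b bE|i b c cE zP z2 IH|p b c pP cE IH].
- rewrite bE /nrm (ebas1 bE) /pairG starX1 mulr1 L1 mul1r.
  rewrite /mubG (_ : lambda D aone = classical_sets.set0) ?fset_set0 ?big_seq_fset0//.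
  by apply: (lambda0 aone_G) => j; rewrite aact1; exact: aroot_pos.
- have xG : G (piel D (lat_val b)) := piel_G (lat_mem b).
  have [E zN] := lambda_saff xG zP; rewrite -cE /mubG E big_fsetU1//= -/(mubG _).
  have := nrm_step cE z2; have := mub_lin_neq0 xG z2.
  set z := aact _ _; rewrite /yroot -/z.
  have zr : affroot z := affroot_act (ainv_G xG) (aroot_affroot i).
  have rE : rho (- z.1) * qp z.2 = evG z.
    by rewrite (prhoN pd (Lam_affroot zr).1) mulrC.
  have tE : pth pd (- z.1) = thiG i.
    rewrite -(thiG_act i (ainv_G xG)); apply: pth_nu.
    by rewrite /nu dotNl dotNr opprK.
  rewrite /mubF rE tE; have e0 := evG_neq0 z; have t0 := thiG_neq0 i.
  move: (evG z) (thiG i) (nrm b) (nrm c) (mubG _) IH e0 t0 => e t Nb Nc m IH e0 t0 [h1 h2] h3.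
  have d0 : t - t^-1 * e != 0.
    by apply: contraNneq h1 => h; rewrite -[X in X == 0](mulfK e0) mulrBl mulfVK// h mul0r.
  have [dd ddE] : exists dd, dd = t - t^-1 * e by exists (t - t^-1 * e).
  rewrite -ddE in d0 *; apply: (mulfI (mulf_neq0 h2 (mulf_neq0 d0 e0))).
  transitivity ((Nc * (t^-1 * e^-1 - t)) * e * (t^-1 - t * e) * m).
    by field; rewrite t0 e0 d0.
  rewrite h3; transitivity ((Nb * m) * (t * e^-1 - t^-1) * e * (t^-1 - t * e)); first by ring.
  by rewrite IH ddE; field; rewrite t0 e0.
have E := (epsP_ebas pP cE); have [[k Uk] _] := eps_P pP; have [k1 k2] := Ugrp_inv Uk.
rewrite /nrm -E (adj_U Uk) -actM k2 act1 -cE /mubG (lambda_Pi pP (piel_G (lat_mem b))).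
exact: IH.
Qed.

Lemma Psi_adj (h k : H) f (b : lat B) : Ugrp (eps h) k ->
  Psi (act (eps h) f) b = pairG (act k (ebas b)) f.
Proof.
by move=> Uk; have [k1 k2] := Ugrp_inv Uk; rewrite /Psi (adj_sym (adj_U Uk) k1 k2).
Qed.

(** The adjoint of eps(T_i) is its inverse, whose value on E_b is the intertwiner image plus a
    multiple of E_b. This is the two-term shape of T_i in the functional representation. *)
Lemma Psi_T i (b : lat B) f : let x := piel D (lat_val b) in
  let e := evG (aact (ainv x) (aroot D i)) in
  Psi (act (eps (gT i)) f) b =
    pairG (PhiG i (yroot x i) (ebas b)) f - kap i / (e - 1) * Psi f b.
Proof.
move=> x e; have [[k Uk] _] := eps_T i; have [k1 k2] := Ugrp_inv Uk.
have [e1 e2] := TTinv i; have xG : G x := piel_G (lat_mem b).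
have kE : k = eps (Tinv i) by apply: (inv_unique k2); rewrite -rmorphM e1 rmorph1.
rewrite (Psi_adj _ _ Uk) kE /Tinv rmorphB epsZ rmorph1 actBl actZl act1 epsT_ebas -/x.
move: (PhiG i _ _) => ph; rewrite -!scaleNr !pairDl !pairZl -/(Psi f b) -addrA -mulrDl.
congr (_ + _); rewrite -[in RHS]mulNr; congr (_ * _); rewrite star_kap /yroot -/e.
have e0 : e != 0 by exact: evG_neq0.
have y1 : e - 1 != 0.
  by rewrite subr_eq0; have := yroot_neq1 i xG; rewrite /yroot invr_eq1.
have y1' : e^-1 - 1 != 0 by rewrite subr_eq0 invr_eq1 -subr_eq0.
have -> : e^-1 - 1 = - (e - 1) / e by rewrite opprB mulrBl mul1r mulfV.
rewrite invf_div invrN mulrN; move: e e0 y1 {y1'} => e e0 y1; move: (kap i) => k'.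
by field.
Qed.

Lemma phiG_ev x i : G x -> let e := evG (aact (ainv x) (aroot D i)) in
  phiG i (yroot x i) = (thiG i * e - (thiG i)^-1) / (e - 1).
Proof.
move=> xG e; rewrite /phiG star_kap star_thiG /kap /yroot -/e.
have e0 : e != 0 by exact: evG_neq0.
have y1 : e - 1 != 0.
  by rewrite subr_eq0; have := yroot_neq1 i xG; rewrite /yroot invr_eq1.
have t0 := thiG_neq0 i.
have -> : e^-1 - 1 = - (e - 1) / e by rewrite opprB mulrBl mul1r mulfV.
rewrite invf_div invrN mulrN; move: e e0 y1 => e e0 y1; move: (thiG i) t0 => t t0.
by field; rewrite t0 y1.
Qed.

Lemma Psi_T_in i (b c : lat B) f : let x := piel D (lat_val b) in
  let e := evG (aact (ainv x) (aroot D i)) in amul (saff D i) x = piel D (lat_val c) ->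
  Psi (act (eps (gT i)) f) b = (thiG i * e - (thiG i)^-1) / (e - 1) * Psi f c
    - kap i / (e - 1) * Psi f b.
Proof.
move=> x e cE; rewrite Psi_T -/x -/e; congr (_ - _); have xG : G x := piel_G (lat_mem b).
rewrite -phiG_ev// /Psi -pairZl; case: (saff_piel b i) => [[c' _ z2]|[j jE]].
  by rewrite (Phi_ebas cE z2).
have := piel_simple j (lat_mem c); rewrite -cE (aactM _ _ xG) jE saff_root.
by move=> /(affposN (aroot_pos i)).
Qed.

Lemma Psi_T_out i (b : lat B) f : let x := piel D (lat_val b) in
  let e := evG (aact (ainv x) (aroot D i)) in
  (forall c : lat B, amul (saff D i) x <> piel D (lat_val c)) ->
  Psi (act (eps (gT i)) f) b = - (kap i / (e - 1) * Psi f b).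
Proof.
move=> x e no; rewrite Psi_T -/x -/e.
case: (saff_piel b i) => [[c cE _]|[j jE]]; first by case: (no c).
by rewrite (Phi_simple jE (ebasP b).2) pair0l add0r.
Qed.

Lemma Psi_Y (a b : lat B) f :
  Psi (act (yelG a) f) b = qsharpG (lat_val a) (lat_val b) * Psi f b.
Proof.
have := adj_Y (- a) (ebas b) f; rewrite opprK Y_ebas pairZl qsharpGN invrK => E.
by rewrite /Psi -E.
Qed.

Lemma Psi_P p (b c : lat B) f : in_Pi D B p ->
  amul (ainv p) (piel D (lat_val b)) = piel D (lat_val c) ->
  Psi (act (eps (gP p)) f) b = Psi f c.
Proof.
move=> pP cE; have [[k Uk] _] := eps_P pP; have [k1 k2] := Ugrp_inv Uk.
have [p1 p2] := gP_inv pP.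
have kE : k = eps (gP (ainv p)) by apply: (inv_unique k2); rewrite -rmorphM p1 rmorph1.
by rewrite (Psi_adj _ _ Uk) kE (epsP_ebas (Pi_inv pP) cE).
Qed.

Lemma nrm_neq0 (b : lat B) : nrm b != 0.
Proof.
by apply/eqP => e; have := nrm_mub b; rewrite e mul0r => /esym/eqP; rewrite oner_eq0.
Qed.

Lemma Psi_expand f : exists s : seq (lat B), [/\ uniq s,
  forall b : lat B, b \notin s -> Psi f b = 0 &
  f = \sum_(b <- s) star (Psi f b / nrm b) *: ebas b].
Proof.
have [s [d su fE]] := in_spanP (in_span_all f).
have PE (b : lat B) : Psi f b = \sum_(b' <- s) star (d b') * (nrm b *+ (b == b')).
  by rewrite fE /Psi pair_sumr; apply: eq_bigr => c _; rewrite pairZr -Psi_ebas.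
have Ps (b : lat B) : b \in s -> Psi f b = star (d b) * nrm b.
  move=> bs; rewrite PE (bigD1_seq b)//= eqxx big1 ?addr0// => c.
  by rewrite eq_sym => /negPf ->; rewrite mulr0.
exists s; split=> // [b bs|].
  rewrite PE big1_seq// => c /andP[_ cs]; case: eqVneq => [e|_]; last by rewrite mulr0.
  by move: bs; rewrite e cs.
rewrite {1}fE !big_seq; apply: eq_bigr => b bs.
by rewrite (Ps b bs) mulfK ?nrm_neq0// pstarK.
Qed.

(** Parseval's identity, with the inverse norms written as mu_bullet. *)
Lemma pair_Psi f f' (s : seq (lat B)) :
  f = \sum_(b <- s) star (Psi f b / nrm b) *: ebas b ->
  star (pairG f f') =
    \sum_(b <- s) mubG (piel D (lat_val b)) * Psi f b * star (Psi f' b).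
Proof.
move=> fE; rewrite {1}fE pair_suml rmorph_sum; apply: eq_bigr => b _.
rewrite pairZl rmorphM pstarK; congr (_ * _); rewrite [RHS]mulrC; congr (_ * _).
by apply: (mulfI (nrm_neq0 b)); rewrite mulfV ?nrm_neq0// nrm_mub.
Qed.

(** * Identification with the Macdonald polynomials *)

Lemma ebas_lead (b : lat B) : gcoef (ebas b) b != 0 /\
  forall c : lat B, gcoef (ebas b) c != 0 -> c = b \/ wt_succ D (lat_val c) (lat_val b).
Proof.
have [e1 ex] := ebasP b.
have e0 : ebas b != 0.
  by apply/eqP => E; move: e1; rewrite E eval_rho0 => /esym/eqP; rewrite oner_eq0.
have [d [dn dchi dmin]] := Y_spec e0 (fun (a : lat B) _ => Y_ebas a b).
suff E : d = b by move: dn dmin; rewrite E; split.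
apply: lat_val_inj; apply: qsharpG_sep; try exact: lat_mem.
move=> a aB ad; have ad' : dominant D (lat_val (toB B a)) by rewrite toBK.
have := dchi _ ad'; rewrite toBK// => /invr_inj; rewrite /qsharpG => e.
by exists (umin D (lat_val d) *m a), (umin D (lat_val b) *m a).
Qed.

(** In the expansion of f take an index d, equal to b or succeeded by it, that succeeds no other
    index. Only E_d contributes to the coefficient of X_d, so X_d occurs in f. *)
Lemma supp_Psi f (S : lat B -> Prop) : (forall c : lat B, gcoef f c != 0 -> S c) ->
  forall b : lat B, Psi f b != 0 ->
  exists2 d : lat B, S d /\ Psi f d != 0 & b = d \/ wt_succ D (lat_val b) (lat_val d).
Proof.
move=> fS b Pb; have [s [su sN fE]] := Psi_expand f.
pose r (u v : lat B) := wt_succ D (lat_val u) (lat_val v).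
pose s' := [seq b : lat B <- s | Psi f b != 0].
have bs : b \in s' by rewrite mem_filter Pb; apply: contraNT Pb => /sN ->.
have [||d ds [bd dm]] := @rel_min _ r s' b _ _ bs; rewrite /r.
- by move=> u; exact: wt_succ_irr.
- by move=> u v v' uv vv'; exact: wt_succ_trans uv vv'.
have : Psi f d != 0 by move: ds; rewrite mem_filter => /andP[].
move=> Pd; exists d; last by case: bd => [->|]; [left|right].
split=> //; apply: fS; rewrite fE gcoef_sum (bigD1_seq d)//=; last first.
  by move: ds; rewrite mem_filter => /andP[].
rewrite big1_seq ?addr0 => [|c /andP[cd cs]].
  rewrite gcoefZ mulf_neq0 ?(ebas_lead d).1// fmorph_eq0 mulf_neq0 ?invr_eq0 ?nrm_neq0//.
rewrite gcoefZ; have [->|Pc] := eqVneq (Psi f c) 0; first by rewrite mul0r rmorph0 mul0r.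
have [->|/((ebas_lead c).2)[e|h]] := eqVneq (gcoef (ebas c) d) 0; first by rewrite mulr0.
  by move: cd; rewrite e eqxx.
by case: (dm c _ h); rewrite mem_filter Pc.
Qed.

Definition is_macG (b : lat B) f : Prop :=
  (forall c : lat B, gcoef (f - XpG b) c != 0 -> wt_succ D (lat_val c) (lat_val b)) /\
  (forall c : lat B, wt_succ D (lat_val c) (lat_val b) -> pairG f (XpG c) = 0).

(** For c succeeding b, the expansion of X_c involves only E_d with d equal to c or succeeding c,
    all orthogonal to E_b. *)
Lemma is_macG_ebas (b : lat B) : is_macG b ((gcoef (ebas b) b)^-1 *: ebas b).
Proof.
have [l0 lmin] := ebas_lead b; split=> c.
  rewrite gcoefD gcoefN gcoefZ gcoefM; have [<-|bc] := eqVneq b c.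
    by rewrite mulVf// subrr eqxx.
  rewrite subr0 mulf_eq0 negb_or => /andP[_ /lmin[e|//]].
  by move: bc; rewrite e eqxx.
move=> cb; rewrite pairZl -/(Psi _ _); apply/eqP; rewrite mulf_eq0; apply/orP; right.
apply/negPn/negP => Pb.
have [|d [-> _] bd] := @supp_Psi (XpG c) (fun d : lat B => d = c) _ b Pb.
  by move=> d; rewrite gcoefM; case: (eqVneq c d) => [->//|_]; rewrite eqxx.
case: bd => [e|h]; first by move: cb; rewrite e => /wt_succ_irr.
exact: wt_succ_irr (wt_succ_trans cb h).
Qed.

(** The difference expands in the E_e with e succeeding b and is orthogonal to all of these; as
    their norms are nonzero, it vanishes. *)
Lemma is_macG_unique (b : lat B) f f' : is_macG b f -> is_macG b f' -> f = f'.
Proof.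
move=> [f1 f2] [g1 g2]; pose d := f - f'.
have d1 (c : lat B) : gcoef d c != 0 -> wt_succ D (lat_val c) (lat_val b).
  have -> : d = (f - XpG b) - (f' - XpG b) by rewrite /d opprB addrA subrK.
  rewrite gcoefD gcoefN; have [->|/f1//] := eqVneq (gcoef (f - XpG b) c) 0.
  by rewrite add0r oppr_eq0 => /g1.
have d2 (c : lat B) : wt_succ D (lat_val c) (lat_val b) -> pairG d (XpG c) = 0.
  by move=> cb; rewrite /d -scaleN1r pairDl pairZl (f2 c cb) (g2 c cb) mulr0 addr0.
suff d0 : d = 0 by apply/eqP; rewrite -subr_eq0 -/d d0.
have P0 (c : lat B) : Psi d c = 0.
  apply/eqP/negPn/negP => /(supp_Psi d1)[e [eb Pe] _].
  have [s [su sN dE]] := Psi_expand d.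
  have es : e \in s by apply: contraNT Pe => /sN ->.
  have : pairG d (ebas e) = 0.
    rewrite [ebas e]gexpand pair_sumr big1_seq// => c' /andP[_]; rewrite gsuppE.
    move=> /((ebas_lead e).2)[->|h]; rewrite pairZr d2 ?mulr0//.
    exact: wt_succ_trans h eb.
  rewrite dE pair_suml (bigD1_seq e)//= big1 => [|c' ce]; last first.
    by rewrite pairZl (ebas_orth ce) mulr0.
  rewrite pairZl addr0 -/(nrm e) => /eqP; rewrite mulf_eq0 (negPf (nrm_neq0 e)) orbF.
  by rewrite fmorph_eq0 mulf_eq0 invr_eq0 (negPf (nrm_neq0 e)) (negPf Pe).
have [s [su sN dE]] := Psi_expand d; rewrite dE big1// => c _.
by rewrite P0 mul0r rmorph0 scale0r.
Qed.

(** * The star involution and the longest element *)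

Lemma star_act_word w f : starG (act (\prod_(i <- w) gT i) f) =
  act (\prod_(i <- w) Tinv i) (starG f).
Proof.
elim: w => [|i w IH]; first by rewrite !big_nil !act1.
by rewrite !big_cons !actM (DL_inv _ (act_DL i)) -act_Tinv IH.
Qed.

Lemma telV_ainv x p w : reduced D B x p w ->
  telV (ainv x) = gP p * \prod_(i <- w) Tinv i.
Proof.
move=> r; have [pP xE _] := r; have rww := reduced_rw r; have wG := wel_G w.
have pG := in_Pi_G pP; have vP := Pi_inv pP; have vG := in_Pi_G vP.
rewrite awordE in xE.
have rE : ainv x = amul (wel (rev w)) (ainv p) by rewrite xE (ainvM pG wG) wel_rev.
have rwr : rw (rev w) by rewrite /rw wel_rev (len_ainv wG) size_rev rww.
have [p1 p2] := gP_inv pP; have [w1 w2] := prod_word_inv (rev w); rewrite revK in w1 w2.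
rewrite /telV rE (telGM (wel_G (rev w)) vG); last first.
  have := len_ainv (amul_G pG wG); rewrite -xE rE => ->.
  by rewrite xE (len_Pi pP wG) wel_rev (len_ainv wG) vP.2 addn0.
rewrite (telG_wel rwr) (telG_Pi vP); apply: hinvGE.
  by rewrite -mulrA (mulrA (\prod_(i <- w) _)) w2 mul1r p1.
by rewrite -mulrA (mulrA (gP (ainv p))) p2 mul1r w1.
Qed.

(** Starring inverts each T_i but keeps the order of the letters, so T_x becomes the inverse of T
    for x^-1. *)
Lemma star_act_tel x f : G x -> starG (act (telG x) f) = act (telV (ainv x)) (starG f).
Proof.
move=> /reduced_exists[p [w r]]; rewrite (telGE r) (telV_ainv r) !actM; have [pP _ _] := r.
by rewrite !(actP _ pP) (starX_wactG _ (in_Pi_G pP)) star_act_word.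
Qed.

Lemma w0_word : exists s, rw (map some s) /\ lin (w0 D) = wel (map some s).
Proof. by have [s rs sE] := in_W_wel w0_W; exists s. Qed.

Definition tw0G : K := \prod_(a <- posroots D) pth pd a.

Lemma tw0G_word s : rw (map some s) -> lin (w0 D) = wel (map some s) ->
  tw0G = \prod_(i <- map some s) thiG i.
Proof.
move=> rs sE; rewrite -prodw_thi -(lambda_word _ rs) -sE /tw0G.
rewrite -(big_map (fun a => (a, 0) : @affV R n) predT (fun z : @affV R n => pth pd z.1)).
apply: perm_big; apply: uniq_perm.
- by rewrite map_inj_uniq ?pos_uniq// => u v [].
- by rewrite fset_uniq.
have lf := lambda_finite (lin_G w0_W).
move=> z; rewrite in_fset_set//; apply/mapP/idP => [[a aP ->]|].
  by apply/mem_set/lambda_w0; exists a.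
by move=> /set_mem/lambda_w0[a aP ->]; exists a.
Qed.

Lemma tw0G_neq0 : tw0G != 0.
Proof. by rewrite /tw0G prodf_seq_neq0; apply/allP => a _ /=; exact: pth_neq0. Qed.

Lemma eps_w0 : eps (telG (lin (w0 D))) = telV (lin (w0 D)).
Proof.
have [s [rs sE]] := w0_word; have wG := wel_G (map some s).
have r : reduced D B (lin (w0 D)) aone (map some s).
  by rewrite sE -[wel _](amul1x wG); exact: rw_reduced Pi1 rs.
have -> : lin (w0 D) = ainv (lin (w0 D)) by rewrite ainv_lin invmx_w0.
rewrite (telV_ainv r) P1H mul1r ainv_lin invmx_w0 sE (telG_wel rs).
exact: eps_word.
Qed.

(** Both sides are T of the same element, factored as w_0 tr(a) and as tr(w_0(a)) w_0, with additive
    lengths in both cases. *)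
Lemma w0_tr (a : lat B) : dominant D (lat_val a) ->
  telG (lin (w0 D)) * yelG a = telG (tr (w0 D *m lat_val a)) * telG (lin (w0 D)).
Proof.
move=> ad; have wG := lin_G w0_W; have aB := lat_mem a; have tG := tr_G aB.
have waB : w0 D *m lat_val a \in B by exact: B_W w0_W aB.
have tG' := tr_G waB; rewrite (yelG_dom ad) -!telGM//.
- congr telG; rewrite /amul /= mul1mx mulmx1 invmx_w0 w0_mulK addr0 invmx1 mulmx0 add0r.
  by [].
- apply: (len_amul tG' wG) => z zP zN.
  have /lambda_w0[c cP ->] : lambda D (lin (w0 D)) z by [].
  rewrite aact_lin aact_tr sub0r (dot_W _ _ w0_W).
  have cr := root_W w0_W (pos_root cP).
  have nr := affroot_act tG' (affroot_act wG (_ : affroot (c, 0))).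
  have {}nr : affroot (w0 D *m c, - dot c (lat_val a)).
    have := nr; rewrite aact_lin aact_tr sub0r (dot_W _ _ w0_W); apply.
    by split=> /=; [exact: pos_root cP|exists 0; rewrite mulr0z].
  have := dot_pos_dominant cP ad; rewrite le_eqVlt => /orP[/eqP<-|c0].
    by rewrite oppr0; apply/affneg_fin; exact: w0_pos.
  by apply: affroot_lt0 => //=; rewrite oppr_lt0.
apply: (len_amul wG tG) => -[c e] zP zN.
have /(lambda_tr_dominant _ _ aB ad)[cr cP e0 ec] : lambda D (tr (lat_val a)) (c, e) by [].
apply: affroot_lt0; first exact: affroot_act wG (affroot_act tG cr).
by rewrite aact_tr aact_lin /= subr_lt0.
Qed.

(** Starring turns Y for the dominant weight -w_0(a) into the inverse of T for the translation by
    w_0(a), which T_(w_0) conjugates back to Y_a^-1. Hence T_(w_0)^-1 maps the starred E_b to an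
    eigenvector, and evaluation fixes the scalar. *)
Lemma star_ebas (b c : lat B) : lat_val c = - (w0 D *m lat_val b) ->
  starG (ebas b) = tw0G^-1 *: act (telG (lin (w0 D))) (ebas c).
Proof.
move=> cE; have wG := lin_G w0_W; have [t1 t2] := telG_inv wG.
pose g := act (telV (lin (w0 D))) (starG (ebas b)).
have wg : act (telG (lin (w0 D))) g = starG (ebas b) by rewrite -actM t1 act1.
have [eb1 _] := ebasP b; have [ec1 _] := ebasP c.
have ev_star : evalG (starG (ebas b)) = 1 by rewrite eval_starG eb1 rmorph1.
have [s [rs sE]] := w0_word.
have evw F : evalG (act (telG (lin (w0 D))) F) = tw0G * evalG F.
  by rewrite sE (telG_wel rs) eval_act_word (tw0G_word rs sE).
have eg : evalG g = tw0G^-1.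
  by apply: (mulfI tw0G_neq0); rewrite -evw wg ev_star mulfV ?tw0G_neq0.
suff gE : tw0G *: g = ebas c.
  by rewrite -gE actZr scalerA mulVf ?tw0G_neq0// scale1r wg.
pose aw (a : lat B) := toB B (- (w0 D *m lat_val a)).
have awE (a : lat B) : lat_val (aw a) = - (w0 D *m lat_val a).
  by rewrite toBK// rpredN; exact: B_W w0_W (lat_mem a).
have gY (a : lat B) : dominant D (lat_val a) ->
    act (yelG a) g = (qsharpG (lat_val (aw a)) (lat_val b))^-1 *: g.
  move=> ad.
  have awd : dominant D (lat_val (aw a)).
    move=> i; rewrite awE dotNl -(w0_mulK (al i)) (dot_W _ _ w0_W) -dotNr dotC.
    by apply: dot_pos_dominant ad; exact/w0_pos/simple_pos.
  have aB := B_W w0_W (lat_mem a).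
  have tG := tr_G aB; have [s1 s2] := telG_inv tG.
  have aE : ainv (tr (lat_val (aw a))) = tr (w0 D *m lat_val a).
    by rewrite awE /ainv /tr /= invmx1 mul1mx opprK.
  have E1 : act (telV (tr (w0 D *m lat_val a))) (starG (ebas b)) =
      qsharpG (lat_val (aw a)) (lat_val b) *: starG (ebas b).
    rewrite -aE -star_act_tel; last exact: tr_G (lat_mem _).
    by rewrite -(yelG_dom awd) Y_ebas starXZ fmorphV star_qsharpG invrK.
  have E2 : act (telG (tr (w0 D *m lat_val a))) (starG (ebas b)) =
      (qsharpG (lat_val (aw a)) (lat_val b))^-1 *: starG (ebas b).
    rewrite -[X in _ = _ *: X](act1 (starG (ebas b))) -s1 actM E1 actZr scalerA.
    by rewrite mulVf ?qsharpG_neq0// scale1r.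
  have E3 : yelG a * telV (lin (w0 D)) = telV (lin (w0 D)) * telG (tr (w0 D *m lat_val a)).
    rewrite -[LHS]mul1r -t2 -!mulrA (mulrA (telG (lin _)) (yelG a)) (w0_tr ad).
    by rewrite -mulrA t1 mulr1.
  by rewrite /g -actM E3 actM E2 actZr.
have g0 : g != 0.
  by apply/eqP => E; move: eg; rewrite E eval_rho0 => /esym/eqP; rewrite invr_eq0 (negPf tw0G_neq0).
have [d [dn dchi dmin]] := Y_spec g0 gY.
(* The exponents of q alone identify the lowest weight; the full eigenvalue is then supplied by
   [Y_spec]. *)
have dc : d = c.
  apply: lat_val_inj; apply: qsharpG_sep; try exact: lat_mem.
  move=> a aB ad; have ad' : dominant D (lat_val (toB B a)) by rewrite toBK.
  have := dchi _ ad' => /invr_inj; rewrite awE toBK// /qsharpG => E.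
  exists (umin D (lat_val d) *m a), (umin D (lat_val b) *m - (w0 D *m a)).
  rewrite -E cE; congr (qp _ / _).
  by rewrite dotNl dotNr -{1}(w0_mulK (lat_val b)) (dot_W _ _ w0_W).
apply: (Y_unique (chi := fun a : lat B => (qsharpG (lat_val a) (lat_val c))^-1)) => //.
- by move=> a ad; rewrite actZr (gY a ad) (dchi a ad) dc !scalerA mulrC.
- by move=> a _; exact: Y_ebas.
by rewrite eval_rhoZ eg mulfV ?tw0G_neq0.
Qed.

(** Modulo [Q] every Y_a with a dominant acts by its eigenvalue on 1. For b <> 0 some such a has a
    different eigenvalue on E_b, which forces E_b into [Q]; only the multiples of E_0 = 1 remain. *)
Lemma span_invariants (Q : KX -> Prop) :
  (forall f f', Q f -> Q f' -> Q (f + f')) -> (forall c f, Q f -> Q (c *: f)) ->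
  (forall i f, Q (act (gT i) f - thiG i *: f)) ->
  (forall p f, in_Pi D B p -> Q (wactG p f - f)) ->
  forall f, exists c, Q (f - c *: 1).
Proof.
move=> QD QZ QT QP.
have Q0 : Q 0 by have := QZ 0 _ (QT None 0); rewrite scale0r.
have QW w f : Q (act (\prod_(i <- w) gT i) f - (\prod_(i <- w) thiG i) *: f).
  elim: w => [|i w IH]; first by rewrite !big_nil act1 scale1r subrr.
  rewrite !big_cons actM; set g := act _ f; rewrite -/g in IH.
  have -> : act (gT i) g - (thiG i * \prod_(j <- w) thiG j) *: f =
      (act (gT i) g - thiG i *: g) + thiG i *: (g - (\prod_(j <- w) thiG j) *: f).
    by rewrite scalerBr scalerA addrA subrK.
  by apply: QD; [exact: QT|exact: QZ].
have zE : lat_val (0 : lat B) = 0 := lat_val0.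
have QY (a : lat B) f : dominant D (lat_val a) ->
    Q (act (yelG a) f - (qsharpG (lat_val a) 0)^-1 *: f).
  move=> ad; have [p [w r]] := reduced_exists (tr_G (lat_mem a)); have [pP _ _] := r.
  rewrite (yelG_dom ad) (telGE r) actM (actP _ pP).
  have -> : (qsharpG (lat_val a) 0)^-1 = \prod_(i <- w) thiG i.
    by rewrite -(rho_reduced ad r) /qsharpG umin0 mul1mx dot0r pqp0 mul1r invrK.
  set g := act _ f.
  have -> : wactG p g - (\prod_(i <- w) thiG i) *: f = (wactG p g - g) +
      (g - (\prod_(i <- w) thiG i) *: f) by rewrite addrA subrK.
  by apply: QD; [exact: QP|exact: QW].
have Qe (b : lat B) : b != 0 -> Q (ebas b).
  move=> b0; have [[a [ad ne]]|no] := pselect (exists a : lat B, dominant D (lat_val a) /\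
    qsharpG (lat_val a) (lat_val b) != qsharpG (lat_val a) 0).
    have := QY a (ebas b) ad; rewrite Y_ebas -scalerBl => Qb.
    set k := (_ - _ : K) in Qb; have k0 : k != 0.
      by rewrite subr_eq0; apply: contra ne => /eqP/invr_inj ->.
    by have := QZ k^-1 _ Qb; rewrite scalerA mulVf// scale1r.
  case/eqP: b0; apply: lat_val_inj; rewrite zE.
  apply: qsharpG_sep; rewrite ?lat_mem ?rpred0// => a aB ad.
  exists (umin D (lat_val b) *m a), (umin D 0 *m a); apply/eqP/negPn/negP => ne.
  by apply: no; exists (toB B a); rewrite toBK.
move=> f; have [s [d ->]] := in_span_all f.
elim: s => [|b s [c Qc]]; first by exists 0; rewrite big_nil scale0r subrr.
rewrite big_cons; have [->|b0] := eqVneq b 0.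
  exists (d 0 + c); rewrite (@ebas1 0) ?zE ?piel0// scalerDl opprD addrACA subrr add0r.
  exact: Qc.
by exists c; rewrite -addrA; apply: QD => //; exact/QZ/Qe.
Qed.

(** * The constant term *)

Section LaurentSeries.
Local Notation C := (coefring D).
Variable LA : galgebra C (@affV R n).
Implicit Types (p q : LA) (d : R) (s : seq (@affV R n)).

(** The height of affine vectors: as alpha_0 = [-theta, 1], this weight of the second coordinate
    gives all of alpha_0, ..., alpha_n degree 1. *)
Definition affdeg r : R := ht D r.1 + (ht D (theta D) + 1) * r.2.

Lemma affdegD r (r' : @affV R n) : affdeg (r + r') = affdeg r + affdeg r'.
Proof. by rewrite /affdeg /= htD mulrDr addrACA. Qed.

Lemma affdeg0 : affdeg 0 = 0.
Proof. by have := affdegD 0 0; rewrite addr0 => /eqP; rewrite -subr_eq0 opprD addNKr oppr_eq0 => /eqP. Qed.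

Lemma affdegN r : affdeg (- r) = - affdeg r.
Proof. by apply/eqP; rewrite -addr_eq0 -affdegD addNr affdeg0. Qed.

Lemma affdegMn r (m : nat) : affdeg (r *+ m) = affdeg r *+ m.
Proof. by elim: m => [|m IH]; rewrite ?affdeg0// !mulrS affdegD IH. Qed.

Lemma ht_Qp a : in_Qp D a -> 0 <= ht D a.
Proof. by move=> /in_Qp_ge0[_ a0]; apply: sumr_ge0 => i _; exact: a0. Qed.

Lemma ht_ge1 a : a \in posroots D -> 1 <= ht D a.
Proof.
move=> aP; have := aP; rewrite mem_pos => /andP[_ /asboolP/in_QpE aN].
suff [i ai] : exists i, 1 <= cf D a i.
  rewrite /ht (bigD1 i)//= -[1]addr0 lerD// sumr_ge0// => j _.
  by have := aN j; rewrite natrEint => /andP[].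
have [i ai] := root_neq0_cf (pos_root aP); exists i.
by have := aN i; move: ai => /[swap] /natrP[[|m] ->]; rewrite ?eqxx// ler1n.
Qed.

(** For positive level [theta_dominates] bounds how far the height of the vector part can fall. The
    second bound leaves finitely many positive roots in each degree. *)
Lemma affdeg_pos r (j : int) : affpos D r -> r.2 = nu r.1 *~ j ->
  1 <= affdeg r /\ j%:~R <= affdeg r.
Proof.
move=> [rD [k rk kP]] rj; have -> : j = k by apply: (nu_mulz_inj rD); rewrite -rj -rk.
have [nuI /ht_Qp thD] := theta_dominates (rootN rD).
have nuN : nu (- r.1) = nu r.1 by rewrite /nu dotNl dotNr opprK.
rewrite nuN in nuI thD; rewrite htD htZ -scaleN1r htZ mulN1r in thD.
have tP : 1 <= ht D (theta D) by exact/ht_ge1/theta_pos.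
have n1 : 1 <= nu r.1.
  have := nu_gt0 (root_neq0 rD); move: nuI; rewrite intrEfloor => /eqP <-.
  by rewrite ltr0z ler1z; lia.
have hN : ht D (- r.1) = - ht D r.1 by rewrite -scaleN1r htZ mulN1r.
rewrite /affdeg rk -mulrzr; move: thD; rewrite -[X in 0 <= _ - X]opprK => thD.
case: kP => [k0|[-> rP]].
  have k1 : 1 <= k%:~R :> R by rewrite ler1z; lia.
  have h1 : - ht D r.1 <= nu r.1 * ht D (theta D) by lra.
  move: (ht D (theta D)) (ht D r.1) (nu r.1) (k%:~R) tP n1 k1 h1 => T h v l tP n1 k1 h1.
  have a1 : v <= v * l by rewrite ler_peMr//; lra.
  have a2 : l <= v * l by rewrite ler_peMl//; lra.
  have a3 : T * v <= T * (v * l) by rewrite ler_pM2l//; lra.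
  by rewrite mulrDl mul1r; split; lra.
by have := ht_ge1 rP; rewrite mulr0z !mulr0 addr0; split=> //; lra.
Qed.

Lemma affdeg_ge1 r : affpos D r -> 1 <= affdeg r.
Proof. by move=> rP; have [_ [j jE _]] := rP; have [] := affdeg_pos rP jE. Qed.

(** Nonnegative degrees make congruence in low degree compatible with products. Integrality is there
    because [mu] is indexed by integer exponents of q. *)
Definition conic p : Prop := forall r, gcoef p r != 0 ->
  [/\ 0 <= affdeg r, 0 <= r.2 & r.2 \is a Num.int].

Lemma conic_at0 : [/\ 0 <= affdeg 0, 0 <= (0 : @affV R n).2 & (0 : @affV R n).2 \is a Num.int].
Proof. by split; [rewrite affdeg0|exact: lexx|exact: rpred0]. Qed.

Lemma conic1 : conic 1.
Proof.
move=> r; rewrite -(gM0 LA) gcoefM; case: (eqVneq 0 r) => [<- _|_]; rewrite ?eqxx//.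
exact: conic_at0.
Qed.

Lemma conicM p q : conic p -> conic q -> conic (p * q).
Proof.
move=> pC qC r; rewrite gcoef_mul => nz.
have [[r' [p0 q0]]|no] := pselect (exists r', gcoef p r' != 0 /\ gcoef q (r - r') != 0).
  have [d1 i1 k1] := pC _ p0; have [d2 i2 k2] := qC _ q0.
  have E : r = r' + (r - r') by rewrite addrC subrK.
  rewrite E affdegD; split; [exact: addr_ge0|exact: addr_ge0|exact: rpredD].
case/eqP: nz; apply: big1 => r' _; apply/eqP; rewrite mulf_eq0 -[_ || _]negbK negb_or.
by apply/negP => /andP[h1 h2]; apply: no; exists r'.
Qed.

Definition dcongr d p q : Prop := forall r, affdeg r <= d -> gcoef p r = gcoef q r.

Lemma dcongrM d p p' q q' : conic p -> conic q' -> dcongr d p p' -> dcongr d q q' ->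
  dcongr d (p * q) (p' * q').
Proof.
move=> pC qC pp qq r rd.
have -> : gcoef (p * q) r = gcoef (p * q') r.
  rewrite !gcoef_mul !big_seq; apply: eq_bigr => r'; rewrite gsuppE => /pC[h _ _].
  by rewrite qq// affdegD affdegN; lra.
rewrite mulrC [p' * _]mulrC !gcoef_mul !big_seq; apply: eq_bigr => r'; rewrite gsuppE => /qC[h _ _].
by rewrite pp// affdegD affdegN; lra.
Qed.

Definition tsq r : C := tvar D (nu r.1) ^+ 2.
Definition geo (M : nat) (c : C) r : LA := \sum_(m < M) c ^+ m *: gM LA (r *+ m).
(** The factor (1 - X_r) / (1 - t_r X_r) of mu, with the geometric series cut after M terms. *)
Definition fac M r : LA := (1 - gM LA r) * geo M (tsq r) r.
Definition PS M s : LA := \prod_(r <- s) fac M r.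

Lemma gcoef1 r : gcoef (1 : LA) r = (r == 0)%:R.
Proof. by rewrite -(gM0 LA) gcoefM eq_sym. Qed.

Lemma affpos_nu_int r : affpos D r -> r.2 \is a Num.int.
Proof.
move=> [rD [j -> _]]; have [nuI _] := theta_dominates rD.
by rewrite -mulrzr rpredM// intr_int.
Qed.

Lemma conic_bin r : affpos D r -> conic (1 - gM LA r).
Proof.
move=> rP r'; rewrite gcoefD gcoefN gcoef1 gcoefM.
case: (eqVneq r' 0) => [-> _|_]; first exact: conic_at0.
case: (eqVneq r r') => [<- _|_]; last by rewrite subr0 eqxx.
split; [have := affdeg_ge1 rP; lra|exact: affpos_ge0|exact: affpos_nu_int].
Qed.

Lemma gcoef_geo M (c : C) r r' : gcoef (geo M c r) r' = \sum_(m < M) c ^+ m * (r *+ m == r')%:R.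
Proof. by rewrite /geo gcoef_sum; apply: eq_bigr => m _; rewrite gcoefZ gcoefM. Qed.

Lemma conic_geo M (c : C) r : affpos D r -> conic (geo M c r).
Proof.
move=> rP r'; rewrite gcoef_geo => nz.
have [m /eqP <-] : exists m : 'I_M, r *+ m == r'.
  apply/existsP; apply: contraNT nz => /existsPn h; rewrite big1// => m _.
  by rewrite (negPf (h m)) mulr0.
rewrite affdegMn affV2Mn; split.
- by rewrite mulrn_wge0//; have := affdeg_ge1 rP; lra.
- by rewrite mulrn_wge0//; exact: affpos_ge0.
by rewrite rpredMn//; exact: affpos_nu_int.
Qed.

Lemma conic_fac M r : affpos D r -> conic (fac M r).
Proof. by move=> rP; apply: conicM; [exact: conic_bin|exact: conic_geo]. Qed.

Lemma conic_PS M s : (forall r, r \in s -> affpos D r) -> conic (PS M s).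
Proof.
move=> sP; rewrite /PS big_seq; elim/big_ind: _ => [|p q|r /sP]; first exact: conic1.
  exact: conicM.
exact: conic_fac.
Qed.

Lemma geo_congr d M M' (c : C) r : affpos D r -> d < M%:R -> d < M'%:R ->
  dcongr d (geo M c r) (geo M' c r).
Proof.
move=> rP; wlog MM' : M M' / (M <= M')%N.
  by move=> h dM dM'; case: (leqP M M') => [/h|/ltnW/h h'] //; [exact|move=> r' /h' ->].
move=> dM _ r' rd; rewrite !gcoef_geo -!(big_mkord xpredT (fun m => c ^+ m * (r *+ m == r')%:R)).
rewrite [RHS](@big_cat_nat _ _ _ M)//= [X in _ = _ + X]big_nat_cond [X in _ = _ + X]big1 ?addr0// => m /andP[/andP[Mm _] _].
case: eqP => [e|_]; rewrite ?mulr0//; move: rd; rewrite -e affdegMn.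
have h2 : M%:R <= m%:R :> R by rewrite ler_nat.
have h1 := affdeg_ge1 rP; rewrite -[_ *+ m]mulr_natr => h3; exfalso.
have : m%:R <= affdeg r * m%:R by rewrite ler_peMl.
by move: dM h2 h3; move: (M%:R) (m%:R : R) (affdeg r * _) => u v v'; lra.
Qed.

Lemma dcongr_refl d p : dcongr d p p. Proof. by []. Qed.

Lemma fac_congr d M M' r : affpos D r -> d < M%:R -> d < M'%:R ->
  dcongr d (fac M r) (fac M' r).
Proof.
move=> rP dM dM'; apply: dcongrM; first exact: conic_bin.
- exact: conic_geo.
- exact: dcongr_refl.
exact: geo_congr.
Qed.

Lemma fac_congr1 d M r : affpos D r -> (0 < M)%N -> d < affdeg r -> dcongr d (fac M r) 1.
Proof.
move=> rP M0 dr; rewrite -[X in dcongr _ _ X](mulr1 1); apply: dcongrM.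
- exact: conic_bin.
- exact: conic1.
- move=> r' rd; rewrite gcoefD gcoefN gcoefM; case: eqP => [e|_]; last by rewrite subr0.
  by move: rd; rewrite -e leNgt dr.
move=> r' rd; rewrite gcoef_geo gcoef1; case: M M0 => // M _.
rewrite big_ord_recl expr0 mul1r mulr0n eq_sym big1 ?addr0// => m _.
case: eqP => [e|_]; rewrite ?mulr0//; move: rd; rewrite -e affdegMn /= mulrS.
have : 0 <= affdeg r *+ m by rewrite mulrn_wge0//; have := affdeg_ge1 rP; lra.
by move=> h1 h2; exfalso; lra.
Qed.

Definition complete d s : Prop := [/\ uniq s, forall r, r \in s -> affpos D r &
  forall r, affpos D r -> affdeg r <= d -> r \in s].

Lemma PS_trunc d M s : (forall r, r \in s -> affpos D r) -> (0 < M)%N ->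
  dcongr d (PS M s) (PS M [seq r <- s | affdeg r <= d]).
Proof.
elim: s => [|r s IH] sP M0; first exact: dcongr_refl.
have rP := sP r (mem_head _ _); have sP' : forall r', r' \in s -> affpos D r'.
  by move=> r' rs; apply: sP; rewrite inE rs orbT.
have tP : conic (PS M [seq r <- s | affdeg r <= d]).
  by apply: conic_PS => r'; rewrite mem_filter => /andP[_]; exact: sP'.
rewrite /PS big_cons /=; case: ifP => rd.
  rewrite big_cons; apply: dcongrM => //; [exact: conic_fac|exact: IH].
rewrite -[X in dcongr _ _ X]mul1r; apply: dcongrM => //; first exact: conic_fac.
  by apply: fac_congr1 => //; rewrite ltNge rd.
exact: IH.
Qed.

Lemma PS_congrM d M M' s : (forall r, r \in s -> affpos D r) -> d < M%:R -> d < M'%:R ->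
  dcongr d (PS M s) (PS M' s).
Proof.
elim: s => [|r s IH] sP dM dM'; first by rewrite /PS !big_nil.
have sP' : forall r', r' \in s -> affpos D r'.
  by move=> r' rs; apply: sP; rewrite inE rs orbT.
have rP := sP r (mem_head _ _).
rewrite /PS !big_cons; apply: dcongrM; [exact: conic_fac|exact: conic_PS| |exact: IH].
exact: fac_congr.
Qed.

(** Factors of degree above d are 1 up to degree d, so any finite set with all positive roots up to
    degree d computes mu there. This leaves the freedom to choose sets adapted to a symmetry. *)
Lemma PS_congr d M M' s s' : complete d s -> complete d s' -> 0 <= d -> d < M%:R -> d < M'%:R ->
  dcongr d (PS M s) (PS M' s').
Proof.
move=> [us sP sd] [us' sP' sd'] d0 dM dM' r rd.
have M0 (N : nat) : d < N%:R -> (0 < N)%N by rewrite -(ltr_nat R) => h; lra.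
rewrite (PS_trunc sP (M0 _ dM) rd) (PS_trunc sP' (M0 _ dM') rd).
have -> : PS M' [seq r <- s' | affdeg r <= d] = PS M' [seq r <- s | affdeg r <= d].
  apply: perm_big; apply: uniq_perm; rewrite ?filter_uniq// => r'.
  rewrite !mem_filter; case: (boolP (affdeg r' <= d)) => //= r'd.
  by apply/idP/idP => [/sP' h|/sP h]; [exact: sd|exact: sd'].
apply: (PS_congrM _ dM dM' rd) => r'; rewrite mem_filter => /andP[_]; exact: sP.
Qed.

Definition iota2 (x : 'cV[R]_n * int) : @affV R n := (x.1, x.2%:~R).

Lemma iota2_inj : injective iota2.
Proof. by move=> [u1 k1] [u2 k2] [-> /intr_inj ->]. Qed.

Lemma iota2D (x y : 'cV[R]_n * int) : iota2 (x + y) = iota2 x + iota2 y.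
Proof. by apply: affV_eq => //=; rewrite rmorphD. Qed.

Lemma iota2B (x y : 'cV[R]_n * int) : iota2 (x - y) = iota2 x - iota2 y.
Proof. by apply: affV_eq => //=; rewrite rmorphB. Qed.

Lemma iota20 : iota2 0 = 0. Proof. by []. Qed.

Lemma iota2Mn (x : 'cV[R]_n * int) (m : nat) : iota2 (x *+ m) = iota2 x *+ m.
Proof. by elim: m => // m IH; rewrite !mulrS iota2D IH. Qed.

Definition approx d (F : lser D) p : Prop := [/\ conic p,
  forall x : 'cV[R]_n * int, F x != 0 -> 0 <= affdeg (iota2 x) &
  forall x : 'cV[R]_n * int, affdeg (iota2 x) <= d -> F x = gcoef p (iota2 x)].

(** [lmul] sums over an infinite index set. In degree at most d, nonnegativity of degrees confines
    the nonzero terms to the support of the truncation p. *)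
Lemma approx_lmul d F F' p q : approx d F p -> approx d F' q -> approx d (lmul F F') (p * q).
Proof.
move=> [pC F0 FE] [qC F'0 F'E].
have vanish (x y : 'cV[R]_n * int) : F y * F' (x - y) != 0 ->
    0 <= affdeg (iota2 y) /\ affdeg (iota2 y) <= affdeg (iota2 x).
  rewrite mulf_eq0 negb_or => /andP[/F0 h1 /F'0]; rewrite iota2B affdegD affdegN => h2.
  by split=> //; lra.
split; first exact: conicM.
  move=> x; apply: contra_neqT => xd; apply: fsbig1 => y _.
  by apply/eqP; apply: contraNT xd => /vanish[h1 h2]; lra.
move=> x xd; pose s := [seq (r.1, Num.floor r.2) | r <- gsupp p].
have sE r : r \in gsupp p -> iota2 (r.1, Num.floor r.2) = r.
  rewrite gsuppE => /pC[_ _]; rewrite intrEfloor => /eqP E.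
  by apply: affV_eq => //=; rewrite E.
have us : uniq s.
  rewrite map_inj_in_uniq ?gsupp_uniq// => r r' rs rs' /(congr1 iota2).
  by rewrite !sE.
rewrite /lmul (@fsbigE _ _ _ _ _ s)//; last first.
  move=> y _ ys; apply/eqP; apply: contraNT ys => nz; have [h1 h2] := vanish _ _ nz.
  move: nz; rewrite mulf_eq0 negb_or => /andP[Fy _].
  apply/mapP; exists (iota2 y); rewrite ?gsuppE -?FE//; first exact: le_trans xd.
  by case: y {h1 h2 Fy} => y1 y2; rewrite /iota2 /= intrKfloor.
rewrite gcoef_mul big_map big_mkcond !big_seq; apply: eq_bigr => r rs; rewrite in_setT.
have rE := sE r rs; set y := (r.1, _) in rE *.
have [r0 _ _] : [/\ 0 <= affdeg r, 0 <= r.2 & r.2 \is a Num.int] by apply: pC; rewrite -gsuppE.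
have xyE : iota2 (x - y) = iota2 x - r by rewrite iota2B rE.
have dxy : affdeg (iota2 x - r) <= d by rewrite affdegD affdegN; lra.
have F'xy : F' (x - y) = gcoef q (iota2 x - r) by rewrite F'E xyE.
rewrite F'xy; have [yd|yd] := leP (affdeg r) d; first by rewrite FE ?rE.
have -> : gcoef q (iota2 x - r) = 0; last by rewrite !mulr0.
apply/eqP/negPn/negP => /qC[]; rewrite affdegD affdegN => h _ _; lra.
Qed.

Lemma approx1 d : approx d (lone D) 1.
Proof.
split; first exact: conic1.
  by move=> x; rewrite /lone; case: (eqVneq x 0) => [-> _|_]; rewrite ?eqxx// iota20 affdeg0.
move=> x _; rewrite /lone gcoef1 -iota20 (inj_eq iota2_inj).
by [].
Qed.

Lemma approx_lbin d (x : 'cV[R]_n * int) : affpos D (iota2 x) ->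
  approx d (lbin D x) (1 - gM LA (iota2 x)).
Proof.
move=> xP; split; first exact: conic_bin.
  move=> y; rewrite /lbin; case: (eqVneq y 0) => [-> _|_]; first by rewrite iota20 affdeg0.
  case: (eqVneq y x) => [-> _|_]; last by rewrite subr0 eqxx.
  by have := affdeg_ge1 xP; lra.
move=> y _; rewrite /lbin gcoefD gcoefN gcoef1 gcoefM -iota20 !(inj_eq iota2_inj).
by rewrite [x == y]eq_sym.
Qed.

Lemma approx_lgeo d M (c : C) (x : 'cV[R]_n * int) : affpos D (iota2 x) -> d < M%:R ->
  approx d (lgeo c x) (geo M c (iota2 x)).
Proof.
move=> xP dM; have x1 := affdeg_ge1 xP.
have mE (m m' : nat) : x *+ m = x *+ m' -> m = m'.
  move=> /(congr1 (fun u : 'cV[R]_n * int => affdeg (iota2 u))); rewrite !iota2Mn !affdegMn.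
  by apply: mulrIn; lra.
have lE (m : nat) : lgeo c x (x *+ m) = c ^+ m.
  rewrite /lgeo (_ : classical_sets.mkset _ = classical_sets.set1 m) ?fsbig_set1//.
  by apply/seteqP; split=> m' /= => [/mE ->|->].
have l0 (y : 'cV[R]_n * int) : (forall m : nat, y <> x *+ m) -> lgeo c x y = 0.
  move=> h; rewrite /lgeo (_ : classical_sets.mkset _ = classical_sets.set0) ?fsbig_set0//.
  by apply/seteqP; split=> m' //= /h.
split; first exact: conic_geo.
  move=> y; have [[m ->] _|no] := pselect (exists m : nat, y = x *+ m).
    by rewrite iota2Mn affdegMn mulrn_wge0//; lra.
  by rewrite l0 ?eqxx// => m ym; apply: no; exists m.
move=> y yd; rewrite gcoef_geo; have [[m ym]|no] := pselect (exists m : nat, y = x *+ m).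
  have mM : (m < M)%N.
    rewrite -(ltr_nat R); apply: le_lt_trans dM; apply: le_trans yd.
    by rewrite ym iota2Mn affdegMn -(mulr_natr (affdeg (iota2 x))) ler_peMl.
  rewrite ym lE (bigD1 (Ordinal mM))//= iota2Mn eqxx mulr1 big1 ?addr0// => k km.
  case: eqP => [|_]; rewrite ?mulr0// -!iota2Mn => /iota2_inj/mE e.
  by case/eqP: km; apply: val_inj.
rewrite l0 => [|m ym]; last by apply: no; exists m.
rewrite big1// => m _; case: eqP => [|_]; rewrite ?mulr0// -iota2Mn => /iota2_inj e.
by case: no; exists m.
Qed.

Definition raff a (i : nat) : @affV R n := (a, nu a *+ i).

Lemma raff_iota a i : a \in roots D -> iota2 (a, Num.floor (nu a) *+ i) = raff a i.
Proof.
move=> aD; apply: affV_eq => //=; have [nuI _] := theta_dominates aD.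
have -> : (Num.floor (nu a) *+ i)%:~R = (Num.floor (nu a))%:~R *+ i :> R.
  by elim: i => [|i IH]; rewrite ?mulr0n// !mulrS intrD IH.
by move: nuI; rewrite intrEfloor => /eqP ->.
Qed.

Lemma raff_pos a i : a \in posroots D -> affpos D (raff a i) /\ affpos D (raff (- a) i.+1).
Proof.
move=> aP; have aD := pos_root aP; split.
  split=> //; exists (Posz i); first by rewrite -pmulrn.
  by case: i => [|i]; [right|left].
have nuN : nu (- a) = nu a by rewrite /nu dotNl dotNr opprK.
split; first by rewrite /= rootNE.
by exists (Posz i.+1); [rewrite -pmulrn|left].
Qed.

Lemma approx_mu_factor d M a i : a \in posroots D -> d < M%:R ->
  approx d (mu_factor D a i) (fac M (raff a i) * fac M (raff (- a) i.+1)).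
Proof.
move=> aP dM; have aD := pos_root aP; have [p1 p2] := raff_pos i aP.
have nuN : nu (- a) = nu a by rewrite /nu dotNl dotNr opprK.
have e1 := raff_iota i aD; have e2 := raff_iota i.+1 (rootN aD); rewrite nuN in e2.
rewrite /fac mulrACA -e1 -e2 in p1 p2 *; rewrite /mu_factor.
have -> : tsq (iota2 (- a, Num.floor (nu a) *+ i.+1)) = tvar D (nu a) ^+ 2.
  by rewrite /tsq /= nuN.
apply: approx_lmul; apply: approx_lmul; [exact: approx_lbin|exact: approx_lbin| |].
  exact: approx_lgeo.
exact: approx_lgeo.
Qed.

Definition SN (N : nat) : seq (@affV R n) :=
  [seq raff a i | a <- posroots D, i <- iota 0 N] ++
  [seq raff (- a) i.+1 | a <- posroots D, i <- iota 0 N].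

Lemma approx_mu_trunc d M N : d < M%:R -> approx d (mu_trunc D N) (PS M (SN N)).
Proof.
move=> dM; rewrite /mu_trunc.
have -> : PS M (SN N) = \prod_(a <- posroots D) \prod_(i < N)
    (fac M (raff a i) * fac M (raff (- a) i.+1)).
  rewrite /PS /SN big_cat !big_allpairs_dep /= -big_split; apply: eq_bigr => a _.
  by rewrite -big_split -(big_mkord xpredT (fun i => fac M (raff a i) * fac M (raff (- a) i.+1)))
    /index_iota subn0.
rewrite !big_seq; elim/big_rec2: _ => [|a p F aP IH]; first exact: approx1.
apply: approx_lmul IH; elim/big_rec2: _ => [|i p' F' _ IH]; first exact: approx1.
apply: approx_lmul IH; exact: approx_mu_factor.
Qed.

Lemma SN_complete d (N : nat) : d < N%:R -> complete d (SN N).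
Proof.
move=> dN; split.
- rewrite cat_uniq; apply/and3P; split.
  + apply: allpairs_uniq => [| |[a i] [b j]]; rewrite ?pos_uniq ?iota_uniq//.
    move=> /allpairsP[[a' i'] /= [aP _ [-> ->]]] /allpairsP[[b' j'] /= [_ _ [-> ->]]] [e].
    by rewrite -e => /(mulrIn (lt0r_neq0 (nu_gt0 (root_neq0 (pos_root aP))))) ->.
  + apply/hasPn => _ /allpairsP[[a i] /= [aP _ ->]]; apply/negP.
    move=> /allpairsP[[b j] /= [bP _ [e _]]]; have := posN aP.
    by rewrite e bP.
  apply: allpairs_uniq => [| |[a i] [b j]]; rewrite ?pos_uniq ?iota_uniq//.
  move=> /allpairsP[[a' i'] /= [aP _ [-> ->]]] /allpairsP[[b' j'] /= [_ _ [-> ->]]] [/oppr_inj e].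
  have nuN (a0 : 'cV[R]_n) : nu (- a0) = nu a0 by rewrite /nu dotNl dotNr opprK.
  rewrite -e !nuN => /(mulrIn (lt0r_neq0 (nu_gt0 (root_neq0 (pos_root aP))))) [->].
  by [].
- by move=> r; rewrite mem_cat => /orP[] /allpairsP[[a i] /= [aP _ ->]]; have [] := raff_pos i aP.
move=> r rP rd; have [rD [j rj jP]] := rP; have [_ jd] := affdeg_pos rP rj.
have jN : (`|j| < N)%N.
  have : j%:~R < N%:R :> R by lra.
  by rewrite -[N%:R]/((Posz N)%:~R) ltr_int; case: jP => [|[-> _]]; lia.
rewrite mem_cat; have [r1P|r1N] := boolP (r.1 \in posroots D).
  apply/orP; left; apply/allpairsP; exists (r.1, `|j|%N); split=> //; first by rewrite mem_iota.
  apply: affV_eq => //=; rewrite rj pmulrn; congr (_ *~ _).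
  by case: jP => [|[-> _]]; lia.
have j0 : 0 < j by case: jP => // -[_]; rewrite (negPf r1N).
apply/orP; right; apply/allpairsP; exists (- r.1, (`|j|.-1)%N); split=> /=.
- by rewrite posNE.
- by rewrite mem_iota; lia.
have -> : (`|j|.-1.+1)%N = `|j|%N by lia.
apply: affV_eq; rewrite /= ?opprK// rj pmulrn; congr (_ *~ _); lia.
Qed.

Lemma mu_val d M s (x : 'cV[R]_n * int) : complete d s -> 0 <= d -> d < M%:R ->
  affdeg (iota2 x) <= d -> mu D x = gcoef (PS M s) (iota2 x).
Proof.
move=> sc d0 dM xd; pose c := gcoef (PS M s) (iota2 x).
have E N : d < N%:R -> mu_trunc D N x = c.
  move=> dN; have [_ _ ->//] := approx_mu_trunc N dM.
  by apply: (PS_congr (SN_complete dN)).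
have bP : d < (Num.bound d)%:R by exact: archi_boundP.
rewrite /mu; case: classical_sets.xgetP => [c' _ [N0 h]|/(_ c)[]].
  rewrite -(h (maxn N0 (Num.bound d)) (leq_maxl _ _)); apply: E.
  by apply: lt_le_trans bP _; rewrite ler_nat leq_maxr.
exists (Num.bound d) => N bN; apply: E; apply: lt_le_trans bP _.
by rewrite ler_nat.
Qed.

(** Fractional exponents of q, which occur through mtilde, get coefficient 0. *)
Definition muA r : C := if r.2 \is a Num.int then mu D (r.1, Num.floor r.2) else 0.

Lemma muA_val d M s r : complete d s -> 0 <= d -> d < M%:R -> affdeg r <= d ->
  muA r = gcoef (PS M s) r.
Proof.
move=> sc d0 dM rd; rewrite /muA; have [rI|rI] := boolP (r.2 \is a Num.int).
  have E : iota2 (r.1, Num.floor r.2) = r.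
    by apply: affV_eq => //=; move: rI; rewrite intrEfloor => /eqP.
  by rewrite (mu_val sc d0 dM) E.
have [us sP _] := sc; apply/esym/eqP/negPn/negP => /(conic_PS sP)[_ _ h].
by rewrite h in rI.
Qed.

(** The coefficient of q^k in the constant term of p mu. *)
Definition Mu p (k : R) : C := \sum_(r <- gsupp p) gcoef p r * muA ((0, k) - r).

Lemma MuE p (k : R) : Mu p k = glift idfun (fun r : @affV R n => muA ((0, k) - r) : C^o) p.
Proof. by []. Qed.

Lemma Mu_bound p (k : R) : exists2 e : R, 0 <= e & forall r, r \in gsupp p -> affdeg ((0, k) - r) <= e.
Proof.
exists (\sum_(r <- gsupp p) `|affdeg ((0, k) - r)|); first exact: sumr_ge0.
move=> r rp; rewrite (bigD1_seq r) ?gsupp_uniq//=.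
by apply: le_trans (ler_norm _) _; rewrite lerDl sumr_ge0.
Qed.

Lemma Mu_val d M s p (k : R) : complete d s -> 0 <= d -> d < M%:R ->
  (forall r, r \in gsupp p -> affdeg ((0, k) - r) <= d) ->
  Mu p k = gcoef (p * PS M s) (0, k).
Proof.
move=> sc d0 dM pdeg; rewrite /Mu gcoef_mul !big_seq; apply: eq_bigr => r /pdeg rd.
by rewrite (muA_val sc d0 dM rd).
Qed.

(** * Invariance of the constant term *)

Section ConstantTerm.
Local Notation mm := (2 * mtilde B)%N.
Variable emb : {rmorphism {poly C} -> K}.
Hypothesis emb_inj : injective emb.
Hypothesis emb_frac : forall z : K, exists pz dz : {poly C}, dz != 0 /\ z = emb pz / emb dz.
Hypothesis emb_qp : forall (k : nat) (e : R), mm%:R * e = k%:R -> qp e = emb 'X^k.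
Hypothesis emb_th : forall a, a \in roots D -> pth pd a ^+ 2 = emb ((tvar D (nu a)) ^+ 2)%:P.

Definition actR x p : LA := glift idfun (fun r : @affV R n => gM LA (aact x r)) p.

Lemma actR_mul x p q : actR x (p * q) = actR x p * actR x q.
Proof. by apply: glift_mul => r r'; rewrite aactD gMD. Qed.

Lemma actRD x p q : actR x (p + q) = actR x p + actR x q.
Proof. exact: gliftD. Qed.

Lemma actR0 x : actR x 0 = 0.
Proof. exact: glift0. Qed.

Lemma actR_gM x r : actR x (gM LA r) = gM LA (aact x r).
Proof. exact: gliftM. Qed.

Lemma actR1 x : actR x 1 = 1.
Proof. by rewrite -(gM0 LA) actR_gM aact0. Qed.

Lemma actR_coef x p r : G x -> gcoef (actR x p) (aact x r) = gcoef p r.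
Proof.
move=> xG; move: p; apply: galgebra_additive_eq => [p q|p q|c s].
- by rewrite /actR gliftD gcoefD.
- exact: gcoefD.
rewrite /actR gliftZ gliftM !gcoefZ !gcoefM; congr (_ * _%:R).
have inj : injective (aact x) by move=> r1 r2 E; rewrite -(aactK r1 xG) E (aactK _ xG).
by rewrite (inj_eq inj).
Qed.

Lemma aactMn x r (m : nat) : aact x (r *+ m) = aact x r *+ m.
Proof. by elim: m => [|m IH]; rewrite ?aact0// !mulrS aactD IH. Qed.

Lemma actR_fac M x r : G x -> actR x (fac M r) = fac M (aact x r).
Proof.
move=> xG; rewrite /fac actR_mul; congr (_ * _).
  by rewrite /actR gliftD -scaleN1r gliftZ scaleN1r gliftM -/(actR x 1) actR1.
rewrite /geo (big_morph (actR x) (actRD x) (actR0 x)); apply: eq_bigr => m _.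
rewrite /actR gliftZ gliftM aactMn; congr (_ ^+ m *: _).
by rewrite /tsq; congr (tvar D _ ^+ 2); rewrite -(nu_W r.1 xG.1).
Qed.

Lemma actR_PS M x (s : seq (@affV R n)) : G x -> actR x (PS M s) = PS M (map (aact x) s).
Proof.
move=> xG; elim: s => [|r s IH]; first by rewrite /PS !big_nil actR1.
by rewrite /PS /= !big_cons actR_mul (actR_fac _ _ xG); congr (_ * _).
Qed.

Lemma archi_lt (e : R) : exists2 N : nat, (0 < N)%N & e < N%:R.
Proof.
exists (Num.bound `|e|).+1 => //; apply: le_lt_trans (ler_norm e) _.
apply: lt_le_trans (archi_boundP (normr_ge0 e)) _; by rewrite ler_nat.
Qed.

Lemma aact_const x (k : R) : aact x (0, k) = (0, k).
Proof. by apply: affV_eq; rewrite /= ?mulmx0// dot0l subr0. Qed.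

(** Choose a complete set whose image under x is complete as well; the two truncations are exchanged
    by x. *)
Lemma muA_Pi x r : in_Pi D B x -> muA (aact x r) = muA r.
Proof.
move=> xP; have xG := in_Pi_G xP; have vP := Pi_inv xP.
pose e := `|affdeg r| + `|affdeg (aact x r)|.
have e0 : 0 <= e by rewrite addr_ge0.
have [N N0 eN] := archi_lt e; have [us sP sc] := SN_complete eN.
pose S := undup (SN N ++ map (aact (ainv x)) (SN N)).
have Sc : complete e S.
  split; first exact: undup_uniq.
    move=> r'; rewrite mem_undup mem_cat => /orP[/sP//|/mapP[r2 /sP r2P ->]].
    exact: Pi_pos vP r2P.
  by move=> r' rP rd; rewrite mem_undup mem_cat sc.
have inj : injective (aact x) by move=> r1 r2 E; rewrite -(aactK r1 xG) E (aactK _ xG).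
have Sc' : complete e (map (aact x) S).
  split; first by rewrite (map_inj_uniq inj) undup_uniq.
    by move=> _ /mapP[r2 r2S ->]; apply: Pi_pos xP _; case: Sc => _ h _; exact: h.
  move=> r' rP rd; apply/mapP; exists (aact (ainv x) r'); last by rewrite (aactVK _ xG).
  by rewrite mem_undup mem_cat map_f ?orbT// sc.
rewrite (muA_val Sc' e0 eN); last by rewrite /e; have := ler_norm (affdeg (aact x r)); have := normr_ge0 (affdeg r); lra.
rewrite (muA_val Sc e0 eN); last by rewrite /e; have := ler_norm (affdeg r); have := normr_ge0 (affdeg (aact x r)); lra.
by rewrite -(actR_PS _ _ xG) (actR_coef _ _ xG).
Qed.

Lemma Mu_gM r (k : R) : Mu (gM LA r) k = muA ((0, k) - r).
Proof. by rewrite MuE gliftM. Qed.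

Lemma MuD p q (k : R) : Mu (p + q) k = Mu p k + Mu q k.
Proof. by rewrite !MuE (@gliftD _ _ LA _ C^o). Qed.

Lemma MuZ (c : C) p (k : R) : Mu (c *: p) k = c * Mu p k.
Proof. by rewrite !MuE (@gliftZ _ _ LA _ C^o). Qed.

Lemma geo_tel M (c : C) r :
  (1 - c *: gM LA r) * geo M c r = 1 - c ^+ M *: gM LA (r *+ M).
Proof.
elim: M => [|M IH]; first by rewrite /geo big_ord0 mulr0 expr0 scale1r mulr0n gM0 subrr.
rewrite /geo big_ord_recr /= mulrDr IH mulrBl mul1r -scalerAl -scalerAr -gMD scalerA -exprS.
by rewrite -mulrS addrA subrK.
Qed.

(** Split off the factor of alpha_i from mu. The rest, taken over an s_i-stable set, is invariant; p
    times the split factor telescopes to X_(s_i(r)) - X_r times 1 minus a multiple of a high power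
    of X_(alpha_i), and that power is invisible in the degrees concerned. *)
Lemma Mu_T i r p q (k : R) : (1 - gM LA (aroot D i)) * q = gM LA (aact (saff D i) r) - gM LA r ->
  p = (1 - tsq (aroot D i) *: gM LA (aroot D i)) * q -> Mu p k = 0.
Proof.
move=> qE pE; have sG := saff_G i; set al_i := aroot D i in qE pE *.
have [e e0 pe] := Mu_bound p k.
have [N N0 eN] := archi_lt e; have [us sP sc] := SN_complete eN.
(* The positive roots other than alpha_i are closed up under s_i, which keeps them positive. *)
pose T1 := [seq r' <- SN N | r' != al_i].
pose S := undup (T1 ++ map (aact (saff D i)) T1).
have T1P r' : r' \in T1 -> affpos D r' /\ r' <> al_i.
  by rewrite mem_filter => /andP[/eqP h1 /sP h2].
have sT1 r' : r' \in T1 -> affpos D (aact (saff D i) r') /\ aact (saff D i) r' <> al_i.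
  move=> /T1P[h1 h2]; split; first exact: affpos_saff.
  move=> E; have := congr1 (aact (saff D i)) E; rewrite saffK saff_root => E2.
  by move: h1; rewrite E2 => /(affposN (aroot_pos i)).
have SP r' : r' \in S -> affpos D r' /\ r' <> al_i.
  by rewrite mem_undup mem_cat => /orP[/T1P//|/mapP[r2 /sT1 h ->]].
have alS : al_i \notin S by apply/negP => /SP[].
have Sc : complete e (al_i :: S).
  split; first by rewrite /= alS undup_uniq.
    by move=> r'; rewrite inE => /orP[/eqP->|/SP[]//]; exact: aroot_pos.
  move=> r' rP rd; rewrite inE; case: eqP => //= /eqP rne.
  by rewrite mem_undup mem_cat mem_filter rne sc.
have inj : injective (aact (saff D i)) by move=> r1 r2 E; rewrite -(saffK i r1) E saffK.
have sS : perm_eq (map (aact (saff D i)) S) S.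
  apply: uniq_perm; rewrite ?(map_inj_uniq inj) ?undup_uniq// => r'.
  apply/mapP/idP => [[r2 r2S ->]|rS].
    move: r2S; rewrite !mem_undup !mem_cat => /orP[h|/mapP[r3 h ->]].
      by rewrite map_f ?orbT.
    by rewrite saffK h.
  exists (aact (saff D i) r'); last by rewrite saffK.
  move: rS; rewrite !mem_undup !mem_cat => /orP[h|/mapP[r3 h ->]].
    by rewrite map_f ?orbT.
  by rewrite saffK h.
(* M is so large that the remainder of the geometric series lies beyond the degrees of both
   coefficients to be compared. *)
have [M M0 eM] := archi_lt (e + `|affdeg ((0, k) - r)| + `|affdeg ((0, k) - aact (saff D i) r)|).
have eM' : e < M%:R by move: eM; have := normr_ge0 (affdeg ((0, k) - r));
  have := normr_ge0 (affdeg ((0, k) - aact (saff D i) r)); lra.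
rewrite (Mu_val Sc e0 eM' pe) /PS big_cons -/(PS M S).
set PP := PS M S.
have Pinv r' : gcoef PP (aact (saff D i) r') = gcoef PP r'.
  rewrite -{1}(_ : actR (saff D i) PP = PP) ?(actR_coef _ _ sG)//.
  by rewrite (actR_PS _ _ sG); exact: perm_big.
have Pc : conic PP by apply: conic_PS => r' /SP[].
have -> : p * (fac M al_i * PP) = (gM LA (aact (saff D i) r) - gM LA r) * PP -
    (tsq al_i) ^+ M *: ((gM LA (aact (saff D i) r + al_i *+ M) - gM LA (r + al_i *+ M)) * PP).
  rewrite pE /fac.
  have -> : (1 - tsq al_i *: gM LA al_i) * q * ((1 - gM LA al_i) * geo M (tsq al_i) al_i * PP) =
      ((1 - gM LA al_i) * q) * ((1 - tsq al_i *: gM LA al_i) * geo M (tsq al_i) al_i) * PP.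
    move: (geo M _ _) => A''; move: (1 - tsq al_i *: _) (1 - gM LA al_i) => A A'.
    by ring.
  rewrite qE geo_tel mulrBr mulr1 mulrBl; congr (_ - _).
  by rewrite -scalerAr -scalerAl !gMD -mulrBl.
rewrite gcoefD gcoefN gcoefZ !mulrBl !gcoefD !gcoefN !gcoef_mulM.
have s0 : (0, k) - aact (saff D i) r = aact (saff D i) ((0, k) - r) by rewrite aactB aact_const.
have dM r' : affdeg r' < M%:R -> gcoef PP (r' - al_i *+ M) = 0.
  move=> h; apply/eqP/negPn/negP => /Pc[hd _ _]; move: hd.
  rewrite affdegD affdegN affdegMn.
  have a1 : affdeg al_i = 1.
    rewrite /al_i /affdeg; case: (i) => [j|] /=; rewrite ?ht_simple; first by rewrite mulr0 addr0.
    by rewrite mulr1 -(scaleN1r (theta D)) htZ mulN1r addrA addNr add0r.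
  by rewrite a1; lra.
rewrite !opprD !addrA !dM ?subrr ?mulr0 ?subr0; last 2 first.
- by move: eM; have := ler_norm (affdeg ((0, k) - r));
    have := normr_ge0 (affdeg ((0, k) - aact (saff D i) r)); lra.
- by move: eM; have := ler_norm (affdeg ((0, k) - aact (saff D i) r));
    have := normr_ge0 (affdeg ((0, k) - r)); lra.
by rewrite s0 Pinv subrr.
Qed.

Local Notation embC := (emb \o polyC : {rmorphism C -> K}).
Definition evA p : KX := glift embC XaffG p.
Definition LamA p : Prop := forall r, gcoef p r != 0 -> Lam r.

Lemma evAD p q : evA (p + q) = evA p + evA q. Proof. exact: gliftD. Qed.
Lemma evAZ (c : C) p : evA (c *: p) = emb c%:P *: evA p. Proof. exact: gliftZ. Qed.
Lemma evA_gM r : evA (gM LA r) = XaffG r. Proof. exact: gliftM. Qed.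

Lemma evAN p : evA (- p) = - evA p.
Proof. by rewrite -scaleN1r evAZ polyCN polyC1 rmorphN1 scaleN1r. Qed.

Lemma evA1 : evA 1 = 1. Proof. by rewrite -(gM0 LA) evA_gM Xaff0. Qed.

Lemma evA_mul p q : LamA p -> LamA q -> evA (p * q) = evA p * evA q.
Proof. by move=> pL qL; apply: (glift_mul_on _ _ pL qL) => r r'; exact: XaffD. Qed.

Lemma LamAD p q : LamA p -> LamA q -> LamA (p + q).
Proof.
move=> pL qL r; rewrite gcoefD; have [->|/pL//] := eqVneq (gcoef p r) 0.
by rewrite add0r => /qL.
Qed.

Lemma LamAZ (c : C) p : LamA p -> LamA (c *: p).
Proof. by move=> pL r; rewrite gcoefZ mulf_eq0 negb_or => /andP[_ /pL]. Qed.

Lemma LamA_gM r : Lam r -> LamA (gM LA r).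
Proof. by move=> rL r'; rewrite gcoefM; case: (eqVneq r r') => [<-//|_]; rewrite eqxx. Qed.

Lemma LamA_mul p q : LamA p -> LamA q -> LamA (p * q).
Proof.
move=> pL qL r; rewrite gcoef_mul => nz.
have [[r' [p0 q0]]|no] := pselect (exists r', gcoef p r' != 0 /\ gcoef q (r - r') != 0).
  by have := LamD (pL _ p0) (qL _ q0); rewrite addrC subrK.
case/eqP: nz; apply: big1 => r' _; apply/eqP; rewrite mulf_eq0 -[_ || _]negbK negb_or.
by apply/negP => /andP[h1 h2]; apply: no; exists r'.
Qed.

Lemma LamA0 : LamA 0. Proof. by move=> r; rewrite gcoef0 eqxx. Qed.

Lemma LamA_sum I (s : seq I) (F : I -> LA) : (forall i, LamA (F i)) -> LamA (\sum_(i <- s) F i).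
Proof. by move=> FL; elim/big_ind: _ => //; [exact: LamA0|exact: LamAD]. Qed.

(* Krel f says that <f mu> = 0: after a denominator d is cleared, f is a            *)
(* polynomial in X and q, whose product with the power series mu has no constant   *)
(* term in X.                                                                      *)
Definition Krel f : Prop := exists p, exists d : {poly C},
  [/\ d != 0, LamA p, emb d *: f = evA p & forall k, Mu p k = 0].

Lemma mm_gt0 : (0 < mm)%N.
Proof. by have [h _] := mtilde_spec; rewrite muln_gt0 h. Qed.

(** The affine vector whose X is the k-th power of q^(1/(2 mtilde)), the variable of {poly C}. *)
Definition vexp (k : nat) : @affV R n := (0, k%:R / mm%:R).

Lemma vexp_Lam k : Lam (vexp k).
Proof.
split; first exact: rpred0.
have m0 : mm%:R != 0 :> R by rewrite pnatr_eq0 -lt0n mm_gt0.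
by rewrite /qint /= mulrC divfK// natr_int.
Qed.

Lemma qp_vexp k : qp (k%:R / mm%:R) = emb 'X^k.
Proof.
have m0 : mm%:R != 0 :> R by rewrite pnatr_eq0 -lt0n mm_gt0.
by apply: emb_qp; rewrite mulrC divfK.
Qed.

Definition polyA (d : {poly C}) : LA := \sum_(i < size d) d`_i *: gM LA (vexp i).

Lemma polyA_Lam (d : {poly C}) : LamA (polyA d).
Proof. by apply: LamA_sum => i; apply: LamAZ; apply: LamA_gM; exact: vexp_Lam. Qed.

Lemma evA_poly (d : {poly C}) : evA (polyA d) = emb d *: 1.
Proof.
rewrite /polyA (big_morph _ evAD (_ : evA 0 = 0)); last exact: glift0.
rewrite -[in RHS](coefK d) poly_def rmorph_sum scaler_suml; apply: eq_bigr => i _.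
rewrite evAZ evA_gM /XaffG /= qp_vexp.
have -> : toB B 0 = 0 by apply: lat_val_inj; rewrite toBK ?lat_val0 ?rpred0.
by rewrite gM0 scalerA -mul_polyC rmorphM.
Qed.

Lemma Mu_shift (e k : R) p : Mu (gM LA (0, e) * p) k = Mu p (k - e).
Proof.
move: p; apply: galgebra_additive_eq => [p q|p q|c r].
- by rewrite mulrDr MuD.
- exact: MuD.
rewrite -scalerAr -gMD !MuZ !Mu_gM; congr (_ * muA _).
by apply: affV_eq; rewrite /= ?opprD ?addrA ?subr0 ?add0r// addrAC.
Qed.

Lemma Mu_poly (d : {poly C}) p (k : R) : (forall k, Mu p k = 0) -> Mu (polyA d * p) k = 0.
Proof.
move=> p0; rewrite /polyA mulr_suml.
have M0 : Mu (0 : LA) k = 0 by rewrite -(scale0r (0 : LA)) MuZ mul0r.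
rewrite (big_morph (fun q => Mu q k) (fun q q' => MuD q q' k) M0) big1// => i _.
by rewrite -scalerAl MuZ Mu_shift p0 mulr0.
Qed.

Lemma KrelD f f' : Krel f -> Krel f' -> Krel (f + f').
Proof.
move=> [p [d [d0 pL pE pM]]] [p' [d' [d'0 p'L p'E p'M]]].
exists (polyA d' * p + polyA d * p'), (d * d'); split.
- exact: mulf_neq0.
- by apply: LamAD; apply: LamA_mul => //; exact: polyA_Lam.
- rewrite evAD !evA_mul ?evA_poly -?pE -?p'E//; try exact: polyA_Lam.
  by rewrite -!scalerAl !mul1r !scalerA scalerDr rmorphM [emb d' * _]mulrC.
by move=> k; rewrite MuD !Mu_poly ?addr0.
Qed.

Lemma KrelZ c f : Krel f -> Krel (c *: f).
Proof.
move=> [p [d [d0 pL pE pM]]]; have [pz [dz [dz0 ->]]] := emb_frac c.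
exists (polyA pz * p), (dz * d); split; first exact: mulf_neq0.
- by apply: LamA_mul => //; exact: polyA_Lam.
- rewrite evA_mul ?evA_poly -?pE//; last exact: polyA_Lam.
  rewrite -scalerAl mul1r !scalerA rmorphM; congr (_ *: _).
  have e0 : emb dz != 0 by rewrite -(rmorph0 emb) (inj_eq emb_inj).
  by rewrite mulrC mulrA divfK.
by move=> k; rewrite Mu_poly.
Qed.

Definition gquotA (k : int) r (s : @affV R n) : LA :=
  match k with
  | Posz k => - \sum_(j < k) gM LA (r - s *+ j.+1)
  | Negz k => \sum_(j < k.+1) gM LA (r + s *+ j)
  end.

Lemma gquotAP (k : int) r (s : @affV R n) :
  (gM LA s - 1) * gquotA k r s = gM LA (r - s *~ k) - gM LA r.
Proof.
case: k => k /=.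
  rewrite -pmulrn; elim: k => [|k IH]; first by rewrite big_ord0 subr0 subrr oppr0 mulr0.
  rewrite big_ord_recr /= opprD mulrDr IH mulrBl mul1r mulrN -gMD.
  have -> : s + (r - s *+ k.+1) = r - s *+ k by rewrite mulrS opprD addrCA addNKr.
  by rewrite opprK; ring.
rewrite NegzE mulrNz opprK -pmulrn; elim: k => [|k IH].
  by rewrite big_ord1 mulr0n addr0 mulrBl mul1r -gMD mulr1n [s + r]addrC.
rewrite big_ord_recr /= mulrDr IH mulrBl mul1r -gMD.
have -> : s + (r + s *+ k.+1) = r + s *+ k.+2 by rewrite addrCA -mulrS.
by ring.
Qed.

Lemma gquotA_Lam (k : int) r (s : @affV R n) : Lam r -> Lam s -> LamA (gquotA k r s).
Proof.
move=> rL sL; case: k => k /=.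
  rewrite -scaleN1r; apply: LamAZ; apply: LamA_sum => j; apply: LamA_gM.
  by apply: LamD => //; exact/LamN/LamMn.
by apply: LamA_sum => j; apply: LamA_gM; apply: LamD => //; exact: LamMn.
Qed.

Lemma Krel_alg c (f1 f2 f3 f4 : KX) : c != 0 -> f1 - f2 = (f3 - 1) * f4 ->
  c *: f1 + (c - c^-1) *: f4 - c *: f2 = - c^-1 *: ((1 - c ^+ 2 *: f3) * f4).
Proof.
move=> t0 E.
have -> : c *: f1 + (c - c^-1) *: f4 - c *: f2 = c *: (f1 - f2) + (c - c^-1) *: f4.
  by rewrite scalerBr addrAC.
rewrite E !mulrBl !mul1r -scalerAl scalerBr (scalerBr (- c^-1)) scalerA.
have -> : - c^-1 * c ^+ 2 = - c by rewrite mulNr expr2 mulKf.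
by rewrite scalerBl !scaleNr opprK addrA subrK addrC.
Qed.

(** On X_b the operator T_i - t_i^(1/2) is -t_i^(-1/2) (1 - t_i X_(alpha_i)) times the quotient of
    X_(s_i(b)) - X_b by X_(alpha_i) - 1, which is the form treated in [Mu_T]. *)
Lemma Krel_T i (F : KX -> KX) f : DL i F -> Krel (F f - thiG i *: f).
Proof.
move=> FD; have [FA FZ _] := FD; rewrite [f]gexpand.
have F0 : F 0 = 0 by rewrite -[X in F X](scale0r 0) FZ scale0r.
rewrite (big_morph F FA F0) scaler_sumr -sumrB.
have K0 : Krel 0.
  exists 0, 1; split; [exact: oner_neq0|exact: LamA0|by rewrite scaler0 /evA glift0|].
  by move=> k; rewrite -(scale0r (0 : LA)) MuZ mul0r.
elim/big_ind: _ => [//|g g'|b _]; first exact: KrelD.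
rewrite FZ scalerA [thiG i * _]mulrC -scalerA -scalerBr; apply: KrelZ.
have aL := Lam_aroot i; pose r : @affV R n := (lat_val b, 0); have rL : Lam r := Lam_lat b.
have [k rk] := apair_int i rL; rewrite -Xaff_B (DL_Xaff FD rL rk).
have t0 := thiG_neq0 i; set gq := gquot k r _.
have gE : XaffG (aact (saff D i) r) - XaffG r = (XaffG (aroot D i) - 1) * gq.
  by rewrite (gquotP _ rL aL) (saff_int rk).
have gAE : evA (gquotA k r (aroot D i)) = gq.
  apply: (Xaroot_reg (i := i)); rewrite -gE.
  have := congr1 evA (gquotAP k r (aroot D i)); rewrite -(saff_int rk).
  have bL : LamA (gM LA (aroot D i) - 1).
    apply: LamAD; first exact: LamA_gM.
    by rewrite -scaleN1r; apply: LamAZ; rewrite -(gM0 LA); exact/LamA_gM/Lam0.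
  by rewrite (evA_mul bL (gquotA_Lam rL aL)) !evAD !evAN evA1 !evA_gM.
set xs := XaffG (aact _ r) in gE *; set x0 := XaffG r in gE *; set xa := XaffG (aroot D i) in gE *.
have -> : thiG i *: xs + kap i *: gq - thiG i *: x0 =
    - (thiG i)^-1 *: ((1 - thiG i ^+ 2 *: xa) * gq).
  exact: (Krel_alg t0 gE).
apply: KrelZ; exists ((1 - tsq (aroot D i) *: gM LA (aroot D i)) * gquotA k r (aroot D i)), 1.
have bL : LamA (1 - tsq (aroot D i) *: gM LA (aroot D i)).
  apply: LamAD; first by rewrite -(gM0 LA); exact/LamA_gM/Lam0.
  by rewrite -scaleN1r; do 2 apply: LamAZ; exact: LamA_gM.
split; [exact: oner_neq0|exact: LamA_mul bL (gquotA_Lam rL aL)| |].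
  rewrite rmorph1 scale1r (evA_mul bL (gquotA_Lam rL aL)) gAE; congr (_ * _).
  rewrite evAD evAN evAZ evA1 evA_gM.
  congr (_ - _ *: _); rewrite /tsq -emb_th; last exact: (aroot_affroot i).1.
  by rewrite -(thiG_act i aone_G) aact1.
move=> k'; set gA := gquotA k r _.
have E : (1 - gM LA (aroot D i)) * (- gA) = gM LA (aact (saff D i) r) - gM LA r.
  by rewrite mulrN -mulNr opprB gquotAP -(saff_int rk).
have := Mu_T k' E erefl; set b' := 1 - _ => M0.
have -> : b' * gA = -1 *: (b' * - gA) by rewrite scaleN1r mulrN opprK.
by rewrite MuZ M0 mulr0.
Qed.

Lemma Krel0 : Krel 0.
Proof.
exists 0, 1; split; [exact: oner_neq0|exact: LamA0|by rewrite scaler0 /evA glift0|].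
by move=> k; rewrite -(scale0r (0 : LA)) MuZ mul0r.
Qed.

Lemma Krel_P x f : in_Pi D B x -> Krel (wactG x f - f).
Proof.
move=> xP; have xG := in_Pi_G xP; move: f; apply: galgebra_ind => [|f f'|c b].
- by rewrite wact0 subr0; exact: Krel0.
- by move=> h1 h2; rewrite wactD opprD addrACA; exact: KrelD.
rewrite wactZ -scalerBr; apply: KrelZ; pose r : @affV R n := (lat_val b, 0).
exists (gM LA (aact x r) - gM LA r), 1; split; first exact: oner_neq0.
- apply: LamAD; first exact: LamA_gM (Lam_act xG (Lam_lat b)).
  by rewrite -scaleN1r; apply: LamAZ; exact: LamA_gM (Lam_lat b).
- by rewrite rmorph1 scale1r evAD evAN !evA_gM Xaff_B wactXp.
move=> k; rewrite MuD -scaleN1r MuZ !Mu_gM mulN1r.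
have -> : (0, k) - aact x r = aact x ((0, k) - r) by rewrite aactB aact_const.
by rewrite (muA_Pi _ xP) subrr.
Qed.

(** * Power series and rationality *)

Local Notation mser := (@mu_ser R n D B).

Lemma pser_mulD (P Q : {poly C}) (s : nat -> C) k :
  pser_mul (P + Q) s k = pser_mul P s k + pser_mul Q s k.
Proof. by rewrite /pser_mul -big_split; apply: eq_bigr => i _; rewrite coefD mulrDl. Qed.

Lemma pser_mul0 (s : nat -> C) k : pser_mul 0 s k = 0.
Proof. by rewrite /pser_mul big1// => i _; rewrite coef0 mul0r. Qed.

Lemma pser_mulN (P : {poly C}) (s : nat -> C) k : pser_mul (- P) s k = - pser_mul P s k.
Proof. by rewrite /pser_mul -sumrN; apply: eq_bigr => i _; rewrite coefN mulNr. Qed.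

(** Up to order l the series may be replaced by a polynomial; associativity is borrowed from
    polynomials in this way. *)
Lemma pser_mul_coef (P : {poly C}) (s : nat -> C) k l : (k <= l)%N ->
  pser_mul P s k = (P * \poly_(j < l.+1) s j)`_k.
Proof.
move=> kl; rewrite coefM; apply: eq_bigr => i _; rewrite coef_poly.
by rewrite ltnS (leq_trans (leq_subr _ _) kl).
Qed.

Lemma pser_mulA (P Q : {poly C}) (s : nat -> C) k :
  pser_mul (P * Q) s k = pser_mul P (pser_mul Q s) k.
Proof.
rewrite (pser_mul_coef _ _ (leqnn k)) -mulrA coefM /pser_mul; apply: eq_bigr => i _.
by rewrite -(pser_mul_coef Q s (leq_subr i k)).
Qed.

Lemma pser_mulXn (c : C) (m : nat) (s : nat -> C) k :
  pser_mul (c *: 'X^m) s k = c * (if (m <= k)%N then s (k - m)%N else 0).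
Proof.
rewrite /pser_mul; case: leqP => mk; last first.
  rewrite mulr0 big1// => i _; rewrite coefZ coefXn.
  by case: eqP => [e|_]; [have := ltn_ord i; rewrite e ltnS leqNgt mk|rewrite mulr0 mul0r].
have mk' : (m < k.+1)%N by rewrite ltnS.
rewrite (bigD1 (Ordinal mk'))//= coefZ coefXn eqxx mulr1 big1 ?addr0// => i im.
rewrite coefZ coefXn; case: eqP => [e|_]; last by rewrite mulr0 mul0r.
by case/eqP: im; apply: val_inj.
Qed.

Lemma mu00 : mu D (0, 0) = 1.
Proof.
have [N N0 eN] := archi_lt 0; have Sc := SN_complete eN.
have E0 : iota2 ((0, 0) : 'cV[R]_n * int) = 0 by [].
rewrite (mu_val Sc (lexx 0) eN) ?E0 ?affdeg0//.
have [_ sP _] := Sc; rewrite (PS_trunc sP N0 (_ : affdeg 0 <= 0)) ?affdeg0//.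
rewrite (_ : [seq r <- SN N | affdeg r <= 0] = [::]) ?/PS ?big_nil ?gcoef1 ?eqxx//.
apply/eqP; rewrite -[_ == _]negbK -has_filter; apply/negP => /hasP[r /sP/affdeg_ge1].
by move=> h1 h2; lra.
Qed.

Lemma mser00 : mser 0 0%N = 1.
Proof. by rewrite /mu_ser dvdn0 div0n mu00. Qed.

Lemma pser_reg (P : {poly C}) (s : nat -> C) : s 0%N = 1 ->
  (forall k, pser_mul P s k = 0) -> P = 0.
Proof.
move=> s0 Ps; apply/polyP => k; rewrite coef0; elim/ltn_ind: k => k IH.
have := Ps k; rewrite /pser_mul big_ord_recr /= subnn s0 mulr1 big1 ?add0r//.
by move=> i _; rewrite IH ?mul0r.
Qed.

Lemma mu_neg a (j : int) : j < 0 -> mu D (a, j) = 0.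
Proof.
move=> j0; pose e := `|affdeg (iota2 (a, j))|.
have [N N0 eN] := archi_lt e; have Sc := SN_complete eN; have [_ sP _] := Sc.
rewrite (mu_val Sc (normr_ge0 _) eN) ?ler_norm//.
apply/eqP/negPn/negP => /(conic_PS sP)[_ h _]; move: h; rewrite /= ler0z.
by rewrite leNgt j0.
Qed.

(** A factor q^N makes all exponents of q nonnegative. Sorting the terms by their weight in B then
    turns the vanishing of all [Mu] into one identity of power series in q^(1/(2 mtilde)). *)
Lemma Krel_pser f : Krel f -> exists2 d : {poly C}, d != 0 &
  exists s : seq (lat B), exists P : lat B -> {poly C},
  [/\ uniq s, forall b : lat B, b \notin s -> P b = 0,
   forall b : lat B, emb (P b) = emb d * gcoef f b &
      forall k, \sum_(b <- s) pser_mul (P b) (mser (- lat_val b)) k = 0].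
Proof.
move=> [p [d [d0 pL pE pM]]].
have m0 : mm%:R != 0 :> R by rewrite pnatr_eq0 -lt0n mm_gt0.
have [N N0 Np] : exists2 N : nat, (0 < N)%N & forall r, r \in gsupp p -> 0 <= r.2 + N%:R.
  have [N N0 hN] := archi_lt (\sum_(r <- gsupp p) `|r.2|); exists N => // r rp.
  have : `|r.2| <= \sum_(r <- gsupp p) `|r.2|.
    by rewrite (bigD1_seq r) ?gsupp_uniq//= lerDl sumr_ge0.
  by have := ler_norm (- r.2); rewrite normrN; lra.
pose ex (r : @affV R n) : nat := Num.truncn (mm%:R * (r.2 + N%:R)).
have exE r : r \in gsupp p -> (ex r)%:R = mm%:R * (r.2 + N%:R).
  move=> rp; have h0 := Np r rp; rewrite gsuppE in rp; have [_ rq] := pL r rp.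
  apply/eqP; rewrite -natrEtruncn natrEint mulr_ge0 ?ler0n// andbT.
  by rewrite mulrDr rpredD// -natrM natr_int.
pose P (b : lat B) := \sum_(r <- gsupp p | toB B r.1 == b) gcoef p r *: 'X^(ex r).
exists (d * 'X^(mm * N)); first by rewrite mulf_neq0// monic_neq0 ?monicXn.
exists (undup [seq toB B r.1 | r <- gsupp p]), P; split; first exact: undup_uniq.
- move=> b; rewrite mem_undup => bs; rewrite /P big_seq_cond big1// => r /andP[rp /eqP e].
  by case/negP: bs; rewrite -e; apply: map_f.
- move=> b; have -> : emb (d * 'X^(mm * N)) = emb d * qp N%:R.
    by rewrite rmorphM (@emb_qp (mm * N)%N N%:R)// -natrM.
 
  rewrite mulrAC -gcoefZ pE /evA /glift gcoef_sum /P rmorph_sum big_mkcond mulr_suml /= !big_seq.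
  apply: eq_bigr => r rp; have rL : Lam r by apply: pL; rewrite -gsuppE.
  rewrite gcoefZ /XaffG gcoefZ gcoefM; case: eqP => _; last by rewrite !mulr0 mul0r.
  rewrite mulr1 -mul_polyC rmorphM -mulrA; congr (_ * _).
  rewrite -(emb_qp (k := ex r) (e := r.2 + N%:R)); last by rewrite exE.
  by rewrite (pqpD pd rL.2)//; exact: qint_int (natr_int _ _).
move=> k; rewrite -[RHS](pM (k%:R / mm%:R - N%:R)) /Mu.
transitivity (\sum_(b <- undup [seq toB B r.1 | r <- gsupp p])
    \sum_(r <- gsupp p | toB B r.1 == b) gcoef p r *
      (if (ex r <= k)%N then mser (- lat_val b) (k - ex r)%N else 0)).
  apply: eq_bigr => b _; rewrite /P.
  rewrite (big_morph (fun Q => pser_mul Q (mser (- lat_val b)) k)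
    (fun Q Q' => pser_mulD Q Q' _ k) (pser_mul0 _ k)).
  by apply: eq_bigr => r _; exact: pser_mulXn.
rewrite (exchange_big_dep xpredT)//= !big_seq; apply: eq_bigr => r rp.
have rL : Lam r by apply: pL; rewrite -gsuppE.
have h1 : toB B r.1 \in undup [seq toB B r0.1 | r0 <- gsupp p].
  by rewrite mem_undup; apply/mapP; exists r.
rewrite big_mkcond (bigD1_seq (toB B r.1) h1 (undup_uniq _)) eqxx.
rewrite big1 ?addr0 => [|b bne]; last by rewrite eq_sym (negPf bne).
apply: etrans (addr0 _) _; congr (_ * _); rewrite (toBK rL.1) /muA /= sub0r.
have eE := exE r rp; set e2 := k%:R / mm%:R - N%:R - r.2.
have e2E : mm%:R * e2 = k%:R - (ex r)%:R.
  by rewrite eE /e2 !mulrBr mulrCA divff// mulr1 mulrDr opprD addrA addrAC.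
(* A negative exponent contributes 0 on both sides, since mu has no negative powers of q; below, so
   does a nonintegral one. *)
case: leqP => ek; last first.
  case: ifP => // e2I; rewrite mu_neg//.
  have : e2 < 0.
    by rewrite -(pmulr_rlt0 _ (_ : 0 < mm%:R)) ?ltr0n ?mm_gt0// e2E subr_lt0 ltr_nat.
  by move: e2I; rewrite intrEfloor => /eqP E; rewrite -[X in X < 0]E ltrz0.
rewrite -natrB// in e2E; rewrite /mu_ser; case: ifP => [/dvdnP[l lE]|ndv].
  have e2l : e2 = (Posz l)%:~R.
    by apply: (mulfI m0); rewrite e2E lE mulnC natrM.
  by rewrite e2l intr_int intrKfloor lE mulnK ?mm_gt0.
case: ifP => // e2I; case/negP: (negbT ndv).
have e20 : 0 <= e2.
  by rewrite -(pmulr_rge0 _ (_ : 0 < mm%:R)) ?ltr0n ?mm_gt0// e2E ler0n.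
have : e2 \is a Num.nat by rewrite natrEint e2I.
move=> /natrP[l lE]; apply/dvdnP; exists l; apply/eqP; rewrite mulnC -(eqr_nat R) -e2E lE.
by rewrite -natrM.
Qed.

Definition ratio a c : Prop := exists P d : {poly C}, [/\ d != 0, c = emb P / emb d &
  pser_mul d (mser a) =1 pser_mul P (mser 0)].

Lemma emb_neq0 (d : {poly C}) : d != 0 -> emb d != 0.
Proof. by move=> d0; rewrite -(rmorph0 emb) (inj_eq emb_inj). Qed.

(** The series <mu> begins with 1, so a polynomial that annihilates it is zero. *)
Lemma ratio_unique a c c' : ratio a c -> ratio a c' -> c = c'.
Proof.
move=> [P [d [d0 -> E]]] [P' [d' [d'0 -> E']]].
apply/eqP; rewrite eqr_div ?emb_neq0// -!rmorphM (inj_eq emb_inj) -subr_eq0; apply/eqP.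
apply: (pser_reg mser00) => k; rewrite pser_mulD pser_mulN.
rewrite [P * d']mulrC [P' * d]mulrC !pser_mulA.
have e1 : pser_mul P (mser 0) = pser_mul d (mser a) by apply/funext => j; rewrite E.
have e2 : pser_mul P' (mser 0) = pser_mul d' (mser a) by apply/funext => j; rewrite E'.
by rewrite e1 e2 -!pser_mulA mulrC subrr.
Qed.

Lemma Krel_scalar c : Krel (c *: 1) -> c = 0.
Proof.
move=> /Krel_pser[d d0 [s [P [us Ps PE PM]]]].
have P1 (b : lat B) : b != 0 -> P b = 0.
  move=> b0; apply: emb_inj; rewrite PE gcoefZ -(gM0 KX) gcoefM eq_sym (negPf b0).
  by rewrite !mulr0 rmorph0.
have P0 : P 0 = 0.
  apply: (pser_reg mser00) => k; have [s0|s0] := boolP ((0 : lat B) \in s); last first.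
    by rewrite Ps// pser_mul0.
  have E0 : mser (- lat_val (0 : lat B)) = mser 0 by rewrite lat_val0 oppr0.
  rewrite -E0 -[RHS](PM k) (bigD1_seq 0 s0 us) /= big1 ?addr0// => b b0.
  by rewrite P1// pser_mul0.
have := PE 0; rewrite P0 rmorph0 gcoefZ -(gM0 KX) gcoefM eqxx mulr1 => /esym/eqP.
by rewrite mulf_eq0 (negPf (emb_neq0 d0)) => /eqP.
Qed.

(** The relation reads <X_b mu> = c <mu>. This is where the coefficients of mu / <mu> become
    rational functions. *)
Lemma Krel_ratio (b : lat B) c : Krel (XpG b - c *: 1) -> ratio (- lat_val b) c.
Proof.
have [-> h|b0] := eqVneq b 0.
  have -> : c = 1.
    apply/eqP; rewrite eq_sym -subr_eq0; apply/eqP/Krel_scalar.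
    by rewrite scalerBl scale1r; move: h; rewrite (gM0 KX).
  exists 1, 1; split; [exact: oner_neq0|by rewrite rmorph1 divr1|].
  by move=> k; rewrite lat_val0 oppr0.
move=> /Krel_pser[d d0 [s [P [us Ps PE PM]]]].
have gE (b' : lat B) : gcoef (XpG b - c *: 1) b' = (b == b')%:R - c * (0 == b')%:R.
  by rewrite gcoefD gcoefN gcoefZ -(gM0 KX) !gcoefM.
have P1 (b' : lat B) : b' != 0 -> b' != b -> P b' = 0.
  move=> h1 h2; apply: emb_inj; rewrite PE gE eq_sym (negPf h2) eq_sym (negPf h1).
  by rewrite mulr0 subrr mulr0 rmorph0.
have Pb : P b = d.
  by apply: emb_inj; rewrite PE gE eqxx eq_sym (negPf b0) mulr0 subr0 mulr1.
have P0 : emb (P 0) = - (emb d * c).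
  by rewrite PE gE (negPf b0) eqxx mulr1 sub0r mulrN.
exists (- P 0), d; split=> //.
  by rewrite rmorphN P0 opprK mulrC mulKf ?emb_neq0.
move=> k; rewrite pser_mulN; apply/eqP; rewrite -addr_eq0; apply/eqP.
have bs : b \in s by apply: contraNT d0 => /Ps; rewrite Pb => ->.
have := PM k; rewrite (bigD1_seq b)//= Pb => E.
rewrite -[RHS]E; congr (_ + _).
have [s0|s0] := boolP ((0 : lat B) \in s); last first.
  rewrite Ps// pser_mul0 big1_seq// => b' /andP[h1 h2]; rewrite P1 ?pser_mul0//.
  by apply: contraNneq s0 => <-.
have E0 : mser (- lat_val (0 : lat B)) = mser 0 by rewrite lat_val0 oppr0.
rewrite -E0 (big_rem _ s0) /= eq_sym b0 big1_seq ?addr0// => b' /andP[h1].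
rewrite mem_rem_uniq// inE => /andP[h2 _].
by rewrite P1 ?pser_mul0.
Qed.

Section Normalized.
Hypothesis Krel_all : forall f, exists c, Krel (f - c *: 1).
Variable mc : 'cV[R]_n -> K.
Hypothesis mcP : forall a, (exists c, ratio a c) -> ratio a (mc a).
Definition ctG f : K := \sum_(b <- gsupp f) gcoef f b * mc (- lat_val b).

Lemma ctGE f : ctG f = glift idfun (fun b : lat B => mc (- lat_val b) : K^o) f.
Proof. by []. Qed.

Lemma ctGD f f' : ctG (f + f') = ctG f + ctG f'.
Proof. by rewrite !ctGE (@gliftD _ _ KX _ K^o). Qed.

Lemma ctGZ c f : ctG (c *: f) = c * ctG f.
Proof. by rewrite !ctGE (@gliftZ _ _ KX _ K^o). Qed.

Lemma Krel_mc (b : lat B) : Krel (XpG b - mc (- lat_val b) *: 1).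
Proof.
have [c h] := Krel_all (XpG b); have r := Krel_ratio h.
by rewrite (ratio_unique (mcP (ex_intro _ c r)) r).
Qed.

Lemma Krel_ctG f : Krel (f - ctG f *: 1).
Proof.
move: f; apply: galgebra_ind => [|f f' h h'|c b].
- have -> : ctG 0 = 0 by rewrite -(scale0r (0 : KX)) ctGZ mul0r.
  by rewrite scale0r subr0; exact: Krel0.
- by rewrite ctGD scalerDl opprD addrACA; exact: KrelD.
rewrite ctGZ -scalerA -scalerBr; apply: KrelZ.
have -> : ctG (XpG b) = mc (- lat_val b) by rewrite ctGE (@gliftM _ _ KX _ K^o).
exact: Krel_mc.
Qed.

Lemma ctG_Krel f : Krel f -> ctG f = 0.
Proof.
move=> h; apply: Krel_scalar; have h2 := KrelD h (KrelZ (-1) (Krel_ctG f)).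
by rewrite scaleN1r opprB addrC subrK in h2.
Qed.

Lemma ctG1 : ctG 1 = 1.
Proof.
apply/eqP; rewrite eq_sym -subr_eq0; apply/eqP/Krel_scalar.
by rewrite scalerBl scale1r; exact: Krel_ctG.
Qed.

Lemma ctG_T i (F : KX -> KX) f : DL i F -> ctG (F f) = thiG i * ctG f.
Proof.
move=> FD; have := ctG_Krel (Krel_T f FD); rewrite -scaleNr ctGD ctGZ mulNr => /eqP.
by rewrite subr_eq0 => /eqP.
Qed.

Lemma ctG_P x f : in_Pi D B x -> ctG (wactG x f) = ctG f.
Proof.
move=> xP; have := ctG_Krel (Krel_P f xP); rewrite -scaleN1r ctGD ctGZ mulN1r => /eqP.
by rewrite subr_eq0 => /eqP.
Qed.

End Normalized.

End ConstantTerm.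

End LaurentSeries.

Lemma ebas_mac (b : lat B) f : is_macG b f -> (evalG f)^-1 *: f = ebas b.
Proof.
move=> fm; rewrite (is_macG_unique fm (is_macG_ebas b)) eval_rhoZ (ebasP b).1 mulr1 scalerA.
by rewrite invrK divff ?scale1r// (ebas_lead b).1.
Qed.

Lemma ebas_word (E : seq (@aidx n) -> KX -> Prop) (b : lat B) p w : E [::] 1 ->
  (forall i w f (y : K), E w f -> f != 0 ->
    act (eps (XHG (XaffG (aroot D i)))) f = y *: f -> y != 1 -> phiG i y != 0 ->
    E (i :: w) ((phiG i y)^-1 *: PhiG i y f)) ->
  reduced D B (piel D (lat_val b)) p w -> exists2 e, E w e & ebas b = act (eps (gP p)) e.
Proof.
move=> E0 E1 red; have [f [fE fc f1]] := intertwiner_exists E0 E1 red.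
by exists f => //; rewrite (ychar_ebas fc f1).
Qed.

(** Both sides vanish on T_i(f) - t_i^(1/2) f and on pi(f) - f and agree at 1, so [span_invariants]
    yields the star-symmetry of mu_circ. *)
Lemma L_star f : L (starG f) = star (L f).
Proof.
have [] := @span_invariants (fun f => L (starG f) = star (L f)) _ _ _ _ f.
- by move=> f1 f2 E1 E2; rewrite starXD !LD rmorphD E1 E2.
- by move=> c f1 E1; rewrite starXZ !LZ rmorphM E1.
- move=> i f1; rewrite starXB starXZ (DL_inv _ (act_DL i)) star_thiG.
  rewrite -!scaleNr !LD !LZ LT LT /kap.
  by rewrite -!mulrDl opprB (addrCA (thiG i)) !subrr addr0 subrr !mul0r rmorph0.
- move=> p f1 pP; rewrite starXB (starX_wactG _ (in_Pi_G pP)) -!scaleN1r !LD !LZ !LP//.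
  by rewrite !mulN1r !subrr rmorph0.
move=> c; rewrite starXB starXZ starX1 -!scaleN1r !LD !LZ L1 rmorphD !rmorphM rmorphN1 rmorph1.
by move=> /addIr.
Qed.

(** * The transforms *)

Section Transform.
Variable F : lmodType K.
Variable fc : F -> lat B -> K.
Implicit Types (t : F).
Hypothesis fcL : forall c t t' (b : lat B), fc (c *: t + t') b = c * fc t b + fc t' b.
Hypothesis fc_inj : forall t t', (forall b : lat B, fc t b = fc t' b) -> t = t'.
Hypothesis fc_mk : forall (s : seq (lat B)) (d : lat B -> K), uniq s ->
  (forall b : lat B, b \notin s -> d b = 0) -> exists t, forall b : lat B, fc t b = d b.
Variable pairT : F -> F -> K.
Hypothesis pairTE : forall t t' (s : seq (lat B)), uniq s ->
  (forall b : lat B, b \notin s -> fc t b = 0) ->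
  pairT t t' = \sum_(b <- s) mubG (piel D (lat_val b)) * fc t b * star (fc t' b).
Variable delta : lat B -> F.
Hypothesis deltaE : forall b c : lat B,
  fc (delta c) b = (mubG (piel D (lat_val c)))^-1 *+ (b == c).
Variable actF : H -> F -> F.
Hypothesis actF1 : forall t, actF 1 t = t.
Hypothesis actFM : forall (h k : H) t, actF (h * k) t = actF h (actF k t).
Hypothesis actFl : forall c (h k : H) t, actF (c *: h + k) t = c *: actF h t + actF k t.
Hypothesis actFr : forall c (h : H) t t', actF h (c *: t + t') = c *: actF h t + actF h t'.
Hypothesis actFX : forall (a b : lat B) t,
  fc (actF (gX a) t) b = qsharpG (lat_val a) (lat_val b) * fc t b.
Hypothesis actFP : forall p (b c : lat B) t, in_Pi D B p ->
  amul (ainv p) (piel D (lat_val b)) = piel D (lat_val c) -> fc (actF (gP p) t) b = fc t c.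
Hypothesis actFT_in : forall i (b c : lat B) t, let x := piel D (lat_val b) in
  let e := evG (aact (ainv x) (aroot D i)) in amul (saff D i) x = piel D (lat_val c) ->
  fc (actF (gT i) t) b = (thiG i * e - (thiG i)^-1) / (e - 1) * fc t c - kap i / (e - 1) * fc t b.
Hypothesis actFT_out : forall i (b : lat B) t, let x := piel D (lat_val b) in
  let e := evG (aact (ainv x) (aroot D i)) in
  (forall c : lat B, amul (saff D i) x <> piel D (lat_val c)) ->
  fc (actF (gT i) t) b = - (kap i / (e - 1) * fc t b).
Hypothesis generated : forall Q : H -> Prop, Q 1 -> (forall h k : H, Q h -> Q k -> Q (h + k)) ->
  (forall h k : H, Q h -> Q k -> Q (h * k)) -> (forall c (h : H), Q h -> Q (c *: h)) ->
  (forall i, Q (gT i)) -> (forall b : lat B, Q (gX b)) ->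
  (forall p, in_Pi D B p -> Q (gP p)) -> forall h : H, Q h.
Hypothesis epsK : forall h : H, eps (eps h) = h.
Variable eta : {rmorphism H -> H}.
Hypothesis etaZ : forall c (h : H), eta (c *: h) = star c *: eta h.
Hypothesis etaT : forall i, eta (gT i) = hinvG (gT i).
Hypothesis etaX : forall b : lat B, eta (gX b) = gX (- b).
Hypothesis etaP : forall p, in_Pi D B p -> eta (gP p) = gP p.

(** The values are finitely supported because f is a finite combination of the E_b, which are
    orthogonal. *)
Lemma psi_exists : exists psi : KX -> F, forall f (b : lat B), fc (psi f) b = pairG (ebas b) f.
Proof.
have ex f : exists t, forall b : lat B, fc t b = pairG (ebas b) f.
  by have [s [us sP _]] := Psi_expand f; have [t tE] := fc_mk us sP; exists t.
by have [psi psiE] := boolp.choice ex; exists psi.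
Qed.

Variable psi : KX -> F.
Hypothesis psiE : forall f (b : lat B), fc (psi f) b = pairG (ebas b) f.

Lemma psi_linear c f f' : psi (c *: f + f') = star c *: psi f + psi f'.
Proof. by apply: fc_inj => b; rewrite fcL !psiE pairDr pairZr. Qed.

Lemma psiD f f' : psi (f + f') = psi f + psi f'.
Proof. by rewrite -[f in LHS]scale1r psi_linear rmorph1 scale1r. Qed.

Lemma psi0 : psi 0 = 0.
Proof. by apply: (addIr (psi 0)); rewrite -psiD addr0 add0r. Qed.

Lemma psiZ c f : psi (c *: f) = star c *: psi f.
Proof. by rewrite -[_ *: f]addr0 psi_linear psi0 addr0. Qed.

Lemma psi_unitary f f' : pairT (psi f) (psi f') = star (pairG f f').
Proof.
have [s [us sP fE]] := Psi_expand f.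
rewrite (pair_Psi f' fE) (pairTE _ us) => [|b bs]; last by rewrite psiE; exact: sP.
by apply: eq_bigr => b _; rewrite !psiE.
Qed.

Lemma psi_act (h : H) f : psi (act h f) = actF (eps h) (psi f).
Proof.
(* As eps is an involution, it suffices to treat the operators eps(h) for h a generator, whose
   adjoints on the E_b are known. *)
rewrite -{1}[h]epsK; move: (eps h) f; apply: generated.
- by move=> f; rewrite rmorph1 act1 actF1.
- move=> h1 h2 E1 E2 f; rewrite rmorphD actDl psiD E1 E2.
  by rewrite -[h1 in RHS]scale1r actFl scale1r.
- by move=> h1 h2 E1 E2 f; rewrite rmorphM actM actFM E1 E2.
- move=> c h1 E1 f; rewrite epsZ actZl psiZ pstarK E1.
  have a0 t : actF 0 t = 0.
    have := actFl 1 0 0 t; rewrite scaler0 addr0 scale1r => E.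
    by apply: (addIr (actF 0 t)); rewrite -E add0r.
  by rewrite -[c *: h1]addr0 actFl a0 addr0.
- move=> i f; apply: fc_inj => b; rewrite psiE.
  have [[c cE]|no] := pselect (exists c : lat B,
      amul (saff D i) (piel D (lat_val b)) = piel D (lat_val c)).
    by rewrite (actFT_in _ cE) !psiE; exact: Psi_T_in.
  have no' (c : lat B) : amul (saff D i) (piel D (lat_val b)) <> piel D (lat_val c).
    by move=> E; apply: no; exists c.
  by rewrite (actFT_out _ no') psiE; exact: Psi_T_out.
- by move=> a f; apply: fc_inj => b; rewrite epsX actFX !psiE; exact: Psi_Y.
move=> p pP f; apply: fc_inj => b; have [c cE] := Pi_piel b (Pi_inv pP).
by rewrite (actFP _ pP cE) !psiE; exact: Psi_P.
Qed.

Lemma psi_ebas (b : lat B) : psi (ebas b) = delta b.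
Proof.
apply: fc_inj => c; rewrite psiE deltaE -[LHS]/(Psi (ebas b) c) Psi_ebas.
have [->|//] := eqVneq c b; congr (_ *+ _).
have m := nrm_mub b; have m0 : mubG (piel D (lat_val b)) != 0.
  by apply: contra_eq_neq m => ->; rewrite mulr0 eq_sym oner_eq0.
by apply: (mulIf m0); rewrite m mulVf.
Qed.

Lemma psi_sum (s : seq (lat B)) (d : lat B -> K) :
  psi (\sum_(b <- s) d b *: ebas b) = \sum_(b <- s) star (d b) *: delta b.
Proof.
rewrite (big_morph psi psiD psi0); apply: eq_bigr => b _.
by rewrite psiZ psi_ebas.
Qed.

Lemma starG_act (h : H) f : starG (act h f) = act (eta h) (starG f).
Proof.
move: h f; apply: generated.
- by move=> f; rewrite rmorph1 !act1.
- by move=> h1 h2 E1 E2 f; rewrite rmorphD !actDl starXD E1 E2.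
- by move=> h1 h2 E1 E2 f; rewrite rmorphM !actM E1 E2.
- by move=> c h1 E1 f; rewrite etaZ !actZl starXZ E1.
- move=> i f; have [e1 e2] := TTinv i.
  by rewrite etaT (hinvGE e2 e1) act_Tinv (DL_inv _ (act_DL i)).
- move=> b f; rewrite etaX !actX starXM; congr (_ * _).
  by rewrite -[X in starG X]scale1r starXU rmorph1 scale1r.
by move=> p pP f; rewrite (etaP pP) !actP// starX_wactG//; exact: in_Pi_G.
Qed.

Let phi f := psi (starG f).

Lemma phi_linear c f f' : phi (c *: f + f') = c *: phi f + phi f'.
Proof. by rewrite /phi starXD starXZ psi_linear pstarK. Qed.

Lemma phi_coord f (b : lat B) : fc (phi f) b = L (f * ebas b).
Proof. by rewrite psiE /pairG starXK mulrC. Qed.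

Lemma phi_unitary f f' : pairT (phi f) (phi f') = pairG f f'.
Proof. by rewrite psi_unitary /pairG -starXM L_star pstarK. Qed.

Lemma phi_act (h : H) f : phi (act h f) = actF (eps (eta h)) (phi f).
Proof. by rewrite /phi starG_act psi_act. Qed.

Lemma star_tw0G : star tw0G = tw0G^-1.
Proof. by rewrite rmorph_prod -prodfV; apply: eq_bigr => a _; exact: pstar_th. Qed.

(** psi is semilinear, so the scalar of [star_ebas] is inverted, and eps sends T_(w_0) to its
    inverse. *)
Lemma phi_ebas (b : lat B) : phi (ebas b) =
  tw0G *: actF (hinvG (telG (lin (w0 D)))) (delta (toB B (- (w0 D *m lat_val b)))).
Proof.
have wB : - (w0 D *m lat_val b) \in B by rewrite rpredN; apply: B_W (w0_W) (lat_mem b).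
rewrite /phi (star_ebas (toBK wB)) psiZ fmorphV star_tw0G invrK psi_act psi_ebas.
by rewrite eps_w0.
Qed.

Lemma phi_sum (s : seq (lat B)) (d : lat B -> K) :
  phi (\sum_(b <- s) d b *: ebas b) = \sum_(b <- s) (d b * tw0G) *:
    actF (hinvG (telG (lin (w0 D)))) (delta (toB B (- (w0 D *m lat_val b)))).
Proof.
have p0 : phi 0 = 0 by rewrite /phi starX0 psi0.
have pD : {morph phi : f f' / f + f'} by move=> f f'; rewrite /phi starXD psiD.
rewrite (big_morph phi pD p0); apply: eq_bigr => b _.
by rewrite -scalerA -phi_ebas -[_ *: ebas b]addr0 phi_linear p0 addr0.
Qed.

End Transform.

End Hecke.

End AbstractParameters.

End AffineWeylGroup.

(** * Generation of the algebra by the T_i, the X_b and Pi *)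

Section GeneratedByRelations.
Context {R : realType} {n : nat} (D : rootSystem R n) (B : zmodClosed 'cV[R]_n).
Hypothesis QB : forall v, in_Q D v -> v \in B.
Hypothesis BP : forall v, v \in B -> in_P D v.
Variable H : daha D B.
Variable Q : H -> Prop.
Hypothesis Q1 : Q 1.
Hypothesis QD : forall h k : H, Q h -> Q k -> Q (h + k).
Hypothesis QM : forall h k : H, Q h -> Q k -> Q (h * k).
Hypothesis QZ : forall (c : Kqt D) (h : H), Q h -> Q (c *: h).
Hypothesis QT : forall i, Q (gT H i).
Hypothesis QX : forall b, Q (gX H b).
Hypothesis QP : forall x, in_Pi D B x -> Q (gP H x).

Definition gen_mem : {pred H} := fun h => `[< Q h >].

Lemma gen_memP h : reflect (Q h) (h \in gen_mem).
Proof. exact: asboolP. Qed.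

Lemma gen_closed : GRing.subalg_closed gen_mem.
Proof.
split; first exact/gen_memP.
  by move=> c h k /gen_memP hQ /gen_memP kQ; apply/gen_memP/QD => //; exact: QZ.
by move=> h k /gen_memP hQ /gen_memP kQ; apply/gen_memP/QM.
Qed.

HB.instance Definition _ :=
  GRing.isSubalgClosed.Build (Kqt D) H gen_mem (GRing.subalg_closed_semi gen_closed).

Record gensub := GenSub { genval :> halg H; genvalP : genval \in gen_mem }.
HB.instance Definition _ := [isSub for genval].
HB.instance Definition _ := [Choice of gensub by <:].
HB.instance Definition _ := [SubChoice_isSubAlgebra of gensub by <:].

Let sT i : gensub := insubd (0 : gensub) (gT H i).
Let sX b : gensub := insubd (0 : gensub) (gX H b).
Let sP x : gensub := insubd (0 : gensub) (gP H x).
Definition genv (h : gensub) : halg H := val h.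
HB.instance Definition _ := GRing.RMorphism.copy genv (val : gensub -> halg H).
HB.instance Definition _ := GRing.Linear.copy genv (val : gensub -> halg H).

Lemma genvM (h k : gensub) : genv (h * k) = genv h * genv k.
Proof. exact: (rmorphM (genv : {rmorphism gensub -> halg H})). Qed.

Lemma genvD (h k : gensub) : genv (h + k) = genv h + genv k.
Proof. exact: (raddfD (genv : {linear gensub -> halg H})). Qed.

Lemma genvB (h k : gensub) : genv (h - k) = genv h - genv k.
Proof. exact: (raddfB (genv : {linear gensub -> halg H})). Qed.

Lemma genvZ (c : Kqt D) (h : gensub) : genv (c *: h) = c *: genv h.
Proof. by rewrite linearZ. Qed.

Lemma genv1 : genv 1 = 1.
Proof. exact: (rmorph1 (genv : {rmorphism gensub -> halg H})). Qed.

Lemma genv0 : genv 0 = 0.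
Proof. exact: (raddf0 (genv : {linear gensub -> halg H})). Qed.

Lemma val_sT i : genv (sT i) = gT H i.
Proof. by apply: insubdK; exact/gen_memP. Qed.

Lemma val_sX b : genv (sX b) = gX H b.
Proof. by apply: insubdK; exact/gen_memP. Qed.

Lemma val_sP x : in_Pi D B x -> genv (sP x) = gP H x.
Proof. by move=> xP; apply: insubdK; exact/gen_memP/QP. Qed.

Lemma val_altprod m i j : genv (altprod sT m i j) = altprod (gT H) m i j.
Proof.
by elim: m i j => [|m IH] i j /=; rewrite ?genv1// genvM IH val_sT.
Qed.

Lemma val_XH f : genv (XH sX f) = XH (gX H) f.
Proof.
rewrite /XH (big_morph genv genvD genv0); apply: eq_bigr => b _.
by rewrite genvZ val_sX.
Qed.

Lemma gensub_rel : daha_rel sT sX sP.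
Proof.
have rl := daha_relP H; have vi : injective genv by exact: val_inj.
split.
- move=> i; apply: vi; rewrite genvM genvB genvD !genvZ genv1 genv0 val_sT.
  exact: (rel_quad rl).
- by move=> i j m ij o; apply: vi; rewrite !val_altprod; exact: (rel_braid rl).
- by apply: vi; rewrite val_sX genv1; exact: (rel_X0 rl).
- by move=> b c; apply: vi; rewrite genvM !val_sX; exact: (rel_XD rl).
- have P1 : in_Pi D B aone.
    split; last exact: len1.
    by split; [exists [::]|exact: rpred0].
  by apply: vi; rewrite (val_sP P1) genv1; exact: (rel_P1 rl).
- move=> x y xP yP; apply: vi; rewrite genvM (val_sP xP) (val_sP yP) -(rel_PM rl)//.

  exact: val_sP (Pi_mul QB BP xP yP).
- move=> x i j xP xij; apply: vi; rewrite !genvM !val_sT (val_sP xP).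
  exact: (rel_PT rl).
- move=> i b f fE; apply: vi; rewrite genvB !genvM genvZ !val_sT val_sX !val_XH.
  exact: (rel_TX rl).
move=> x b xP; apply: vi; rewrite !genvM val_sX val_XH (val_sP xP).
exact: (rel_PX rl).
Qed.

(** The elements with property Q form a subalgebra that contains the generators and satisfies the
    relations. The universal property maps the whole algebra into it, and by uniqueness the
    composite with the inclusion is the identity. *)
Lemma daha_generated h : Q h.
Proof.
have [f [fT fX fP] _] := daha_univ H gensub_rel.
have [f0 _ f0E] := daha_univ H (daha_relP H).
pose g : {lrmorphism halg H -> halg H} := genv \o f.
pose g' : {lrmorphism halg H -> halg H} := idfun.
have gE : g h = f0 h.
  apply: f0E => [i|b|x xP]; rewrite /g /=.
  - by rewrite fT; exact: val_sT.
  - by rewrite fX; exact: val_sX.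
  - by rewrite (fP _ xP); exact: val_sP.
have g'E : g' h = f0 h by apply: f0E.
have -> : h = genv (f h) by rewrite -[LHS]/(g' h) g'E -gE.
exact/gen_memP/genvalP.
Qed.

End GeneratedByRelations.

(** * The parameters q and t *)

Section ParametersQT.
Context {R : realType} {n : nat} (D : rootSystem R n).
Variable B : zmodClosed 'cV[R]_n.
Hypothesis QB : forall v, in_Q D v -> v \in B.
Hypothesis BP : forall v, v \in B -> in_P D v.
Implicit Types (u v a b c : 'cV[R]_n) (r : @affV R n).

Lemma qt_ev_th r a : affroot D r -> r.2 != 0 ->
  qpow D B r.2 / qrho D r.1 * th D a ^+ 2 != 1.
Proof.
move=> rR r20; apply: (ev_root_thi QB BP rR r20); rewrite expr2.
exact: (monomialM (monomial_th D a) (monomial_th D a)).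
Qed.

Lemma th_order a : th D a ^+ 4 != 1.
Proof.
apply/eqP => E; have := monomialX 4 (monomial_th D a).
by rewrite -exprnP E => /monomial_eq1[_ /eqP].
Qed.

(** Both sides are monomials, and on B the exponents of q^(1/(2 mtilde)) are exact integers. *)
Lemma qt_sep a b c u v : a \in B -> b \in B -> c \in B ->
  qpow D B (dot a b) / qrho D u = qpow D B (dot a c) / qrho D v -> dot a b = dot a c.
Proof.
move=> aB bB cB E.
have [e em] := monomial_qrho D u; have [e' em'] := monomial_qrho D v.
have m1 := monomialM (monomial_qpow D B (dot a b)) (monomialV em).
have m2 := monomialM (monomial_qpow D B (dot a c)) (monomialV em').
move: m1; rewrite E => /(monomial_uniq m2)[fE _].
move: fE; rewrite oppr0 !addr0 => fE.
have hb := qint_dot BP aB bB; have hc := qint_dot BP aB cB.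
rewrite /qint !intrEfloor in hb hc.
have m0 : (2 * mtilde B)%:R != 0 :> R.
  by rewrite pnatr_eq0 -lt0n muln_gt0 (mtilde_spec BP).1.
by apply: (mulfI m0); rewrite -(eqP hb) -(eqP hc) fE.
Qed.

Definition qt_params : params D B :=
  @Params R n D B (Kqt D) (@star R n D) (qpow D B) (qrho D) (th D)
    (@starK R n D) (star_qpow D B) (@star_qrho R n D) (@star_th R n D)
    (qpow0 D B) (@qpowD R n D B) (@qpowN R n D B) (@qpow_neq0 R n D B)
    (@qrho0 R n D) (@qrhoD R n D B BP) (@qrhoN R n D B BP) (@qrho_neq0 R n D)
    (qrho_simple QB BP) (@th_neq0 R n D) (@thE R n D) th_order
    (@th_lambda_umin R n D B QB BP) (@ev_root_neq1 R n D B QB BP) qt_ev_th qt_sep.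

End ParametersQT.

Lemma big_supp_eq (I : eqType) (V : nmodType) (s s' : seq I) (F : I -> V) :
  uniq s -> uniq s' -> {subset s <= s'} -> (forall i, i \in s' -> i \notin s -> F i = 0) ->
  \sum_(i <- s) F i = \sum_(i <- s') F i.
Proof.
move=> us us' ss F0; have p : perm_eq s [seq i <- s' | i \in s].
  apply: uniq_perm; rewrite ?filter_uniq// => i.
  by rewrite mem_filter; case: (boolP (i \in s)) => // /ss ->.
rewrite (perm_big _ p) big_filter [RHS](bigID (fun i => i \in s)) /=.
rewrite [X in _ = _ + X]big1_seq ?addr0// => i /andP[h1 h2]; exact: F0.
Qed.

Lemma sum_pred1_seq (I : eqType) (V : nmodType) (s : seq I) (F : I -> V) i :
  uniq s -> (i \notin s -> F i = 0) -> \sum_(j <- s) F j *+ (j == i) = F i.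
Proof.
move=> us F0; have [si|si] := boolP (i \in s).
  rewrite (bigD1_seq i)//= eqxx big1 ?addr0// => j ji.
  by rewrite (negPf ji).
rewrite (F0 si) big1_seq// => j /andP[_ js].
by case: eqP => // E; case/negP: si; rewrite -E.
Qed.

(** This regroups the positive roots by length, as in the definition of [tw0]. *)
Lemma prod_count (A : comPzRingType) (U I : eqType) (s : seq U) (l : seq I) (e : U -> I)
    (F : I -> A) : uniq l -> {in s, forall a, e a \in l} ->
  \prod_(x <- l) F x ^+ count (fun a => e a == x) s = \prod_(a <- s) F (e a).
Proof.
move=> ul; elim: s => [|a s IH] sl; first by rewrite big_nil big1.
rewrite big_cons -IH => [|b bs]; last by apply: sl; rewrite inE bs orbT.
rewrite -[F (e a)](_ : \prod_(x <- l) F x ^+ (e a == x) = _).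
  by rewrite -big_split /=; apply: eq_bigr => x _; rewrite exprD.
rewrite (bigD1_seq (e a)) ?sl ?mem_head//= eqxx expr1 big1 ?mulr1// => x xa.
by rewrite eq_sym (negPf xa).
Qed.

Lemma linear_exists (A : pzRingType) (U V : lmodType A) (F : U -> V) :
  (forall c x y, F (c *: x + y) = c *: F x + F y) ->
  exists F' : {linear U -> V}, forall x, F' x = F x.
Proof.
move=> FL; pose m := GRing.isLinear.Build A U V *:%R F FL.
pose F' : {linear U -> V} := HB.pack F m.
by exists F'.
Qed.

(** * Specialization to rational functions in q and t *)

Section Transforms.
Context {R : realType} {n : nat} (D : rootSystem R n).
Variable B : zmodClosed 'cV[R]_n.
Hypothesis QB : forall v, in_Q D v -> v \in B.
Hypothesis BP : forall v, v \in B -> in_P D v.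
Implicit Types (u v a b : 'cV[R]_n).
Implicit Types (x y z : @affW R n) (r : @affV R n).
Implicit Types (w : seq (@aidx n)) (g h : 'M[R]_n).
Local Notation al := (simple D).

Local Notation piel_act := (piel_act (D:=D) (B:=B) QB BP).

Local Notation Lam_aroot := (Lam_aroot (D:=D) (B:=B) QB).
Local Notation Xsharp_ev := (Xsharp_ev (D:=D) (B:=B) QB BP).
Local Notation pd := (qt_params QB BP).
Local Notation K := (pK pd).
Local Notation qp := (pqp pd).
Local Notation rho := (prho pd).
Local Notation star := (pstar pd).
(** The names ending in q give the concrete objects the types of the abstract development; most of
    the properties required there then hold by conversion. *)
Definition KXq : galgebra K (lat B) := galgebra_galg K (lat B).
Local Notation KX := KXq.
Local Notation XpG := (gM KX).
Implicit Types (f : KX) (c : K).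
Variable H0 : daha D B.
Definition Hq : algType K := halg H0.
Local Notation H := Hq.
Definition gTq : @aidx n -> H := Defs.gT H0.
Definition gXq : lat B -> H := Defs.gX H0.
Definition gPq : @affW R n -> H := Defs.gP H0.
Local Notation gT := gTq.
Local Notation gX := gXq.
Local Notation gP := gPq.
Local Notation XaffG := (XaffG (D:=D) (B:=B) (pd:=pd) KX).
Local Notation evG := (evG (D:=D) (B:=B) pd).
Local Notation wactG := (wactG (D:=D) (B:=B) (pd:=pd) (KX:=KX)).
Local Notation starG := (starG (D:=D) (B:=B) (pd:=pd) (KX:=KX)).
Local Notation evalG := (evalG (D:=D) (B:=B) (pd:=pd) (KX:=KX)).
Local Notation lat_val_inj := (lat_val_inj (B:=B)).
Local Notation thiG := (thiG (D:=D) (B:=B) pd).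
Local Notation kap := (kap (D:=D) (B:=B) pd).
Lemma quadH : forall i, (gT i - (thiG i)%:A) * (gT i + ((thiG i)^-1)%:A) = 0.
Proof. exact: (rel_quad (daha_relP H0)). Qed.

Lemma altprodE k i j : altprod (Defs.gT H0) k i j = \prod_(m <- alt k i j) gT m.
Proof. by elim: k i j => [|k IH] i j /=; rewrite ?big_nil// big_cons IH. Qed.

Lemma braidH : forall i j k, i != j ->
  aorder (amul (saff D i) (saff D j)) k ->
  \prod_(m <- alt k i j) gT m = \prod_(m <- alt k j i) gT m.
Proof.
by move=> i j k ij o; rewrite -!altprodE; exact: (rel_braid (daha_relP H0) ij o).
Qed.

Lemma X0H : gX 0 = 1.
Proof. exact: (rel_X0 (daha_relP H0)). Qed.

Lemma XDH : forall b b' : lat B, gX (b + b') = gX b * gX b'.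
Proof. exact: (rel_XD (daha_relP H0)). Qed.

Lemma P1H : gP aone = 1.
Proof. exact: (rel_P1 (daha_relP H0)). Qed.

Lemma PMH : forall x y, in_Pi D B x -> in_Pi D B y -> gP (amul x y) = gP x * gP y.
Proof. by move=> x y; exact: (rel_PM (daha_relP H0)). Qed.

Lemma PTH : forall x i j, in_Pi D B x -> aact x (aroot D i) = aroot D j ->
  gP x * gT i = gT j * gP x.
Proof. by move=> x i j; exact: (rel_PT (daha_relP H0)). Qed.
Local Notation qsharpG := (qsharpG (D:=D) (B:=B) pd).
Local Notation XHG := (XHG (D:=D) (B:=B) (pd:=pd) (KX:=KX) (H:=H) gX).
Local Notation hinvG := (hinvG (D:=D) (B:=B) (pd:=pd) (H:=H)).
Local Notation yelG := (yelG (D:=D) (B:=B) (pd:=pd) (H:=H) gT gP).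
Lemma TXH : forall i (b : lat B) f,
  (XaffG (aroot D i) - 1) * f = XaffG (aact (saff D i) (lat_val b, 0)) - XpG b ->
  gT i * gX b - XHG (XaffG (aact (saff D i) (lat_val b, 0))) * gT i = kap i *: XHG f.
Proof. by move=> i b f; exact: (rel_TX (daha_relP H0)). Qed.

Lemma PXH : forall x (b : lat B), in_Pi D B x ->
  gP x * gX b = XHG (XaffG (aact x (lat_val b, 0))) * gP x.
Proof. by move=> x b; exact: (rel_PX (daha_relP H0)). Qed.

Variable act0 : H0 -> Defs.KX D B -> Defs.KX D B.
Hypothesis hX : is_polynomial_rep act0.
Definition actq : H -> KX -> KX := act0.
Local Notation act := actq.

Lemma act1 : forall f, act 1 f = f.
Proof. by have [[a1 _ _ _] _ _ _] := hX; exact: a1. Qed.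

Lemma actM : forall (h k : H) f, act (h * k) f = act h (act k f).
Proof. by have [[_ a2 _ _] _ _ _] := hX; exact: a2. Qed.

Lemma act_linl : forall c (h k : H) f, act (c *: h + k) f = c *: act h f + act k f.
Proof. by have [[_ _ a3 _] _ _ _] := hX; exact: a3. Qed.

Lemma act_linr : forall c (h : H) f f', act h (c *: f + f') = c *: act h f + act h f'.
Proof. by have [[_ _ _ a4] _ _ _] := hX; exact: a4. Qed.

Lemma actX : forall (b : lat B) f, act (gX b) f = XpG b * f.
Proof. by have [_ a _ _] := hX; exact: a. Qed.

Lemma actP : forall x f, in_Pi D B x -> act (gP x) f = wactG x f.
Proof. by have [_ _ a _] := hX; exact: a. Qed.

Lemma actT : forall i f, (XaffG (aroot D i) - 1) *
  (act (gT i) f - thiG i *: wactG (saff D i) f) = kap i *: (wactG (saff D i) f - f).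
Proof. by have [_ _ _ a] := hX; exact: a. Qed.

Variable eps0 : {rmorphism H0 -> H0}.
Hypothesis heps : is_epsilon eps0.
Definition epsq : {rmorphism H -> H} := eps0.
Local Notation eps := epsq.

Lemma epsZ : forall c (h : H), eps (c *: h) = star c *: eps h.
Proof. by have [e _ _ _ _] := heps; exact: e. Qed.

Lemma epsX : forall b : lat B, eps (gX b) = yelG b.
Proof. by have [_ e _ _ _] := heps; exact: e. Qed.

Lemma epsY : forall b : lat B, eps (yelG b) = gX b.
Proof. by have [_ _ e _ _] := heps; exact: e. Qed.

Lemma epsT : forall j : 'I_n, eps (gT (Some j)) = hinvG (gT (Some j)).
Proof. by have [_ _ _ e _] := heps; exact: e. Qed.

Lemma epsK : forall h : H, eps (eps h) = h.
Proof. by have [_ _ _ _ e] := heps; exact: e. Qed.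
Local Notation act_DL := (act_DL (D:=D) (B:=B) (pd:=pd) (KX:=KX) (H:=H) (gT:=gT) (act:=act) act_linr actT).
Local Notation ychar := (ychar (D:=D) (B:=B) (pd:=pd) (KX:=KX) (H:=H) gT gP act).
Local Notation PhiG := (PhiG (D:=D) (B:=B) (pd:=pd) (KX:=KX) (H:=H) gT act eps).
Local Notation phiG := (phiG (D:=D) (B:=B) (pd:=pd)).
Local Notation ybasis_exists := (ybasis_exists (D:=D) (B:=B) QB BP (pd:=pd) (KX:=KX) (H:=H) (gT:=gT) (gX:=gX) (gP:=gP) quadH braidH X0H XDH P1H PMH PTH TXH PXH (act:=act) act1 actM act_linl act_linr actX actP actT (eps:=eps) epsZ epsX epsY epsT).
Lemma ebas_exists : exists ebas : lat B -> KX,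
  forall b : lat B, evalG (ebas b) = 1 /\ ychar (piel D (lat_val b)) (ebas b).
Proof. by have [e eP] := boolp.choice ybasis_exists; exists e. Qed.

Section WithBasis.
Variable ebas : lat B -> KX.
Hypothesis ebasP : forall b : lat B, evalG (ebas b) = 1 /\ ychar (piel D (lat_val b)) (ebas b).

Definition LAq : galgebra (coefring D) (@affV R n) := galgebra_galg (coefring D) (@affV R n).
Local Notation LA := LAq.
Definition embq : {rmorphism {poly (coefring D)} -> K} :=
  (@FracField.tofrac {poly (coefring D)} : {rmorphism {poly (coefring D)} -> Kqt D}).
Local Notation emb := embq.
Local Notation mm := (2 * mtilde B)%N.
Local Notation C := (coefring D).

Lemma emb_inj : injective emb.
Proof. by move=> p q /eqP; rewrite tofrac_eq => /eqP. Qed.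

Lemma emb_frac : forall z : K, exists pz dz : {poly C}, dz != 0 /\ z = emb pz / emb dz.
Proof. exact: (@tofrac_numden R n D). Qed.

Lemma emb_qp : forall (k : nat) (e : R), mm%:R * e = k%:R -> qp e = emb 'X^k.
Proof.
move=> k e E; rewrite [RHS]rmorphXn -[LHS]/(qpow D B e) /qpow E.
by rewrite -[k%:R]/((Posz k)%:~R) intrKfloor.
Qed.

Lemma emb_th : forall a, a \in roots D -> pth pd a ^+ 2 = emb ((tvar D (nu a)) ^+ 2)%:P.
Proof. by move=> a _; rewrite polyC_exp [RHS]rmorphXn. Qed.

Definition mcq : 'cV[R]_n -> K := mu_circ D B.
Local Notation mc := mcq.
Local Notation Krel := (Krel (D:=D) (B:=B) (pd:=pd) (KX:=KX) LA emb).
Local Notation KrelD := (KrelD (D:=D) (B:=B) BP (pd:=pd) (KX:=KX) (LA:=LA) (emb:=emb) emb_qp).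
Local Notation KrelZ := (KrelZ (D:=D) (B:=B) BP (pd:=pd) (KX:=KX) (LA:=LA) (emb:=emb) emb_inj emb_frac emb_qp).
Local Notation Krel_T := (Krel_T (D:=D) (B:=B) QB BP (pd:=pd) (KX:=KX) LA (emb:=emb) emb_inj emb_frac emb_qp emb_th).
Local Notation Krel_P := (Krel_P (D:=D) (B:=B) QB BP (pd:=pd) (KX:=KX) LA (emb:=emb) emb_inj emb_frac emb_qp).
Local Notation ratio := (ratio (D:=D) (B:=B) (pd:=pd) emb).
Local Notation ctG := (ctG (D:=D) (B:=B) (pd:=pd) (KX:=KX) mc).
Local Notation ctGD := (ctGD (D:=D) (B:=B) (pd:=pd) (KX:=KX) mc).
Local Notation ctGZ := (ctGZ (D:=D) (B:=B) (pd:=pd) (KX:=KX) mc).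
Local Notation span_invariants := (span_invariants (D:=D) (B:=B) QB BP (pd:=pd) (KX:=KX) (H:=H) (gT:=gT) (gX:=gX) (gP:=gP) quadH braidH X0H XDH P1H PMH PTH TXH PXH (act:=act) act1 actM act_linl act_linr actX actP actT (eps:=eps) epsZ epsX epsY epsT (ebas:=ebas) ebasP).
Lemma mcP : forall a, (exists c, ratio a c) -> ratio a (mc a).
Proof.
move=> a [c cP]; rewrite /mcq /mu_circ.
by case: classical_sets.xgetP => [x _ //|no]; case: (no c cP).
Qed.

(** The eigenbasis enters the theory of the constant term here, before any inner product is
    available. *)
Lemma Krel_all : forall f, exists c, Krel (f - c *: 1).
Proof.
have K1 : forall f f', Krel f -> Krel f' -> Krel (f + f') by move=> f f'; exact: KrelD.
have K2 : forall c f, Krel f -> Krel (c *: f) by move=> c f; exact: KrelZ.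
have K3 : forall i f, Krel (act (gT i) f - thiG i *: f).
  by move=> i f; exact: Krel_T (act_DL i).
have K4 : forall p f, in_Pi D B p -> Krel (wactG p f - f) by move=> p f; exact: Krel_P.
exact: (span_invariants K1 K2 K3 K4).
Qed.

Local Notation ctG1 := (ctG1 (D:=D) (B:=B) BP (pd:=pd) (KX:=KX) (LA:=LA) (emb:=emb) emb_inj emb_frac emb_qp Krel_all (mc:=mc) mcP).
Local Notation ctG_T := (ctG_T (D:=D) (B:=B) QB BP (pd:=pd) (KX:=KX) (LA:=LA) (emb:=emb) emb_inj emb_frac emb_qp emb_th Krel_all (mc:=mc) mcP).
Local Notation ctG_P := (ctG_P (D:=D) (B:=B) QB BP (pd:=pd) (KX:=KX) (LA:=LA) (emb:=emb) emb_inj emb_frac emb_qp Krel_all (mc:=mc) mcP).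
Definition Lq : KX -> K := ctG.
Local Notation L := Lq.

Lemma LD : forall f f', L (f + f') = L f + L f'.
Proof. exact: ctGD. Qed.

Lemma LZ : forall c f, L (c *: f) = c * L f.
Proof. exact: ctGZ. Qed.

Lemma L1 : L 1 = 1.
Proof. exact: ctG1. Qed.

Lemma LT : forall i f, L (act (gT i) f) = thiG i * L f.
Proof. by move=> i f; exact: ctG_T (act_DL i). Qed.

Lemma LP : forall p f, in_Pi D B p -> L (wactG p f) = L f.
Proof. by move=> p f; exact: ctG_P. Qed.
Local Notation pairG := (pairG (D:=D) (B:=B) (pd:=pd) (KX:=KX) L).
Local Notation mubG := (mubG (D:=D) (B:=B) pd).
Local Notation is_macG := (is_macG (D:=D) (B:=B) (pd:=pd) (KX:=KX) L).
Local Notation is_macG_ebas := (is_macG_ebas (D:=D) (B:=B) QB BP (pd:=pd) (KX:=KX) (H:=H) (gT:=gT) (gX:=gX) (gP:=gP) quadH braidH X0H XDH P1H PMH PTH TXH PXH (act:=act) act1 actM act_linl act_linr actX actP actT (eps:=eps) epsZ epsX epsY epsT (L:=L) LD LZ L1 LT LP (ebas:=ebas) ebasP).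
Local Notation tw0G := (tw0G (D:=D) (B:=B) pd).
Definition Fq : lmodType K := Fsharp D B.
Definition fc (t : Fq) (b : lat B) : K := (t : Fsharp D B)@_(pib D b).
Implicit Types (t : Fq).

Lemma fcL : forall c t t' (b : lat B), fc (c *: t + t') b = c * fc t b + fc t' b.
Proof. by move=> c t t' b; rewrite /fc mcoeffD mcoeffZ. Qed.

Lemma pib_surj (x : piB D B) : exists b : lat B, x = pib D b.
Proof. by case: x => x xP; have [b xE] := asboolW xP; exists b; apply: val_inj. Qed.

Lemma piel_inj (b b' : lat B) : piel D (lat_val b) = piel D (lat_val b') -> b = b'.
Proof.
move=> E; apply: lat_val_inj.
by rewrite -[LHS](piel_act (lat_mem b)) E (piel_act (lat_mem b')).
Qed.

Lemma pib_inj : injective (@pib R n D B).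
Proof. by move=> b b' /(congr1 val); exact: piel_inj. Qed.

Lemma fc_inj : forall t t', (forall b : lat B, fc t b = fc t' b) -> t = t'.
Proof. by move=> t t' tt'; apply/malgP => x; have [b ->] := pib_surj x; exact: tt'. Qed.

Lemma pib_coef (k : Kqt D) (b b' : lat B) :
  (<< k *g pib D b >> : Fsharp D B)@_(pib D b') = k *+ (b == b').
Proof. by rewrite mcoeffU (inj_eq pib_inj). Qed.

Lemma fc_mk : forall (s : seq (lat B)) (d : lat B -> K), uniq s ->
  (forall b : lat B, b \notin s -> d b = 0) -> exists t, forall b : lat B, fc t b = d b.
Proof.
move=> s d us d0; exists (\sum_(b <- s) << d b *g pib D b >> : Fsharp D B) => b.
rewrite /fc (big_morph (fun t : Fsharp D B => t@_(pib D b)) (fun t t' => mcoeffD _ t t') (mcoeff0 _)).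
transitivity (\sum_(b' <- s) d b' *+ (b' == b)); last exact: sum_pred1_seq us (d0 b).
by apply: eq_bigr => b' _; exact: pib_coef.
Qed.

Definition pairTq : Fq -> Fq -> K := @pairF R n D B.

Lemma pairTE : forall t t' (s : seq (lat B)), uniq s ->
  (forall b : lat B, b \notin s -> fc t b = 0) ->
  pairTq t t' = \sum_(b <- s) mubG (piel D (lat_val b)) * fc t b * star (fc t' b).
Proof.
move=> t t' s us s0.
rewrite -[LHS]/(\sum_(x <- msupp (t : Fsharp D B)) mu_bullet D B (val x) *
  (t : Fsharp D B)@_x * Defs.star (t' : Fsharp D B)@_x).
rewrite -[RHS](big_map (@pib R n D B) xpredT (fun x : piB D B => mu_bullet D B (val x) *
  (t : Fsharp D B)@_x * Defs.star (t' : Fsharp D B)@_x)).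
apply: big_supp_eq.
- exact: fset_uniq.
- by rewrite map_inj_uniq//; exact: pib_inj.
- move=> x; have [b ->] := pib_surj x; rewrite -mcoeff_neq0 => h.
  by apply: map_f; apply: contraNT h => /s0 h; apply/eqP.
- move=> x _; rewrite -mcoeff_eq0 => /eqP ->.
  by rewrite mulr0 mul0r.
Qed.

Definition deltaq : lat B -> Fq := @delta R n D B.
Local Notation delta := deltaq.

Lemma deltaE : forall b c : lat B,
  fc (delta c) b = (mubG (piel D (lat_val c)))^-1 *+ (b == c).
Proof. by move=> b c; rewrite eq_sym; exact: pib_coef. Qed.

Variable actF0 : H0 -> Fsharp D B -> Fsharp D B.
Hypothesis hF : is_functional_rep actF0.
Definition actFq : H -> Fq -> Fq := actF0.
Local Notation actF := actFq.

Lemma actF1 : forall t, actF 1 t = t.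
Proof. by have [[a1 _ _ _] _ _ _] := hF; exact: a1. Qed.

Lemma actFM : forall (h k : H) t, actF (h * k) t = actF h (actF k t).
Proof. by have [[_ a2 _ _] _ _ _] := hF; exact: a2. Qed.

Lemma actFl : forall c (h k : H) t, actF (c *: h + k) t = c *: actF h t + actF k t.
Proof. by have [[_ _ a3 _] _ _ _] := hF; exact: a3. Qed.

Lemma actFX : forall (a b : lat B) t,
  fc (actF (gX a) t) b = qsharpG (lat_val a) (lat_val b) * fc t b.
Proof. by have [_ a _ _] := hF; move=> b b' t; exact: a. Qed.

Lemma fval_in t (b : lat B) : fval (t : Fsharp D B) (piel D (lat_val b)) = fc t b.
Proof.
rewrite /fval -[piel D (lat_val b)]/(val (pib D b)) valK.
by [].
Qed.

Lemma fval_out t x : (forall b : lat B, x <> piel D (lat_val b)) ->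
  fval (t : Fsharp D B) x = 0.
Proof.
by move=> no; rewrite /fval insubN//; apply/negP => /asboolP[b]; exact: no.
Qed.

Lemma actFP : forall p (b c : lat B) t, in_Pi D B p ->
  amul (ainv p) (piel D (lat_val b)) = piel D (lat_val c) -> fc (actF (gP p) t) b = fc t c.
Proof.
have [_ _ a _] := hF; move=> p b c t pP E.
by have := a p t b pP; rewrite E fval_in.
Qed.

Lemma actF_T i (b : lat B) t : let e := evG (aact (ainv (piel D (lat_val b))) (aroot D i)) in
  fc (actF (gT i) t) b = (thiG i * e - (thiG i)^-1) / (e - 1) *
      (fval (t : Fsharp D B) (amul (saff D i) (piel D (lat_val b))) : K)
    - kap i / (e - 1) * fc t b.
Proof.
move=> e; have [_ _ _ a] := hF; have := a i t b; cbv zeta.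
rewrite (Xsharp_ev (Lam_aroot i) (lat_mem b)) => E.
exact: E.
Qed.

Lemma actFT_in : forall i (b c : lat B) t, let x := piel D (lat_val b) in
  let e := evG (aact (ainv x) (aroot D i)) in amul (saff D i) x = piel D (lat_val c) ->
  fc (actF (gT i) t) b = (thiG i * e - (thiG i)^-1) / (e - 1) * fc t c - kap i / (e - 1) * fc t b.
Proof. by move=> i b c t x e E; rewrite actF_T -/x E fval_in. Qed.

Lemma actFT_out : forall i (b : lat B) t, let x := piel D (lat_val b) in
  let e := evG (aact (ainv x) (aroot D i)) in
  (forall c : lat B, amul (saff D i) x <> piel D (lat_val c)) ->
  fc (actF (gT i) t) b = - (kap i / (e - 1) * fc t b).
Proof. by move=> i b t x e no; rewrite actF_T (fval_out _ no) mulr0 add0r. Qed.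

Lemma generated : forall Q : H -> Prop, Q 1 -> (forall h k : H, Q h -> Q k -> Q (h + k)) ->
  (forall h k : H, Q h -> Q k -> Q (h * k)) -> (forall c (h : H), Q h -> Q (c *: h)) ->
  (forall i, Q (gT i)) -> (forall b : lat B, Q (gX b)) ->
  (forall p, in_Pi D B p -> Q (gP p)) -> forall h : H, Q h.
Proof. by move=> Q q1 qD qM qZ qT qX qP; exact: (daha_generated QB BP q1 qD qM qZ qT qX qP). Qed.

Variable eta0 : {rmorphism H0 -> H0}.
Hypothesis heta : is_eta eta0.
Definition etaq : {rmorphism H -> H} := eta0.
Local Notation eta := etaq.

Lemma etaZ : forall c (h : H), eta (c *: h) = star c *: eta h.
Proof. by have [e _ _ _ _] := heta; exact: e. Qed.

Lemma etaT : forall i, eta (gT i) = hinvG (gT i).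
Proof. by have [_ e _ _ _] := heta; exact: e. Qed.

Lemma etaX : forall b : lat B, eta (gX b) = gX (- b).
Proof. by have [_ _ e _ _] := heta; exact: e. Qed.

Lemma etaP : forall p, in_Pi D B p -> eta (gP p) = gP p.
Proof. by have [_ _ _ e _] := heta; exact: e. Qed.
Local Notation ebas_mac := (ebas_mac (D:=D) (B:=B) QB BP (pd:=pd) (KX:=KX) (H:=H) (gT:=gT) (gX:=gX) (gP:=gP) quadH braidH X0H XDH P1H PMH PTH TXH PXH (act:=act) act1 actM act_linl act_linr actX actP actT (eps:=eps) epsZ epsX epsY epsT (L:=L) LD LZ L1 LT LP (ebas:=ebas) ebasP).
Local Notation ebas_word := (ebas_word (D:=D) (B:=B) QB BP (pd:=pd) (KX:=KX) (H:=H) (gT:=gT) (gX:=gX) (gP:=gP) quadH braidH X0H XDH P1H PMH PTH TXH PXH (act:=act) act1 actM act_linl act_linr actX actP actT (eps:=eps) epsZ epsX epsY epsT (ebas:=ebas) ebasP).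
Local Notation psi_exists := (psi_exists (D:=D) (B:=B) QB BP (pd:=pd) (KX:=KX) (H:=H) (gT:=gT) (gX:=gX) (gP:=gP) quadH braidH X0H XDH P1H PMH PTH TXH PXH (act:=act) act1 actM act_linl act_linr actX actP actT (eps:=eps) epsZ epsX epsY epsT (L:=L) LD LZ L1 LT LP (ebas:=ebas) ebasP fc_mk).
Local Notation psi_linear := (psi_linear (D:=D) (B:=B) (pd:=pd) (KX:=KX) (L:=L) LD LZ (ebas:=ebas) fcL fc_inj).
Local Notation psi_unitary := (psi_unitary (D:=D) (B:=B) QB BP (pd:=pd) (KX:=KX) (H:=H) (gT:=gT) (gX:=gX) (gP:=gP) quadH braidH X0H XDH P1H PMH PTH TXH PXH (act:=act) act1 actM act_linl act_linr actX actP actT (eps:=eps) epsZ epsX epsY epsT (L:=L) LD LZ L1 LT LP (ebas:=ebas) ebasP pairTE).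
Local Notation psi_act := (psi_act (D:=D) (B:=B) QB BP (pd:=pd) (KX:=KX) (H:=H) (gT:=gT) (gX:=gX) (gP:=gP) quadH braidH X0H XDH P1H PMH PTH TXH PXH (act:=act) act1 actM act_linl act_linr actX actP actT (eps:=eps) epsZ epsX epsY epsT (L:=L) LD LZ LT LP (ebas:=ebas) ebasP fcL fc_inj actF1 actFM actFl actFX actFP actFT_in actFT_out generated epsK).
Local Notation psi_sum := (psi_sum (D:=D) (B:=B) QB BP (pd:=pd) (KX:=KX) (H:=H) (gT:=gT) (gX:=gX) (gP:=gP) quadH braidH X0H XDH P1H PMH PTH TXH PXH (act:=act) act1 actM act_linl act_linr actX actP actT (eps:=eps) epsZ epsX epsY epsT (L:=L) LD LZ L1 LT LP (ebas:=ebas) ebasP fcL fc_inj deltaE).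
Local Notation phi_linear := (phi_linear (D:=D) (B:=B) (pd:=pd) (KX:=KX) (L:=L) LD LZ (ebas:=ebas) fcL fc_inj).
Local Notation phi_coord := (phi_coord (D:=D) (B:=B) (pd:=pd) (KX:=KX) (L:=L) (ebas:=ebas)).
Local Notation phi_unitary := (phi_unitary (D:=D) (B:=B) QB BP (pd:=pd) (KX:=KX) (H:=H) (gT:=gT) (gX:=gX) (gP:=gP) quadH braidH X0H XDH P1H PMH PTH TXH PXH (act:=act) act1 actM act_linl act_linr actX actP actT (eps:=eps) epsZ epsX epsY epsT (L:=L) LD LZ L1 LT LP (ebas:=ebas) ebasP pairTE).
Local Notation phi_act := (phi_act (D:=D) (B:=B) QB BP (pd:=pd) (KX:=KX) (H:=H) (gT:=gT) (gX:=gX) (gP:=gP) quadH braidH X0H XDH P1H PMH PTH TXH PXH (act:=act) act1 actM act_linl act_linr actX actP actT (eps:=eps) epsZ epsX epsY epsT (L:=L) LD LZ LT LP (ebas:=ebas) ebasP fcL fc_inj actF1 actFM actFl actFX actFP actFT_in actFT_out generated epsK etaZ etaT etaX etaP).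
Local Notation phi_sum := (phi_sum (D:=D) (B:=B) QB BP (pd:=pd) (KX:=KX) (H:=H) (gT:=gT) (gX:=gX) (gP:=gP) quadH braidH X0H XDH P1H PMH PTH TXH PXH (act:=act) act1 actM act_linl act_linr actX actP actT (eps:=eps) epsZ epsX epsY epsT (L:=L) LD LZ L1 LT LP (ebas:=ebas) ebasP fcL fc_inj deltaE actF1 actFM actFl actFX actFP actFT_in actFT_out generated epsK).
Lemma pairXE f f' : pairX (f : Defs.KX D B) (f' : Defs.KX D B) = pairG f f'.
Proof. exact: erefl. Qed.

Lemma ct_starX (f f' : Defs.KX D B) : ct (starX f * f') = pairX f' f.
Proof. by rewrite /pairX mulrC. Qed.

Lemma is_macdonaldE (b : lat B) f : is_macdonald b (f : Defs.KX D B) <-> is_macG b f.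
Proof.
split=> -[h1 h2]; split; try exact: h1.
  by move=> c' cb; rewrite -pairXE; exact: h2.
by move=> c' cb; rewrite [LHS]pairXE; exact: h2.
Qed.

Lemma is_macdonald_ebas (b : lat B) : exists f : KX, is_macdonald b (f : Defs.KX D B).
Proof. by exists ((gcoef (ebas b) b)^-1 *: ebas b); apply/is_macdonaldE/is_macG_ebas. Qed.

(** A Macdonald polynomial exists, so the choice in [macdonald] is a genuine one; by uniqueness it
    is a multiple of the eigenvector, and the normalization makes the two equal. *)
Lemma EcalE (b : lat B) : Ecal D b = ebas b.
Proof.
have m : is_macdonald b (macdonald D b).
  have [e eP] := is_macdonald_ebas b.
  by rewrite /macdonald; case: classical_sets.xgetP => [e' _ //|no]; case: (no e).
rewrite /Ecal; move: (macdonald D b) m => f /is_macdonaldE fm.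
exact: ebas_mac fm.
Qed.

Lemma tw0E : tw0 D = tw0G.
Proof.
apply: (@prod_count (Kqt D) _ _ (posroots D) (lengths D) (fun a => nu a) (thnu D)).
  exact: undup_uniq.
by move=> a /pos_root aD; rewrite mem_undup; exact: map_f.
Qed.

Lemma ebas_epsG (b : lat B) : is_epsG eps0 act0 (piel D (lat_val b)) (Ecal D b).
Proof.
move=> p w red; rewrite EcalE.
pose Ep : seq (@aidx n) -> KX -> Prop := epsG eps0 act0.
have E0 : Ep [::] 1 by exact: epsG_nil.
have E1 : forall i w f (y : K), Ep w f -> f != 0 ->
    act (eps (XHG (XaffG (aroot D i)))) f = y *: f -> y != 1 -> phiG i y != 0 ->
    Ep (i :: w) ((phiG i y)^-1 *: PhiG i y f).
  move=> i w' f y e1 e2 e3 e4 e5.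
  exact: (epsG_cons e1 e2 e3 e4 e5).
have [e' h1 h2] := ebas_word E0 E1 red.
by exists e'; [exact: h1|exact: h2].
Qed.

Lemma transforms :
  exists (phi : {linear Defs.KX D B -> Fsharp D B}) (psi : Defs.KX D B -> Fsharp D B),
  (forall (f : Defs.KX D B) (b : lat B), (phi f)@_(pib D b) = ct (f * Ecal D b)) /\
  (forall (f : Defs.KX D B) (b : lat B), (psi f)@_(pib D b) = ct (starX f * Ecal D b)
               /\ (psi f)@_(pib D b) = pairX (Ecal D b) f) /\
  [/\ (forall (f g : Defs.KX D B), pairF (phi f) (phi g) = pairX f g) /\
      (forall (h : H0) (p : Defs.KX D B), phi (act0 h p) = actF0 (eps0 (eta0 h)) (phi p)),
      [/\ forall (c : Kqt D) (f g : Defs.KX D B), psi (c *: f + g) = Defs.star c *: psi f + psi g,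
          forall (f g : Defs.KX D B), pairF (psi f) (psi g) = Defs.star (pairX f g) &
          forall (h : H0) (p : Defs.KX D B), psi (act0 h p) = actF0 (eps0 h) (psi p)],
      let expansion := forall g : {malg (Kqt D)[lat B]},
        psi (\sum_(d <- msupp g) g@_d *: Ecal D d)
        = \sum_(d <- msupp g) Defs.star g@_d *: Defs.delta D d in
      expansion /\
      (expansion <->
       forall b : lat B, is_epsG eps0 act0 (piel D (lat_val b)) (Ecal D b)) &
      forall g : {malg (Kqt D)[lat B]},
        phi (\sum_(d <- msupp g) g@_d *: Ecal D d)
        = \sum_(d <- msupp g) (g@_d * tw0 D) *:
            actF0 (hinv (Tel H0 (lin (w0 D))))
                 (Defs.delta D (toB B (- (w0 D *m lat_val d))))].
Proof.
have [psi psiE] := psi_exists.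
pose phi0 : Defs.KX D B -> Fsharp D B := fun f => psi (starG f).
have [phi phiE] := linear_exists (phi_linear psiE : forall (c : Kqt D) (f f' : Defs.KX D B), phi0 (c *: f + f') = c *: phi0 f + phi0 f').
have eE : @Ecal R n D B = ebas by apply: funext => b; exact: EcalE.
have phiE' : (phi : Defs.KX D B -> Fsharp D B) = phi0 by apply: funext.
exists phi, psi; rewrite phiE' eE; split; first exact: (phi_coord psiE).
split.
  move=> f b; have E : (psi f)@_(pib D b) = pairX (ebas b) f.
    rewrite [RHS]pairXE.
    exact: psiE.
  split; last exact: E.
  by rewrite E ct_starX.
split.
- split.
    move=> f f'; rewrite [RHS]pairXE.
    exact: (phi_unitary psiE).
  exact: (phi_act psiE).
- split.
  + exact: (psi_linear psiE).
  + move=> f f'; rewrite pairXE.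
    exact: (psi_unitary psiE).
  exact: (psi_act psiE).
- have ex : forall g : {malg (Kqt D)[lat B]},
        psi (\sum_(d <- msupp g) g@_d *: ebas d)
        = \sum_(d <- msupp g) Defs.star g@_d *: Defs.delta D d.
    by move=> g; exact: (psi_sum psiE).
  split; first exact: ex.
  (* The expansion and the intertwiner relations are both established, so each implies the other. *)
  split=> [_ b|_]; last exact: ex.
  by rewrite -EcalE; exact: ebas_epsG.
move=> g; rewrite tw0E.
exact: (phi_sum psiE).
Qed.

End WithBasis.

End Transforms.

Theorem theorem4p2 (R : realType) (n : nat) (D : rootSystem R n)
    (B : zmodClosed 'cV[R]_n)
    (QB : forall v, in_Q D v -> v \in B) (BP : forall v, v \in B -> in_P D v)
    (H : daha D B)
    (eps : {rmorphism H -> H}) (heps : is_epsilon eps)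
    (eta : {rmorphism H -> H}) (heta : is_eta eta)
    (actX : H -> KX D B -> KX D B) (hX : is_polynomial_rep actX)
    (actF : H -> Fsharp D B -> Fsharp D B) (hF : is_functional_rep actF) :
  exists (phi : {linear KX D B -> Fsharp D B}) (psi : KX D B -> Fsharp D B),
  (forall f b, (phi f)@_(pib D b) = ct (f * Ecal D b)) /\
  (forall f b, (psi f)@_(pib D b) = ct (starX f * Ecal D b)
               /\ (psi f)@_(pib D b) = pairX (Ecal D b) f) /\
  [/\ (* (a) *)
      (forall f g, pairF (phi f) (phi g) = pairX f g) /\
      (forall h p, phi (actX h p) = actF (eps (eta h)) (phi p)),
      (* (b) *)
      [/\ forall c f g, psi (c *: f + g) = star c *: psi f + psi g,
          forall f g, pairF (psi f) (psi g) = star (pairX f g) &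
          forall h p, psi (actX h p) = actF (eps h) (psi p)],
      (* (c) *)
      let expansion := forall g : {malg (Kqt D)[lat B]},
        psi (\sum_(b <- msupp g) g@_b *: Ecal D b)
        = \sum_(b <- msupp g) star g@_b *: delta D b in
      expansion /\
      (expansion <->
       forall b, is_epsG eps actX (piel D (lat_val b)) (Ecal D b)) &
      (* (d) *)
      forall g : {malg (Kqt D)[lat B]},
        phi (\sum_(b <- msupp g) g@_b *: Ecal D b)
        = \sum_(b <- msupp g) (g@_b * tw0 D) *:
            actF (hinv (Tel H (lin (w0 D))))
                 (delta D (toB B (- (w0 D *m lat_val b))))].
Proof.
have [ebas ebasP] := ebas_exists QB BP hX heps.
exact: (@transforms R n D B QB BP H actX hX eps heps ebas ebasP actF hF eta heta).
Qed.
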